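(* Let $\nu\in[0,\infty)$ and $\varphi:[0,\infty)\to[0,\infty)$ with $\|\varphi\|_{L^1}=\int_0^\infty\varphi(t)\,dt<1$. Let $(N_1,N_2)$ be the $2$-dimensional Hawkes process with intensities $$\lambda_{1,t}=\nu+\int_{(0,t)}\varphi(t-s)\,dN_{2,s},\qquad \lambda_{2,t}=\nu+\int_{(0,t)}\varphi(t-s)\,dN_{1,s},$$ and let $S=N_1-N_2$. Then $$\bigl(T^{-1/2}S_{Tv},\ v\in[0,1]\bigr)\to\bigl(\sigma W_v,\ v\in[0,1]\bigr)\quad\text{as }T\to\infty,$$ in law for the Skorokhod topology, where $(W_v)_{v\in[0,1]}$ is a standard Brownian motion and $$\sigma^2=\frac{2\nu}{(1-\|\varphi\|_{L^1})(1+\|\varphi\|_{L^1})^2}.$$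
   Context: A $d$-dimensional Hawkes process with intensity $(\lambda_1,\dots,\lambda_d)$ is understood as follows. Let $(T_n)_{n\ge1}$ be a non-decreasing sequence of random variables with values in $(0,\infty]$ with $T_n<T_{n+1}$ on $\{T_n<\infty\}$, and $(Z_n)_{n\ge1}$ random variables with values in $\{1,\dots,d\}$. Put $N_{i,t}=\sum_{n\ge1}\mathbf 1_{\{T_n\le t\}\cap\{Z_n=i\}}$ for $t\ge0$ (so $N_{i,0}=0$ and no two components jump simultaneously) and $\mathscr F_t=\sigma(N_{i,s}:s\le t,\,1\le i\le d)$. For all $n\ge1$ and $i$, the process $N_{i,t\wedge T_n}-\int_0^{t\wedge T_n}\lambda_{i,s}\,ds$ is an $(\mathscr F_t)$-martingale under $P$. Kernels are Borel functions. No stationarity is assumed. Here $d=2$. *)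

(* Defs.v *)
From HB Require Import structures.
From mathcomp Require Import all_boot all_order all_algebra.
From mathcomp Require Import all_classical all_reals all_analysis.
From mathcomp Require Import measurable_realfun.

Set Implicit Arguments.
Unset Strict Implicit.
Unset Printing Implicit Defensive.

Import Order.TTheory GRing.Theory Num.Theory.
Import numFieldNormedType.Exports.

Local Open Scope classical_set_scope.
Local Open Scope ring_scope.

(** ** The Skorokhod space D([0,1]) *)

Definition cadlag01 (R : realType) (f : R -> R) : Prop :=
  (forall x : R, 0 <= x < 1 -> f y @[y --> x^'+] --> f x) /\
  (forall x : R, 0 < x <= 1 -> cvg (f y @[y --> x^'-])).

(* Only the restriction of the path to [0,1] matters: paths that agree on [0,1]
   are topologically indistinguishable for the topology defined below. *)
Record skorokhod (R : realType) := Skorokhod {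
  skorokhod_path :> R -> R;
  skorokhod_path_cadlag : cadlag01 skorokhod_path
}.

(* A strictly increasing map of [0,1] onto itself is automatically
   continuous. *)
Definition time_change (R : realType) (l : R -> R) : Prop :=
  set_bij `[0, 1] `[0, 1] l /\
  {in `[0, 1] &, {homo l : s t / s < t}}.

(* Up to strict versus large inequalities, which do not affect the topology,
   this is the ball of radius [e] for the Skorokhod (J1) distance
   inf_l max (sup_t |l t - t|, sup_t |f t - g (l t)|). *)
Definition skorokhod_ball (R : realType) (f : skorokhod R) (e : R)
    (g : skorokhod R) : Prop :=
  exists2 l : R -> R, time_change l &
    forall t : R, t \in `[0, 1] -> `|l t - t| < e /\ `|f t - g (l t)| < e.

Section skorokhod_topology.
Variable R : realType.
Implicit Types f g h : skorokhod R.

Lemma skorokhod_ball_center f (e : R) : 0 < e -> skorokhod_ball f e f.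
Proof.
move=> e0; exists id; last by move=> t _; rewrite !subrr normr0.
by split=> //; split=> // x /= xI; exists x.
Qed.

Lemma skorokhod_ball_sym f g (e : R) :
  skorokhod_ball f e g -> skorokhod_ball g e f.
Proof.
move=> [l [[lI linj lsurj] lmono] lfg].
have /choice[k kP] : forall t : R, exists s,
    t \in `[0, 1] -> s \in `[0, 1] /\ l s = t.
  move=> t; have [tI|_] := boolP (t \in `[0, 1]); last by exists 0.
  by have [s sI <-] := lsurj _ tI; exists s.
have lk t : t \in `[0, 1] -> l (k t) = t by move=> /kP[].
have kI t : t \in `[0, 1] -> k t \in `[0, 1] by move=> /kP[].
exists k; last first.
  move=> t tI; have [] := lfg _ (kI _ tI); rewrite lk // => ? ?.
  by rewrite distrC; split=> //; rewrite distrC.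
split; first split.
- by move=> t /= tI; exact: kI.
- move=> s t; rewrite !inE /= => sI tI kst.
  by rewrite -(lk _ sI) -(lk _ tI) kst.
- move=> s /= sI; exists (l s); first exact: lI.
  have lsI : l s \in `[0, 1] by exact: lI.
  by apply: linj; rewrite ?inE /=; [exact: kI|exact: sI|exact: lk].
move=> s t sI tI st; rewrite ltNge; apply/negP => kts.
have : l (k t) <= l (k s).
  move: kts; rewrite le_eqVlt => /predU1P[->//|].
  by move=> /(lmono _ _ (kI _ tI) (kI _ sI)) /ltW.
by rewrite !lk // leNgt st.
Qed.

Lemma skorokhod_ball_triangle f g h (e1 e2 : R) :
  skorokhod_ball f e1 g -> skorokhod_ball g e2 h ->
  skorokhod_ball f (e1 + e2) h.
Proof.
move=> [l [lbij lmono] lfg] [k [kbij kmono] kgh].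
have lI t : t \in `[0, 1] -> l t \in `[0, 1] by case: lbij => + _ _; exact.
exists (k \o l).
  split; first exact: set_bij_comp lbij kbij.
  by move=> s t sI tI st /=; apply: kmono; [exact: lI|exact: lI|exact: lmono].
move=> t tI /=; have [l1 l2] := lfg _ tI; have [k1 k2] := kgh _ (lI _ tI).
split.
  rewrite -(subrKA (l t)) addrC; apply: le_lt_trans (ler_normD _ _) _.
  exact: ltrD.
rewrite -(subrKA (g (l t))); apply: le_lt_trans (ler_normD _ _) _.
exact: ltrD.
Qed.

End skorokhod_topology.

HB.instance Definition _ (R : realType) := gen_eqMixin (skorokhod R).
HB.instance Definition _ (R : realType) := gen_choiceMixin (skorokhod R).
HB.instance Definition _ (R : realType) :=
  hasNbhs.Build (skorokhod R) (nbhs_ (entourage_ (@skorokhod_ball R))).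
HB.instance Definition _ (R : realType) :=
  @Nbhs_isPseudoMetric.Build R (skorokhod R)
    (entourage_ (@skorokhod_ball R)) erefl (@skorokhod_ball R)
    (@skorokhod_ball_center R) (@skorokhod_ball_sym R)
    (@skorokhod_ball_triangle R) erefl.

Lemma cadlag01_cst0 (R : realType) : cadlag01 (fun _ : R => 0 : R).
Proof. by split=> x _; [exact: cvg_cst|exact: is_cvg_cst]. Qed.

(* The zero path is a junk value; it is only ever used on a null set. *)
Definition to_skorokhod (R : realType) (f : R -> R) : skorokhod R :=
  if pselect (cadlag01 f) is left fD then Skorokhod fD
  else Skorokhod (@cadlag01_cst0 R).

(* Convergence in law in D([0,1]) of the processes [X i], along the filter [G],
   to the process [Y]; these processes are written [X i v w] and [Y v w] with
   [v] the time and [w] the outcome. The first two clauses say that they are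
   almost surely D([0,1])-valued (so that the law makes sense), the last one is
   weak convergence of the laws. *)
Definition cvg_in_law (R : realType) (I : Type) (G : set_system I)
    (d : measure_display) (Omega : measurableType d) (P : probability Omega R)
    (X : I -> R -> Omega -> R)
    (d' : measure_display) (Omega' : measurableType d')
    (P' : probability Omega' R) (Y : R -> Omega' -> R) : Prop :=
  [/\ \forall i \near G, {ae P, forall w, cadlag01 (X i ^~ w)},
      {ae P', forall w, cadlag01 (Y ^~ w)} &
      forall F : skorokhod R -> R,
        continuous F -> (exists M : R, forall f, `|F f| <= M) ->
        'E_P [fun w => F (to_skorokhod (X i ^~ w))]%E @[i --> G] -->
        'E_P' [fun w => F (to_skorokhod (Y ^~ w))]%E].

(** ** Brownian motion on [0,1] *)

(* A family [W] of random variables indexed by R, of which only the times in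
   [0,1] matter. [normal_prob m s] has mean [m] and standard deviation [s]. *)
Definition standard_brownian01 (R : realType) (d : measure_display)
    (Omega : measurableType d) (P : probability Omega R)
    (W : R -> Omega -> R) : Prop :=
  [/\ forall v : R, 0 <= v <= 1 -> measurable_fun setT (W v),
      forall w, W 0 w = 0,
      forall w, {within `[0, 1], continuous (W ^~ w)},
      forall s t : R, 0 <= s -> s < t -> t <= 1 ->
        forall B : set (measurableTypeR R), measurable B ->
          P [set w | B (W t w - W s w)] =
          normal_prob 0 (Num.sqrt (t - s)) B &
      forall (n : nat) (t : nat -> R) (B : nat -> set (measurableTypeR R)),
        0 <= t 0%N -> t n <= 1 ->
        (forall k, (k < n)%N -> t k <= t k.+1) ->
        (forall k, measurable (B k)) ->
        P [set w | forall k, (k < n)%N -> B k (W (t k.+1) w - W (t k) w)] =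
        (\prod_(k < n) P [set w | B k (W (t k.+1) w - W (t k) w)%R])%E].

(** ** Martingales *)

(* A filtration [FF] is given by its sets of events, and [M] is indexed by R, of
   which only the times [t >= 0] matter. The last clause is
   E[M t | FF s] = M s, conditional expectation being characterized by its
   integrals over the events of [FF s]. *)
Definition martingale (R : realType) (d : measure_display)
    (Omega : measurableType d) (P : probability Omega R)
    (FF : R -> set_system Omega) (M : R -> Omega -> \bar R) : Prop :=
  [/\ forall t : R, 0 <= t -> forall B : set (\bar R), measurable B ->
        FF t (M t @^-1` B),
      forall t : R, 0 <= t -> P.-integrable setT (M t) &
      forall s t : R, 0 <= s -> s <= t -> forall A, FF s A ->
        (\int[P]_(w in A) M t w = \int[P]_(w in A) M s w)%E].

(** ** Hawkes processes *)

Section point_process.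
Variables (R : realType) (d : measure_display) (Omega : measurableType d).
Variables (dim : nat) (T : nat -> Omega -> \bar R) (Z : nat -> Omega -> 'I_dim).

(* Jump times [T n] and marks [Z n] are numbered from [n = 0] and marks range
   over ['I_dim = {0, ..., dim - 1}]. *)
Definition marked_times : Prop :=
  [/\ forall n, measurable_fun setT (T n),
      forall n i, measurable [set w | Z n w = i],
      forall n w, (0 < T n w)%E,
      forall n w, (T n w <= T n.+1 w)%E &
      forall n w, (T n w < +oo)%E -> (T n w < T n.+1 w)%E].

Definition counting_process (i : 'I_dim) (t : R) (w : Omega) : \bar R :=
  (\sum_(0 <= n <oo)
    (\1_[set w | (T n w <= t%:E)%E /\ Z n w = i] w)%:E)%E.

(* The random measure dN_i on the line: unit mass at each finite jump time of
   mark [i]. *)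
Definition jump_measure (i : 'I_dim) (w : Omega) :
    {measure set (measurableTypeR R) -> \bar R} :=
  mseries (fun n =>
    if (T n w < +oo)%E && (Z n w == i) then
      (@dirac _ (measurableTypeR R) (fine (T n w)) R
       : {measure set (measurableTypeR R) -> \bar R})
    else mzero) 0.

Definition history (t : R) : set_system Omega :=
  <<s [set A | exists (i : 'I_dim) (s : R) (B : set (\bar R)),
         [/\ 0 <= s <= t, measurable B & A = counting_process i s @^-1` B]] >>.

(* [lambda i s w] is the intensity of the component [i] at time [s]. *)
Definition hawkes_process (P : probability Omega R)
    (lambda : 'I_dim -> R -> Omega -> \bar R) : Prop :=
  marked_times /\
  forall (n : nat) (i : 'I_dim),
    martingale P history (fun t w =>
      let u := fine (Order.min t%:E (T n w)) in
      counting_process i u w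
      - \int[lebesgue_measure]_(s in `[0%R, u]) lambda i s w)%E.

End point_process.

(* Main.v *)
Require Import Defs.
From HB Require Import structures.
From mathcomp Require Import all_boot all_order all_algebra.
From mathcomp Require Import all_classical all_reals all_analysis.
From mathcomp Require Import measurable_realfun.
From mathcomp Require Import ring lra.
Set Implicit Arguments.
Unset Strict Implicit.
Unset Printing Implicit Defensive.
Import Order.TTheory GRing.Theory Num.Theory.
Import numFieldNormedType.Exports.
Local Open Scope classical_set_scope.
Local Open Scope ring_scope.

(* Let [a] be the mass of the kernel and [M = M_1 - M_2] the difference of the two
   compensated counting processes. The path of [S = N_1 - N_2] solves the linear
   equation [S + phi * S = M]. Convolving with [phi] a path that oscillates little
   on macroscopic blocks almost amounts to multiplying it by [a], so [S] is
   uniformly close to [M / (1 + a)] on the scale [sqrt tau], by contraction.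
   The bracket of [M] is [N_1 + N_2], and the renewal equation for [N_1 + N_2]
   (with the martingale [M_1 + M_2]) gives [N_1 + N_2 ~ 2 nu t / (1 - a)].
   Hence the increments of [M] over the blocks become independent and Gaussian:
   in Lindeberg's exchange, the test function is smoothed by the increments of the
   given Brownian motion itself. Doob's inequality for the fourth moment controls
   the oscillations inside the blocks. A bounded continuous functional on the
   Skorokhod space is squeezed between functionals that are Lipschitz for the
   uniform norm; the latter only see the step paths.
   Everything is stopped at the [n]-th jump with [n ~ tau ^ 2], so that all random
   variables at a given time are bounded; the probability that this matters is
   [O (1 / tau)]. *)

(** * Expectations of bounded random variables *)

(** The numbers [1 - a] and [1 + a] come from diagonalising the exchange of the two components:
    [N_1 + eps N_2], with [eps] equal to 1 or -1, solves a scalar renewal equation with kernel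
    [eps phi]. So the bracket grows at rate [2 nu / (1 - a)], the difference is its martingale
    divided by [1 + a], and [sigma^2] is that rate divided by [(1 + a)^2]. The obstacle is that
    [phi] is merely integrable: without a first moment no speed of convergence is available, and the
    estimates hold up to an [e] that is small once [tau] is large ([regular]). Hence the order of
    choices: the number of blocks and the size of the sub-steps before [e], and [tau] last.
    Conditional identities are tested against bounded past variables [H] instead of using
    conditional expectations. Brackets and fourth moments are read off partitions whose errors
    vanish by dominated convergence; this is where the boundedness gained by stopping matters. The
    level [tau ^ 2] comes from Markov's inequality: [n + 1] jumps before [tau] have probability at
    most [rate tau / (n + 1)]. Fourth moments are used because a union bound over [m] blocks needs
    probabilities of order [m^-2]. *)

Section expectation.
Context {R : realType} {d : measure_display} {Omega : measurableType d}.
Variable P : probability Omega R.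
Implicit Types (f g : Omega -> R) (A : set Omega).

Definition ibl f := P.-integrable setT (EFin \o f).

Definition Ex f : R := \int[P]_w f w.

Definition Pr A : R := fine (P A).

(** Boundedness everywhere, not only almost surely, makes this class an algebra inside the
    integrable functions; integrability goals then follow from the shape of the formula, as in the
    tactic [bm]. *)
Definition bmf f := measurable_fun setT f /\ exists C : R, forall w, `|f w| <= C.

Lemma bmf_ge0 f : bmf f ->
  measurable_fun setT f /\ exists C : R, 0 <= C /\ forall w, `|f w| <= C.
Proof.
move=> [mf [C fC]]; split=> //; exists (Num.max C 0); split.
  by rewrite le_max lexx orbT.
by move=> w; rewrite le_max fC.
Qed.

Lemma bmf_meas f : bmf f -> measurable_fun setT f. Proof. by case. Qed.

Lemma bmf_cst (c : R) : bmf (fun=> c).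
Proof. by split; [exact: measurable_cst|exists `|c|]. Qed.

Lemma bmfD f g : bmf f -> bmf g -> bmf (fun w => f w + g w).
Proof.
move=> [mf [C fC]] [mg [D gD]]; split; first exact: measurable_funD.
by exists (C + D) => w; rewrite (le_trans (ler_normD _ _))// lerD.
Qed.

Lemma bmfN f : bmf f -> bmf (fun w => - f w).
Proof.
move=> [mf [C fC]]; split; first exact: measurableT_comp.
by exists C => w; rewrite normrN.
Qed.

Lemma bmfB f g : bmf f -> bmf g -> bmf (fun w => f w - g w).
Proof. by move=> bf bg; apply: bmfD => //; exact: bmfN. Qed.

Lemma bmfM f g : bmf f -> bmf g -> bmf (fun w => f w * g w).
Proof.
move=> [mf [C fC]] [mg [D gD]]; split; first exact: measurable_funM.
by exists (C * D) => w; rewrite normrM ler_pM.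
Qed.

Lemma bmfX f n : bmf f -> bmf (fun w => f w ^+ n).
Proof.
move=> [mf [C fC]]; split; first exact: measurable_funX.
by exists (C ^+ n) => w; rewrite normrX lerXn2r ?nnegrE ?(le_trans _ (fC w)).
Qed.

Lemma bmf_norm f : bmf f -> bmf (fun w => `|f w|).
Proof.
move=> [mf [C fC]]; split; first exact: measurableT_comp.
by exists C => w; rewrite normr_id.
Qed.

Lemma bmf_max f g : bmf f -> bmf g -> bmf (fun w => Num.max (f w) (g w)).
Proof.
move=> [mf [C fC]] [mg [D gD]]; split; first exact: measurable_maxr.
exists (Num.max C D) => w; rewrite le_max.
by case: (leP (f w) (g w)) => _; rewrite ?fC ?gD ?orbT.
Qed.

Lemma bmf_sum (I : Type) (r : seq I) (Q : pred I) (F : I -> Omega -> R) :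
  (forall i, bmf (F i)) -> bmf (fun w => \sum_(i <- r | Q i) F i w).
Proof.
move=> bF; elim: r => [|i r IH].
  by under eq_fun do rewrite big_nil; exact: bmf_cst.
under eq_fun do rewrite big_cons.
by case: (Q i) => //; exact: bmfD.
Qed.

Lemma bmf_prod (I : Type) (r : seq I) (Q : pred I) (F : I -> Omega -> R) :
  (forall i, bmf (F i)) -> bmf (fun w => \prod_(i <- r | Q i) F i w).
Proof.
move=> bF; elim: r => [|i r IH].
  by under eq_fun do rewrite big_nil; exact: bmf_cst.
under eq_fun do rewrite big_cons.
by case: (Q i) => //; exact: bmfM.
Qed.

Lemma bmf_indic A : measurable A -> bmf (\1_A : Omega -> R).
Proof.
move=> mA; split; first exact: measurable_indic.
by exists 1 => w; rewrite indicE; case: (_ \in _); rewrite ?normr1 ?normr0.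
Qed.

Lemma bmf_comp (h : R -> R) f C : measurable_fun setT h ->
  (forall x, `|h x| <= C) -> measurable_fun setT f -> bmf (fun w => h (f w)).
Proof.
move=> mh hC mf; split; first exact: measurableT_comp.
by exists C => w; exact: hC.
Qed.

Lemma bmf_ibl f : bmf f -> ibl f.
Proof.
move=> [mf [C fC]]; apply: measurable_bounded_integrable => //.
  by rewrite -ge0_fin_numE// fin_num_measure.
exists C; split; first exact: num_real.
by move=> x Cx w _; apply: (le_trans (fC w)); exact: ltW.
Qed.

Lemma iblD f g : ibl f -> ibl g -> ibl (fun w => f w + g w).
Proof.
move=> fi gi; have := integrableD measurableT fi gi.
by apply: eq_integrable.
Qed.

Lemma iblZ (c : R) f : ibl f -> ibl (fun w => c * f w).
Proof.
move=> fi; have := integrableZl measurableT c fi.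
by apply: eq_integrable => // w _ /=; rewrite EFinM.
Qed.

Lemma iblN f : ibl f -> ibl (fun w => - f w).
Proof. by move=> fi; have := iblZ (-1) fi; under eq_fun do rewrite mulN1r. Qed.

Lemma iblB f g : ibl f -> ibl g -> ibl (fun w => f w - g w).
Proof. by move=> ? ?; apply: iblD => //; exact: iblN. Qed.

Lemma ibl_meas f : ibl f -> measurable_fun setT f.
Proof. by move=> /measurable_int/measurable_EFinP. Qed.

Lemma ibl_le f g : measurable_fun setT f -> ibl g ->
  (forall w, `|f w| <= g w) -> ibl f.
Proof.
move=> mf ig fg; apply: (le_integrable _ _ _ ig) => //.
  exact/measurable_EFinP.
move=> w _ /=; rewrite lee_fin (le_trans (fg w))// ler_norm //.
Qed.

Lemma ibl_norm f : ibl f -> ibl (fun w => `|f w|).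
Proof.
move=> fi; have := integrable_norm fi; apply.
Qed.

Lemma iblMb f g : ibl f -> bmf g -> ibl (fun w => f w * g w).
Proof.
move=> fi [mg [C gC]].
apply: (@ibl_le _ (fun w => C * `|f w|)).
- by apply: measurable_funM => //; exact: ibl_meas.
- exact/iblZ/ibl_norm.
- by move=> w; rewrite normrM mulrC ler_wpM2r.
Qed.

Lemma ExD f g : ibl f -> ibl g -> Ex (fun w => f w + g w) = Ex f + Ex g.
Proof. by move=> ? ?; rewrite /Ex RintegralD. Qed.

Lemma ExB f g : ibl f -> ibl g -> Ex (fun w => f w - g w) = Ex f - Ex g.
Proof. by move=> ? ?; rewrite /Ex RintegralB. Qed.

Lemma ExZ (c : R) f : ibl f -> Ex (fun w => c * f w) = c * Ex f.
Proof. by move=> ?; rewrite /Ex RintegralZl. Qed.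

Lemma ExZr (c : R) f : ibl f -> Ex (fun w => f w * c) = Ex f * c.
Proof. by move=> ?; rewrite /Ex RintegralZr. Qed.

Lemma ExN f : ibl f -> Ex (fun w => - f w) = - Ex f.
Proof.
by move=> fi; rewrite -mulN1r -ExZ//; congr Ex; apply/funext => w; rewrite mulN1r.
Qed.

Lemma Ex_cst (c : R) : Ex (fun=> c) = c.
Proof.
rewrite /Ex Rintegral_cst//.
have -> : fine (P setT) = 1 by rewrite (probability_setT P).
by rewrite mulr1.
Qed.

Lemma Ex_sum (I : Type) (r : seq I) (Q : pred I) (F : I -> Omega -> R) :
  (forall i, bmf (F i)) ->
  Ex (fun w => \sum_(i <- r | Q i) F i w) = \sum_(i <- r | Q i) Ex (F i).
Proof.
move=> bF; elim: r => [|i r IH].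
  by rewrite big_nil -[RHS](Ex_cst 0); under eq_fun do rewrite big_nil.
rewrite big_cons; under eq_fun do rewrite big_cons.
by case: (Q i) => //; rewrite ExD ?IH//; apply: bmf_ibl => //; exact: bmf_sum.
Qed.

Lemma Ex_le f g : ibl f -> ibl g -> (forall w, f w <= g w) -> Ex f <= Ex g.
Proof. by move=> ? ? fg; apply: le_Rintegral. Qed.

Lemma Ex_ge0 f : (forall w, 0 <= f w) -> 0 <= Ex f.
Proof. by move=> f0; apply: Rintegral_ge0. Qed.

Lemma Ex_norm_le f : ibl f -> `|Ex f| <= Ex (fun w => `|f w|).
Proof. by move=> fi; apply: le_normr_Rintegral. Qed.

Lemma Ex_normB f g h : ibl f -> ibl g -> ibl h ->
  (forall w, `|f w - g w| <= h w) -> `|Ex f - Ex g| <= Ex h.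
Proof.
move=> fi gi hi fgh; rewrite -ExB//.
rewrite (le_trans (Ex_norm_le _))//; first exact: iblB.
by apply: Ex_le => //; apply: ibl_norm; exact: iblB.
Qed.

Lemma Ex_bound f C : ibl f -> (forall w, `|f w| <= C) -> `|Ex f| <= C.
Proof.
move=> fi fC; rewrite -[leRHS]Ex_cst (le_trans (Ex_norm_le fi))//.
by apply: Ex_le => //; [exact: ibl_norm|exact/bmf_ibl/bmf_cst].
Qed.

Lemma Ex_indic A : measurable A -> Ex (\1_A : Omega -> R) = Pr A.
Proof. by move=> mA; rewrite /Ex /Rintegral integral_indic// setIT. Qed.

Lemma Pr_ge0 A : 0 <= Pr A. Proof. exact: fine_ge0. Qed.

Lemma PrE A : measurable A -> (Pr A)%:E = P A.
Proof. by move=> mA; rewrite fineK// fin_num_measure. Qed.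

Lemma Pr_le A B : measurable A -> measurable B -> A `<=` B -> Pr A <= Pr B.
Proof.
move=> mA mB AB; rewrite -lee_fin !PrE//; apply: le_measure => //; rewrite inE//.
Qed.

Lemma PrC A : measurable A -> Pr (~` A) = 1 - Pr A.
Proof.
move=> mA; apply: EFin_inj; rewrite EFinB !PrE//; last exact: measurableC.
exact: probability_setC.
Qed.

Lemma PrU A B : measurable A -> measurable B -> Pr (A `|` B) <= Pr A + Pr B.
Proof.
move=> mA mB; rewrite -lee_fin EFinD !PrE//; last exact: measurableU.
exact: measureU2.
Qed.

Lemma Pr_bigsetU n (A : nat -> set Omega) : (forall i, measurable (A i)) ->
  Pr (\big[setU/set0]_(i < n) A i) <= \sum_(i < n) Pr (A i).
Proof.
move=> mA; elim: n => [|n IH].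
  by rewrite !big_ord0 /Pr measure0.
rewrite !big_ord_recr/= (le_trans (PrU _ _))//.
  by apply: bigsetU_measurable.
by rewrite lerD2r.
Qed.

Lemma Pr_markov f (c : R) A : measurable A -> ibl f -> (forall w, 0 <= f w) ->
  (forall w, A w -> c <= f w) -> c * Pr A <= Ex f.
Proof.
move=> mA fi f0 Acf; rewrite -Ex_indic// -ExZ; last exact/bmf_ibl/bmf_indic.
apply: Ex_le => //; first exact/iblZ/bmf_ibl/bmf_indic.
move=> w; rewrite indicE; case: (boolP (w \in A)) => [/set_mem/Acf|_].
  by rewrite mulr1.
by rewrite mulr0.
Qed.

(** Jensen's inequality, read off the nonnegative variance of [|f|]. *)
Lemma Ex_sqr_norm f : bmf f -> Ex (fun w => `|f w|) ^+ 2 <= Ex (fun w => f w ^+ 2).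
Proof.
move=> bf; set m := Ex (fun w => `|f w|).
have: 0 <= Ex (fun w => (`|f w| - m) ^+ 2).
  by apply: Ex_ge0 => w; exact: sqr_ge0.
have bn := bmf_norm bf.
have -> : (fun w => (`|f w| - m) ^+ 2) =
    (fun w => (f w ^+ 2 - 2 * m * `|f w|) + m ^+ 2).
  by apply/funext => w; rewrite sqrrB real_normK ?num_real//; ring.
rewrite ExD; last 2 first.
- apply: bmf_ibl; apply: bmfB; first exact: bmfX.
  by apply: bmfM => //; exact: bmf_cst.
- exact/bmf_ibl/bmf_cst.
rewrite ExB; last 2 first.
- exact/bmf_ibl/bmfX.
- by apply/iblZ/bmf_ibl.
rewrite ExZ; last exact: bmf_ibl.
rewrite Ex_cst -/m.
by lra.
Qed.

Lemma Ex_cvg (f_ : nat -> Omega -> R) f g :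
  (forall n, measurable_fun setT (f_ n)) -> ibl g ->
  (forall n w, `|f_ n w| <= g w) ->
  (forall w, f_ n w @[n --> \oo] --> f w) ->
  ibl f /\ Ex (f_ n) @[n --> \oo] --> Ex f.
Proof.
move=> mf_ ig fg cf.
have mf : measurable_fun setT f.
  by apply: (@measurable_fun_cvg _ _ _ setT f_) => // w _; exact: cf.
have cE : {ae P, forall w, setT w -> (EFin \o f_ n) w @[n --> \oo] --> (EFin \o f) w}.
  by apply: aeW => w _; apply: cvg_EFin; [exact: nearW|exact: cf].
have bE : {ae P, forall w n, setT w -> (`|(EFin \o f_ n) w| <= (EFin \o g) w)%E}.
  by apply: aeW => w n _ /=; rewrite lee_fin.
have [i1 _ i3] := @dominated_convergence _ _ _ P setT measurableT
  (fun n => EFin \o f_ n) (EFin \o f) (EFin \o g)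
  (fun n => proj2 (measurable_EFinP _ _) (mf_ n))
  (proj2 (measurable_EFinP _ _) mf) cE ig bE.
split=> //.
have fin : (\int[P]_x (f x)%:E)%E = (Ex f)%:E.
  by rewrite /Ex /Rintegral fineK// integrable_fin_num.
by move: i3; rewrite /= fin => /fine_cvg.
Qed.

End expectation.

Ltac bm := repeat first [ assumption | solve [apply: bmf_cst] | apply: bmfN
  | apply: bmfB | apply: bmfD | apply: bmfM | apply: bmfX
  | apply: bmf_norm | apply: bmf_max | solve [by []] ].

(** * Maximal inequality and layer cake *)

(** The sum counts the positive integers up to [x], so it is the integer part of [x]. It serves to
    discretise a bounded variable into indicators of its level sets. *)
Lemma layer_approx (R : realType) (K : nat) (x : R) : 0 <= x <= K%:R ->
  `|x - \sum_(i < K) (i.+1%:R <= x)%R%:R| <= 1.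
Proof.
elim: K => [|K IH] /andP[x0 xK].
  by rewrite big_ord0 subr0 ger0_norm// (le_trans xK).
rewrite big_ord_recr/=; case: (leP x K%:R) => xK'.
  have -> : (K.+1%:R <= x) = false.
    by apply/negbTE; rewrite -ltNge (le_lt_trans xK')// ltr_nat.
  by rewrite addr0 IH// x0.
rewrite (eq_bigr (fun=> 1)) => [|i _]; last first.
  by rewrite (le_trans _ (ltW xK'))// ler_nat.
rewrite sumr_const card_ord.
move: xK; rewrite -natr1 => xK.
by case: (leP _ x) => h /=; rewrite ler_norml; apply/andP; split; lra.
Qed.

Fixpoint runmax {R : realType} (X : nat -> R) n : R :=
  if n is n'.+1 then Num.max (runmax X n') (X n) else X 0%N.

Lemma runmax_ge {R : realType} (X : nat -> R) n k : (k <= n)%N -> X k <= runmax X n.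
Proof.
elim: n => [|n IH]; first by rewrite leqn0 => /eqP ->.
rewrite leq_eqVlt => /predU1P[->|/IH h] /=; rewrite le_max ?lexx ?orbT//.
by rewrite h.
Qed.

(* This pathwise form of Doob's L2 maximal inequality avoids any layer-cake
   integration: taking expectations, the sum is nonnegative for a submartingale. *)
Lemma runmax_sqr_le {R : realType} (X : nat -> R) n : (forall k, 0 <= X k) ->
  runmax X n ^+ 2 <=
    4 * X n ^+ 2 - 4 * \sum_(k < n) runmax X k * (X k.+1 - X k).
Proof.
move=> X0.
have h : 2^-1 * runmax X n ^+ 2 <=
    runmax X n * X n - \sum_(k < n) runmax X k * (X k.+1 - X k).
  elim: n => [|n IH]; first by rewrite /= big_ord0; have := X0 0%N; nra.
  rewrite big_ord_recr/=; set s := \sum_(k < n) _ in IH *.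
  set a := runmax X n in IH *; set b := X n.+1; set c := X n in IH *.
  case: (leP a b) => hm; last by rewrite -/a; lra.
  have := sqr_ge0 (b - a); rewrite !expr2; lra.
set s := \sum_(k < n) _ in h *.
have := sqr_ge0 (2^-1 * runmax X n - X n); rewrite !expr2 in h *; lra.
Qed.

Section expectation2.
Context {R : realType} {d : measure_display} {Omega : measurableType d}.
Variable P : probability Omega R.
Implicit Types (f g H xi : Omega -> R) (A : set Omega).

(** Expectation of [runmax_sqr_le]. The submartingale property is asked for in tested form, against
    the running maximum, which is what [comp_doob] supplies. *)
Lemma Ex_doob (X : nat -> Omega -> R) n : (forall k, bmf (X k)) ->
  (forall k w, 0 <= X k w) ->
  (forall k, (k < n)%N ->
    0 <= Ex P (fun w => runmax (X ^~ w) k * (X k.+1 w - X k w))) ->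
  Ex P (fun w => runmax (X ^~ w) n ^+ 2) <= 4 * Ex P (fun w => X n w ^+ 2).
Proof.
move=> bX X0 XM.
have bm k : bmf (fun w => runmax (X ^~ w) k).
  by elim: k => [|k IH] //=; apply: bmf_max.
have bt k : bmf (fun w => runmax (X ^~ w) k * (X k.+1 w - X k w)).
  by apply: bmfM => //; exact: bmfB.
have bs : bmf (fun w => \sum_(k < n) runmax (X ^~ w) k * (X k.+1 w - X k w)).
  exact: bmf_sum.
apply: (@le_trans _ _ (Ex P (fun w => 4 * X n w ^+ 2 -
    4 * \sum_(k < n) runmax (X ^~ w) k * (X k.+1 w - X k w)))).
  apply: Ex_le.
  - exact/bmf_ibl/bmfX.
  - by apply: bmf_ibl; bm.
  - by move=> w; apply: runmax_sqr_le => k.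
rewrite ExB; last 2 first.
- exact/iblZ/bmf_ibl/bmfX.
- exact/iblZ/bmf_ibl.
rewrite !ExZ; last 2 first.
- exact/bmf_ibl.
- exact/bmf_ibl/bmfX.
rewrite Ex_sum// lerBlDr lerDl mulr_ge0//.
by apply: sumr_ge0 => k _; exact: XM.
Qed.

Lemma measurable_ge (r : R) f : measurable_fun setT f ->
  measurable [set w | r <= f w].
Proof.
move=> mf; have -> : [set w | r <= f w] = f @^-1` `[r, +oo[%classic.
  by apply/seteqP; split=> w /=; rewrite in_itv/= andbT.
by rewrite -[X in measurable X]setTI; apply: mf.
Qed.

(** A discrete layer cake: with [|H| <= C], the variable [q (H + C)] is within 1 of a sum of level
    indicators, to which [xi] is orthogonal. So [q |S| <= E|xi|] for every [q], where [S] is the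
    mean of [xi (H + C)]. Orthogonality known on events thus reaches bounded variables. *)
Lemma Ex_layer_bmf xi H : bmf xi -> bmf H -> Ex P xi = 0 ->
  (forall r, Ex P (fun w => xi w * \1_[set w | r <= H w] w) = 0) ->
  Ex P (fun w => xi w * H w) = 0.
Proof.
move=> bxi bH xi0 xir.
have [mH [C [C0 HC]]] := bmf_ge0 bH.
have bc : bmf (fun _ : Omega => C) by exact: bmf_cst.
pose S := Ex P (fun w => xi w * (H w + C)).
have bI r : bmf (\1_[set w | r <= H w] : Omega -> R).
  exact/bmf_indic/measurable_ge.
have key q : (0 < q)%N -> q%:R * `|S| <= Ex P (fun w => `|xi w|).
  move=> q0; have q0' : (0 : R) < q%:R by rewrite ltr0n.
  pose K := (Num.trunc (q%:R * (2 * C))).+1.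
  have KC : q%:R * (2 * C) <= K%:R.
    by rewrite ltW// truncnS_gt.
  pose a i : R := i.+1%:R / q%:R - C.
  have aE i w : (i.+1%:R <= q%:R * (H w + C)) = (a i <= H w).
    by rewrite /a lerBlDr ler_pdivrMr// mulrC.
  have -> : q%:R * `|S| = `|Ex P (fun w => xi w * (q%:R * (H w + C)))
     - Ex P (fun w => \sum_(i < K) xi w * \1_[set w | a i <= H w] w)|.
    rewrite (_ : (fun w => xi w * (q%:R * (H w + C))) =
        (fun w => q%:R * (xi w * (H w + C)))); last first.
      by apply/funext => w; ring.
    rewrite ExZ; last by apply/bmf_ibl/bmfM => //; exact: bmfD.
    rewrite Ex_sum; last by move=> i; exact: bmfM.
    by rewrite big1 ?subr0 ?normrM ?(gtr0_norm q0')// => i _; exact: xir.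
  apply: Ex_normB.
  - apply/bmf_ibl/bmfM => //; apply: bmfM; first exact: bmf_cst.
    exact: bmfD.
  - by apply/bmf_ibl/bmf_sum => i; exact: bmfM.
  - exact/bmf_ibl/bmf_norm.
  move=> w; rewrite -mulr_sumr -mulrBr normrM ler_piMr//.
  rewrite (eq_bigr (fun i : 'I_K => (i.+1%:R <= q%:R * (H w + C))%R%:R)); last first.
    move=> i _; rewrite indicE aE; congr (nat_of_bool _)%:R.
    by apply/idP/idP => [/set_mem//|/mem_set].
  apply: layer_approx; have := HC w; rewrite ler_norml => /andP[h1 h2].
  apply/andP; split; first by apply: mulr_ge0; [exact: ltW|lra].
  by apply: le_trans KC; rewrite ler_pM2l//; lra.
have S0 : S = 0.
  apply/eqP; rewrite -normr_le0 leNgt; apply/negP => Spos.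
  pose q := (Num.trunc (Ex P (fun w => `|xi w|) / `|S|)).+1.
  have := key q isT; apply/negP; rewrite -ltNge.
  by rewrite -ltr_pdivrMr// truncnS_gt.
rewrite (_ : (fun w => xi w * H w) = (fun w => xi w * (H w + C) - C * xi w)); last first.
  by apply/funext => w; ring.
rewrite ExB ?ExZ ?xi0 -?/S ?S0 ?mulr0 ?subr0//.
- exact: bmf_ibl.
- by apply/bmf_ibl/bmfM => //; exact: bmfD.
- exact/iblZ/bmf_ibl.
Qed.

(** Truncation at [-n] and [n]: a level set of the truncated variable is everything, a level set of
    [H], or empty. Dominated convergence removes the truncation. *)
Lemma Ex_layer xi H : bmf xi -> ibl P H -> Ex P xi = 0 ->
  (forall r, Ex P (fun w => xi w * \1_[set w | r <= H w] w) = 0) ->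
  Ex P (fun w => xi w * H w) = 0.
Proof.
move=> bxi iH xi0 xir.
have mH := ibl_meas iH.
pose Hn (n : nat) w := Num.max (- n%:R) (Num.min n%:R (H w)).
have bHn n : bmf (Hn n).
  split.
    apply: measurable_maxr; first exact: measurable_cst.
    by apply: measurable_minr => //; exact: measurable_cst.
  exists n%:R => w; rewrite ler_norml le_max lexx/= ge_max ge_min lexx/=.
  by rewrite andbT (@le_trans _ _ 0)// oppr_le0.
have HnH n w : `|Hn n w| <= `|H w|.
  rewrite /Hn; have n0 : (0 : R) <= n%:R by [].
  have Hle := ler_norm (H w); have Hge := lerNnormlW (lexx `|H w|).
  rewrite ler_norml le_max le_min Hge ge_max ge_min Hle orbT andbT.
  have H0 := normr_ge0 (H w).
  by apply/andP; split; [apply/orP; right|]; lra.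
have z n : Ex P (fun w => xi w * Hn n w) = 0.
  apply: Ex_layer_bmf => // r.
  case: (leP r (- n%:R)) => rn.
    rewrite (_ : (fun w => _) = xi)//; apply/funext => w.
    by rewrite indicE mem_set ?mulr1//= /Hn le_max rn.
  case: (leP r n%:R) => rn'.
    rewrite -[RHS](xir r); congr (Ex P _); apply/funext => w.
    congr (_ * _); rewrite !indicE; congr (nat_of_bool _)%:R.
    have e : (r <= Hn n w) = (r <= H w).
      by rewrite /Hn le_max le_min (leNgt r) rn/= rn'.
    by apply/idP/idP => /set_mem/= h; apply/mem_set; rewrite /= ?e// -e.
  rewrite (_ : (fun w => _) = (fun=> 0)) ?Ex_cst//; apply/funext => w.
  rewrite indicE memNset ?mulr0//= /Hn; apply/negP; rewrite -ltNge gt_max.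
  rewrite gt_min rn' andbT /= (le_lt_trans _ rn')//.
  by rewrite (@le_trans _ _ 0)// oppr_le0.
have [_ [C [C0 xiC]]] := bmf_ge0 bxi.
have [] := @Ex_cvg _ _ _ P (fun n w => xi w * Hn n w) (fun w => xi w * H w)
    (fun w => C * `|H w|).
- by move=> n; apply: measurable_funM; [exact: bmf_meas|exact: bmf_meas].
- exact/iblZ/ibl_norm.
- by move=> n w; rewrite normrM ler_pM.
- move=> w; apply: cvgM; first exact: cvg_cst.
  apply: cvg_near_cst; near=> n.
  have : `|H w| <= n%:R by near: n; exact: nbhs_infty_ger.
  rewrite ler_norml => /andP[h1 h2]; rewrite /Hn.
  by rewrite min_r// max_r.
move=> _; under eq_fun do rewrite z.
by move=> /cvg_lim <- //; rewrite lim_cst.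
Unshelve. all: by end_near.
Qed.

(** Two layer arguments: for a fixed event of [f], indicators of [g] are replaced by [g]; with [g]
    in place, indicators of [f] are replaced by [f], which may be unbounded. *)
Lemma Ex_indep f g : ibl P f -> bmf g ->
  (forall A B : set R, measurable A -> measurable B ->
    Pr P (f @^-1` A `&` g @^-1` B) = Pr P (f @^-1` A) * Pr P (g @^-1` B)) ->
  Ex P (fun w => f w * g w) = Ex P f * Ex P g.
Proof.
move=> fi bg fg.
have mf := ibl_meas fi; have mg := bmf_meas bg.
have mpre (h : Omega -> R) (B : set R) : measurable_fun setT h -> measurable B ->
    measurable (h @^-1` B).
  by move=> mh mB; rewrite -[X in measurable X]setTI; exact: mh.
have mray (r : R) : measurable [set x : R | r <= x].
  rewrite (_ : [set x | _] = `[r, +oo[%classic) //.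
  by apply/seteqP; split=> x /=; rewrite in_itv/= andbT.
have ind (B C : set Omega) (w : Omega) : (\1_B w : R) * \1_C w = \1_(B `&` C) w.
  rewrite !indicE -natrM mulnb; congr (nat_of_bool _)%:R.
  apply/idP/idP => [/andP[/set_mem ? /set_mem ?]|/set_mem[? ?]].
    by apply/mem_set; split.
  by apply/andP; split; apply/mem_set.
have s1 (A : set R) : measurable A ->
    Ex P (fun w => (\1_(f @^-1` A) w - Pr P (f @^-1` A)) * g w) = 0.
  move=> mA; have mfA := mpre _ _ mf mA.
  have b1 : bmf (\1_(f @^-1` A) : Omega -> R) by exact: bmf_indic.
  apply: Ex_layer_bmf => //.
  - by apply: bmfB => //; exact: bmf_cst.
  - rewrite ExB; [|exact: bmf_ibl|exact/bmf_ibl/bmf_cst].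
    by rewrite Ex_indic// Ex_cst subrr.
  move=> r; have mgr := mpre _ _ mg (mray r).
  have b2 : bmf (\1_(g @^-1` [set x : R | r <= x]) : Omega -> R) by exact: bmf_indic.
  rewrite (_ : (fun w => _) = (fun w => \1_(f @^-1` A `&` g @^-1` [set x : R | r <= x]) w
     - Pr P (f @^-1` A) * \1_(g @^-1` [set x : R | r <= x]) w)); last first.
    by apply/funext => w; rewrite mulrBl ind.
  rewrite ExB; last 2 first.
  - by apply/bmf_ibl/bmf_indic/measurableI.
  - exact/iblZ/bmf_ibl.
  rewrite ExZ; last exact/bmf_ibl.
  by rewrite !Ex_indic ?fg ?subrr//; exact: measurableI.
have ig := bmf_ibl P bg.
have s2 : Ex P (fun w => (g w - Ex P g) * f w) = 0.
  apply: Ex_layer => //.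
  - by apply: bmfB => //; exact: bmf_cst.
  - by rewrite ExB// ?Ex_cst ?subrr//; exact/bmf_ibl/bmf_cst.
  move=> r; have := s1 _ (mray r).
  set A := f @^-1` _.
  have b1 : bmf (\1_A : Omega -> R) by apply: bmf_indic; exact: mpre.
  rewrite (_ : (fun w => _) = (fun w => \1_A w * g w - Pr P A * g w)); last first.
    by apply/funext => w; rewrite mulrBl.
  rewrite ExB; [|exact/bmf_ibl/bmfM|exact/iblZ].
  rewrite ExZ// => h.
  rewrite (_ : (fun w => _) = (fun w => \1_A w * g w - Ex P g * \1_A w)); last first.
    by apply/funext => w; rewrite mulrBl mulrC.
  rewrite ExB; [|exact/bmf_ibl/bmfM|exact/iblZ/bmf_ibl].
  rewrite ExZ; last exact/bmf_ibl.
  by rewrite Ex_indic ?(mulrC (Ex P g))//; exact: mpre.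
move: s2; rewrite (_ : (fun w => _) = (fun w => f w * g w - Ex P g * f w)); last first.
  by apply/funext => w; rewrite mulrBl mulrC.
rewrite ExB; [|exact: iblMb|exact/iblZ].
by rewrite ExZ// (mulrC (Ex P g)) => /eqP; rewrite subr_eq0 => /eqP.
Qed.

End expectation2.

(** * Moments of the normal law *)

Section density.
Import HBNNSimple.
Context {R : realType} {d : measure_display} {Omega : measurableType d}.
Variable P : {measure set Omega -> \bar R}.
Local Notation mu := (@lebesgue_measure R).
Local Open Scope ereal_scope.

(** Both sides are monotone limits along simple functions approximating [f]; for a simple function
    the identity is [PX] on each fibre. *)
Lemma ge0_integral_density (X : Omega -> measurableTypeR R) (g : R -> R)
    (f : measurableTypeR R -> \bar R) :
  measurable_fun setT X -> measurable_fun setT g -> (forall x, 0 <= g x)%R ->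
  (forall B : set (measurableTypeR R), measurable B ->
    P (X @^-1` B) = \int[mu]_(x in B) (g x)%:E) ->
  measurable_fun setT f -> (forall x, 0 <= f x) ->
  \int[P]_w f (X w) = \int[mu]_x (f x * (g x)%:E).
Proof.
move=> mX mg g0 PX mf f0.
pose f_ := nnsfun_approx measurableT mf.
have cf x : (f_ n x)%:E @[n --> \oo] --> f x.
  by apply: cvg_nnsfun_approx.
have ndf x : {homo (fun n => f_ n x) : m n / (m <= n)%N >-> (m <= n)%R}.
  by move=> m n mn; exact/lefP/nd_nnsfun_approx.
transitivity (limn (fun n => \int[P]_w (f_ n (X w))%:E)).
  rewrite -monotone_convergence//.
  - by apply: eq_integral => w _; apply/esym/cvg_lim => //; exact: cf.
  - by move=> n; apply/measurable_EFinP; exact: measurableT_comp.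
  - by move=> n w _; rewrite lee_fin.
  - by move=> w _ m n mn; rewrite lee_fin; exact: ndf.
rewrite [X in limn X](_ : _ =
    (fun n => \int[mu]_x ((f_ n x)%:E * (g x)%:E))); last first.
  apply/funext => n.
  have mfn r : measurable (f_ n @^-1` [set r]) by [].
  have mXfn r : measurable (X @^-1` (f_ n @^-1` [set r])).
    by rewrite -[X in measurable X]setTI; exact: mX.
  transitivity (\sum_(k \in range (f_ n))
      \int[P]_w (k * \1_(X @^-1` (f_ n @^-1` [set k])) w)%:E).
    under eq_integral do rewrite fimfunE -fsumEFin//.
    rewrite ge0_integral_fsum//.
    - move=> y; apply/measurable_EFinP/measurable_funM => //.
      apply: measurable_indic; exact: mXfn.
    - move=> y x _; rewrite lee_fin.
      by have := nnfun_muleindic_ge0 (f_ n) y (X x); rewrite -EFinM lee_fin.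
  transitivity (\sum_(k \in range (f_ n))
      \int[mu]_x (k * \1_(f_ n @^-1` [set k]) x * g x)%:E); last first.
    under [RHS]eq_integral do rewrite -EFinM fimfunE mulr_fsuml// -fsumEFin//.
    rewrite ge0_integral_fsum//.
    - by move=> y; apply/measurable_EFinP/measurable_funM => //; exact/measurable_funM.
    - move=> y x _; rewrite lee_fin mulr_ge0//.
      by have := nnfun_muleindic_ge0 (f_ n) y x; rewrite -EFinM lee_fin.
  apply: eq_fsbigr => r /set_mem[x _ rE].
  have r0 : (0 <= r)%R by rewrite -rE.
  under eq_integral do rewrite EFinM.
  rewrite ge0_integralZl//; last first.
    by apply/measurable_EFinP; apply: measurable_indic; exact: mXfn.
  rewrite integral_indic// setIT PX//.
  under [RHS]eq_integral do rewrite -mulrA EFinM.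
  rewrite ge0_integralZl//; last 2 first.
  - by apply/measurable_EFinP/measurable_funM.
  - by move=> y _; rewrite lee_fin mulr_ge0.
  congr (_ * _); rewrite [LHS]integral_mkcond; apply: eq_integral => y _.
  by rewrite patchE indicE; case: ifP => _; rewrite ?mul1r ?mul0r.
rewrite -monotone_convergence//.
- apply: eq_integral => x _; apply/cvg_lim => //.
  by apply: cvgeZr => //; exact: cf.
- by move=> n; apply: emeasurable_funM; exact/measurable_EFinP.
- by move=> n x _; rewrite mule_ge0 ?lee_fin.
- by move=> x _ m n mn; rewrite lee_wpmul2r ?lee_fin//; exact: ndf.
Qed.

End density.

Section gauss_moments.
Context {R : realType}.
Variable (v : R).
Hypothesis v0 : 0 < v.
Local Notation mu := (@lebesgue_measure R).
Let s := Num.sqrt v.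
Let p := normal_pdf 0 s.

Let s_neq0 : s != 0. Proof. by rewrite gt_eqF// sqrtr_gt0. Qed.

Let pE x : p x = normal_peak s * expR (- x ^+ 2 / (2 * v)).
Proof.
rewrite /p normal_pdfE// /normal_fun subr0; congr (_ * expR (_ / _)).
by rewrite sqr_sqrtr ?ltW// mulr_natl.
Qed.

Let p_ge0 x : 0 <= p x. Proof. exact: normal_pdf_ge0. Qed.

Let cp : continuous p. Proof. exact: continuous_normal_pdf. Qed.

Let pN x : p (- x) = p x. Proof. by rewrite !pE sqrrN. Qed.

Let is_derive_p (x : R) : is_derive x (1 : R) p (- (x / v) * p x).
Proof.
rewrite (_ : p = fun x => normal_peak s * expR (- x ^+ 2 / (2 * v))); last first.
  by apply/funext => y; exact: pE.
apply: is_derive_eq.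
rewrite /GRing.scale /=.
have : v != 0 by rewrite gt_eqF.
by move=> ?; field.
Qed.

(** Truncation to [[0, n]] puts the moments within reach of the fundamental theorem of calculus;
    evenness and [n -> oo] recover the whole line. *)
Let J k (n : R) := \int[mu]_(x in `[0, n]) (x ^+ k * p x).

Let cJ k : continuous (fun x : R => x ^+ k * p x).
Proof. by move=> x; apply: cvgM; [exact: exprn_continuous|exact: cp]. Qed.

Let iJ k (n : R) : mu.-integrable `[0, n] (EFin \o (fun x : R => x ^+ k * p x)).
Proof.
apply: continuous_compact_integrable; first exact: segment_compact.
exact/continuous_subspaceT/cJ.
Qed.

(** Integration by parts: since [p' = - (x / v) p], the function [- v x^(k+1) p] is a primitive of
    the difference of the two integrands. *)
Let J_rec k n : 0 < n -> J k.+2 n = k.+1%:R * v * J k n - v * n ^+ k.+1 * p n.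
Proof.
move=> n0; pose F x := - v * x ^+ k.+1 * p x.
pose f x := x ^+ k.+2 * p x - k.+1%:R * v * (x ^+ k * p x).
have dF (x : R) : is_derive x (1 : R) F (f x).
  have ? := is_derive_p x.
  have dX : is_derive x (1 : R) (fun y : R => y ^+ k.+1) (k.+1%:R * x ^+ k).
    apply: DeriveDef; first exact: exprn_derivable.
    by rewrite exp_derive /= /GRing.scale /= mulr1.
  rewrite (_ : F = - v *: ((fun y : R => y ^+ k.+1) * p)); last first.
    by apply/funext => y; rewrite /F -mulrA.
  apply: is_derive_eq.
  rewrite /GRing.scale /= /f.
  have : v != 0 by rewrite gt_eqF.
  by move=> ?; rewrite !exprS; field.
have cf : continuous f.
  move=> x; apply: cvgB; first exact: cJ.
  by apply: cvgM; [exact: cvg_cst|exact: cJ].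
have cF : continuous F.
  by move=> x; apply/differentiable_continuous/derivable1_diffP; have [] := dF x.
have := @continuous_FTC2 _ f F 0 n n0 (continuous_subspaceT cf).
have h : derivable_oo_LRcontinuous F 0 n.
  split; first by move=> x _; have [] := dF x.
    by apply: cvg_at_right_filter; exact: cF.
  by apply: cvg_at_left_filter; exact: cF.
move=> /(_ h) e.
have {e} : (\int[mu]_(x in `[0%R, n]) (f x)%:E = (F n - F 0)%:E)%E.
  rewrite e// => x _; rewrite derive1E; exact: derive_val.
have -> : (\int[mu]_(x in `[0%R, n]) (f x)%:E)%E = (J k.+2 n - k.+1%:R * v * J k n)%:E.
  rewrite /J -RintegralZl// -RintegralB//; last first.
    by apply: (integrableZl _ (k.+1%:R * v) (iJ k n)) => //.
  rewrite /Rintegral fineK// integrable_fin_num//.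
  apply: continuous_compact_integrable; first exact: segment_compact.
  exact/continuous_subspaceT.
case; rewrite /F expr0n/= mulr0 mul0r subr0.
by move=> h2; lra.
Qed.

Let even_lim (f : R -> R) : (forall x, 0 <= f x) -> continuous f ->
  (forall x, f (- x) = f x) ->
  ((\int[mu]_(x in `[0, n%:R]) (f x * p x))%:E) @[n --> \oo]
  --> (\int[mu]_(x in [set x | (0 <= x)%R]) (f x * p x)%:E)%E /\
  (\int[mu]_x ((f x)%:E * (p x)%:E) =
   2%:E * \int[mu]_(x in [set x | (0 <= x)%R]) (f x * p x)%:E)%E.
Proof.
move=> f0 cf fN.
have cfp : continuous (fun x => f x * p x) by move=> x; apply: cvgM; [exact: cf|exact: cp].
split; last first.
  under eq_integral do rewrite -EFinM.
  rewrite ge0_symfun_integralT//.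
  - by move=> x; rewrite mulr_ge0.
  - by move=> x /=; rewrite fN pN.
rewrite (_ : [set x : R | 0 <= x] = \bigcup_n `[0, (n%:R : R)]%classic); last first.
  apply/seteqP; split=> x /=.
    move=> x0; exists (Num.trunc x).+1 => //=; rewrite in_itv/= x0/=.
    by rewrite ltW// truncnS_gt.
  by move=> [n _] /=; rewrite in_itv/= => /andP[].
rewrite (_ : (fun n => _) = (fun n => \int[mu]_(x in `[0%R, n%:R]) (f x * p x)%:E)%E).
  apply: ge0_nondecreasing_set_cvg_integral => //.
  - apply/nondecreasing_seqP => n; rewrite subsetEset => x /=.
    rewrite !in_itv/= => /andP[-> /= h]; rewrite (le_trans h)// ler_nat//.
  - move=> n; apply/measurable_EFinP/measurable_funTS; exact: continuous_measurable_fun.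
  - by move=> n x _; rewrite lee_fin mulr_ge0.
apply/funext => n; rewrite /Rintegral fineK// integrable_fin_num//.
apply: continuous_compact_integrable; first exact: segment_compact.
exact/continuous_subspaceT.
Qed.

Let half (f : R -> R) := (\int[mu]_(x in [set x | (0 <= x)%R]) (f x * p x)%:E)%E.

Let J0_lim : J 0 n%:R @[n --> \oo] --> (2^-1 : R).
Proof.
have [h1 h2] := even_lim (f := fun=> 1) (fun=> ler01) (fun=> cvg_cst _) (fun=> erefl).
have h3 : half (fun=> 1) = (2^-1)%:E.
  move: h2; under eq_integral do rewrite mul1e.
  rewrite integral_normal_pdf -/(half _) => h2.
  move: h2; case: (half _) => [r| |].
  - by rewrite -EFinM => -[r2]; congr (_%:E); lra.
  - by rewrite gt0_muley.
  - by rewrite gt0_muleNy.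
move: h1; rewrite -/(half _) h3 => /fine_cvg; apply: cvg_trans.
apply: near_eq_cvg; near=> n.
by rewrite /J /=; apply: eq_Rintegral => x _; rewrite expr0.
Unshelve. all: by end_near. Qed.

(** From [exp y >= 1 + y] at [y = n^2 / (2 v)]. It makes the boundary term of [J_rec] vanish for
    [k = 0]. *)
Let np_le (n : R) : 0 < n -> n * p n <= normal_peak s * (2 * v) / n.
Proof.
move=> n0; rewrite pE mulrCA -mulrA ler_wpM2l ?normal_peak_ge0//.
rewrite mulNr expRN ler_pdivrMr ?expR_gt0//.
have h : 0 < 2 * v / n by rewrite divr_gt0// mulr_gt0.
apply: le_trans (_ : 2 * v / n * (1 + n ^+ 2 / (2 * v)) <= _); last first.
  by rewrite ler_pM2l// expR_ge1Dx.
rewrite mulrDr mulr1.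
suff -> : 2 * v / n * (n ^+ 2 / (2 * v)) = n by rewrite lerDr ltW.
have vn0 : v != 0 by rewrite gt_eqF.
have nn0 : n != 0 by rewrite gt_eqF.
by field; rewrite vn0 nn0.
Qed.

Let np_lim : (n%:R * p n%:R) @[n --> \oo] --> (0 : R).
Proof.
set K := normal_peak s * (2 * v).
have h : (K * n.+1%:R^-1) @[n --> \oo] --> (0 : R).
  rewrite -(mulr0 K); apply: cvgM; first exact: cvg_cst.
  exact: cvg_harmonic.
rewrite -(@cvg_shiftS _ (fun n => n%:R * p n%:R)).
apply: (squeeze_cvgr _ (cvg_cst 0) h); near=> n.
by rewrite mulr_ge0//= np_le.
Unshelve. all: by end_near. Qed.

Let J2_lim : J 2 n%:R @[n --> \oo] --> (2^-1 * v : R).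
Proof.
have h : (1 * v * J 0 n%:R - v * (n%:R * p n%:R)) @[n --> \oo] --> (2^-1 * v).
  rewrite (_ : 2^-1 * v = 1 * v * 2^-1 - v * 0); last by ring.
  apply: cvgB; first by apply: cvgM; [exact: cvg_cst|exact: J0_lim].
  by apply: cvgM; [exact: cvg_cst|exact: np_lim].
apply: cvg_trans h; apply: near_eq_cvg; near=> n.
rewrite J_rec ?expr1 ?mulrA//.
by rewrite ltr0n; near: n; exact: nbhs_infty_gt.
Unshelve. all: by end_near. Qed.

Lemma normal_second_moment :
  (\int[mu]_x ((x ^+ 2)%:E * (p x)%:E) = v%:E)%E.
Proof.
have [h1 ->] := even_lim (f := fun x => x ^+ 2) (fun x => sqr_ge0 x)
  (@exprn_continuous R 2) (fun x => sqrrN x).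
rewrite -/(half (fun x => x ^+ 2)).
have -> : half (fun x => x ^+ 2) = (2^-1 * v)%:E.
  apply: (cvg_unique _ h1) => //.
  by apply: cvg_EFin; [exact: nearW|exact: J2_lim].
by rewrite -EFinM mulrA divff// mul1r.
Qed.

(** The boundary term of [J_rec] is dropped by its sign, so the limit of the truncated second moment
    is enough. Taylor remainders ask for an upper bound only. *)
Lemma normal_fourth_moment :
  (\int[mu]_x ((x ^+ 4)%:E * (p x)%:E) <= (3 * v ^+ 2)%:E)%E.
Proof.
have f0 (x : R) : 0 <= x ^+ 4 by rewrite (_ : 4%N = (2 * 2)%N)// exprM sqr_ge0.
have f4N (x : R) : (- x) ^+ 4 = x ^+ 4 by ring.
have [h1 ->] := even_lim (f := fun x => x ^+ 4) f0
  (@exprn_continuous R 4) f4N.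
rewrite -/(half (fun x => x ^+ 4)); set h4 := half _ in h1 *.
have h3 : (h4 <= (3 * v * (2^-1 * v))%:E)%E.
  have h2 : ((3 * v * J 2 n%:R)%:E : \bar R) @[n --> \oo] --> (3 * v * (2^-1 * v))%:E.
    apply: cvg_EFin; first exact: nearW.
    by apply: cvgM; [exact: cvg_cst|exact: J2_lim].
  apply: (lee_cvg_to h1 h2); near=> n; rewrite -/(J 4 n%:R).
  rewrite lee_fin J_rec; last first.
    by rewrite ltr0n; near: n; exact: nbhs_infty_gt.
  by rewrite gerBl !mulr_ge0 ?exprn_ge0// ltW.
rewrite (_ : 3 * v ^+ 2 = 2 * (3 * v * (2^-1 * v))); last by field.
by rewrite EFinM lee_wpmul2l.
Unshelve. all: by end_near. Qed.

(** Symmetry of the density under [x -> - x], phrased with positive and negative parts so that every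
    integrand is nonnegative. *)
Lemma normal_first_moment :
  (\int[mu]_x ((Num.max x 0)%:E * (p x)%:E) =
   \int[mu]_x ((Num.max (- x) 0)%:E * (p x)%:E))%E.
Proof.
under eq_integral do rewrite -EFinM.
under [RHS]eq_integral do rewrite -EFinM.
have cm : continuous (fun x : R => Num.max (- x) 0 * p x).
  move=> x; apply: cvgM; last exact: cp.
  by apply: (@continuous_max _ _ (fun x : R => - x) (fun=> 0));
    [exact: opp_continuous|exact: cvg_cst].
transitivity (\int[mu]_(x in `[0%R, +oo[) (Num.max x 0 * p x)%:E)%E.
  rewrite [RHS]integral_mkcond; apply: eq_integral => x _; rewrite patchE.
  case: ifPn => //; rewrite notin_setE /= in_itv/= andbT => /negP; rewrite -ltNge => x0.
  by rewrite max_r ?mul0r// ltW.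
transitivity (\int[mu]_(x in `]-oo, (- 0)%R]) (Num.max (- x) 0 * p x)%:E)%E.
  rewrite ge0_integration_by_substitutionNy.
  - by apply: eq_integral => x _ /=; rewrite opprK pN.
  - exact: continuous_subspaceT.
  - by move=> x _; rewrite mulr_ge0// le_max lexx orbT.
rewrite [LHS]integral_mkcond; apply: eq_integral => x _; rewrite patchE.
case: ifPn => //; rewrite notin_setE /= in_itv/= oppr0 => /negP; rewrite -ltNge => x0.
by rewrite max_r ?mul0r// oppr_le0 ltW.
Qed.
End gauss_moments.

(** * Increments of Brownian motion *)

Section brownian.
Context {R : realType} {d : measure_display} {Omega : measurableType d}.
Variables (P : probability Omega R) (W : R -> Omega -> R).
Hypothesis W_brownian : standard_brownian01 P W.
Local Notation mu := (@lebesgue_measure R).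

Definition incr s t w := W t w - W s w.

Lemma brownian_meas v : 0 <= v <= 1 -> measurable_fun setT (W v).
Proof. by have [+ _ _ _ _] := W_brownian; exact. Qed.

Lemma measurable_incr s t : 0 <= s -> s <= t -> t <= 1 -> measurable_fun setT (incr s t).
Proof.
move=> s0 st t1; apply: measurable_funB; apply: brownian_meas; apply/andP; split=> //;
  [exact: le_trans st|exact: le_trans t1].
Qed.

Section moments.
Variables s t : R.
Hypotheses (s0 : 0 <= s) (st : s < t) (t1 : t <= 1).
Let D := incr s t.

Let ts0 : 0 < t - s. Proof. by rewrite subr_gt0. Qed.

Let mD : measurable_fun setT D. Proof. by apply: measurable_incr => //; exact: ltW. Qed.

Let mX n : measurable_fun setT (fun x : R => x ^+ n).
Proof. exact: exprn_measurable. Qed.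

Let integral_D (f : R -> R) : measurable_fun setT f -> (forall x, 0 <= f x) ->
  (\int[P]_w (f (D w))%:E = \int[mu]_x ((f x)%:E * (normal_pdf 0 (Num.sqrt (t - s)) x)%:E))%E.
Proof.
move=> mf f0.
rewrite (@ge0_integral_density _ _ _ P D (normal_pdf 0 (Num.sqrt (t - s))) (EFin \o f))//.
- exact: measurable_normal_pdf.
- exact: normal_pdf_ge0.
- move=> B mB; have [_ _ _ + _] := W_brownian.
  by move=> /(_ s t s0 st t1 B mB).
- exact/measurable_EFinP.
Qed.

Lemma ibl_incr4 : ibl P (fun w => D w ^+ 4).
Proof.
apply/integrableP; split.
  by apply/measurable_EFinP; exact: (measurableT_comp (mX 4) mD).
have f0 (x : R) : 0 <= x ^+ 4 by rewrite (_ : 4%N = (2 * 2)%N)// exprM sqr_ge0.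
under eq_integral do rewrite /= ger0_norm//.
by rewrite (@integral_D (fun x => x ^+ 4) (mX 4))// (le_lt_trans (normal_fourth_moment ts0))// ltry.
Qed.

Lemma Ex_incr4 : Ex P (fun w => D w ^+ 4) <= 3 * (t - s) ^+ 2.
Proof.
rewrite -lee_fin /Ex /Rintegral fineK; last exact: integrable_fin_num ibl_incr4.
have f0 (x : R) : 0 <= x ^+ 4 by rewrite (_ : 4%N = (2 * 2)%N)// exprM sqr_ge0.
by rewrite (@integral_D (fun x => x ^+ 4))//; exact: normal_fourth_moment.
Qed.

Lemma ibl_incr2 : ibl P (fun w => D w ^+ 2).
Proof.
apply/integrableP; split.
  by apply/measurable_EFinP; exact: (measurableT_comp (mX 2) mD).
under eq_integral do rewrite /= ger0_norm ?sqr_ge0//.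
rewrite (@integral_D (fun x => x ^+ 2))//; last by move=> x; exact: sqr_ge0.
by rewrite normal_second_moment// ltry.
Qed.

Lemma Ex_incr2 : Ex P (fun w => D w ^+ 2) = t - s.
Proof.
rewrite /Ex /Rintegral (@integral_D (fun x => x ^+ 2))//; last by move=> x; exact: sqr_ge0.
by rewrite normal_second_moment.
Qed.

Lemma ibl_incr : ibl P D.
Proof.
apply: (@ibl_le _ _ _ _ _ (fun w => 1 + D w ^+ 2)) => //.
  by apply: iblD; [exact/bmf_ibl/bmf_cst|exact: ibl_incr2].
move=> w; rewrite -[D w ^+ 2]real_normK ?num_real//.
have := sqr_ge0 (`|D w| - 1); have := normr_ge0 (D w); rewrite !expr2; nra.
Qed.

Lemma Ex_incr : Ex P D = 0.
Proof.
have mmax : measurable_fun setT (fun x : R => Num.max x 0).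
  by apply: measurable_maxr => //; exact: measurable_id.
have mmin : measurable_fun setT (fun x : R => Num.max (- x) 0).
  by apply: measurable_maxr => //; exact: oppr_measurable.
have i1 : ibl P (fun w => Num.max (D w) 0).
  apply: (ibl_le _ (ibl_norm ibl_incr)); first exact: measurableT_comp mmax mD.
  by move=> w; rewrite ger0_norm ?le_max ?lexx ?orbT// ge_max ler_norm normr_ge0.
have i2 : ibl P (fun w => Num.max (- D w) 0).
  apply: (ibl_le _ (ibl_norm ibl_incr)); first exact: measurableT_comp mmin mD.
  by move=> w; rewrite ger0_norm ?le_max ?lexx ?orbT// ge_max -[X in _ <= X]normrN ler_norm normr_ge0.
have -> : D = (fun w => Num.max (D w) 0 - Num.max (- D w) 0).
  apply/funext => w; case: (leP (D w) 0) => h.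
    by rewrite max_l ?oppr_ge0// opprK add0r.
  by rewrite max_r ?subr0// oppr_le0 ltW.
rewrite ExB// /Ex /Rintegral.
rewrite (@integral_D (fun x => Num.max x 0))//; last by move=> x; rewrite le_max lexx orbT.
rewrite (@integral_D (fun x => Num.max (- x) 0))//; last by move=> x; rewrite le_max lexx orbT.
by rewrite normal_first_moment// subrr.
Qed.

End moments.

Lemma chain_le n (t : nat -> R) : (forall k, (k < n)%N -> t k <= t k.+1) ->
  forall i j, (i <= j <= n)%N -> t i <= t j.
Proof.
move=> tk i j /andP[]; elim: j => [|j IH]; first by rewrite leqn0 => /eqP ->.
rewrite leq_eqVlt => /predU1P[->//|ij] jn.
by apply: le_trans (tk _ jn); apply: IH => //; exact: ltnW.
Qed.

Lemma measurable_incr_chain n (t : nat -> R) :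
  0 <= t 0%N -> t n <= 1 -> (forall k, (k < n)%N -> t k <= t k.+1) ->
  forall k, (k < n)%N -> measurable_fun setT (incr (t k) (t k.+1)).
Proof.
move=> t0 tn tk k kn; apply: measurable_incr.
- by apply: le_trans t0 _; apply: (chain_le tk); rewrite leq0n ltnW.
- exact: tk.
- by apply: le_trans tn; apply: (chain_le tk); rewrite kn leqnn.
Qed.

Lemma Pr_incr_indep n (t : nat -> R) (B : nat -> set R) :
  0 <= t 0%N -> t n <= 1 -> (forall k, (k < n)%N -> t k <= t k.+1) ->
  (forall k, measurable (B k)) ->
  Pr P [set w | forall k, (k < n)%N -> B k (incr (t k) (t k.+1) w)] =
  \prod_(k < n) Pr P [set w | B k (incr (t k) (t k.+1) w)].
Proof.
move=> t0 tn tk mB; have [_ _ _ _] := W_brownian.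
move=> /(_ n t B t0 tn tk mB); rewrite {1}/Pr => ->.
rewrite (eq_bigr (fun k : 'I_n => (Pr P [set w | B k (incr (t k) (t k.+1) w)])%:E)).
  by rewrite -(big_morph EFin EFinM erefl).
move=> k _; rewrite PrE//; rewrite -[X in measurable X]setTI.
by have := measurable_incr_chain t0 tn tk (ltn_ord k); apply.
Qed.

(** Independence is given on events. The layer lemma carries it to bounded functions one factor at a
    time, the other factors being frozen into a single variable. *)
Lemma Ex_prod_incr n (t : nat -> R) (f : nat -> R -> R) :
  0 <= t 0%N -> t n <= 1 -> (forall k, (k < n)%N -> t k <= t k.+1) ->
  (forall k, bmf (f k)) ->
  Ex P (fun w => \prod_(k < n) f k (incr (t k) (t k.+1) w)) =
  \prod_(k < n) Ex P (fun w => f k (incr (t k) (t k.+1) w)).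
Proof.
move=> t0 tn tk bf.
have mD := measurable_incr_chain t0 tn tk.
pose D k := incr (t k) (t k.+1).
have bfD (h : R -> R) (k : 'I_n) : bmf h -> bmf (fun w => h (D k w)).
  move=> [mh [C hC]]; apply: (bmf_comp mh hC); exact: mD.
have b1 (A : set R) : measurable A -> bmf (\1_A : R -> R) by exact: bmf_indic.
have mpre (A : set R) (k : 'I_n) : measurable A -> measurable (D k @^-1` A).
  by move=> mA; rewrite -[X in measurable X]setTI; apply: mD.
(* [j] counts the leading factors that are still arbitrary; from index [j] on they are indicators,
   so [j = 0] is the independence of events. *)
suff key j (h : nat -> R -> R) : (forall k, bmf (h k)) ->
    (forall k, (j <= k)%N -> exists2 B : set R, measurable B & h k = \1_B) ->
    Ex P (fun w => \prod_(k < n) h k (D k w)) =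
    \prod_(k < n) Ex P (fun w => h k (D k w)).
  pose h k := if (k < n)%N then f k else \1_(setT : set R).
  have := key n h; rewrite (_ : (fun w => _) = (fun w => \prod_(k < n) f k (D k w))).
    move=> ->.
    - by apply: eq_bigr => k _; rewrite /h ltn_ord.
    - by move=> k; rewrite /h; case: ifP => // _; exact: b1.
    - by move=> k nk; exists setT => //; rewrite /h ltnNge nk.
  by apply/funext => w; apply: eq_bigr => k _; rewrite /h ltn_ord.
elim: j h => [|j IH] h bh hB.
  have /choice[B BP] : forall k, exists B : set R, measurable B /\ h k = \1_B.
    by move=> k; have [B ? ?] := hB k isT; exists B.
  have mB k : measurable (B k) by have [] := BP k.
  have := Pr_incr_indep t0 tn tk mB.
  rewrite -Ex_indic; last first.
    rewrite (_ : [set w | _] = \bigcap_(k in [set k | (k < n)%N]) (D k @^-1` B k)).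
      apply: bigcap_measurableType.
      by move=> k /= kn; exact: (mpre (B k) (Ordinal kn)).
    by [].
  rewrite (_ : \1__ = (fun w => \prod_(k < n) h k (D k w))).
    move=> ->; apply: eq_bigr => k _; rewrite -Ex_indic; last exact: mpre.
    by congr (Ex P _); apply/funext => w; have [_ ->] := BP k.
  apply/funext => w; rewrite indicE.
  under eq_bigr do rewrite (proj2 (BP _)) indicE.
  case: (boolP (w \in _)) => [/set_mem/= h1|].
    by rewrite big1// => k _; rewrite mem_set//; exact: h1.
  move=> /negP h1; apply/esym/eqP; apply/negPn/negP => /prodf_neq0 h2.
  apply: h1; apply/mem_set => k kn; have := h2 (Ordinal kn) isT.
  by rewrite /=; case: (boolP (_ \in _)) => [/set_mem//|]; rewrite eqxx.
(* If [n <= j], the factor [j] lies outside the product and can be replaced by an indicator. *)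
have [jn|nj] := ltnP j n; last first.
  pose h' k := if k == j then \1_(setT : set R) else h k.
  have hE (k : 'I_n) : h' k = h k.
    by rewrite /h'; case: eqP => // kj; have := ltn_ord k; rewrite kj ltnNge nj.
  have := IH h'.
  under eq_bigr do rewrite hE.
  rewrite (_ : (fun w => _) = (fun w => \prod_(k < n) h k (D k w))); last first.
    by apply/funext => w; apply: eq_bigr => k _; rewrite hE.
  apply.
  - by move=> k; rewrite /h'; case: ifP => // _; exact: b1.
  - move=> k jk; rewrite /h'; case: eqP => [_|/eqP kj]; first by exists setT.
    by apply: hB; rewrite ltn_neqAle eq_sym kj.
pose J := Ordinal jn.
pose K w := \prod_(k < n | k != J) h k (D k w).
pose c := \prod_(k < n | k != J) Ex P (fun w => h k (D k w)).
have bK : bmf K by apply: bmf_prod => k; exact: bfD.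
have split (u : R -> R) : Ex P (fun w => K w * u (D J w)) =
    Ex P (fun w => \prod_(k < n) (if val k == j then u else h k) (D k w)).
  congr (Ex P _); apply/funext => w; rewrite [RHS](bigD1 J)//= eqxx mulrC.
  congr (_ * _); apply: eq_bigr => k kJ; case: eqP => // kj.
  by move: kJ; rewrite -val_eqE /= kj eqxx.
have keyA (A : set R) : measurable A ->
    Ex P (fun w => K w * \1_A (D J w)) = c * Ex P (fun w => \1_A (D J w)).
  move=> mA; rewrite split (IH (fun k => if k == j then \1_A else h k)).
  - rewrite (bigD1 J)//= eqxx mulrC; congr (_ * _); apply: eq_bigr => k kJ.
    by case: eqP => // kj; move: kJ; rewrite -val_eqE /= kj eqxx.
  - by move=> k; case: eqP => // _; exact: b1.
  - move=> k jk; case: eqP => [_|/eqP kj]; first by exists A.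
    by apply: hB; rewrite ltn_neqAle eq_sym kj.
rewrite -[LHS](_ : Ex P (fun w => K w * h j (D J w)) = _); last first.
  rewrite split; congr (Ex P _); apply/funext => w; apply: eq_bigr => k _.
  by case: eqP => // ->.
rewrite [RHS](bigD1 J)//= -/c mulrC.
have bj := bfD _ J (bh j).
have EK : Ex P K = c.
  have := keyA setT measurableT.
  rewrite (_ : (fun w => _) = K); last by apply/funext => w; rewrite indicE in_setT mulr1.
  rewrite (_ : (fun w => _) = (fun=> 1)); last by apply/funext => w; rewrite indicE in_setT.
  by rewrite Ex_cst mulr1.
(* The centred product [K - c] of the other factors is orthogonal to every level indicator of the
   factor [j], by [keyA]. *)
have := @Ex_layer_bmf _ _ _ P (fun w => K w - c) (fun w => h j (D J w)).
have bc : bmf (fun _ : Omega => c) by exact: bmf_cst.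
have bKc : bmf (fun w => K w - c) by bm.
have EKc (g : Omega -> R) : bmf g ->
    Ex P (fun w => (K w - c) * g w) = Ex P (fun w => K w * g w) - c * Ex P g.
  move=> bg; rewrite -ExZ; last exact: bmf_ibl.
  rewrite -ExB; last 2 first.
  - by apply: bmf_ibl; bm.
  - by apply: bmf_ibl; bm.
  by congr (Ex P _); apply/funext => w; rewrite mulrBl.
rewrite EKc// => /(_ bKc bj) H.
apply/eqP; rewrite -subr_eq0; apply/eqP; rewrite [c * _]mulrC mulrC; apply: H.
  by rewrite ExB ?EK ?Ex_cst ?subrr//; exact: bmf_ibl.
move=> r; pose A := [set x | r <= h j x].
have mA : measurable A by apply: measurable_ge; exact: bmf_meas.
rewrite (_ : \1__ = (fun w => \1_A (D J w))); last by apply/funext.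
by rewrite EKc ?keyA ?subrr//; apply: bfD; exact: b1.
Qed.

(** [f] is allowed to be unbounded because it will be the identity and the square, which bring in
    the mean and the variance of an increment. *)
Lemma Ex_incr_indep r s t (f g : R -> R) : 0 <= r -> r <= s -> s <= t -> t <= 1 ->
  measurable_fun setT f -> bmf g ->
  ibl P (fun w => f (incr r s w)) ->
  Ex P (fun w => f (incr r s w) * g (incr s t w)) =
  Ex P (fun w => f (incr r s w)) * Ex P (fun w => g (incr s t w)).
Proof.
move=> r0 rs st t1 mf [mg [C gC]] fi.
have m1 : measurable_fun setT (incr r s).
  by apply: measurable_incr => //; exact: le_trans t1.
have m2 : measurable_fun setT (incr s t).
  by apply: measurable_incr => //; exact: le_trans rs.
apply: Ex_indep => //; first exact: bmf_comp gC m2.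
move=> A B mA mB.
pose u k := if k is k'.+1 then (if k' is 0%N then s else t) else r.
pose Q k := if k is 0%N then f @^-1` A else g @^-1` B.
have mQ k : measurable (Q k).
  by case: k => [|k]; rewrite /Q -[X in measurable X]setTI; [exact: mf|exact: mg].
have uk k : (k < 2)%N -> u k <= u k.+1 by case: k => [|[|]].
have := @Pr_incr_indep 2 u Q r0 t1 uk mQ.
rewrite !big_ord_recl big_ord0 mulr1 /= => <-; congr (Pr P _).
apply/seteqP; split=> w /=.
  by move=> [h1 h2] [|[|]].
by move=> h; split; [exact: (h 0%N)|exact: (h 1%N)].
Qed.

End brownian.

(** * Lindeberg exchange *)

Definition lip {R : realType} (L : R) (f : R -> R) := forall x y, `|f x - f y| <= L * `|x - y|.

(** Derivatives are replaced by the Taylor inequality that they would give. Every clause survives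
    averaging over translations with the same [L], which spares differentiation under the
    expectation. *)
Record smooth3 {R : realType} (L : R) (f f1 f2 : R -> R) : Prop := {
  smooth3_bounded : forall x, [/\ `|f x| <= L, `|f1 x| <= L & `|f2 x| <= L];
  smooth3_lip : [/\ lip L f, lip L f1 & lip L f2];
  smooth3_taylor : forall x y,
    `|f (x + y) - f x - f1 x * y - 2^-1 * f2 x * y ^+ 2| <= L * `|y| ^+ 3 }.

Lemma smooth3_ge0 {R : realType} (L : R) f f1 f2 : smooth3 L f f1 f2 -> 0 <= L.
Proof. by move=> /smooth3_bounded/(_ 0)[+ _ _]; exact: le_trans. Qed.

Lemma lip_continuous {R : realType} (L : R) (f : R -> R) : lip L f -> continuous f.
Proof.
move=> fL x.
have L0 : 0 <= L by have := fL 0 1; rewrite sub0r normrN1 mulr1; apply: le_trans.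
apply/cvgrPdist_le => e e0; near=> y.
rewrite (le_trans (fL _ _))//.
have : `|x - y| <= e / (L + 1).
  near: y; have /cvgrPdist_le h := @cvg_id _ (nbhs x).
  by apply: h; rewrite divr_gt0// ltr_wpDl.
rewrite ler_pdivlMr ?ltr_wpDl// => h.
have := normr_ge0 (x - y); nra.
Unshelve. all: by end_near. Qed.

Lemma lip_bmf {R : realType} (L C : R) (f : R -> R) :
  lip L f -> (forall x, `|f x| <= C) -> bmf (f : R -> R).
Proof.
move=> fL fC; split; last by exists C.
by apply: continuous_measurable_fun; exact: lip_continuous fL.
Qed.

(** Young's inequality, from [a^2 (a - b)^2 >= 0] with [a = |y|]. It trades third moments for second
    and fourth ones; when these are of order [b^2] and [b^4], both terms have order [b^3]. *)
Lemma cube_le {R : realType} (b y : R) : 0 < b -> `|y| ^+ 3 <= b * y ^+ 2 + y ^+ 4 / b.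
Proof.
move=> b0; set a := `|y|.
have a0 : 0 <= a by exact: normr_ge0.
rewrite -[y ^+ 2]real_normK ?num_real// (_ : y ^+ 4 = a ^+ 4); last first.
  by rewrite (_ : 4%N = (2 * 2)%N)// !exprM real_normK ?num_real.
rewrite -(ler_pM2r b0) mulrDl mulfVK ?gt_eqF//.
have : 0 <= a ^+ 2 * (a - b) ^+ 2 by rewrite mulr_ge0 ?sqr_ge0.
have : 0 <= a ^+ 3 * b by rewrite mulr_ge0 ?exprn_ge0// ltW.
rewrite !exprS !expr0 !mulr1; nra.
Qed.

(** * Smoothing by the remaining Brownian increment *)

Section gaussian_smoothing.
Context {R : realType} {d : measure_display} {Omega : measurableType d}.
Variables (P : probability Omega R) (W : R -> Omega -> R).
Hypothesis W_brownian : standard_brownian01 P W.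
Variables (t sigma : R).
Hypothesis t1 : t <= 1.

(** The backward heat flow with terminal value [f] at time [t], realised by the given Brownian
    motion. *)
Definition smoothing (f : R -> R) r x := Ex P (fun w => f (x + sigma * incr W r t w)).

Lemma smoothing_end f x : smoothing f t x = f x.
Proof.
rewrite /smoothing -[RHS](Ex_cst P); congr (Ex P _); apply/funext => w.
by rewrite /incr subrr mulr0 addr0.
Qed.

Section fixed_time.
Variable r : R.
Hypotheses (r0 : 0 <= r) (rt : r <= t).

Let mi : measurable_fun setT (incr W r t).
Proof. exact: (measurable_incr W_brownian). Qed.

Lemma bmf_shift (f : R -> R) x : bmf f -> bmf (fun w => f (x + sigma * incr W r t w)).
Proof.
move=> [mf [C fC]]; apply: (@bmf_comp _ _ _ f (fun w => x + sigma * incr W r t w) C) => //.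
by apply: measurable_funD; [exact: measurable_cst|apply: measurable_funM].
Qed.

Lemma smoothing_bounded f L x : bmf f -> (forall y, `|f y| <= L) ->
  `|smoothing f r x| <= L.
Proof. by move=> bf fL; apply: Ex_bound => //; exact/bmf_ibl/bmf_shift. Qed.

Lemma smoothing_lip f L : bmf f -> lip L f -> lip L (smoothing f r).
Proof.
move=> bf fL x y; rewrite -[leRHS](Ex_cst P); apply: Ex_normB.
- exact/bmf_ibl/bmf_shift.
- exact/bmf_ibl/bmf_shift.
- exact/bmf_ibl/bmf_cst.
by move=> w; rewrite (le_trans (fL _ _))// opprD addrACA subrr addr0.
Qed.

Lemma smooth3_smoothing L f f1 f2 : smooth3 L f f1 f2 ->
  smooth3 L (smoothing f r) (smoothing f1 r) (smoothing f2 r).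
Proof.
move=> [fb [fL f1L f2L] fT].
have bf : bmf f by apply: (lip_bmf fL) => x; have [h _ _] := fb x; exact: h.
have bf1 : bmf f1 by apply: (lip_bmf f1L) => x; have [_ h _] := fb x; exact: h.
have bf2 : bmf f2 by apply: (lip_bmf f2L) => x; have [_ _ h] := fb x; exact: h.
split.
- by move=> x; split; apply: smoothing_bounded => // y; have [] := fb y.
- by split; apply: smoothing_lip.
move=> x y; rewrite /smoothing.
have i0 := bmf_ibl P (bmf_shift x bf).
have i1 := bmf_ibl P (bmf_shift x bf1).
have i2 := bmf_ibl P (bmf_shift x bf2).
have ic (c : R) : ibl P (fun=> c) by exact/bmf_ibl/bmf_cst.
have i3 := bmf_ibl P (bmf_shift (x + y) bf).
rewrite -ExZr// -ExZ// -ExZr; last exact: iblZ.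
have i4 : ibl P (fun w => f1 (x + sigma * incr W r t w) * y).
  by apply: iblMb => //; exact: bmf_cst.
have i5 : ibl P (fun w => 2^-1 * f2 (x + sigma * incr W r t w) * y ^+ 2).
  by apply: iblMb; [exact: iblZ|exact: bmf_cst].
rewrite -ExB// -ExB//; last exact: iblB.
rewrite -ExB//; last by apply: iblB => //; exact: iblB.
apply: Ex_bound; first by apply: iblB => //; apply: iblB => //; exact: iblB.
by move=> w; have := fT (x + sigma * incr W r t w) y; rewrite [x + _ + y]addrAC.
Qed.

End fixed_time.

(** One step of the backward heat equation. The increment from [r] splits into independent parts
    [D + z], and Taylor's inequality is used at [x + sigma z]; the zero mean of [D] kills the linear
    term. By [cube_le] the cubic remainder costs [b b^2 + 3 b^4 / b = 4 b^3]. *)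
Lemma smoothing_step L f f1 f2 r r' b x : smooth3 L f f1 f2 ->
  0 <= r -> r < r' -> r' <= t -> 0 < b -> r' - r = b ^+ 2 ->
  `|smoothing f r x - smoothing f r' x
    - 2^-1 * (sigma ^+ 2 * b ^+ 2) * smoothing f2 r' x|
  <= L * `|sigma| ^+ 3 * (4 * b ^+ 3).
Proof.
move=> fS r0 rr r't b0 rb.
have r'0 : 0 <= r' by rewrite (le_trans r0)// ltW.
have rt : r <= t by rewrite (le_trans _ r't)// ltW.
have r'1 : r' <= 1 by exact: le_trans t1.
have L0 := smooth3_ge0 fS.
case: fS => fb [fL f1L f2L] fT.
have bf : bmf f by apply: (lip_bmf fL) => y; have [h _ _] := fb y; exact: h.
have bf1 : bmf f1 by apply: (lip_bmf f1L) => y; have [_ h _] := fb y; exact: h.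
have bf2 : bmf f2 by apply: (lip_bmf f2L) => y; have [_ _ h] := fb y; exact: h.
pose D := incr W r r'; pose z := incr W r' t.
have bz (g : R -> R) : bmf g -> bmf (fun w => g (x + sigma * z w)).
  by move=> bg; exact: bmf_shift.
have iD : ibl P D by exact: ibl_incr.
have iD2 : ibl P (fun w => D w ^+ 2) by exact: ibl_incr2.
have iD4 : ibl P (fun w => D w ^+ 4) by exact: ibl_incr4.
have mshift (g : R -> R) : measurable_fun setT g -> measurable_fun setT (fun u => g (x + sigma * u)).
  move=> mg; apply: (measurableT_comp mg).
  by apply: measurable_funD; [exact: measurable_cst|apply: measurable_funM; [exact: measurable_cst|exact: measurable_id]].
have bsh (g : R -> R) : bmf g -> bmf (fun u : R => g (x + sigma * u)).
  by move=> [mg [C gC]]; split; [exact: mshift|exists C].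
have e1 : Ex P (fun w => D w * f1 (x + sigma * z w)) = 0.
  have := @Ex_incr_indep _ _ _ P W W_brownian r r' t id (fun u => f1 (x + sigma * u))
    r0 (ltW rr) r't t1 (@measurable_id _ _ _) (bsh _ bf1) iD.
  by move=> ->; rewrite Ex_incr// mul0r.
have e2 : Ex P (fun w => D w ^+ 2 * f2 (x + sigma * z w)) = b ^+ 2 * smoothing f2 r' x.
  have := @Ex_incr_indep _ _ _ P W W_brownian r r' t (fun u => u ^+ 2) (fun u => f2 (x + sigma * u))
    r0 (ltW rr) r't t1 (exprn_measurable 2) (bsh _ bf2) iD2.
  by move=> ->; rewrite Ex_incr2// rb.
have i1 : ibl P (fun w => D w * f1 (x + sigma * z w)) by apply: iblMb => //; exact: bz.
have i2 : ibl P (fun w => D w ^+ 2 * f2 (x + sigma * z w)) by apply: iblMb => //; exact: bz.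
have i0 : ibl P (fun w => f (x + sigma * incr W r t w)) by exact/bmf_ibl/bmf_shift.
have i0' : ibl P (fun w => f (x + sigma * z w)) by exact/bmf_ibl/bz.
rewrite (_ : _ - _ - _ = Ex P (fun w => f (x + sigma * incr W r t w) - f (x + sigma * z w)
    - (sigma * (D w * f1 (x + sigma * z w))
       + 2^-1 * sigma ^+ 2 * (D w ^+ 2 * f2 (x + sigma * z w))))); last first.
  have i3 := iblZ sigma i1; have i4 := iblZ (2^-1 * sigma ^+ 2) i2.
  rewrite ExB; [|exact: iblB|exact: iblD].
  by rewrite ExB// ExD// !ExZ// e1 e2 mulr0 add0r; congr (_ - _); ring.
have i3 := iblZ sigma i1; have i4 := iblZ (2^-1 * sigma ^+ 2) i2.
have iB : ibl P (fun w => b * D w ^+ 2 + b^-1 * D w ^+ 4) by apply: iblD; exact: iblZ.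
apply: (@le_trans _ _ (Ex P (fun w => L * `|sigma| ^+ 3 * (b * D w ^+ 2 + b^-1 * D w ^+ 4)))).
  rewrite (le_trans (Ex_norm_le _))//; first by apply: iblB; [exact: iblB|exact: iblD].
  apply: Ex_le; last move=> w.
  - by apply: ibl_norm; apply: iblB; [exact: iblB|exact: iblD].
  - exact: iblZ.
  have := fT (x + sigma * z w) (sigma * D w).
  rewrite (_ : x + sigma * z w + sigma * D w = x + sigma * incr W r t w); last first.
    by rewrite /z /D /incr; ring.
  rewrite [`|sigma * D w|]normrM [(`|sigma| * _) ^+ 3]exprMn [L * _]mulrA => h.
  rewrite (_ : _ - (_ + _) = f (x + sigma * incr W r t w) - f (x + sigma * z w) -
     f1 (x + sigma * z w) * (sigma * D w) - 2^-1 * f2 (x + sigma * z w) * (sigma * D w) ^+ 2);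
     last by ring.
  apply: (le_trans h); rewrite ler_wpM2l ?mulr_ge0 ?exprn_ge0//.
  by rewrite [_^-1 * _]mulrC; exact: cube_le.
rewrite ExZ// ExD; [|exact: iblZ..].
rewrite !ExZ// Ex_incr2// ler_wpM2l ?mulr_ge0 ?exprn_ge0// rb.
have := @Ex_incr4 _ _ _ P W W_brownian r r' r0 rr r'1; rewrite rb => h.
rewrite (_ : 4 * b ^+ 3 = b * b ^+ 2 + b^-1 * (3 * (b ^+ 2) ^+ 2)); last first.
  have bn0 : b != 0 by rewrite gt_eqF.
  by field.
by rewrite lerD2l ler_pM2l// invr_gt0.
Qed.

End gaussian_smoothing.

(** * Replacement of martingale increments by Gaussian ones *)

Section lindeberg.
Context {R : realType} {d : measure_display} {Omega : measurableType d}.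
Variable (P : probability Omega R).
Context {d' : measure_display} {Omega' : measurableType d'}.
Variables (P' : probability Omega' R) (W : R -> Omega' -> R).
Hypothesis W_brownian : standard_brownian01 P' W.

(** Telescoping of [E[H F_k(y_k)]], where [F_k] is [f] averaged over the Brownian noise left after
    [k] steps: none at [k = K], and nothing but noise at [k = 0]. [H] stands for conditioning on the
    past; [v k] has the same conditional mean as the squared increment and is close in mean to the
    Gaussian variance [sigma^2 b^2]. *)
Lemma lindeberg (L sigma s t m2 m4 eta b : R) (f f1 f2 : R -> R) (K : nat)
    (H : Omega -> R) (y v : nat -> Omega -> R) :
  smooth3 L f f1 f2 -> 0 <= s -> s < t -> t <= 1 -> 0 < b -> t - s = K%:R * b ^+ 2 ->
  bmf H -> (forall w, `|H w| <= 1) ->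
  (forall k, bmf (y k)) -> (forall k, bmf (v k)) -> (forall w, y 0%N w = 0) ->
  (forall k (g : R -> R), (k < K)%N -> bmf g ->
    Ex P (fun w => H w * (g (y k w) * (y k.+1 w - y k w))) = 0) ->
  (forall k (g : R -> R), (k < K)%N -> bmf g ->
    Ex P (fun w => H w * (g (y k w) * ((y k.+1 w - y k w) ^+ 2 - v k w))) = 0) ->
  (forall k, (k < K)%N -> Ex P (fun w => (y k.+1 w - y k w) ^+ 2) <= m2) ->
  (forall k, (k < K)%N -> Ex P (fun w => (y k.+1 w - y k w) ^+ 4) <= m4) ->
  (forall k, (k < K)%N -> Ex P (fun w => `|v k w - sigma ^+ 2 * b ^+ 2|) <= eta) ->
  `|Ex P (fun w => H w * f (y K w)) -
    Ex P H * Ex P' (fun w => f (sigma * incr W s t w))|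
  <= K%:R * (L * (b * m2 + m4 / b) + L * eta + L * `|sigma| ^+ 3 * (4 * b ^+ 3)).
Proof.
move=> fS s0 st t1 b0 tsK bH H1 by_ bv y0 M1 M2 E2 E4 Ev.
pose r k := s + k%:R * b ^+ 2.
have b20 : 0 < b ^+ 2 by rewrite exprn_gt0.
have rK : r K = t by rewrite /r -tsK addrC subrK.
have rS k : r k.+1 = r k + b ^+ 2 by rewrite /r -natr1; ring.
have rlt k : r k < r k.+1 by rewrite rS ltrDl.
have r0 k : 0 <= r k by rewrite /r addr_ge0// mulr_ge0// ltW.
have rle k : (k <= K)%N -> r k <= t.
  by move=> kK; rewrite -rK /r lerD2l ler_wpM2r ?ler_nat// ltW.
pose F k := smoothing P' W t sigma f (r k).
pose F1 k := smoothing P' W t sigma f1 (r k).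
pose F2 k := smoothing P' W t sigma f2 (r k).
have FS k : (k <= K)%N -> smooth3 L (F k) (F1 k) (F2 k).
  by move=> kK; apply: smooth3_smoothing => //; exact: rle.
pose a k := Ex P (fun w => H w * F k (y k w)).
have -> : Ex P (fun w => H w * f (y K w)) = a K.
  by congr (Ex P _); apply/funext => w; rewrite /F rK smoothing_end.
have -> : Ex P H * Ex P' (fun w => f (sigma * incr W s t w)) = a 0%N.
  rewrite /a -ExZr; last exact: bmf_ibl.
  congr (Ex P _); apply/funext => w; congr (_ * _); rewrite y0 /F /smoothing /r mul0r addr0.
  by congr (Ex P' _); apply/funext => w'; rewrite add0r.
have L0 := smooth3_ge0 fS.
set B := _ + _ + _.
have step k : (k < K)%N -> `|a k.+1 - a k| <= B.
  move=> kK; have := FS _ kK; have := FS _ (ltnW kK).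
  case=> Fb [FL F1L F2L] _ [Gb [GL G1L G2L] GT].
  have bF : bmf (F k) by apply: (lip_bmf FL) => u; have [h _ _] := Fb u; exact: h.
  have bG : bmf (F k.+1) by apply: (lip_bmf GL) => u; have [h _ _] := Gb u; exact: h.
  have bG1 : bmf (F1 k.+1) by apply: (lip_bmf G1L) => u; have [_ h _] := Gb u; exact: h.
  have bG2 : bmf (F2 k.+1) by apply: (lip_bmf G2L) => u; have [_ _ h] := Gb u; exact: h.
  have bcomp (g : R -> R) j : bmf g -> bmf (fun w => g (y j w)).
    by move=> [mg [C gC]]; apply: (bmf_comp mg gC); exact: bmf_meas.
  pose xi w := y k.+1 w - y k w.
  have bxi : bmf xi by exact: bmfB.
  have c1 := bcomp _ k bF; have c2 := bcomp _ k.+1 bG.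
  have c3 := bcomp _ k bG1; have c4 := bcomp _ k bG2.
  have c5 := bcomp _ k bG; have bvk := bv k.
  pose c := sigma ^+ 2 * b ^+ 2.
  (* The three brackets are the Taylor remainder of the martingale step, the error
     on the conditional variance, and the remainder of the Gaussian step. *)
  pose U w := H w * (F k.+1 (y k.+1 w) - F k.+1 (y k w) - F1 k.+1 (y k w) * xi w
                - 2^-1 * F2 k.+1 (y k w) * xi w ^+ 2).
  pose V w := H w * (2^-1 * F2 k.+1 (y k w) * (v k w - c)).
  pose Z w := H w * (F k (y k w) - F k.+1 (y k w) - 2^-1 * c * F2 k.+1 (y k w)).
  have bU : bmf U by rewrite /U; bm.
  have bV : bmf V by rewrite /V; bm.
  have bZ : bmf Z by rewrite /Z; bm.
  have -> : a k.+1 - a k = Ex P U + Ex P V - Ex P Z.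
    have h1 := M1 k _ kK bG1; have h2 := M2 k _ kK bG2.
    have b1 : bmf (fun w => H w * (F1 k.+1 (y k w) * xi w)) by bm.
    have b2 : bmf (fun w => H w * (F2 k.+1 (y k w) * (xi w ^+ 2 - v k w))) by bm.
    rewrite -ExD; [|exact: bmf_ibl..].
    rewrite -ExB; [|by apply: bmf_ibl; bm|exact: bmf_ibl].
    rewrite /a -ExB; [|by apply: bmf_ibl; bm..].
    (* [h1] and [h2] say that two expectations vanish; subtracting these makes the three brackets
       add up pointwise. *)
    rewrite -[LHS]subr0 -{1}(mulr0 2^-1) -{1}h2 -ExZ; last exact: bmf_ibl.
    rewrite -[LHS]subr0 -{1}h1.
    rewrite -ExB; [|by apply: bmf_ibl; bm..].
    rewrite -ExB; [|by apply: bmf_ibl; bm..].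
    by congr (Ex P _); apply/funext => w; rewrite /U /V /Z /xi; ring.
  rewrite (le_trans (ler_normB _ _))// /B; apply: lerD.
    rewrite (le_trans (ler_normD _ _))//; apply: lerD.
      rewrite (le_trans (Ex_norm_le _))//; first exact: bmf_ibl.
      apply: (@le_trans _ _ (Ex P (fun w => L * (b * xi w ^+ 2 + b^-1 * xi w ^+ 4)))).
        apply: Ex_le; [by apply: bmf_ibl; bm|by apply: bmf_ibl; bm|move=> w].
        rewrite normrM -[leRHS]mul1r ler_pM//.
        have := GT (y k w) (xi w); rewrite (_ : y k w + xi w = y k.+1 w) => [h|]; last first.
          by rewrite /xi addrC subrK.
        rewrite (le_trans h)// ler_wpM2l// [_^-1 * _]mulrC; exact: cube_le.
      rewrite ExZ; last by apply: bmf_ibl; bm.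
      rewrite ler_wpM2l// ExD; [|by apply: bmf_ibl; bm..].
      rewrite !ExZ; [|by apply: bmf_ibl; bm..].
      by rewrite lerD// ?[m4 / b]mulrC ler_pM2l ?invr_gt0//; [exact: E2|exact: E4].
    rewrite (le_trans (Ex_norm_le _))//; first exact: bmf_ibl.
    apply: (@le_trans _ _ (Ex P (fun w => L * `|v k w - c|))).
      apply: Ex_le; [by apply: bmf_ibl; bm|by apply: bmf_ibl; bm|move=> w].
      rewrite normrM -[leRHS]mul1r ler_pM// normrM ler_wpM2r// normrM.
      have [_ _ h] := Gb (y k w).
      rewrite (ger0_norm (_ : 0 <= 2^-1))//.
      by have := normr_ge0 (F2 k.+1 (y k w)); lra.
    rewrite ExZ; last by apply: bmf_ibl; bm.
    by rewrite ler_wpM2l// Ev.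
  apply: Ex_bound; first exact: bmf_ibl.
  move=> w; rewrite normrM -[leRHS]mul1r ler_pM//.
  have := @smoothing_step _ _ _ P' W W_brownian t sigma t1 L f f1 f2 (r k) (r k.+1) b
    (y k w) fS (r0 k) (rlt k) (rle _ kK) b0.
  by apply; rewrite rS addrC addrA addNr add0r.
clearbody a B.
suff : forall k, (k <= K)%N -> `|a k - a 0%N| <= k%:R * B by apply.
elim=> [|k IH] kK; first by rewrite subrr normr0 mul0r.
rewrite -(subrKA (a k)) (le_trans (ler_normD _ _))// -natr1 mulrDl mul1r addrC.
by apply: lerD; [exact: IH (ltnW kK)|exact: step].
Qed.

End lindeberg.

(** * Smooth test functions *)

Section smooth_step.
Context {R : realType}.
Implicit Types x y : R.

Definition clip x : R := Num.max 0 (Num.min x 1).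

(** It goes from 0 to 1 on [[0, 1]] and its first two derivatives vanish at both ends, so clipping
    preserves two Lipschitz derivatives; these are [sstep1] and [sstep2]. *)
Definition quintic x : R := x ^+ 3 * (6 * x ^+ 2 - 15 * x + 10).

Definition sstep x : R := quintic (clip x).
Definition sstep1 x : R := 30 * clip x ^+ 2 * (1 - clip x) ^+ 2.
Definition sstep2 x : R := 60 * clip x * (1 - clip x) * (1 - 2 * clip x).

Lemma clip_cases x : [\/ x <= 0 /\ clip x = 0, 0 <= x <= 1 /\ clip x = x | 1 <= x /\ clip x = 1].
Proof.
rewrite /clip; case: (leP x 0) => x0.
  apply: Or31; split=> //; rewrite min_l ?max_l//.
  by rewrite (le_trans x0).
case: (leP x 1) => x1; first by apply: Or32; rewrite (ltW x0) max_r// ltW.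
by apply: Or33; rewrite max_r// (ltW x1).
Qed.

Lemma clip_itv x : 0 <= clip x <= 1.
Proof. by case: (clip_cases x) => -[h ->]; rewrite ?lexx ?ler01. Qed.

Lemma clip_lip x y : `|clip x - clip y| <= `|x - y|.
Proof.
wlog xy : x y / x <= y.
  move=> h; case: (leP x y) => [/h//|/ltW/h].
  by rewrite distrC [X in _ <= X]distrC.
rewrite distrC [X in _ <= X]distrC (ger0_norm (_ : 0 <= y - x)) ?subr_ge0//.
rewrite ler_norml; apply/andP; split;
case: (clip_cases x) => -[hx ->]; case: (clip_cases y) => -[hy ->]; lra.
Qed.

Lemma quintic_itv x : 0 <= x <= 1 -> 0 <= quintic x <= 1.
Proof.
move=> /andP[x0 x1]; rewrite /quintic.
have h y : 0 < 6 * y ^+ 2 - 15 * y + 10 by have := sqr_ge0 (y - 5 / 4); nra.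
apply/andP; split; first by rewrite mulr_ge0 ?exprn_ge0// ltW.
rewrite -subr_ge0.
have -> : 1 - x ^+ 3 * (6 * x ^+ 2 - 15 * x + 10) =
  (1 - x) ^+ 3 * (6 * (1 - x) ^+ 2 - 15 * (1 - x) + 10) by ring.
by rewrite mulr_ge0 ?exprn_ge0 ?subr_ge0// ltW.
Qed.

Lemma sstep_itv x : 0 <= sstep x <= 1.
Proof. exact/quintic_itv/clip_itv. Qed.


Lemma sstep_le0 x : x <= 0 -> sstep x = 0.
Proof.
move=> x0; rewrite /sstep (_ : clip x = 0) ?/quintic; first by ring.
by case: (clip_cases x) => -[h ->]; lra.
Qed.

Lemma sstep_ge1 x : 1 <= x -> sstep x = 1.
Proof.
move=> x0; rewrite /sstep (_ : clip x = 1) ?/quintic; first by ring.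
by case: (clip_cases x) => -[h ->]; lra.
Qed.

Lemma quintic_le x : 0 <= x <= 1 -> quintic x <= 10 * x ^+ 3.
Proof.
move=> /andP[x0 x1]; rewrite /quintic mulrC ler_wpM2r ?exprn_ge0//; nra.
Qed.

Lemma quinticC x : quintic (1 - x) = 1 - quintic x.
Proof. by rewrite /quintic; ring. Qed.

(** [c] is the divided difference of a polynomial [g]; clipping is a contraction. *)
Lemma lip_clip (g : R -> R) (L : R) :
  (forall a b, 0 <= a <= 1 -> 0 <= b <= 1 ->
    exists2 c, `|c| <= L & g a - g b = (a - b) * c) -> 0 <= L ->
  lip L (fun x => g (clip x)).
Proof.
move=> h L0 x y; have [c cL ->] := h _ _ (clip_itv x) (clip_itv y).
by rewrite normrM mulrC ler_pM// clip_lip.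
Qed.

Let monom (a b : R) i j : 0 <= a <= 1 -> 0 <= b <= 1 -> 0 <= a ^+ i * b ^+ j <= 1.
Proof.
move=> /andP[a0 a1] /andP[b0 b1]; rewrite mulr_ge0 ?exprn_ge0//=.
by rewrite mulr_ile1 ?exprn_ge0 ?exprn_ile1.
Qed.

(** The constant 1000 is crude. If [x] and [x + y] lie on different sides of an end of [[0, 1]],
    that end is within [|y|] of both, and the third order contact there makes every term of the
    remainder cubic in [|y|]. *)
Lemma smooth3_sstep : smooth3 1000 sstep sstep1 sstep2.
Proof.
split.
- move=> x; have h := clip_itv x; split.
  + by have /andP[? ?] := sstep_itv x; rewrite ger0_norm//; lra.
  + rewrite /sstep1; move: (clip x) h => a /andP[a0 a1].
    rewrite (_ : _ * _ = 30 * (a * (1 - a)) ^+ 2); last by ring.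
    have u0 : 0 <= a * (1 - a) by nra.
    have u1 : a * (1 - a) <= 1 by nra.
    by rewrite ger0_norm; nra.
  + rewrite /sstep2; move: (clip x) h => a /andP[a0 a1].
    have u0 : 0 <= a * (1 - a) by nra.
    have u1 : a * (1 - a) <= 1 by nra.
    rewrite (_ : _ * _ = 60 * (a * (1 - a)) * (1 - 2 * a)); last by ring.
    by rewrite ler_norml; apply/andP; split; nra.
- split;
    [apply: (@lip_clip quintic)
    |apply: (@lip_clip (fun a => 30 * a ^+ 2 * (1 - a) ^+ 2))
    |apply: (@lip_clip (fun a => 60 * a * (1 - a) * (1 - 2 * a)))];
    try exact: ler0n; move=> a b ha hb.
  (* Divided differences of the monomials, with all exponents explicit so that [monom] bounds each
     term. *)
  + exists (6 * (a ^+ 4 * b ^+ 0 + a ^+ 3 * b ^+ 1 + a ^+ 2 * b ^+ 2 + a ^+ 1 * b ^+ 3 + a ^+ 0 * b ^+ 4)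
      - 15 * (a ^+ 3 * b ^+ 0 + a ^+ 2 * b ^+ 1 + a ^+ 1 * b ^+ 2 + a ^+ 0 * b ^+ 3)
      + 10 * (a ^+ 2 * b ^+ 0 + a ^+ 1 * b ^+ 1 + a ^+ 0 * b ^+ 2)); last first.
      by rewrite /quintic; ring.
    have := monom 4 0 ha hb; have := monom 3 1 ha hb; have := monom 2 2 ha hb.
    have := monom 1 3 ha hb; have := monom 0 4 ha hb; have := monom 3 0 ha hb.
    have := monom 2 1 ha hb; have := monom 1 2 ha hb; have := monom 0 3 ha hb.
    have := monom 2 0 ha hb; have := monom 1 1 ha hb; have := monom 0 2 ha hb.
    rewrite ler_norml => ? ? ? ? ? ? ? ? ? ? ? ?; apply/andP; split; lra.
  + exists (30 * (1 - a - b) * (a * (1 - a) + b * (1 - b))); last by ring.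
    move: ha hb => /andP[a0 a1] /andP[b0 b1].
    have u0 : 0 <= a * (1 - a) <= 1 by apply/andP; split; nra.
    have v0 : 0 <= b * (1 - b) <= 1 by apply/andP; split; nra.
    move: (a * (1 - a)) (b * (1 - b)) u0 v0 => u v /andP[u0 u1] /andP[v0 v1].
    by rewrite ler_norml; apply/andP; split; nra.
  + exists (60 * (2 * (a ^+ 2 * b ^+ 0 + a ^+ 1 * b ^+ 1 + a ^+ 0 * b ^+ 2)
      - 3 * (a + b) + 1)); last by ring.
    have := monom 2 0 ha hb; have := monom 1 1 ha hb; have := monom 0 2 ha hb.
    rewrite ler_norml => ? ? ?; apply/andP; split; lra.
move=> x y; set a := `|y|.
have a0 : 0 <= a by exact: normr_ge0.
have ya : - a <= y <= a by rewrite -ler_norml.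
have a3 : 0 <= a ^+ 3 by rewrite exprn_ge0.
have cube_mono u : 0 <= u -> u <= a -> u ^+ 3 <= a ^+ 3.
  by move=> u0 ua; rewrite lerXn2r ?nnegrE.
have qa c : 0 <= c <= 1 -> c <= a -> 0 <= quintic c <= 10 * a ^+ 3.
  move=> hc ca; have /andP[-> _] := quintic_itv hc; have := quintic_le hc.
  by have /andP[c0 _] := hc; have := cube_mono _ c0 ca; lra.
have sq_y : y ^+ 2 = a ^+ 2 by rewrite real_normK ?num_real.
(* [c] will be the distance from [x] to the end that is crossed, and [e] the variation of the
   function itself. *)
have tail c e : 0 <= c <= 1 -> c <= a -> `|e| <= 10 * a ^+ 3 ->
    `|e - 30 * (c * (1 - c)) ^+ 2 * y| + `|2^-1 * (60 * (c * (1 - c)) * (1 - 2 * c)) * y ^+ 2|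
      <= 1000 * a ^+ 3.
  move=> /andP[c0 c1] ca he.
  have u0 : 0 <= c * (1 - c) by nra.
  have uc : c * (1 - c) <= c by nra.
  have u2 : (c * (1 - c)) ^+ 2 <= a ^+ 2.
    by rewrite lerXn2r ?nnegrE// (le_trans uc).
  have h1 : `|30 * (c * (1 - c)) ^+ 2 * y| <= 30 * a ^+ 3.
    rewrite normrM -/a ger0_norm; last by rewrite mulr_ge0 ?sqr_ge0.
    by rewrite (exprSr a 2) mulrA ler_wpM2r// ler_wpM2l.
  have h2 : `|2^-1 * (60 * (c * (1 - c)) * (1 - 2 * c)) * y ^+ 2| <= 30 * a ^+ 3.
    rewrite normrM sq_y (ger0_norm (sqr_ge0 a)) (exprS a 2) [30 * _]mulrA ler_wpM2r ?sqr_ge0//.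
    by rewrite ler_norml; apply/andP; split; nra.
  have := ler_normB e (30 * (c * (1 - c)) ^+ 2 * y); lra.
have [cx|cx|cx] := clip_cases x; rewrite {2}/sstep /sstep1 /sstep2; case: cx => hx ->.
- rewrite (_ : quintic 0 = 0) ?/quintic; last by ring.
  rewrite (_ : _ - _ - _ - _ = sstep (x + y)); last by ring.
  have hc := clip_itv (x + y); have : clip (x + y) <= a.
    by case: (clip_cases (x + y)) => -[h ->]; lra.
  by move=> /(qa _ hc)/andP[h1 h2]; rewrite ger0_norm// /sstep; lra.
- have hx' : 0 <= 1 - x <= 1 by lra.
  case: (clip_cases (x + y)) => -[hy cy]; rewrite /sstep cy.
  + have xa : x <= a by lra.
    rewrite (_ : quintic 0 = 0) ?/quintic; last by ring.
    rewrite -/(quintic x).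
    have /andP[q0 q1] := qa _ hx xa.
    have := tail x (- quintic x) hx xa; rewrite normrN ger0_norm// => /(_ q1).
    apply: le_trans; rewrite (_ : _ - _ - _ - _ = (- quintic x - 30 * (x * (1 - x)) ^+ 2 * y)
      - 2^-1 * (60 * (x * (1 - x)) * (1 - 2 * x)) * y ^+ 2); first exact: ler_normB.
    by ring.
  (* Both points are in [[0, 1]]: the exact Taylor expansion of a polynomial of degree five. *)
  + rewrite (_ : _ - _ - _ - _ =
      (60 * x ^+ 2 - 60 * x + 10 + (30 * x - 15) * y + 6 * y ^+ 2) * y ^+ 3); last first.
      by rewrite /quintic; field.
    rewrite normrM normrX ler_wpM2r//.
    move: hx hy => /andP[x0 x1] /andP[y0 y1].
    have ? : 0 <= x * (1 - x) by nra.
    by rewrite ler_norml; apply/andP; split; nra.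
  + have xa : 1 - x <= a by lra.
    rewrite (_ : quintic 1 = 1) ?/quintic; last by ring.
    rewrite -/(quintic x).
    have /andP[q0 q1] := qa _ hx' xa.
    have := tail (1 - x) (quintic (1 - x)) hx' xa; rewrite ger0_norm// => /(_ q1).
    apply: le_trans; rewrite quinticC (_ : _ - _ - _ - _ = (1 - quintic x - 30 * ((1 - x) * (1 - (1 - x))) ^+ 2 * y)
      + 2^-1 * (60 * ((1 - x) * (1 - (1 - x))) * (1 - 2 * (1 - x))) * y ^+ 2); first exact: ler_normD.
    by ring.
- rewrite (_ : quintic 1 = 1) ?/quintic; last by ring.
  rewrite (_ : _ - _ - _ - _ = - (1 - sstep (x + y))); last by ring.
  have hc := clip_itv (x + y).
  have hc' : 0 <= 1 - clip (x + y) <= 1 by lra.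
  have : 1 - clip (x + y) <= a.
    by case: (clip_cases (x + y)) => -[h ->]; lra.
  move=> /(qa _ hc'); rewrite quinticC -/(sstep _) => /andP[h1 h2].
  by rewrite normrN ger0_norm//; lra.
Qed.

End smooth_step.

Definition smooth {R : realType} (f : R -> R) := exists L f1 f2, smooth3 L f f1 f2.

Lemma smooth_bmf {R : realType} (f : R -> R) : smooth f -> bmf (f : R -> R).
Proof.
move=> [L [f1 [f2 [fb [fL _ _] _]]]].
by apply: (lip_bmf fL) => x; have [h _ _] := fb x; exact: h.
Qed.

Lemma smooth_affine {R : realType} (f : R -> R) (a c : R) :
  smooth f -> smooth (fun x => f (a * x + c)).
Proof.
move=> [L [f1 [f2 fS]]]; have L0 := smooth3_ge0 fS.
case: fS => fb [fL f1L f2L] fT.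
(* [A ^+ 3] dominates [|a|^k] for all [k <= 3], whether [|a|] is small or large, so one constant
   serves all clauses. *)
pose A := 1 + `|a|.
have a0 := normr_ge0 a.
have A1 : 1 <= A by rewrite lerDl.
have aA : `|a| <= A by rewrite lerDr.
have A0 : 0 <= A by exact: le_trans A1.
have pw k : (k <= 3)%N -> `|a| ^+ k <= A ^+ 3.
  move=> k3; apply: (@le_trans _ _ (A ^+ k)); first by rewrite lerXn2r ?nnegrE.
  exact: ler_weXn2l.
have LA k u : (k <= 3)%N -> `|u| <= L -> `|a ^+ k * u| <= L * A ^+ 3.
  by move=> k3 uL; rewrite normrM normrX mulrC ler_pM ?exprn_ge0// pw.
have LL k (g : R -> R) : (k <= 2)%N -> lip L g ->
    lip (L * A ^+ 3) (fun x => a ^+ k * g (a * x + c)).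
  move=> k2 gL x y; rewrite -mulrBr normrM normrX.
  have h := gL (a * x + c) (a * y + c).
  apply: (@le_trans _ _ (`|a| ^+ k * (L * (`|a| * `|x - y|)))).
    rewrite ler_wpM2l ?exprn_ge0// (le_trans h)// opprD addrACA subrr addr0.
    by rewrite -mulrBr normrM.
  rewrite [leLHS](_ : _ = L * `|a| ^+ k.+1 * `|x - y|); last by rewrite exprS; ring.
  by rewrite ler_wpM2r// ler_wpM2l// pw.
exists (L * A ^+ 3), (fun x => a ^+ 1 * f1 (a * x + c)), (fun x => a ^+ 2 * f2 (a * x + c)).
split.
- move=> x; have [h0 h1 h2] := fb (a * x + c); split; [|exact: LA..].
  by have := @LA 0%N _ isT h0; rewrite expr0 mul1r.
- split; [|exact: LL..].
  by have := @LL 0%N _ isT fL; under eq_fun do rewrite expr0 mul1r.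
move=> x y; have := fT (a * x + c) (a * y).
rewrite (_ : a * x + c + a * y = a * (x + y) + c); last by ring.
rewrite (_ : f1 _ * (a * y) = a ^+ 1 * f1 (a * x + c) * y); last by ring.
rewrite (_ : 2^-1 * f2 _ * _ = 2^-1 * (a ^+ 2 * f2 (a * x + c)) * y ^+ 2); last by ring.
move=> h; apply: (le_trans h); rewrite normrM exprMn mulrA ler_wpM2r ?exprn_ge0//.
by rewrite ler_wpM2l// pw.
Qed.

Lemma smoothB {R : realType} (f g : R -> R) : smooth f -> smooth g ->
  smooth (fun x => f x - g x).
Proof.
move=> [L [f1 [f2 [fb [fL f1L f2L] fT]]]] [K [g1 [g2 [gb [gL g1L g2L] gT]]]].
have B (u v : R) : `|u| <= L -> `|v| <= K -> `|u - v| <= L + K.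
  by move=> uL vK; rewrite (le_trans (ler_normB _ _))// lerD.
have lipB (u v : R -> R) : lip L u -> lip K v -> lip (L + K) (fun x => u x - v x).
  move=> uL vK x y.
  rewrite (_ : u x - v x - (u y - v y) = (u x - u y) - (v x - v y)); last by ring.
  by rewrite (le_trans (ler_normB _ _))// mulrDl lerD.
exists (L + K), (fun x => f1 x - g1 x), (fun x => f2 x - g2 x); split.
- move=> x; have [? ? ?] := fb x; have [? ? ?] := gb x; split; exact: B.
- by split; exact: lipB.
move=> x y.
rewrite (_ : _ - _ - _ - _ = (f (x + y) - f x - f1 x * y - 2^-1 * f2 x * y ^+ 2) -
  (g (x + y) - g x - g1 x * y - 2^-1 * g2 x * y ^+ 2)); last by ring.
by rewrite (le_trans (ler_normB _ _))// mulrDl lerD.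
Qed.

Section hat_functions.
Context {R : realType}.
Variables (e : R) (N : nat).
Hypotheses (e0 : 0 < e) (N2 : (1 < N)%N).

(** A bump supported within [e] of the node [e (i - N + 1)]. Being differences of consecutive steps,
    the bumps telescope to a partition of unity on the interval of radius [e (N - 1)]. *)
Definition hat i (x : R) : R :=
  sstep (e^-1 * x + (N%:R - i%:R)) - sstep (e^-1 * x + (N%:R - i.+1%:R)).

Lemma smooth_hat i : smooth (hat i).
Proof.
have h : smooth (@sstep R) by exists 1000, sstep1, sstep2; exact: smooth3_sstep.
by apply: smoothB; exact: smooth_affine.
Qed.

Lemma hatE i x : hat i x =
  sstep (e^-1 * x + N%:R - i%:R) - sstep (e^-1 * x + N%:R - i%:R - 1).
Proof. by rewrite /hat -natr1; congr (sstep _ - sstep _); ring. Qed.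

Lemma hat_ge0 i x : 0 <= hat i x.
Proof.
rewrite hatE; set v := _ - i%:R; rewrite subr_ge0; case: (leP v 1) => h.
  by rewrite sstep_le0 ?subr_le0//; have /andP[] := sstep_itv v.
by rewrite (sstep_ge1 (ltW h)); have /andP[] := sstep_itv (v - 1).
Qed.

Lemma sum_hat n x :
  \sum_(i < n) hat i x = sstep (e^-1 * x + N%:R) - sstep (e^-1 * x + (N%:R - n%:R)).
Proof.
elim: n => [|n IH]; first by rewrite big_ord0 subr0 subrr.
by rewrite big_ord_recr/= IH /hat subrKA.
Qed.

Lemma hat_neq0 i x : hat i x != 0 -> `|x - e * (i%:R - N%:R + 1)| <= e.
Proof.
rewrite hatE; set v := _ - i%:R => h.
have -> : x - e * (i%:R - N%:R + 1) = e * (v - 1).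
  by rewrite /v; have en0 : e != 0 by [rewrite gt_eqF]; field.
rewrite normrM gtr0_norm// ler_piMr ?(ltW e0)//.
rewrite ler_norml; apply/andP; split.
  rewrite leNgt; apply/negP => v0; move/eqP: h; apply.
  by rewrite !sstep_le0 ?subrr//; lra.
rewrite leNgt; apply/negP => v1; move/eqP: h; apply.
by rewrite !sstep_ge1 ?subrr//; lra.
Qed.

Lemma sum_hat_itv x : 0 <= \sum_(i < 2 * N) hat i x <= 1.
Proof.
rewrite sumr_ge0 => [|i _]; last exact: hat_ge0.
rewrite sum_hat; have /andP[_ h1] := sstep_itv (e^-1 * x + N%:R).
by have /andP[h2 _] := sstep_itv (e^-1 * x + (N%:R - (2 * N)%:R)); lra.
Qed.

(** Chebyshev's bound in pointwise form: the left side is 0 on the interval covered by the bumps and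
    at most 1 elsewhere. *)
Lemma sum_hat_tail x :
  1 - \sum_(i < 2 * N) hat i x <= x ^+ 2 / (e * (N%:R - 1)) ^+ 2.
Proof.
have r0 : 0 < e * (N%:R - 1) by rewrite mulr_gt0// subr_gt0 ltr1n.
set r := e * _ in r0 *.
case: (leP `|x| r) => h; last first.
  apply: (@le_trans _ _ 1); first by have /andP[+ _] := sum_hat_itv x; lra.
  rewrite ler_pdivlMr ?exprn_gt0// mul1r -[x ^+ 2]real_normK ?num_real//.
  by rewrite lerXn2r ?nnegrE ?(ltW r0) ?(ltW h).
have : `|e^-1 * x| <= N%:R - 1.
  by rewrite normrM gtr0_norm ?invr_gt0// mulrC ler_pdivrMr// mulrC.
rewrite ler_norml => /andP[h1 h2].
rewrite sum_hat sstep_ge1; last by lra.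
rewrite sstep_le0; last by rewrite natrM; lra.
by rewrite subr0 subrr divr_ge0 ?sqr_ge0.
Qed.

End hat_functions.

Lemma prod_tail {R : realType} (m : nat) (s : 'I_m -> R) :
  (forall i, 0 <= s i <= 1) -> 0 <= 1 - \prod_(i < m) s i <= \sum_(i < m) (1 - s i).
Proof.
elim: m s => [|m IH] s hs; first by rewrite !big_ord0 subrr lexx.
rewrite !big_ord_recl.
have /andP[h1 h2] := IH (fun i => s (lift ord0 i)) (fun i => hs (lift ord0 i)).
have /andP[s0 s1] := hs ord0.
set p := \prod_(i < m) _ in h1 h2 *; set q := \sum_(i < m) _ in h2 *.
have p0 : 0 <= p by apply: prodr_ge0 => i _; have /andP[] := hs (lift ord0 i).
by apply/andP; split; nra.
Qed.

(** * Lipschitz functions of finitely many variables *)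

Section lipschitz_approximation.
Context {R : realType}.
Variables (m : nat) (G : (nat -> R) -> R) (M K : R).
Hypothesis GM : forall y, `|G y| <= M.
Hypothesis GK : forall y y', `|G y - G y'| <= K * \sum_(k < m) `|y k - y' k|.

(** Arguments of [G] are sequences, so coordinates from [m] on receive the default value 0; by [GK]
    they do not influence [G]. *)
Definition node (e : R) (N : nat) (al : {ffun 'I_m -> 'I_(2 * N)}) (k : nat) : R :=
  oapp (fun j : 'I_m => e * ((al j)%:R - N%:R + 1)) 0 (insub k).

Definition hat_approx (e : R) (N : nat) (y : nat -> R) : R :=
  \sum_(al : {ffun 'I_m -> 'I_(2 * N)})
    G (node e al) * \prod_(k < m) hat e N (al k) (y k).

Let M0 : 0 <= M. Proof. exact: le_trans (GM (fun=> 0)). Qed.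

Let K0 : (0 < m)%N -> 0 <= K.
Proof.
move=> m0; have := GK (fun=> 1) (fun=> 0).
under eq_bigr do rewrite subr0 normr1.
rewrite sumr_const card_ord => h; have := le_trans (normr_ge0 _) h.
by rewrite pmulr_lge0// ltr0n.
Qed.

(** Interpolation on a grid: where a product of bumps is nonzero, the node is within [e] in each
    coordinate, whence [K m e]. The mass missing from the partition of unity costs [M] times the
    tails. *)
Lemma hat_approxP e N y : 0 < e -> (1 < N)%N ->
  `|G y - hat_approx e N y| <=
  K * (m%:R * e) + M * \sum_(k < m) (y k ^+ 2 / (e * (N%:R - 1)) ^+ 2).
Proof.
move=> e0 N2.
pose s (k : 'I_m) := \sum_(i < 2 * N) hat e N i (y k).
have s01 k : 0 <= s k <= 1 by exact: sum_hat_itv.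
have sE : \prod_(k < m) s k =
    \sum_(al : {ffun 'I_m -> 'I_(2 * N)}) \prod_(k < m) hat e N (al k) (y k).
  exact: bigA_distr_bigA.
rewrite (_ : _ - _ = (G y * \prod_(k < m) s k - hat_approx e N y) +
  G y * (1 - \prod_(k < m) s k)); last by ring.
have hp (al : {ffun 'I_m -> 'I_(2 * N)}) : 0 <= \prod_(k < m) hat e N (al k) (y k).
  by apply: prodr_ge0 => k _; exact: hat_ge0.
rewrite (le_trans (ler_normD _ _))//; apply: lerD.
  have Ke : 0 <= K * (m%:R * e).
    case: (posnP m) => [->|/K0 K_ge0]; first by rewrite mul0r mulr0.
    by rewrite !mulr_ge0// ltW.
  rewrite sE mulr_sumr /hat_approx -sumrB (le_trans (ler_norm_sum _ _ _))//.
  apply: (@le_trans _ _ (K * (m%:R * e) * \prod_(k < m) s k)); last first.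
    rewrite ler_piMr//; apply: prodr_ile1 => k _; exact: s01.
  rewrite sE mulr_sumr; apply: ler_sum => al _.
  rewrite -mulrBl normrM (ger0_norm (hp al)).
  have [->|nz] := eqVneq (\prod_(k < m) hat e N (al k) (y k)) 0; first by rewrite !mulr0.
  rewrite ler_wpM2r// (le_trans (GK _ _))//.
  case: (posnP m) => [m0|/K0 K_ge0].
    by rewrite big1 ?mulr0// => k; have := ltn_ord k; rewrite [X in (_ < X)%N]m0.
  rewrite ler_wpM2l// (le_trans (ler_sum _ (G := fun=> e) _))//; last first.
    by rewrite sumr_const card_ord mulr_natl.
  move=> k _; rewrite /node valK/=; apply: hat_neq0 => //.
  by apply: contra nz => /eqP h; rewrite (bigD1 k)//= h mul0r.
have /andP[t0 t1] := prod_tail s01.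
rewrite normrM (ger0_norm t0) ler_pM// (le_trans t1)//.
by apply: ler_sum => k _; exact: sum_hat_tail.
Qed.

Section measurability.
Context {d : measure_display} {Omega : measurableType d}.

Lemma measurable_hat_approx (y : nat -> Omega -> R) e N :
  (forall k, (k < m)%N -> measurable_fun setT (y k)) ->
  bmf (fun w => hat_approx e N (y ^~ w)).
Proof.
move=> my; apply: bmf_sum => al; apply: bmfM; first exact: bmf_cst.
apply: bmf_prod => k; have [mh [C hC]] := smooth_bmf (smooth_hat e N (al k)).
exact: (bmf_comp mh hC (my _ (ltn_ord k))).
Qed.

(** [G] is a mere function on sequences; measurability comes from pointwise approximation by
    [hat_approx], a finite sum of products of functions of one variable. *)
Lemma lipschitz_bmf (y : nat -> Omega -> R) :
  (forall k, (k < m)%N -> measurable_fun setT (y k)) ->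
  bmf (fun w => G (y ^~ w)).
Proof.
move=> my; split; last by exists M.
(* With [e = 1 / (n + 1)] and this [N], the radius [e (N - 1)] equals [n + 1], so both error terms
   are [O(1 / n)]. *)
pose A n w := hat_approx n.+1%:R^-1 (n.+1 * n.+1).+1 (y ^~ w).
apply: (@measurable_fun_cvg _ _ _ setT A) => //.
  by move=> n; apply: bmf_meas; exact: measurable_hat_approx.
move=> w _; pose S := \sum_(k < m) y k w ^+ 2.
have h n : `|G (y ^~ w) - A n w| <= (K * m%:R + M * S) * n.+1%:R^-1.
  rewrite (le_trans (hat_approxP _ _ _))//.
  rewrite mulrDl mulrA lerD// -mulr_suml -/S -mulrA.
  rewrite ler_wpM2l// ler_wpM2l ?sumr_ge0//; first by move=> k _; exact: sqr_ge0.
  rewrite -[(n.+1 * n.+1).+1%:R]natr1 addrK natrM mulKf ?pnatr_eq0//.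
  by rewrite lef_pV2 ?posrE ?exprn_gt0 ?ltr0n// -natrX ler_nat leq_pmulr.
have S0 : 0 <= S by apply: sumr_ge0 => k _; exact: sqr_ge0.
apply/cvgrPdist_le => del del0; near=> n.
rewrite (le_trans (h n))//.
suff : `|0 - (K * m%:R + M * S) * n.+1%:R^-1| <= del.
  by rewrite sub0r normrN; apply: le_trans; exact: ler_norm.
near: n; move: del del0; apply/cvgrPdist_le.
rewrite -[X in _ --> X](mulr0 (K * m%:R + M * S)); apply: cvgM; first exact: cvg_cst.
exact: cvg_harmonic.
Unshelve. all: by end_near. Qed.

End measurability.

Section convergence.
Context {d : measure_display} {Omega : measurableType d} (P : probability Omega R).
Context {d' : measure_display} {Omega' : measurableType d'} (P' : probability Omega' R).
Context {I : Type} {F : set_system I} {FF : Filter F}.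
Variables (Y : I -> nat -> Omega -> R) (Z : nat -> Omega' -> R) (V : R).
Hypothesis bY : forall i k, (k < m)%N -> bmf (Y i k).
Hypothesis mZ : forall k, (k < m)%N -> measurable_fun setT (Z k).
Hypothesis iZ : forall k, (k < m)%N -> ibl P' (fun w => Z k w ^+ 2).
Hypothesis YV : \forall i \near F, forall k, (k < m)%N -> Ex P (fun w => Y i k w ^+ 2) <= V.
Hypothesis ZV : forall k, (k < m)%N -> Ex P' (fun w => Z k w ^+ 2) <= V.
Hypothesis YZ : forall f : nat -> R -> R, (forall k, smooth (f k)) ->
  Ex P (fun w => \prod_(k < m) f k (Y i k w)) @[i --> F] -->
  Ex P' (fun w => \prod_(k < m) f k (Z k w)).

Let approx_error {d0 : measure_display} {Om : measurableType d0} (Q : probability Om R)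
    (y : nat -> Om -> R) e N :
  (forall k, (k < m)%N -> measurable_fun setT (y k)) ->
  (forall k, (k < m)%N -> ibl Q (fun w => y k w ^+ 2)) ->
  (forall k, (k < m)%N -> Ex Q (fun w => y k w ^+ 2) <= V) ->
  0 < e -> (1 < N)%N ->
  `|Ex Q (fun w => G (y ^~ w)) - Ex Q (fun w => hat_approx e N (y ^~ w))| <=
  K * (m%:R * e) + M * (m%:R * V / (e * (N%:R - 1)) ^+ 2).
Proof.
move=> my iy yV e0 N2; set r := (e * _) ^+ 2.
have is_ : ibl Q (fun w => \sum_(k < m) y k w ^+ 2) /\
    Ex Q (fun w => \sum_(k < m) y k w ^+ 2) <= m%:R * V.
  have : forall n, (n <= m)%N -> ibl Q (fun w => \sum_(k < n) y k w ^+ 2) /\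
      Ex Q (fun w => \sum_(k < n) y k w ^+ 2) <= n%:R * V.
    elim=> [_|n IH nm].
      under eq_fun do rewrite big_ord0.
      by rewrite Ex_cst mul0r; split=> //; exact/bmf_ibl/bmf_cst.
    have [i1 i2] := IH (ltnW nm); under eq_fun do rewrite big_ord_recr/=.
    split; first by apply: iblD => //; exact: iy.
    rewrite ExD//; last exact: iy.
    by rewrite -natr1 mulrDl mul1r lerD// yV.
  exact.
have i2 := iblZ (M / r) is_.1.
have ic (c : R) : ibl Q (fun=> c) by exact/bmf_ibl/bmf_cst.
apply: (@le_trans _ _ (Ex Q (fun w => K * (m%:R * e) + M / r * \sum_(k < m) y k w ^+ 2))).
  apply: Ex_normB.
  - exact/bmf_ibl/lipschitz_bmf.
  - exact/bmf_ibl/measurable_hat_approx.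
  - exact: iblD.
  move=> w; rewrite (le_trans (hat_approxP _ e0 N2))// lerD2l -/r -mulr_suml.
  by rewrite -mulrA ler_wpM2l// mulrC.
rewrite ExD// Ex_cst lerD2l ExZ; last exact: is_.1.
rewrite -mulrA ler_wpM2l// mulrC ler_wpM2r ?invr_ge0 ?sqr_ge0//.
exact: is_.2.
Qed.

(** Products of bumps are admissible tests for [YZ], and the second moment bound [V] plays the part
    of tightness: it makes the interpolation error uniform along the filter. *)
Lemma cvg_lipschitz :
  Ex P (fun w => G (Y i ^~ w)) @[i --> F] --> Ex P' (fun w => G (Z ^~ w)).
Proof.
apply/cvgrPdist_le => del del0.
have V0 : (0 < m)%N -> 0 <= V.
  by move=> m0; apply: le_trans (ZV m0); apply: Ex_ge0 => w; exact: sqr_ge0.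
have mV0 : 0 <= m%:R * V.
  by case: (posnP m) => [->|/V0 ?]; rewrite ?mul0r// mulr_ge0.
(* [e] brings the oscillation term below [del / 6], and [N] will do the same for the tail term. The
   two interpolation errors and the convergence of the interpolants then take [del / 3] each. *)
pose e := (del / 6) / (1 + `|K| * m%:R).
have d6 : 0 < del / 6 by rewrite divr_gt0.
have Mm : 0 <= M * (m%:R * V) by rewrite mulr_ge0.
have de : 0 < 1 + `|K| * m%:R by rewrite ltr_pwDl// mulr_ge0.
have e0 : 0 < e by rewrite divr_gt0// divr_gt0.
have Ke : K * (m%:R * e) <= del / 6.
  apply: (@le_trans _ _ (`|K| * m%:R * e)).
    by rewrite mulrA ler_wpM2r ?(ltW e0)// ler_wpM2r// ler_norm.
  rewrite /e mulrA ler_pdivrMr// mulrC ler_wpM2l ?lerDr// ltW// divr_gt0//.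
pose b := M * (m%:R * V) / (del / 6) + 1.
have b0 : 0 <= b by rewrite addr_ge0// divr_ge0// ltW.
pose N := (Num.trunc (b / e)).+2.
have N2 : (1 < N)%N by [].
have rb : b <= e * (N%:R - 1).
  rewrite /N -natr1 addrK mulrC -ler_pdivrMr// ltW//; exact: truncnS_gt.
have r1 : 1 <= e * (N%:R - 1).
  by rewrite (le_trans _ rb)// lerDr divr_ge0// ltW.
have Mr : M * (m%:R * V / (e * (N%:R - 1)) ^+ 2) <= del / 6.
  rewrite mulrA ler_pdivrMr ?exprn_gt0 ?(lt_le_trans _ r1)//.
  have : M * (m%:R * V) <= del / 6 * (e * (N%:R - 1)).
    rewrite [leRHS]mulrC -ler_pdivrMr//; apply: le_trans rb.
    by rewrite /b lerDl.
  move=> h; apply: (le_trans h); rewrite ler_wpM2l ?(ltW d6)//.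
  by rewrite expr2 ler_peMr// (le_trans _ r1).
have hA : Ex P (fun w => hat_approx e N (Y i ^~ w)) @[i --> F] -->
    Ex P' (fun w => hat_approx e N (Z ^~ w)).
  pose T (al : {ffun 'I_m -> 'I_(2 * N)}) (y : nat -> R) :=
    \prod_(k < m) hat e N (al k) (y k).
  have bT d0 (Om : measurableType d0) (y : nat -> Om -> R) al :
      (forall k, (k < m)%N -> measurable_fun setT (y k)) -> bmf (fun w => T al (y ^~ w)).
    move=> my; apply: bmf_prod => k.
    have [mh [C hC]] := smooth_bmf (smooth_hat e N (al k)).
    exact: (bmf_comp mh hC (my _ (ltn_ord k))).
  have EA d0 (Om : measurableType d0) (Q : probability Om R) (y : nat -> Om -> R) :
      (forall k, (k < m)%N -> measurable_fun setT (y k)) ->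
      Ex Q (fun w => hat_approx e N (y ^~ w)) =
      \sum_(al : {ffun 'I_m -> 'I_(2 * N)}) G (node e al) * Ex Q (fun w => T al (y ^~ w)).
    move=> my; rewrite Ex_sum; last by move=> al; apply: bmfM; [exact: bmf_cst|exact: bT].
    by apply: eq_bigr => al _; rewrite ExZ//; apply: bmf_ibl; exact: bT.
  rewrite EA//; under eq_cvg => i.
    rewrite EA; last by move=> k km; apply: bmf_meas; exact: bY.
    over.
  apply: cvg_big => [|al _]; first exact: add_continuous.
  apply: cvgM; first exact: cvg_cst.
  pose f (k : nat) := if insub k is Some j then hat e N (al j) else hat e N 0.
  have sf k : smooth (f k) by rewrite /f; case: insub => [j|]; exact: smooth_hat.
  have := YZ sf.
  have fE (y : nat -> R) : \prod_(k < m) f k (y k) = T al y.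
    by apply: eq_bigr => k _; rewrite /f valK.
  rewrite (_ : (fun w => _) = (fun w => T al (Z ^~ w))); last by apply/funext => w; exact: fE.
  rewrite (_ : (fun i => _) = (fun i => Ex P (fun w => T al (Y i ^~ w))))//.
  by apply/funext => i; congr (Ex P _); apply/funext => w; exact: (fE (Y i ^~ w)).
near=> i.
have h1 := @approx_error _ _ P' Z e N mZ iZ ZV e0 N2.
have h2 : `|Ex P (fun w => G (Y i ^~ w)) - Ex P (fun w => hat_approx e N (Y i ^~ w))| <=
    K * (m%:R * e) + M * (m%:R * V / (e * (N%:R - 1)) ^+ 2).
  apply: approx_error => //.
  - by move=> k km; apply: bmf_meas; exact: bY.
  - by move=> k km; apply/bmf_ibl/bmfX; exact: bY.
  - by near: i.
have h3 : `|Ex P' (fun w => hat_approx e N (Z ^~ w)) -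
    Ex P (fun w => hat_approx e N (Y i ^~ w))| <= del / 3.
  by near: i; move/cvgrPdist_le : hA; apply; rewrite divr_gt0.
move: h1 h2 h3; rewrite !ler_norml => /andP[? ?] /andP[? ?] /andP[? ?].
by apply/andP; split; lra.
Unshelve. all: by end_near. Qed.

End convergence.
End lipschitz_approximation.

(** * From step functions to weak convergence in the Skorokhod space *)

Lemma segment_unif_continuous {R : realType} (f : R -> R) (a b : R) :
  {within `[a, b], continuous f} -> forall e, 0 < e ->
  exists2 del, 0 < del & forall x y, x \in `[a, b] -> y \in `[a, b] ->
    `|x - y| < del -> `|f x - f y| < e.
Proof.
move=> /subspace_continuousP cf e e0.
have /compact_near_coveringP/near_covering_withinP cpt := @segment_compact R a b.
pose Q (del x : R) := forall y, y \in `[a, b] -> `|x - y| < del -> `|f x - f y| < e.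
have h : \forall del \near (0 : R)^'+, `[a, b] `<=` Q del.
  apply: cpt => x xab.
  have e2 : 0 < e / 2 by rewrite divr_gt0.
  have /cvgrPdist_lt/(_ _ e2) := cf x xab.
  rewrite near_withinE => -[r /= r0 xr].
  have r2 : 0 < r / 2 by rewrite divr_gt0.
  exists (ball x (r / 2), [set del | del < r / 2]) => /=.
    split; first exact: nbhsx_ballx.
    by apply: nbhs_right_lt.
  move=> [x' del] /= [xx' dr] x'ab y yab yd.
  rewrite -(subrKA (f x)) (le_lt_trans (ler_normD _ _))// (splitr e) ltrD//.
    rewrite distrC; apply: xr => //=; rewrite (lt_trans xx')// ltr_pdivrMr//.
    by rewrite ltr_pMr// ltr1n.
  apply: xr => //=; rewrite -(subrKA x') (le_lt_trans (ler_normD _ _))// (splitr r).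
  by rewrite ltrD// (lt_trans yd).
have [del [d0 hd]] : exists del : R, 0 < del /\ `[a, b] `<=` Q del.
  have h0 : \forall del \near (0 : R)^'+, 0 < del by exact: nbhs_right_gt.
  have [del [? ?]] := filter_ex (filterI h0 h).
  by exists del.
by exists del => // x y xab yab xy; exact: hd.
Qed.

Section expectation_monotone.
Context {R : realType} {d : measure_display} {Omega : measurableType d}.
Variable P : probability Omega R.

(* No measurability is needed: on arbitrary functions the integral is a
   difference of suprema over simple functions. *)
Lemma expectation_le_any (f g : Omega -> R) :
  (forall w, f w <= g w) -> ('E_P [f] <= 'E_P [g])%E.
Proof.
move=> fg; rewrite unlock /integral !patch_setT.
apply: leeB; apply: le_ereal_sup => _ [h /= hf <-]; exists h => //= w;
  apply: (le_trans (hf w)).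
- by rewrite !funeposE ge_max !le_max lee_fin fg/= lexx orbT.
- by rewrite !funenegE ge_max !le_max leeN2 lee_fin fg/= lexx orbT.
Qed.

Lemma expectationE (f : Omega -> R) : ibl P f -> ('E_P [f] = (Ex P f)%:E)%E.
Proof. by move=> fi; rewrite unlock /Ex /Rintegral fineK// integrable_fin_num. Qed.

End expectation_monotone.

(** * Lipschitz minorants of a functional on the Skorokhod space *)

Section lower_envelope.
Context {R : realType}.
Variables (F : skorokhod R -> R) (M : R).
Hypothesis FM : forall f, `|F f| <= M.

(* An inf-convolution of [F] with the uniform distance; it makes sense on
   arbitrary paths and is Lipschitz for the uniform distance. *)
Definition env_set (k : R) (f : R -> R) : set R :=
  [set z | exists (g : skorokhod R) (e : R),
    [/\ 0 <= e, forall t, t \in `[0, 1] -> `|f t - g t| <= e & z = F g + k * e]]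
  `|` [set M].

(** The value [M] belongs to the set so that the infimum stays meaningful at a path with no cadlag
    path at finite uniform distance. *)
Definition lower_env (k : R) (f : R -> R) : R := inf (env_set k f).

Variable k : R.
Hypothesis k0 : 0 <= k.

Let M0 : 0 <= M.
Proof. exact: le_trans (normr_ge0 _) (FM (Skorokhod (@cadlag01_cst0 R))). Qed.

Let env_lb f : lbound (env_set k f) (- M).
Proof.
move=> z [[g [e [e0 _ ->]]]|->]; last by have := M0; lra.
by have := FM g; rewrite ler_norml => /andP[h _]; rewrite ler_wpDr// mulr_ge0.
Qed.

Let env_has_lb f : has_lbound (env_set k f).
Proof. by exists (- M); exact: env_lb. Qed.

Let env_neq0 f : nonempty (env_set k f).
Proof. by exists M; right. Qed.

Lemma lower_env_bounded f : `|lower_env k f| <= M.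
Proof.
rewrite ler_norml; apply/andP; split; first exact: lb_le_inf.
by apply: ge_inf => //; right.
Qed.

Lemma lower_env_lip f f' e : 0 <= e -> (forall t, t \in `[0, 1] -> `|f t - f' t| <= e) ->
  lower_env k f <= lower_env k f' + k * e.
Proof.
move=> e0 ff'; rewrite -lerBlDr; apply: lb_le_inf => //.
move=> z [[g [e' [e'0 h ->]]]|->]; rewrite lerBlDr.
  rewrite -addrA -mulrDr; apply: ge_inf => //; left; exists g, (e' + e); split=> //.
    by rewrite addr_ge0.
  move=> t tI; rewrite -(subrKA (f' t)) addrC (le_trans (ler_normD _ _))//.
  by rewrite lerD ?h ?ff'.
apply: (@le_trans _ _ M); first by apply: ge_inf => //; right.
by rewrite lerDl mulr_ge0.
Qed.

Lemma lower_env_dist f f' e : 0 <= e -> (forall t, t \in `[0, 1] -> `|f t - f' t| <= e) ->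
  `|lower_env k f - lower_env k f'| <= k * e.
Proof.
move=> e0 ff'; have h1 := lower_env_lip e0 ff'.
have h2 := @lower_env_lip f' f e e0 (fun t tI => ltac:(by rewrite distrC; exact: ff')).
by rewrite ler_norml; apply/andP; split; lra.
Qed.

Lemma lower_env_le (g : skorokhod R) : lower_env k g <= F g.
Proof.
apply: ge_inf => //; left; exists g, 0; split=> //; last by rewrite mulr0 addr0.
by move=> t _; rewrite subrr normr0.
Qed.

End lower_envelope.

(** For large [k] a competitor at uniform distance at least [r / 2] pays a penalty of [2 M]; a
    nearer one lies in the Skorokhod ball of radius [r], with the identity as time change, where [F]
    varies by at most [e]. The threshold depends on the path, so the envelopes converge
    pointwise. *)
Lemma lower_env_near {R : realType} (F : skorokhod R -> R) (M : R) (g : skorokhod R) (e : R) :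
  (forall f, `|F f| <= M) -> continuous F -> 0 < e ->
  exists k0, forall k, k0 <= k -> 0 <= k -> F g - e <= lower_env F M k g.
Proof.
move=> FM cF e0.
have M0 : 0 <= M by exact: le_trans (normr_ge0 _) (FM g).
have /cvgrPdist_le/(_ _ e0) := cF g.
move=> /nbhs_ballP[r /= r0 hr].
have r2 : 0 < r / 2 by rewrite divr_gt0.
exists (2 * M / (r / 2)) => k kk k0; apply: lb_le_inf; first by exists M; right.
have := FM g; rewrite ler_norml => /andP[h1 h2].
move=> z [[f [a [a0 h ->]]]|->]; last by lra.
case: (leP (r / 2) a) => ar.
  have : 2 * M <= k * a.
    apply: (@le_trans _ _ (k * (r / 2))); last by rewrite ler_wpM2l.
    by rewrite -ler_pdivrMr.
  by have := FM f; rewrite ler_norml => /andP[h3 h4]; lra.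
have : ball g r f.
  exists id; first by split=> //; split=> // x /= xI; exists x.
  move=> t tI; rewrite subrr normr0; split=> //.
  rewrite (le_lt_trans (h t tI))// (lt_trans ar)// ltr_pdivrMr//.
  by rewrite ltr_pMr// ltr1n.
move=> /hr /=; rewrite ler_norml => /andP[h3 h4].
by have : 0 <= k * a by [rewrite mulr_ge0]; lra.
Qed.

(** The increment [y j] is switched on at [(j + 1) / m], the end of its block; fed with the
    increments of a path, this is the path read at the last grid point up to [t], minus its initial
    value. *)
Definition step_path {R : realType} (m : nat) (y : nat -> R) (t : R) : R :=
  \sum_(j < m | j.+1%:R <= m%:R * t) y j.

Lemma step_path_dist {R : realType} (m : nat) (y y' : nat -> R) t :
  `|step_path m y t - step_path m y' t| <= \sum_(j < m) `|y j - y' j|.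
Proof.
rewrite /step_path -sumrB (le_trans (ler_norm_sum _ _ _))//.
by rewrite [leRHS](bigID (fun j : 'I_m => j.+1%:R <= m%:R * t))/= lerDl sumr_ge0.
Qed.

Lemma step_path_telescope {R : realType} (m : nat) (u : nat -> R) (t : R) :
  0 <= t <= 1 -> exists2 p, (p <= m)%N &
   (p%:R <= m%:R * t < p.+1%:R) /\ step_path m (fun j => u j.+1 - u j) t = u p - u 0%N.
Proof.
move=> /andP[t0 t1]; pose p := Num.trunc (m%:R * t).
have mt0 : 0 <= m%:R * t by rewrite mulr_ge0.
have /andP[p1 p2] : p%:R <= m%:R * t < p.+1%:R by exact: truncn_itv.
have pm : (p <= m)%N.
  by rewrite -(ler_nat R) (le_trans p1)// ler_piMr.
exists p => //; split; first by rewrite p1.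
rewrite -(telescope_sumr u (leq0n p)) big_mkord /step_path.
rewrite (big_ord_widen m (fun j => u j.+1 - u j) pm); apply: eq_bigl => j.
apply/idP/idP => h; first by rewrite -ltnS -(ltr_nat R) (le_lt_trans h).
by rewrite (le_trans _ p1)// ler_nat.
Qed.

(** * From block increments to convergence in law *)

Section abstract_fclt.
Context {R : realType} {d : measure_display} {Omega : measurableType d}.
Variable P : probability Omega R.
Context {d' : measure_display} {Omega' : measurableType d'}.
Variables (P' : probability Omega' R) (W : R -> Omega' -> R).
Hypothesis W_brownian : standard_brownian01 P' W.
Variable sigma : R.

Definition tm (m k : nat) : R := k%:R / m%:R.

Definition brownian_step (m k : nat) (w : Omega') : R :=
  sigma * incr W (tm m k) (tm m k.+1) w.

Definition brownian_path (w : Omega') : R -> R := fun v => sigma * W v w.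

Lemma cadlag_brownian_path w : cadlag01 (brownian_path w).
Proof.
have [_ _ /(_ w)/subspace_continuousP cW _ _] := W_brownian.
have c (x : R) : x \in `[0, 1] -> brownian_path w @ within `[0, 1] (nbhs x) --> brownian_path w x.
  by move=> xI; apply: cvgM; [exact: cvg_cst|exact: cW].
split=> x /andP[x0 x1].
- have xI : x \in `[0, 1] by rewrite in_itv/= x0 ltW.
  apply/cvgrPdist_le => e e0; have /cvgrPdist_le/(_ _ e0) := c x xI.
  rewrite /at_right !near_withinE /= => h.
  have h1 : \forall y \near x, y < 1 by exact: lt_nbhsl.
  apply: filter_app (filterI h h1); near=> y => -[hy y1] xy.
  by apply: hy; rewrite /= in_itv/= (ltW y1) (le_trans x0)// ltW.
- have xI : x \in `[0, 1] by rewrite in_itv/= x1 ltW.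
  apply/cvg_ex; exists (brownian_path w x).
  apply/cvgrPdist_le => e e0; have /cvgrPdist_le/(_ _ e0) := c x xI.
  rewrite /at_left !near_withinE /= => h.
  have h1 : \forall y \near x, 0 < y by exact: lt_nbhsr.
  apply: filter_app (filterI h h1); near=> y => -[hy y1] xy.
  by apply: hy; rewrite /= in_itv/= (ltW y1) (le_trans (ltW xy)).
Unshelve. all: by end_near. Qed.

Let to_skE (f : R -> R) : cadlag01 f -> skorokhod_path (to_skorokhod f) = f.
Proof. by move=> cf; rewrite /to_skorokhod; case: pselect. Qed.

Let tm_chain m : (0 < m)%N ->
  [/\ 0 <= tm m 0, tm m m <= 1 & forall k, (k < m)%N -> tm m k <= tm m k.+1].
Proof.
move=> m0; rewrite /tm mul0r divff ?pnatr_eq0 -?lt0n//; split=> // k _.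
by rewrite ler_wpM2r// ler_nat.
Qed.

Let measurable_step m k : (0 < m)%N -> (k < m)%N ->
  measurable_fun setT (brownian_step m k).
Proof.
move=> m0 km; have [h0 h1 h2] := tm_chain m0; apply: measurable_funM => //.
by have := measurable_incr_chain W_brownian h0 h1 h2 km.
Qed.

Let step2 m k : (0 < m)%N -> (k < m)%N ->
  ibl P' (fun w => brownian_step m k w ^+ 2) /\
  Ex P' (fun w => brownian_step m k w ^+ 2) <= sigma ^+ 2.
Proof.
move=> m0 km.
have mp : (0 : R) < m%:R by rewrite ltr0n.
have t0 : 0 <= tm m k by rewrite divr_ge0.
have tt : tm m k < tm m k.+1 by rewrite ltr_pM2r ?invr_gt0// ltr_nat.
have t1 : tm m k.+1 <= 1 by rewrite ler_pdivrMr// mul1r ler_nat.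
have i2 := ibl_incr2 W_brownian t0 tt t1.
rewrite (_ : (fun w => _) = (fun w => sigma ^+ 2 * incr W (tm m k) (tm m k.+1) w ^+ 2)); last first.
  by apply/funext => w; rewrite exprMn.
split; first exact: iblZ.
rewrite ExZ// (Ex_incr2 W_brownian)// ler_piMr ?sqr_ge0//; lra.
Qed.

Section functional.
Variables (F : skorokhod R -> R) (M : R).
Hypotheses (FM : forall f, `|F f| <= M) (cF : continuous F).

Let FW w := F (to_skorokhod (brownian_path w)).

Let M0 : 0 <= M.
Proof. exact: le_trans (normr_ge0 _) (FM (Skorokhod (@cadlag01_cst0 R))). Qed.

Let env_step k m (y : nat -> R) := lower_env F M k (step_path m y).

Let env_step_lip k m y y' : 0 <= k ->
  `|env_step k m y - env_step k m y'| <= k * \sum_(j < m) `|y j - y' j|.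
Proof.
move=> k0; apply: lower_env_dist => //; first by rewrite sumr_ge0.
by move=> t _; exact: step_path_dist.
Qed.

Let env_step_cvg k w : 0 <= k ->
  env_step k m.+1 (brownian_step m.+1 ^~ w) @[m --> \oo] -->
  lower_env F M k (brownian_path w).
Proof.
move=> k0; have [_ W0 cW _ _] := W_brownian.
apply/cvgrPdist_le => e e0.
pose e' := e / (k + 1) / (1 + `|sigma|).
have k1 : 0 < k + 1 by rewrite ltr_wpDl.
have s1 : 0 < 1 + `|sigma| by rewrite ltr_pwDl.
have e'0 : 0 < e' by rewrite !divr_gt0.
have [del del0 hdel] := segment_unif_continuous (cW w) e'0.
near=> m.
have mp : (0 : R) < m.+1%:R by rewrite ltr0n.
have md : m.+1%:R^-1 < del.
  by near: m; exact: (near_infty_natSinv_lt (PosNum del0)).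
apply: (@le_trans _ _ (k * (`|sigma| * e'))); last first.
  have h : k / (k + 1) <= 1 by rewrite ler_pdivrMr// mul1r lerDl.
  have h' : `|sigma| / (1 + `|sigma|) <= 1 by rewrite ler_pdivrMr// mul1r lerDr.
  rewrite (_ : k * (`|sigma| * e') = e * ((k / (k + 1)) * (`|sigma| / (1 + `|sigma|)))); last first.
    by rewrite /e'; ring.
  by rewrite ler_piMr ?(ltW e0)// mulr_ile1// divr_ge0// ltW.
apply: lower_env_dist => //; first by rewrite mulr_ge0// ltW.
move=> t; rewrite in_itv/= => tI.
have [p pm [/andP[p1 p2]]] := @step_path_telescope _ m.+1 (fun j => sigma * W (tm m.+1 j) w) t tI.
have -> : step_path m.+1 (brownian_step m.+1 ^~ w) t =
   step_path m.+1 (fun j => sigma * W (tm m.+1 j.+1) w - sigma * W (tm m.+1 j) w) t.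
  by apply: eq_bigr => j _; rewrite /brownian_step /incr mulrBr.
move=> ->; rewrite {2}/tm mul0r W0 mulr0 subr0 /brownian_path -mulrBr normrM.
rewrite ler_wpM2l// ltW//; apply: hdel; first by rewrite in_itv.
  rewrite in_itv/= divr_ge0//= ler_pdivrMr// mul1r ler_nat//.
apply: le_lt_trans md.
have tE : t = m.+1%:R * t / m.+1%:R by rewrite mulrC mulKf// gt_eqF.
rewrite {1}tE -mulrBl ger0_norm ?mulr_ge0 ?subr_ge0//.
by rewrite ler_piMl//; move: p2; rewrite -[p.+1%:R]natr1; lra.
Unshelve. all: by end_near. Qed.

Let env_path_cvg w : lower_env F M n%:R (brownian_path w) @[n --> \oo] --> FW w.
Proof.
have cw := cadlag_brownian_path w.
rewrite -[brownian_path w]to_skE//; set g := to_skorokhod _.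
apply/cvgrPdist_le => e e0.
have [k0 hk0] := lower_env_near g FM cF e0.
near=> n.
have kn : k0 <= n%:R by near: n; exact: nbhs_infty_ger.
have h1 := hk0 _ kn (ler0n _ n).
have h2 := lower_env_le FM (ler0n R n) g.
by rewrite ger0_norm ?subr_ge0// lerBlDr -lerBlDl.
Unshelve. all: by end_near. Qed.

Let bmf_env_step k m : 0 <= k -> (0 < m)%N ->
  bmf (fun w => env_step k m (brownian_step m ^~ w)).
Proof.
move=> k0 m0; apply: (@lipschitz_bmf R m (env_step k m) M k).
- by move=> y; exact: lower_env_bounded.
- by move=> y y'; exact: env_step_lip.
- by move=> j jm; exact: measurable_step.
Qed.

Let Ex_env_step k : 0 <= k ->
  ibl P' (fun w => lower_env F M k (brownian_path w)) /\ Ex P' (fun w => env_step k m.+1 (brownian_step m.+1 ^~ w)) @[m --> \oo] -->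
  Ex P' (fun w => lower_env F M k (brownian_path w)).
Proof.
move=> k0; apply: (@Ex_cvg _ _ _ P' (fun m w => env_step k m.+1 (brownian_step m.+1 ^~ w))
   _ (fun=> M)).
- by move=> m; apply: bmf_meas; exact: bmf_env_step.
- exact/bmf_ibl/bmf_cst.
- by move=> m w; exact: lower_env_bounded.
- by move=> w; exact: env_step_cvg.
Qed.

Let Ex_env_path :
  ibl P' FW /\ Ex P' (fun w => lower_env F M n%:R (brownian_path w)) @[n --> \oo] --> Ex P' FW.
Proof.
apply: (@Ex_cvg _ _ _ P' (fun n w => lower_env F M n%:R (brownian_path w)) _ (fun=> M)).
- by move=> n; apply: ibl_meas (proj1 (Ex_env_step (ler0n _ n))).
- exact/bmf_ibl/bmf_cst.
- by move=> m w; exact: lower_env_bounded.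
- exact: env_path_cvg.
Qed.

Lemma ibl_brownian_functional : ibl P' FW.
Proof. exact: Ex_env_path.1. Qed.

(** The interface between the probabilistic and the topological halves: jointly convergent block
    increments [Y], and a path uniformly close to their step path with high probability. The same
    [e] measures distance and probability, and [Y] may depend on it and on [m]. *)
Definition step_approximable (X : R -> R -> Omega -> R) :=
  forall e : R, 0 < e -> exists m0 : nat, forall m, (m0 <= m)%N -> (0 < m)%N ->
  exists (Y : R -> nat -> Omega -> R) (V : R),
  [/\ forall tau k, (k < m)%N -> bmf (Y tau k),
      \forall tau \near +oo, forall k, (k < m)%N -> Ex P (fun w => Y tau k w ^+ 2) <= V,
      forall f : nat -> R -> R, (forall k, smooth (f k)) ->
        Ex P (fun w => \prod_(k < m) f k (Y tau k w)) @[tau --> +oo] -->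
        Ex P' (fun w => \prod_(k < m) f k (brownian_step m k w)) &
      \forall tau \near +oo, exists A : set Omega,
        [/\ measurable A, 1 - e <= Pr P A &
        forall w, A w -> cadlag01 (X tau ^~ w) /\
          forall t, t \in `[0, 1] -> `|X tau t w - step_path m (Y tau ^~ w) t| <= e]].

(** [F] evaluated along the path is not known to be measurable in [w], so the bound is carried by a
    bounded measurable minorant [l]. Applied to [- F], it gives the upper bound as well. *)
Lemma fclt_lower_bound (X : R -> R -> Omega -> R) : step_approximable X ->
  forall del, 0 < del -> \forall tau \near +oo, exists l : Omega -> R,
    [/\ bmf l, forall w, l w <= F (to_skorokhod (X tau ^~ w)) &
        Ex P' FW - del <= Ex P l].
Proof.
move=> XA del del0.
have d4 : 0 < del / 4 by rewrite divr_gt0.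
(* Order of choices: the Lipschitz constant [k] from the Brownian side, the error [e] in terms of
   [k], the number [m] of blocks, and finally [tau]. *)
have [_ /cvgrPdist_le/(_ _ d4)] := Ex_env_path.
move=> [n _ /(_ n (leqnn n)) /= hn].
pose k : R := n%:R.
have k0 : 0 <= k by rewrite ler0n.
pose e := (del / 4) / (k + 2 * M + 1).
have kM : 0 < k + 2 * M + 1 by rewrite ltr_wpDl// addr_ge0// mulr_ge0.
have e0 : 0 < e by rewrite divr_gt0.
have ke : k * e + 2 * M * e <= del / 4.
  rewrite -mulrDl /e mulrCA ler_piMr ?(ltW d4)// ler_pdivrMr// mul1r lerDl//.
have [m0 hm0] := XA e e0.
have [_ /cvgrPdist_le/(_ _ d4)] := Ex_env_step k0.
move=> [m1 _ hm1].
pose m := (maxn m0 m1).+1.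
have /= hm := hm1 m.-1 (leq_maxr _ _).
have mm0 : (m0 <= m)%N by rewrite ltnW// ltnS leq_maxl.
have [Y [V [bY YV YZ YX]]] := hm0 m mm0 isT.
have cG : Ex P (fun w => env_step k m (Y tau ^~ w)) @[tau --> +oo] -->
    Ex P' (fun w => env_step k m (brownian_step m ^~ w)).
  apply: (@cvg_lipschitz R m (env_step k m) M k _ _ _ _ P _ _ P' _ _ _ Y _ (Num.max V (sigma ^+ 2))) => //.
  - by move=> y; exact: lower_env_bounded.
  - by move=> y y'; exact: env_step_lip.
  - by move=> j jm; exact: measurable_step.
  - by move=> j jm; have [] := step2 (isT : (0 < m)%N) jm.
  - apply: filterS YV => tau h j jm; rewrite le_max h//.
  - by move=> j jm; rewrite le_max (step2 (isT : (0 < m)%N) jm).2 orbT.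
have {}cG : \forall tau \near +oo, `|Ex P' (fun w => env_step k m (brownian_step m ^~ w)) -
    Ex P (fun w => env_step k m (Y tau ^~ w))| <= del / 4.
  by move/cvgrPdist_le : cG; exact.
near=> tau.
have [A [mA PA hA]] : exists A : set Omega,
        [/\ measurable A, 1 - e <= Pr P A &
        forall w, A w -> cadlag01 (X tau ^~ w) /\
          forall t, t \in `[0, 1] -> `|X tau t w - step_path m (Y tau ^~ w) t| <= e].
  by near: tau.
have hG : `|Ex P' (fun w => env_step k m (brownian_step m ^~ w)) -
    Ex P (fun w => env_step k m (Y tau ^~ w))| <= del / 4 by near: tau.
have bE : bmf (fun w => env_step k m (Y tau ^~ w)).
  apply: (@lipschitz_bmf R m (env_step k m) M k).
  - by move=> y; exact: lower_env_bounded.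
  - by move=> y y'; exact: env_step_lip.
  - by move=> j jm; apply: bmf_meas; exact: bY.
have bA : bmf (\1_(~` A) : Omega -> R) by apply: bmf_indic; exact: measurableC.
(* On [A] the envelope changes by at most [k e] between the step path and the path; off [A] both
   values lie in [[- M, M]], whence the correction [2 M]. *)
exists (fun w => env_step k m (Y tau ^~ w) - k * e - 2 * M * \1_(~` A) w); split.
- by bm.
- move=> w; rewrite indicE.
  have /andP[l1 l2] : - M <= env_step k m (Y tau ^~ w) <= M.
    by rewrite -ler_norml; exact: lower_env_bounded.
  have /andP[f1 f2] : - M <= F (to_skorokhod (X tau ^~ w)) <= M by rewrite -ler_norml.
  have ke0 : 0 <= k * e by rewrite mulr_ge0// ltW.
  case: (boolP (w \in A)) => [/set_mem Aw|nAw].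
    rewrite memNset; last by move=> h; exact: h.
    rewrite mulr0 subr0; have [cX hX] := hA w Aw.
    apply: le_trans (lower_env_le FM k0 _); rewrite to_skE// lerBlDr.
    by apply: lower_env_lip => //; [exact: ltW|move=> t tI; rewrite distrC; exact: hX].
  rewrite mem_set; last by move=> h; move/negP: nAw; apply; exact: mem_set.
  by rewrite mulr1; lra.
- have ic (c : R) : ibl P (fun=> c) by exact/bmf_ibl/bmf_cst.
  rewrite ExB; [|apply: iblB => //; exact: bmf_ibl|exact/iblZ/bmf_ibl].
  rewrite ExB//; last exact: bmf_ibl.
  rewrite Ex_cst ExZ; last exact: bmf_ibl.
  rewrite Ex_indic; last exact: measurableC.
  rewrite PrC//.
  have : 2 * M * (1 - Pr P A) <= 2 * M * e.
    by rewrite ler_wpM2l ?mulr_ge0// lerBlDr -lerBlDl.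
  move: hn hm hG; rewrite -/k -/FW /m /= !ler_norml => /andP[? ?] /andP[? ?] /andP[? ?] ?.
  lra.
Unshelve. all: by end_near. Qed.

End functional.

Theorem abstract_fclt (X : R -> R -> Omega -> R) :
  (\forall tau \near +oo, {ae P, forall w, cadlag01 (X tau ^~ w)}) ->
  step_approximable X ->
  cvg_in_law (+oo : set_system R) P X P' (fun v w => sigma * W v w).
Proof.
move=> cX XA; split=> //.
  by apply: aeW => w; exact: cadlag_brownian_path.
move=> F cF [M FM].
have iF := ibl_brownian_functional FM cF.
rewrite (expectationE iF).
have cNF : continuous (fun f => - F f) by move=> f; apply: continuousN; exact: cF.
have NFM f : `|- F f| <= M by rewrite normrN.
have lb := fclt_lower_bound FM cF XA.
have ub := fclt_lower_bound NFM cNF XA.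
have ENF : Ex P' (fun w => - F (to_skorokhod (brownian_path w))) =
   - Ex P' (fun w => F (to_skorokhod (brownian_path w))).
  by rewrite ExN.
set x := Ex P' (fun w => F (to_skorokhod (brownian_path w))) in ENF lb.
rewrite -[Ex P' _]/x.
have sandwich del : 0 < del -> \forall tau \near +oo,
    ((x - del)%:E <= 'E_P [fun w => F (to_skorokhod (X tau ^~ w))] <= (x + del)%:E)%E.
  move=> del0; near=> tau.
  have [l [bl lF xl]] : exists l : Omega -> R,
    [/\ bmf l, forall w, l w <= F (to_skorokhod (X tau ^~ w)) & x - del <= Ex P l].
    by near: tau; exact: (lb del del0).
  have [u [bu uF xu]] : exists u : Omega -> R,
    [/\ bmf u, forall w, u w <= - F (to_skorokhod (X tau ^~ w)) & - x - del <= Ex P u].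
    near: tau; have := ub del del0.
    by apply: filterS => tau [u [? ? h]]; exists u; split=> //; rewrite -ENF.
  apply/andP; split.
    apply: (@le_trans _ _ (Ex P l)%:E); first by rewrite lee_fin.
    by rewrite -expectationE; [exact: expectation_le_any|exact: bmf_ibl].
  apply: (@le_trans _ _ (Ex P (fun w => - u w))%:E); last first.
    by rewrite lee_fin ExN; [lra|exact: bmf_ibl].
  rewrite -expectationE; last exact/bmf_ibl/bmfN.
  by apply: expectation_le_any => w; rewrite lerNr.
apply/fine_cvgP; split.
  apply: filterS (sandwich 1 ltr01) => tau /andP[h1 h2].
  by rewrite fin_numElt (lt_le_trans _ h1) ?ltNyr// (le_lt_trans h2) ?ltry.
apply/cvgrPdist_le => e e0.
apply: filterS (sandwich e e0) => tau /andP[] /=.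
case: ('E_P [_])%E => [r| |]//=; rewrite ?leye_eq ?leeNy_eq//.
rewrite !lee_fin => h1 h2; rewrite ler_norml; apply/andP; split; lra.
Unshelve. all: by end_near. Qed.

End abstract_fclt.

(** * The kernel *)

Section kernel_functional.
Context {R : realType}.
Variable phi : R -> R.
Local Notation mu := (@lebesgue_measure R).
Hypothesis phi_meas : measurable_fun (`[0, +oo[ : set R) phi.
Hypothesis phi_ge0 : forall t, 0 <= t -> 0 <= phi t.
Hypothesis phi_lt1 : (\int[mu]_(t in `[0%R, +oo[) (phi t)%:E < 1)%E.

Definition mass : R := fine (\int[mu]_(t in `[0%R, +oo[) (phi t)%:E)%E.

(** For [h] vanishing at negative times, the convolution of [phi] with [h] at time [s] is
    [kint (fun x => h (s - x))]. *)
Definition kint (h : R -> R) : R := \int[mu]_(x in `]0, +oo[) (phi x * h x).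

Let D : set R := `]0%R, +oo[%classic.

Let mD : measurable D. Proof. exact: measurable_itv. Qed.

Let Dgt0 x : D x -> 0 < x. Proof. by rewrite /D /= in_itv/= andbT. Qed.

Let mphi : measurable_fun D phi.
Proof.
apply: measurable_funS phi_meas => //; apply: subset_itvr; by rewrite bnd_simp.
Qed.

Let mass_fin : (\int[mu]_(t in `[0%R, +oo[) (phi t)%:E \is a fin_num)%E.
Proof.
rewrite ge0_fin_numE; first exact: lt_trans (ltry 1).
by apply: integral_ge0 => x; rewrite /= in_itv/= andbT => x0; rewrite lee_fin phi_ge0.
Qed.

Lemma mass_ge0 : 0 <= mass.
Proof.
rewrite fine_ge0// integral_ge0// => x; rewrite /= in_itv/= andbT => x0.
by rewrite lee_fin phi_ge0.
Qed.

Lemma mass_lt1 : mass < 1.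
Proof. by rewrite -lte_fin /mass fineK. Qed.

Let iphi : mu.-integrable D (EFin \o phi).
Proof.
have h : mu.-integrable `[0%R, +oo[ (EFin \o phi).
  apply/integrableP; split; first exact/measurable_EFinP.
  rewrite (_ : (\int[mu]_(x in _) _ = \int[mu]_(t in `[0%R, +oo[) (phi t)%:E)%E).
    by apply: lt_trans phi_lt1 (ltry 1).
  apply: eq_integral => x; rewrite inE/= in_itv/= andbT => x0.
  by rewrite ger0_norm// phi_ge0.
by apply: integrableS h => //; apply: subset_itvr; rewrite bnd_simp.
Qed.

Lemma kint_integrable h : bmf (h : R -> R) ->
  mu.-integrable D (EFin \o (fun x => phi x * h x)).
Proof.
move=> [mh [C hC]]; apply: (@le_integrable _ _ _ mu D _ _ (fun x => `|C|%:E * (EFin \o phi) x)%E) => //.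
- apply/measurable_EFinP; apply: measurable_funM => //; exact: measurable_funTS.
- move=> x Dx /=; rewrite lee_fin normrM mulrC.
  rewrite (_ : `| `|C| * phi x| = `|C| * `|phi x|); last by rewrite normrM normr_id.
  by rewrite ler_wpM2r// (le_trans (hC x))// ler_norm.
- exact: integrableZl.
Qed.

Lemma kintD h g : bmf (h : R -> R) -> bmf (g : R -> R) ->
  kint (fun x => h x + g x) = kint h + kint g.
Proof.
move=> bh bg; rewrite /kint -RintegralD//; last 2 first.
- exact: kint_integrable.
- exact: kint_integrable.
by apply: eq_Rintegral => x _; rewrite mulrDr.
Qed.

Lemma kintZ c h : bmf (h : R -> R) -> kint (fun x => c * h x) = c * kint h.
Proof.
move=> bh; rewrite /kint -RintegralZl//; last exact: kint_integrable.
by apply: eq_Rintegral => x _; rewrite mulrCA.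
Qed.

Lemma kintB h g : bmf (h : R -> R) -> bmf (g : R -> R) ->
  kint (fun x => h x - g x) = kint h - kint g.
Proof.
move=> bh bg; rewrite -mulN1r -kintZ// -kintD//; last by apply: bmfM => //; exact: bmf_cst.
by congr kint; apply/funext => x; rewrite mulN1r.
Qed.

Lemma kint_sum n (c : nat -> R) (h : nat -> R -> R) : (forall k, bmf (h k : R -> R)) ->
  kint (fun x => \sum_(k < n) c k * h k x) = \sum_(k < n) c k * kint (h k).
Proof.
move=> bh; elim: n => [|n IH].
  rewrite big_ord0 /kint; under eq_Rintegral do rewrite big_ord0 mulr0.
  by rewrite Rintegral_cst// mul0r.
under eq_fun do rewrite big_ord_recr/=.
rewrite kintD ?IH ?kintZ ?big_ord_recr//.
  by apply: bmf_sum => k; apply: bmfM => //; exact: bmf_cst.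
by apply: bmfM => //; exact: bmf_cst.
Qed.

Lemma kint_le h g : bmf (h : R -> R) -> bmf (g : R -> R) ->
  (forall x, 0 < x -> h x <= g x) -> kint h <= kint g.
Proof.
move=> bh bg hg; apply: le_Rintegral => //; [exact: kint_integrable..|].
by move=> x /Dgt0 x0; rewrite ler_wpM2l ?hg// phi_ge0// ltW.
Qed.

Lemma eq_kint h g : (forall x, 0 < x -> h x = g x) -> kint h = kint g.
Proof.
by move=> hg; apply: eq_Rintegral => x /set_mem/Dgt0 x0; rewrite hg.
Qed.

Lemma kint_cst c : kint (fun=> c) = c * mass.
Proof.
rewrite -[in LHS](mulr1 c) (@kintZ c (fun=> 1)); last exact: bmf_cst.
congr (_ * _); rewrite /kint /mass /Rintegral; congr fine.
under eq_integral do rewrite mulr1.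
rewrite integral_itv_obnd_cbnd//; exact/measurable_EFinP.
Qed.

Lemma kint_norm_le h C : bmf (h : R -> R) -> (forall x, 0 < x -> `|h x| <= C) ->
  `|kint h| <= C * mass.
Proof.
move=> bh hC.
have h1 : kint (fun=> - C) <= kint h.
  apply: kint_le => //; first exact: bmf_cst.
  by move=> x /hC; rewrite ler_norml => /andP[].
have h2 : kint h <= kint (fun=> C).
  apply: kint_le => //; first exact: bmf_cst.
  by move=> x /hC; rewrite ler_norml => /andP[].
by rewrite !kint_cst in h1 h2; rewrite ler_norml -mulNr h1 h2.
Qed.

Lemma kint_norm h : bmf (h : R -> R) -> `|kint h| <= kint (fun x => `|h x|).
Proof.
move=> bh; rewrite ler_norml; apply/andP; split; last first.
  by apply: kint_le => //; [exact: bmf_norm|move=> x _; exact: ler_norm].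
rewrite -mulN1r -kintZ; last exact: bmf_norm.
apply: kint_le => //; first by apply: bmfM; [exact: bmf_cst|exact: bmf_norm].
by move=> x _; rewrite mulN1r lerNl -normrN ler_norm.
Qed.

Definition ind_le (x u : R) : R := (u <= x)%R%:R.

Lemma bmf_ind_le x : bmf (ind_le x : R -> R).
Proof.
rewrite (_ : ind_le x = \1_`]-oo, x]%classic); first exact: bmf_indic.
apply/funext => u; rewrite /ind_le indicE; congr (nat_of_bool _)%:R.
by apply/idP/idP => [h|/set_mem/=]; [apply/mem_set; rewrite /= in_itv|rewrite in_itv].
Qed.

(** The primitive of [phi] from 0, extended by 0 to negative arguments. *)
Definition Phi (x : R) : R := kint (ind_le x).

Lemma Phi_le0 x : x <= 0 -> Phi x = 0.
Proof.
move=> x0; rewrite /Phi (@eq_kint _ (fun=> 0)) ?kint_cst ?mul0r// => u u0.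
by rewrite /ind_le leNgt (le_lt_trans x0).
Qed.

Lemma Phi_nd x y : x <= y -> Phi x <= Phi y.
Proof.
move=> xy; apply: kint_le; try exact: bmf_ind_le.
move=> u _; rewrite /ind_le ler_nat; case: (leP u x) => // ux.
by rewrite (le_trans ux).
Qed.

Lemma Phi_itv x : 0 <= Phi x <= mass.
Proof.
apply/andP; split; rewrite /Phi.
  rewrite -(mul0r mass) -kint_cst; apply: kint_le; [exact: bmf_cst|exact: bmf_ind_le|].
  by move=> u _; rewrite /ind_le.
rewrite -(mul1r mass) -kint_cst; apply: kint_le; [exact: bmf_ind_le|exact: bmf_cst|].
by move=> u _; rewrite /ind_le lern1 leq_b1.
Qed.

Lemma kint_cvg (h_ : nat -> R -> R) (h : R -> R) C :
  (forall n, measurable_fun setT (h_ n)) -> (forall n x, `|h_ n x| <= C) ->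
  (forall x, 0 < x -> h_ n x @[n --> \oo] --> h x) ->
  kint (h_ n) @[n --> \oo] --> kint h.
Proof.
move=> mh hC hh.
have mhn n : measurable_fun D (fun x => phi x * h_ n x).
  by apply: measurable_funM => //; exact: measurable_funTS.
have ch x : D x -> phi x * h_ n x @[n --> \oo] --> phi x * h x.
  by move=> Dx; apply: cvgM; [exact: cvg_cst|apply: hh; exact: Dgt0].
have mh' : measurable_fun D (fun x => phi x * h x).
  by apply: (@measurable_fun_cvg _ _ _ D (fun n x => phi x * h_ n x)).
have cE : {ae mu, forall x, D x -> (EFin \o (fun x => phi x * h_ n x)) x @[n --> \oo] -->
    (EFin \o (fun x => phi x * h x)) x}.
  by apply: aeW => x Dx; apply: cvg_EFin; [exact: nearW|exact: ch].
have bE : {ae mu, forall x n, D x -> (`|(EFin \o (fun x => phi x * h_ n x)%R) x| <=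
    (fun x => C%:E * (EFin \o phi) x)%E x)%E}.
  apply: aeW => x n /Dgt0 x0 /=.
  have p0 := phi_ge0 (ltW x0).
  by rewrite lee_fin normrM (ger0_norm p0) mulrC ler_wpM2r.
have ig : mu.-integrable D (fun x => C%:E * (EFin \o phi) x)%E by exact: integrableZl.
have [i1 _ i3] := @dominated_convergence _ _ _ mu D mD
  (fun n => EFin \o (fun x => phi x * h_ n x)) (EFin \o (fun x => phi x * h x))
  (fun x => C%:E * (EFin \o phi) x)%E
  (fun n => proj2 (measurable_EFinP _ _) (mhn n))
  (proj2 (measurable_EFinP _ _) mh') cE ig bE.
have fin : (\int[mu]_(x in D) (phi x * h x)%:E)%E = (kint h)%:E.
  by rewrite /kint /Rintegral fineK// integrable_fin_num.
by move: i3; rewrite /= fin => /fine_cvg.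
Qed.

Lemma Phi_cvg : Phi n%:R @[n --> \oo] --> mass.
Proof.
rewrite -[mass]mul1r -kint_cst; apply: (@kint_cvg _ _ 1).
- by move=> n; exact: bmf_meas (bmf_ind_le _).
- by move=> n x; rewrite /ind_le ger0_norm// lern1 leq_b1.
move=> x x0; apply: cvg_near_cst; near=> n; rewrite /ind_le.
suff -> : x <= n%:R by [].
by near: n; exact: nbhs_infty_ger.
Unshelve. all: by end_near. Qed.

(* Cutting the kernel at height [K] gives uniform continuity of its primitive. *)
Lemma Phi_unif e : 0 < e ->
  exists2 del, 0 < del & forall x y, x <= y -> y <= x + del -> Phi y - Phi x <= e.
Proof.
move=> e0.
pose c (n : nat) (x : R) : R := (phi x <= n%:R)%R%:R.
pose pc := fun x => if 0 < x then phi x else 0.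
have mpc : measurable_fun setT pc.
  rewrite (_ : pc = phi \_ D); first by apply/(measurable_restrictT phi).
  apply/funext => x; rewrite /pc patchE; case: ifPn => x0.
    by rewrite mem_set// /D /= in_itv/= x0.
  by rewrite memNset// => /Dgt0 h; rewrite h in x0.
pose b (n : nat) (x : R) : R := (n%:R < pc x)%R%:R.
have mb n : measurable_fun setT (b n).
  rewrite (_ : b n = \1_(pc @^-1` `]n%:R, +oo[)).
    apply: measurable_indic; rewrite -[X in measurable X]setTI; exact: mpc.
  apply/funext => x; rewrite /b indicE; congr (nat_of_bool _)%:R.
  apply/idP/idP => [h|/set_mem/=]; first by apply/mem_set; rewrite /= in_itv/= h.
  by rewrite in_itv/= andbT.
have bb n : bmf (b n : R -> R).
  by split=> //; exists 1 => x; rewrite /b ger0_norm// lern1 leq_b1.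
have : kint (b n) @[n --> \oo] --> kint (fun=> 0).
  apply: (@kint_cvg _ _ 1) => //.
  - by move=> n x; rewrite /b ger0_norm// lern1 leq_b1.
  - move=> x x0; apply: cvg_near_cst; near=> n; rewrite /b.
    suff -> : (n%:R < pc x) = false by [].
    by apply/negbTE; rewrite -leNgt; near: n; exact: nbhs_infty_ger.
have e2 : 0 < e / 2 by rewrite divr_gt0.
rewrite kint_cst mul0r => /cvgrPdist_le/(_ _ e2)[n _ /(_ n (leqnn n))] /=.
rewrite sub0r normrN => hn.
have n1 : (0 : R) < n%:R + 1 by rewrite ltr_wpDl.
exists (e / 2 / (n%:R + 1)); first by rewrite divr_gt0.
move=> x y xy yx; set del := e / 2 / _ in yx.
have bx := bmf_ind_le x; have by_ := bmf_ind_le y.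
rewrite /Phi -kintB//.
(* On []x, y]] the kernel is at most [n] plus its part above height [n]; the two pieces take [e / 2]
   each. *)
apply: (@le_trans _ _ (kint (b n) + \int[mu]_(u in `]x, y]) (n%:R : R))); last first.
  have -> : \int[mu]_(u in `]x, y]) (n%:R : R) = n%:R * (y - x).
    have lxy : fine (mu `]x, y]) = y - x.
      rewrite lebesgue_measure_itv/= lte_fin.
      by case: ifPn => //=; rewrite -leNgt => yx'; have -> : y - x = 0 by lra.
    by rewrite -lxy -Rintegral_cst.
  have h1 : n%:R * (y - x) <= e / 2.
    apply: (@le_trans _ _ ((n%:R + 1) * del)); last by rewrite /del mulrC divfK// gt_eqF.
    by apply: ler_pM => //; lra.
  have := ler_norm (kint (b n)); lra.
have im : mu.-integrable D (EFin \o (fun u => n%:R * \1_(`]x, y]%classic) u)).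
  have h : mu.-integrable D (fun u => (\1_(`]x, y]%classic : set R) u)%:E).
    by apply: (integrableS measurableT) => //; apply: integrable_indic_itv.
  rewrite (_ : _ \o _ = (fun u => n%:R%:E * (\1_(`]x, y]%classic : set R) u)%:E)%E).
    exact: integrableZl.
  by apply/funext => u /=; rewrite EFinM.
have bxy : bmf (fun u => ind_le y u - ind_le x u) by exact: bmfB.
have -> : \int[mu]_(u in `]x, y]) (n%:R : R) =
    \int[mu]_(u in setT) (n%:R * \1_(`]x, y]%classic) u).
  rewrite Rintegral_mkcond; apply: eq_Rintegral => u _.
  by rewrite patchE indicE; case: ifP; rewrite ?mulr1 ?mulr0.
apply: (@le_trans _ _ (kint (b n) + \int[mu]_(u in D) (n%:R * \1_(`]x, y]%classic) u))).
  rewrite /kint -RintegralD//; last exact: kint_integrable.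
  apply: le_Rintegral => //.
  - exact: kint_integrable.
  - have := @integrableD _ _ _ mu D mD _ _ (kint_integrable (bb n)) im.
    by apply: eq_integrable.
  move=> u /Dgt0 u0; have p0 := phi_ge0 (ltW u0).
  rewrite /b /pc u0 indicE /ind_le.
  have -> : (u \in (`]x, y]%classic : set R)) = (x < u) && (u <= y).
    by apply/idP/idP => [/set_mem/=|h]; [rewrite in_itv|apply/mem_set; rewrite /= in_itv].
  case: (leP u x) => ux /=.
    by rewrite (le_trans ux xy) subrr mulr0 mulr0 addr0 mulr_ge0.
  rewrite subr0; case: (leP u y) => uy /=; last by rewrite !mulr0 addr0 mulr_ge0.
  have n0 : (0 : R) <= n%:R by [].
  by rewrite !mulr1; case: (ltP n%:R (phi u)) => h /=; rewrite ?mulr1 ?mulr0; lra.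
rewrite lerD2l [leRHS](_ : _ = \int[mu]_(u in setT) (n%:R * \1_(`]x, y]%classic) u))//.
rewrite Rintegral_mkcond; apply: le_Rintegral => //.
- by rewrite -restrict_EFin; apply/(@integrable_mkcond _ _ _ mu D).
- have h : mu.-integrable setT (fun u => (\1_(`]x, y]%classic : set R) u)%:E).
    by apply: integrable_indic_itv.
  have : mu.-integrable setT (fun u => n%:R%:E * (\1_(`]x, y]%classic : set R) u)%:E)%E.
    exact: integrableZl.
  by under eq_fun do rewrite -EFinM.
by move=> u _; rewrite patchE; case: ifP => // _; rewrite mulr_ge0.
Unshelve. all: by end_near. Qed.

(** Translation invariance, by uniqueness of Lebesgue measure on half-open intervals. *)
Lemma integral_shift (g : R -> \bar R) (c : R) : measurable_fun setT g ->
  (forall x, 0 <= g x)%E ->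
  (\int[mu]_x g (x - c)%R = \int[mu]_x g x)%E.
Proof.
move=> mg g0.
pose sh : measurableTypeR R -> measurableTypeR R := fun x => x - c.
have ms : measurable_fun setT sh.
  by apply: measurable_funB; [exact: measurable_id|exact: measurable_cst].
have pE (A : set R) : measurable A -> pushforward mu sh A = mu A.
  move=> mA; apply/esym.
  pose msh := isMeasurableFun.Build _ _ _ _ sh ms.
  pose fsh : {mfun measurableTypeR R >-> measurableTypeR R} := HB.pack sh msh.
  apply: (@lebesgue_measure_unique R (pushforward mu fsh)) => //= _ [[a b]] _ <-.
  rewrite /pushforward /=.
  rewrite (_ : sh @^-1` `]a, b]%classic = `](a + c), (b + c)]%classic); last first.
    by apply/seteqP; split=> x /=; rewrite !in_itv/= /sh ltrBrDr lerBlDr.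
  rewrite !lebesgue_measure_itv/= !lte_fin ltrD2r; case: ifP => // _.
  by rewrite -!EFinB; congr (_%:E); ring.
transitivity (\int[pushforward mu sh]_x g x)%E.
  by rewrite (ge0_integral_pushforward ms).
apply: eq_measure_integral => A mA _; exact: pE.
Qed.

(** What a jump at time [theta] adds, up to time [u], to the compensator of the other component.
    Compensators thereby become finite sums over past jumps. *)
Lemma integral_delayed (theta u : R) : 0 < theta -> 0 <= u ->
  (\int[mu]_(s in `[0%R, u]) (if (theta < s)%R then phi (s - theta) else 0%R)%:E =
   (Phi (u - theta))%:E)%E.
Proof.
move=> t0 u0.
pose g (x : R) : \bar R := (((fun x => phi x * ind_le (u - theta) x) \_ D) x)%:E.
have bu := bmf_ind_le (u - theta).
have mg : measurable_fun setT g.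
  have h : measurable_fun D (fun x => phi x * ind_le (u - theta) x).
    apply: measurable_funM => //; apply: measurable_funTS; exact: bmf_meas bu.
  by apply/measurable_EFinP; apply/(measurable_restrictT (fun x => phi x * ind_le (u - theta) x)).
have g0 x : (0 <= g x)%E.
  rewrite /g lee_fin patchE; case: ifPn => // /set_mem/Dgt0 x0.
  by rewrite mulr_ge0// phi_ge0// ltW.
have -> : (Phi (u - theta))%:E = (\int[mu]_x g x)%E.
  rewrite /Phi /kint /Rintegral fineK; last first.
    by apply: integrable_fin_num => //; exact: kint_integrable.
  rewrite integral_mkcond; apply: eq_integral => x _.
  by rewrite /g !patchE; case: ifP.
rewrite -(integral_shift theta mg g0) integral_mkcond; apply: eq_integral => s _.
rewrite patchE /g patchE.
have -> : (s \in (`[0%R, u]%classic : set R)) = (0 <= s <= u).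
  by apply/idP/idP => [/set_mem/=|h]; [rewrite in_itv|apply/mem_set; rewrite /= in_itv].
have -> : (s - theta \in D) = (theta < s).
  apply/idP/idP => [/set_mem/Dgt0|h]; first by rewrite subr_gt0.
  by apply/mem_set; rewrite /D /= in_itv/= andbT subr_gt0.
rewrite /ind_le lerD2r; case: (ltP theta s) => ts; last by case: ifP.
by rewrite (ltW (lt_trans t0 ts))/=; case: (leP s u) => _; rewrite ?mulr1 ?mulr0.
Qed.

End kernel_functional.

(** * Compensated simple counting processes *)

Section compensated_process.
Context {R : realType} {d : measure_display} {Omega : measurableType d}.
Variable P : probability Omega R.

(* [ad r f] says that [f] is measurable for the information at time [r]. *)
Record adaptedness (ad : R -> (Omega -> R) -> Prop) : Prop := {
  ad_cst : forall r c, ad r (fun=> c);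
  adD : forall r f g, ad r f -> ad r g -> ad r (fun w => f w + g w);
  adM : forall r f g, ad r f -> ad r g -> ad r (fun w => f w * g w);
  ad_max : forall r f g, ad r f -> ad r g -> ad r (fun w => Num.max (f w) (g w));
  ad_comp : forall r (h : R -> R) f, measurable_fun setT h -> ad r f ->
    ad r (fun w => h (f w));
  ad_mono : forall r r' f, r <= r' -> ad r f -> ad r' f }.

(* [M = S - A] is a martingale, [S] jumps by [1] or [-1] exactly when the simple
   counting process [N] jumps, and the variation of [A] is dominated by that of
   the continuous process [L]. *)
Record compensated (ad : R -> (Omega -> R) -> Prop) (B : R)
    (M N S A L : R -> Omega -> R) : Prop := {
  comp_bmf : forall r, 0 <= r -> bmf (M r) /\ bmf (N r);
  comp_ad : forall r, 0 <= r -> ad r (M r) /\ ad r (N r);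
  comp_mart : forall r r' H, 0 <= r -> r <= r' -> ad r H -> bmf H ->
    Ex P (fun w => H w * (M r' w - M r w)) = 0;
  comp_dec : forall r w, 0 <= r -> M r w = S r w - A r w;
  comp_bound : forall r w, 0 <= r -> 0 <= N r w <= B /\ 0 <= L r w <= B;
  comp_N : forall r r' w, 0 <= r -> r <= r' -> `|S r' w - S r w| <= N r' w - N r w;
  comp_L : forall r r' w, 0 <= r -> r <= r' -> `|A r' w - A r w| <= L r' w - L r w;
  comp_cont : forall w e, 0 < e -> exists2 del, 0 < del &
    forall r r', 0 <= r -> r <= r' -> r' <= r + del -> L r' w - L r w <= e;
  comp_simple : forall w, exists2 del, 0 < del &
    forall r r', 0 <= r -> r <= r' -> r' <= r + del ->
    (N r' w - N r w = 0 \/ N r' w - N r w = 1) /\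
    (S r' w - S r w) ^+ 2 = N r' w - N r w }.

Variable ad : R -> (Omega -> R) -> Prop.
Variables (B : R) (M N S A L : R -> Omega -> R).
Hypothesis adP : adaptedness ad.
Hypothesis comp : compensated ad B M N S A L.

Lemma ad_opp r f : ad r f -> ad r (fun w => - f w).
Proof. by move=> af; apply: (ad_comp adP (h := -%R)) => //; exact: oppr_measurable. Qed.

Lemma adB r f g : ad r f -> ad r g -> ad r (fun w => f w - g w).
Proof. by move=> af ag; apply: (adD adP) => //; exact: ad_opp. Qed.

Lemma adX r f n : ad r f -> ad r (fun w => f w ^+ n).
Proof.
by move=> af; apply: (ad_comp adP (h := fun x => x ^+ n)) => //; exact: exprn_measurable.
Qed.

(** [X] is a convex function of the martingale and [h] a subgradient: the sign for [|M|], twice the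
    increment for a squared increment. Multiplied by the running maximum, a nonnegative adapted
    weight, the left side of the subgradient inequality has mean zero. *)
Lemma comp_doob (tau : nat -> R) (X : nat -> Omega -> R) (h : nat -> Omega -> R) n :
  0 <= tau 0%N -> (forall k, tau k <= tau k.+1) ->
  (forall k, bmf (X k) /\ ad (tau k) (X k)) -> (forall k w, 0 <= X k w) ->
  (forall k, bmf (h k) /\ ad (tau k) (h k)) ->
  (forall k w, h k w * (M (tau k.+1) w - M (tau k) w) <= X k.+1 w - X k w) ->
  Ex P (fun w => runmax (X ^~ w) n ^+ 2) <= 4 * Ex P (fun w => X n w ^+ 2).
Proof.
move=> t0 tS HX X0 Hh hX.
have tk k : 0 <= tau k by elim: k => // k IH; exact: le_trans (tS k).
have bX k := (HX k).1.
have bm k : bmf (fun w => runmax (X ^~ w) k).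
  by elim: k => [|k IH] //=; apply: bmf_max.
have am k : ad (tau k) (fun w => runmax (X ^~ w) k).
  elim: k => [|k IH] /=; first exact: (HX 0%N).2.
  by apply: (ad_max adP); [exact: (ad_mono adP (tS k))|exact: (HX k.+1).2].
have m0 k w : 0 <= runmax (X ^~ w) k by rewrite (le_trans (X0 k w))// runmax_ge.
have bM k := (comp_bmf comp (tk k)).1.
apply: Ex_doob => // k kn.
rewrite -[leLHS](comp_mart comp (H := fun w => runmax (X ^~ w) k * h k w) (tk k) (tS k)).
- apply: Ex_le.
  + apply: bmf_ibl; apply: bmfM; first by apply: bmfM => //; exact: (Hh k).1.
    exact: bmfB.
  + by apply: bmf_ibl; apply: bmfM => //; exact: bmfB.
  + by move=> w; rewrite -mulrA ler_wpM2l.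
- by apply: (adM adP) => //; exact: (Hh k).2.
- by apply: bmfM => //; exact: (Hh k).1.
Qed.

Lemma comp_doob2 (tau : nat -> R) n : 0 <= tau 0%N -> (forall k, tau k <= tau k.+1) ->
  Ex P (fun w => runmax (fun k => `|M (tau k) w|) n ^+ 2) <=
  4 * Ex P (fun w => M (tau n) w ^+ 2).
Proof.
move=> t0 tS.
have tk k : 0 <= tau k by elim: k => // k IH; exact: le_trans (tS k).
rewrite (_ : (fun w => M (tau n) w ^+ 2) = (fun w => `|M (tau n) w| ^+ 2)); last first.
  by apply/funext => w; rewrite real_normK ?num_real.
have msg : measurable_fun setT (fun x : R => Num.sg x).
  rewrite (_ : (fun x : R => Num.sg x) = (fun x => \1_`]0, +oo[%classic x - \1_`]-oo, 0[%classic x)).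
    by apply: measurable_funB; apply: measurable_indic.
  apply/funext => x; rewrite !indicE.
  have -> : (x \in (`]0, +oo[%classic : set R)) = (0 < x).
    by apply/idP/idP => [/set_mem/=|h]; [rewrite in_itv/= andbT|apply/mem_set; rewrite /= in_itv/= h].
  have -> : (x \in (`]-oo, 0[%classic : set R)) = (x < 0).
    by apply/idP/idP => [/set_mem/=|h]; [rewrite in_itv|apply/mem_set; rewrite /= in_itv].
  case: (ltgtP x 0) => [x0|x0|->] /=; rewrite ?mulr1n ?mulr0n.
  - by rewrite ltr0_sg// sub0r.
  - by rewrite gtr0_sg// subr0.
  - by rewrite sgr0 subrr.
apply: (comp_doob (h := fun k w => Num.sg (M (tau k) w))) => //.
- move=> k; split; first exact/bmf_norm/(comp_bmf comp (tk k)).1.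
  apply: (ad_comp adP (h := fun x => `|x|)); first exact: normr_measurable.
  exact: (comp_ad comp (tk k)).1.
- move=> k; split.
    apply: (bmf_comp (C := 1) msg); last exact: bmf_meas (comp_bmf comp (tk k)).1.
    by move=> x; rewrite normr_sg lern1 leq_b1.
  by apply: (ad_comp adP) => //; exact: (comp_ad comp (tk k)).1.
move=> k w; rewrite mulrBr -normrEsg lerD2r.
rewrite (le_trans (ler_norm _))// normrM normr_sg.
by case: (_ != 0); rewrite ?mul1r ?mul0r.
Qed.

Lemma comp_doob4 (tau : nat -> R) n : 0 <= tau 0%N -> (forall k, tau k <= tau k.+1) ->
  Ex P (fun w => runmax (fun k => (M (tau k) w - M (tau 0%N) w) ^+ 2) n ^+ 2) <=
  4 * Ex P (fun w => (M (tau n) w - M (tau 0%N) w) ^+ 4).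
Proof.
move=> t0 tS.
have tk k : 0 <= tau k by elim: k => // k IH; exact: le_trans (tS k).
have t0k k : tau 0%N <= tau k by elim: k => // k IH; exact: le_trans (tS k).
rewrite (_ : (fun w => _ ^+ 4) = (fun w => ((M (tau n) w - M (tau 0%N) w) ^+ 2) ^+ 2)); last first.
  by apply/funext => w; rewrite -exprM.
have by_ k : bmf (fun w => M (tau k) w - M (tau 0%N) w).
  by apply: bmfB; exact: (comp_bmf comp (tk _)).1.
have ay k : ad (tau k) (fun w => M (tau k) w - M (tau 0%N) w).
  apply: adB; first exact: (comp_ad comp (tk k)).1.
  by apply: (ad_mono adP (t0k k)); exact: (comp_ad comp t0).1.
apply: (comp_doob (h := fun k w => 2 * (M (tau k) w - M (tau 0%N) w))) => //.
- by move=> k; split; [exact: bmfX|exact: adX].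
- by move=> k w; exact: sqr_ge0.
- by move=> k; split; [apply: bmfM => //; exact: bmf_cst|apply: (adM adP) => //; exact: (ad_cst adP)].
move=> k w; have := sqr_ge0 (M (tau k.+1) w - M (tau k) w); rewrite !expr2; lra.
Qed.

Section partition.
Variables s t : R.
Hypotheses (s0 : 0 <= s) (st : s <= t).

Definition part p k : R := s + (t - s) * (k%:R / p%:R).

Let ts0 : 0 <= t - s. Proof. by rewrite subr_ge0. Qed.

Lemma part0 p : part p 0 = s. Proof. by rewrite /part mul0r mulr0 addr0. Qed.

Lemma partp p : (0 < p)%N -> part p p = t.
Proof.
move=> p0; have pn : p%:R != 0 :> R by rewrite pnatr_eq0 -lt0n.
by rewrite /part divff// mulr1 addrC subrK.
Qed.

Lemma part_nd p k : part p k <= part p k.+1.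
Proof.
rewrite /part lerD2l; apply: ler_wpM2l; first exact: ts0.
by apply: ler_wpM2r; [rewrite invr_ge0 ler0n|rewrite ler_nat leqnSn].
Qed.

Lemma part_ge p k : s <= part p k.
Proof. by rewrite /part lerDl; apply: mulr_ge0; [exact: ts0|exact: divr_ge0]. Qed.

Let part_ge0 p k : 0 <= part p k. Proof. exact: le_trans (part_ge p k). Qed.

Lemma part_step p k : (0 < p)%N -> part p k.+1 = part p k + (t - s) / p%:R.
Proof. by move=> p0; rewrite /part -natr1; ring. Qed.

Definition xi p k w := M (part p k.+1) w - M (part p k) w.
Definition dN p k w := N (part p k.+1) w - N (part p k) w.

(** A cell of a fine grid contains at most one jump, of size 1, and negligible drift, so [xi^2],
    [xi^4] and [dN xi^2] all agree with [dN] up to a small error. These are the products met in the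
    bracket and in the fourth moment. *)
Definition qerr p k w :=
  `|xi p k w ^+ 2 - dN p k w| + `|xi p k w ^+ 4 - dN p k w|
  + `|dN p k w * xi p k w ^+ 2 - dN p k w|.

Definition Qerr p w := \sum_(k < p) qerr p k w.

Let dL p k w := L (part p k.+1) w - L (part p k) w.

Let dN_ge0 p k w : 0 <= dN p k w.
Proof. exact: le_trans (normr_ge0 _) (comp_N comp w (part_ge0 p k) (part_nd p k)). Qed.

Let dL_ge0 p k w : 0 <= dL p k w.
Proof. exact: le_trans (normr_ge0 _) (comp_L comp w (part_ge0 p k) (part_nd p k)). Qed.

Let sum_dN p w : (0 < p)%N -> \sum_(k < p) dN p k w = N t w - N s w.
Proof.
move=> p0; rewrite /dN -(big_mkord xpredT (fun k => N (part p k.+1) w - N (part p k) w)).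
by rewrite telescope_sumr// part0 partp.
Qed.

Let sum_dL p w : (0 < p)%N -> \sum_(k < p) dL p k w = L t w - L s w.
Proof.
move=> p0; rewrite /dL -(big_mkord xpredT (fun k => L (part p k.+1) w - L (part p k) w)).
by rewrite telescope_sumr// part0 partp.
Qed.

Let t0 : 0 <= t. Proof. exact: le_trans st. Qed.

Let sum_dN_le p w : (0 < p)%N -> \sum_(k < p) dN p k w <= B.
Proof.
move=> p0; rewrite sum_dN//.
have [/andP[? ?] _] := comp_bound comp w s0; have [/andP[? ?] _] := comp_bound comp w t0.
lra.
Qed.

Let sum_dL_le p w : (0 < p)%N -> \sum_(k < p) dL p k w <= B.
Proof.
move=> p0; rewrite sum_dL//.
have [_ /andP[? ?]] := comp_bound comp w s0; have [_ /andP[? ?]] := comp_bound comp w t0.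
lra.
Qed.

Let xi_split p k w : exists a b, [/\ xi p k w = a - b, `|a| <= dN p k w,
  `|b| <= dL p k w & a = S (part p k.+1) w - S (part p k) w].
Proof.
exists (S (part p k.+1) w - S (part p k) w), (A (part p k.+1) w - A (part p k) w).
split=> //.
- by rewrite /xi !(comp_dec comp)//; ring.
- exact: (comp_N comp w (part_ge0 p k) (part_nd p k)).
- exact: (comp_L comp w (part_ge0 p k) (part_nd p k)).
Qed.

Let B0 (w : Omega) : 0 <= B.
Proof. by have [/andP[h1 h2] _] := comp_bound comp w s0; exact: le_trans h1 h2. Qed.

Let dN_le p k w : dN p k w <= B.
Proof.
have [/andP[? ?] _] := comp_bound comp w (part_ge0 p k).
have [/andP[? ?] _] := comp_bound comp w (part_ge0 p k.+1).
rewrite /dN; lra.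
Qed.

Let dL_le p k w : dL p k w <= B.
Proof.
have [_ /andP[? ?]] := comp_bound comp w (part_ge0 p k).
have [_ /andP[? ?]] := comp_bound comp w (part_ge0 p k.+1).
rewrite /dL; lra.
Qed.

Let bxi p k : bmf (xi p k).
Proof. by apply: bmfB; exact: (comp_bmf comp (part_ge0 p _)).1. Qed.

Let bdN p k : bmf (dN p k).
Proof. by apply: bmfB; exact: (comp_bmf comp (part_ge0 p _)).2. Qed.

Let bq p k : bmf (qerr p k).
Proof. by rewrite /qerr; have := bxi p k; have := bdN p k => ? ?; bm. Qed.

Lemma bmf_Qerr p : bmf (Qerr p).
Proof. exact: bmf_sum. Qed.

(** Each of the three errors is at most a constant times [dN + dL], which sums to at most [2 B]; [K]
    adds up the constants. The resulting bound dominates all partitions at once. *)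
Let K : R := 2 * B + 1 + ((2 * B) ^+ 3 + 1) + (B * (2 * B) + 1).

Let Qerr_bounded p w : (0 < p)%N -> `|Qerr p w| <= K * (2 * B).
Proof.
move=> p0; have b0 := B0 w.
rewrite ger0_norm; last by apply: sumr_ge0 => k _; rewrite /qerr !addr_ge0.
apply: (@le_trans _ _ (K * \sum_(k < p) (dN p k w + dL p k w))); last first.
  rewrite ler_wpM2l ?/K ?addr_ge0 ?mulr_ge0 ?exprn_ge0//.
  by rewrite big_split/=; have := sum_dN_le w p0; have := sum_dL_le w p0; lra.
rewrite mulr_sumr; apply: ler_sum => k _.
have [a [b [xiE aN bL _]]] := xi_split p k w.
have xle : `|xi p k w| <= dN p k w + dL p k w.
  by rewrite xiE (le_trans (ler_normB _ _))// lerD.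
have h1 := dN_ge0 p k w; have h2 := dL_ge0 p k w.
have h3 := dN_le p k w; have h4 := dL_le p k w.
rewrite /qerr; set x := xi p k w in xle *; set n := dN p k w in xle h1 h3 *.
set l := dL p k w in xle h2 h4 *.
have x2 : x ^+ 2 = `|x| ^+ 2 by rewrite real_normK ?num_real.
have x4 : x ^+ 4 = `|x| ^+ 4 by rewrite !(exprM _ 2 2) x2.
rewrite x4 x2; set z := `|x| in xle *.
have z0 : 0 <= z by exact: normr_ge0.
have z2 : z <= 2 * B by lra.
have zn : 0 <= n + l by lra.
have e2 : z ^+ 2 <= 2 * B * (n + l) by rewrite expr2; nra.
have e3 : z ^+ 3 <= (2 * B) ^+ 3 by rewrite lerXn2r ?nnegrE// mulr_ge0.
have e4 : z ^+ 4 <= (2 * B) ^+ 3 * (n + l).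
  by rewrite exprSr; apply: ler_pM => //; rewrite exprn_ge0.
have e5 : n * z ^+ 2 <= B * (2 * B) * (n + l).
  by rewrite -mulrA; apply: ler_pM => //; rewrite sqr_ge0.
have q2 := sqr_ge0 z.
have q4 : 0 <= z ^+ 4 by rewrite exprn_ge0.
have q5 : 0 <= n * z ^+ 2 by rewrite mulr_ge0.
have d1 : `|z ^+ 2 - n| <= (2 * B + 1) * (n + l).
  by rewrite ler_norml; apply/andP; split; lra.
have d2 : `|z ^+ 4 - n| <= ((2 * B) ^+ 3 + 1) * (n + l).
  by rewrite ler_norml; apply/andP; split; lra.
have d3 : `|n * z ^+ 2 - n| <= (B * (2 * B) + 1) * (n + l).
  by rewrite ler_norml; apply/andP; split; lra.
by rewrite /K !(mulrDl _ _ (n + l)) in d1 d2 d3 *; lra.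
Qed.

Let Qerr_cvg w : Qerr p.+1 w @[p --> \oo] --> (0 : R).
Proof.
have b0 := B0 w.
apply/cvgrPdist_le => e e0.
(* 21 is 7 times 3: the three errors are at most 1, 5 and 1 times [om (2 dN + dL)], and [2 dN + dL]
   sums to at most [3 B]. *)
pose om := Num.min 1 (e / (21 * (B + 1))).
have om0 : 0 < om by rewrite lt_min ltr01/= divr_gt0// mulr_gt0// ltr_wpDl.
have om1 : om <= 1 by rewrite ge_min lexx.
have ome : 21 * B * om <= e.
  have h : om <= e / (21 * (B + 1)) by rewrite ge_min lexx orbT.
  have h' : 0 < 21 * (B + 1) by rewrite mulr_gt0// ltr_wpDl.
  move: h; rewrite ler_pdivlMr//; lra.
have [d1 d10 hL] := comp_cont comp w om0.
have [d2 d20 hN] := comp_simple comp w.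
pose dd := Num.min d1 d2.
have dd0 : 0 < dd by rewrite lt_min d10.
near=> p.
have mesh : (t - s) / p.+1%:R <= dd.
  have h1 : (0 : R) < p.+1%:R by rewrite ltr0n.
  rewrite ler_pdivrMr// mulrC -ler_pdivrMr//.
  near: p; apply: filterS (nbhs_infty_ger ((t - s) / dd)) => p h.
  by rewrite (le_trans h)// ler_nat.
rewrite sub0r normrN ger0_norm; last by apply: sumr_ge0 => k _; rewrite /qerr !addr_ge0.
have p0 : (0 < p.+1)%N by [].
apply: (@le_trans _ _ (7 * om * \sum_(k < p.+1) (2 * dN p.+1 k w + dL p.+1 k w))); last first.
  rewrite big_split/= -mulr_sumr.
  have := sum_dN_le w p0; have := sum_dL_le w p0.
  set u := \sum_(k < _) _; set v := \sum_(k < _) _ => h1 h2.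
  apply: le_trans ome; rewrite (_ : 21 * B * om = 7 * om * (3 * B)); last by ring.
  by apply: ler_wpM2l; [rewrite mulr_ge0// ltW|lra].
rewrite mulr_sumr; apply: ler_sum => k _.
have [a [b [xiE aN bL aS]]] := xi_split p.+1 k w.
have hstep : part p.+1 k.+1 <= part p.+1 k + dd by rewrite part_step// lerD2l.
have st1 : part p.+1 k.+1 <= part p.+1 k + d1.
  by rewrite (le_trans hstep)// lerD2l ge_min lexx.
have st2 : part p.+1 k.+1 <= part p.+1 k + d2.
  by rewrite (le_trans hstep)// lerD2l ge_min lexx orbT.
have Lom := hL _ _ (part_ge0 p.+1 k) (part_nd p.+1 k) st1.
have [N01 SN] := hN _ _ (part_ge0 p.+1 k) (part_nd p.+1 k) st2.
rewrite -aS -/(dN p.+1 k w) in N01 SN.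
rewrite -/(dL p.+1 k w) in Lom.
have h1 := dN_ge0 p.+1 k w; have h2 := dL_ge0 p.+1 k w.
rewrite /qerr xiE; set n := dN p.+1 k w in aN N01 SN h1 *.
set l := dL p.+1 k w in bL Lom h2 *.
have n1 : n <= 1 by case: N01 => ->.
have nn : n * n = n by case: N01 => ->; rewrite ?mul0r ?mul1r.
have e1 : `|(a - b) ^+ 2 - n| <= om * (2 * n + l).
  have -> : (a - b) ^+ 2 - n = - (2 * a * b) + b ^+ 2 by rewrite -SN; ring.
  rewrite (le_trans (ler_normD _ _))// normrN [`|2 * a * b|]normrM [`|2 * a|]normrM [`|b ^+ 2|]normrX.
  have b1 := normr_ge0 b; have a1 := normr_ge0 a.
  rewrite (ger0_norm (_ : 0 <= 2))//.
  have bo : `|b| <= om by lra.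
  have f1 : `|a| * `|b| <= n * om by apply: ler_pM.
  have f2 : `|b| ^+ 2 <= om * l by rewrite expr2; apply: ler_pM.
  lra.
set q := `|(a - b) ^+ 2 - n| in e1 *.
(* Since [n <= 1] and [q <= 3]. The bound 5 controls the first factor of [(a - b)^4 - n = ((a - b)^2
   + n) ((a - b)^2 - n)], an identity that rests on [n^2 = n]. *)
have sq4 : (a - b) ^+ 2 + n <= 5.
  have : (a - b) ^+ 2 - n <= q by exact: ler_norm.
  have : om * (2 * n + l) <= 3 by nra.
  lra.
have sq0 := sqr_ge0 (a - b).
have q0 : 0 <= q by exact: normr_ge0.
have e2 : `|(a - b) ^+ 4 - n| <= 5 * q.
  have -> : (a - b) ^+ 4 - n = ((a - b) ^+ 2 + n) * ((a - b) ^+ 2 - n) by rewrite -{1}nn; ring.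
  by rewrite normrM ler_wpM2r// ger0_norm//; lra.
have e3 : `|n * (a - b) ^+ 2 - n| <= q.
  have -> : n * (a - b) ^+ 2 - n = n * ((a - b) ^+ 2 - n) by rewrite mulrBr nn.
  by rewrite normrM ger0_norm// -[leRHS]mul1r ler_wpM2r.
lra.
Unshelve. all: by end_near. Qed.

Lemma Ex_Qerr : Ex P (Qerr p.+1) @[p --> \oo] --> (0 : R).
Proof.
have [_] := @Ex_cvg _ _ _ P (fun p => Qerr p.+1) (fun=> 0) (fun=> K * (2 * B))
  (fun p => bmf_meas (bmf_Qerr p.+1)) (bmf_ibl P (bmf_cst _))
  (fun p w => Qerr_bounded w (ltn0Sn p)) Qerr_cvg.
by rewrite Ex_cst.
Qed.

Let y p k w := M (part p k) w - M s w.

Let by_ p k : bmf (y p k).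
Proof.
by apply: bmfB; [exact: (comp_bmf comp (part_ge0 p k)).1|exact: (comp_bmf comp s0).1].
Qed.

Let ay p k : ad (part p k) (y p k).
Proof.
apply: adB; first exact: (comp_ad comp (part_ge0 p k)).1.
by apply: (ad_mono adP (part_ge p k)); exact: (comp_ad comp s0).1.
Qed.

Let yS p k w : y p k.+1 w = y p k w + xi p k w.
Proof. by rewrite /y /xi; ring. Qed.

Let mart0 p k H : ad (part p k) H -> bmf H -> Ex P (fun w => H w * xi p k w) = 0.
Proof. by move=> aH bH; exact: (comp_mart comp (part_ge0 p k) (part_nd p k)). Qed.

(** In the telescoped square the cross terms are martingale increments with adapted coefficients and
    have mean zero. What remains is dominated by [Qerr], which vanishes in mean as the partition is
    refined, while the expectation in question does not depend on the partition. *)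
Lemma comp_variance H : ad s H -> bmf H ->
  Ex P (fun w => H w * ((M t w - M s w) ^+ 2 - (N t w - N s w))) = 0.
Proof.
move=> aH bH.
have bMt := (comp_bmf comp t0).1; have bMs := (comp_bmf comp s0).1.
have bNt := (comp_bmf comp t0).2; have bNs := (comp_bmf comp s0).2.
set E := Ex P _.
have [_ [C [C0 HC]]] := bmf_ge0 bH.
have key p : `|E| <= C * Ex P (Qerr p.+1).
  have p0 : (0 < p.+1)%N by [].
  have -> : E = Ex P (fun w => \sum_(k < p.+1)
      (2 * (H w * y p.+1 k w * xi p.+1 k w) + H w * (xi p.+1 k w ^+ 2 - dN p.+1 k w))).
    congr (Ex P _); apply/funext => w.
    transitivity (H w * \sum_(k < p.+1) (2 * y p.+1 k w * xi p.+1 k w + (xi p.+1 k w ^+ 2 - dN p.+1 k w))).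
      congr (_ * _); rewrite -(sum_dN w p0).
      have -> : (M t w - M s w) ^+ 2 =
          \sum_(k < p.+1) (y p.+1 k.+1 w ^+ 2 - y p.+1 k w ^+ 2).
        rewrite -(big_mkord xpredT (fun k => y p.+1 k.+1 w ^+ 2 - y p.+1 k w ^+ 2)).
        by rewrite telescope_sumr// /y part0 partp// subrr expr0n/= subr0.
      rewrite -sumrB; apply: eq_bigr => k _; rewrite yS; ring.
    by rewrite mulr_sumr; apply: eq_bigr => k _; ring.
  have b1 k : bmf (fun w => H w * y p.+1 k w * xi p.+1 k w).
    by have ? := by_ p.+1 k; have ? := bxi p.+1 k; bm.
  have b2 k : bmf (fun w => H w * (xi p.+1 k w ^+ 2 - dN p.+1 k w)).
    by have ? := bdN p.+1 k; have ? := bxi p.+1 k; bm.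
  rewrite Ex_sum; last by move=> k; have := b1 k; have := b2 k => ? ?; bm.
  have -> : \sum_(k < p.+1) Ex P (fun w => 2 * (H w * y p.+1 k w * xi p.+1 k w) + H w * (xi p.+1 k w ^+ 2 - dN p.+1 k w))
    = \sum_(k < p.+1) Ex P (fun w => H w * (xi p.+1 k w ^+ 2 - dN p.+1 k w)).
    apply: eq_bigr => k _; rewrite ExD; [|exact/iblZ/bmf_ibl|exact: bmf_ibl].
    rewrite ExZ; last exact: bmf_ibl.
    rewrite (mart0 (H := fun w => H w * y p.+1 k w)) ?mulr0 ?add0r//.
    - by apply: (adM adP) => //; exact: (ad_mono adP (part_ge p.+1 k)).
    - exact: bmfM.
  rewrite -Ex_sum// -ExZ; last exact/bmf_ibl/bmf_Qerr.
  rewrite (le_trans (Ex_norm_le _))//; first exact/bmf_ibl/bmf_sum.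
  apply: Ex_le; [by apply/bmf_ibl/bmf_norm/bmf_sum|by apply/iblZ/bmf_ibl/bmf_Qerr|move=> w].
  rewrite (le_trans (ler_norm_sum _ _ _))// /Qerr mulr_sumr; apply: ler_sum => k _.
  rewrite normrM; apply: ler_pM => //.
  by rewrite /qerr -addrA lerDl addr_ge0.
apply/eqP; rewrite -normr_le0.
have h : C * Ex P (Qerr p.+1) @[p --> \oo] --> C * 0.
  by apply: cvgM; [exact: cvg_cst|exact: Ex_Qerr].
rewrite mulr0 in h.
by apply: (ler_cvg_to (cvg_cst `|E|) h); apply: nearW => p; exact: key.
Qed.

End partition.

(* Along a partition the fourth power has increments dominated by [8 y^2 dN + 3 dM^4];
   [\sum y^2 dN] is compared with the final value of [y^2 V], [V = N - N s], by Abel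
   summation. *)
Lemma comp_fourth s t : 0 <= s -> s <= t ->
  Ex P (fun w => (M t w - M s w) ^+ 4) <=
  256 * Ex P (fun w => (N t w - N s w) ^+ 2) + 70 * Ex P (fun w => N t w - N s w).
Proof.
move=> s0 st; have t0 : 0 <= t by exact: le_trans st.
pose y p k w := M (part s t p k) w - M s w.
pose V p k w := N (part s t p k) w - N s w.
pose x := xi s t; pose n := dN s t.
have pge p k : s <= part s t p k by exact: part_ge.
have p0 p k : 0 <= part s t p k by exact: le_trans (pge p k).
have pnd p k : part s t p k <= part s t p k.+1 by exact: part_nd.
have by_ p k : bmf (y p k).
  by apply: bmfB; [exact: (comp_bmf comp (p0 p k)).1|exact: (comp_bmf comp s0).1].
have bV p k : bmf (V p k).
  by apply: bmfB; [exact: (comp_bmf comp (p0 p k)).2|exact: (comp_bmf comp s0).2].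
have bx p k : bmf (x p k) by apply: bmfB; exact: (comp_bmf comp (p0 p _)).1.
have bn p k : bmf (n p k) by apply: bmfB; exact: (comp_bmf comp (p0 p _)).2.
have ay p k : ad (part s t p k) (y p k).
  apply: adB; first exact: (comp_ad comp (p0 p k)).1.
  by apply: (ad_mono adP (pge p k)); exact: (comp_ad comp s0).1.
have aV p k : ad (part s t p k) (V p k).
  apply: adB; first exact: (comp_ad comp (p0 p k)).2.
  by apply: (ad_mono adP (pge p k)); exact: (comp_ad comp s0).2.
have yS p k w : y p k.+1 w = y p k w + x p k w by rewrite /y /x /xi; ring.
have VS p k w : V p k.+1 w = V p k w + n p k w by rewrite /V /n /dN; ring.
have y00 p w : y p 0%N w = 0 by rewrite /y part0 subrr.
have V00 p w : V p 0%N w = 0 by rewrite /V part0 subrr.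
have n0 p k w : 0 <= n p k w.
  exact: le_trans (normr_ge0 _) (comp_N comp w (p0 p k) (pnd p k)).
have V0 p k w : 0 <= V p k w.
  exact: le_trans (normr_ge0 _) (comp_N comp w s0 (pge p k)).
have m0 p k H : ad (part s t p k) H -> bmf H -> Ex P (fun w => H w * x p k w) = 0.
  by move=> aH bH; exact: (comp_mart comp (p0 p k) (pnd p k)).
have m1 p k H : ad (part s t p k) H -> bmf H ->
    Ex P (fun w => H w * x p k w ^+ 2) = Ex P (fun w => H w * n p k w).
  move=> aH bH; apply/eqP; rewrite -subr_eq0 -ExB.
  - apply/eqP; rewrite -[RHS](comp_variance (p0 p k) (pnd p k) aH bH).
    by congr (Ex P _); apply/funext => w; rewrite -mulrBr.
  - by apply: bmf_ibl; have ? := bx p k; bm.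
  - by apply: bmf_ibl; have ? := bn p k; bm.
pose EY := Ex P (fun w => (M t w - M s w) ^+ 4).
pose EV := Ex P (fun w => N t w - N s w).
pose EV2 := Ex P (fun w => (N t w - N s w) ^+ 2).
pose EYV := Ex P (fun w => (M t w - M s w) ^+ 2 * (N t w - N s w)).
have bMM : bmf (fun w => M t w - M s w).
  by apply: bmfB; [exact: (comp_bmf comp t0).1|exact: (comp_bmf comp s0).1].
have bNN : bmf (fun w => N t w - N s w).
  by apply: bmfB; [exact: (comp_bmf comp t0).2|exact: (comp_bmf comp s0).2].
(* Summing [stepU] and absorbing half of [U] gives [8 U <= 16 EYV + 32 sum e3]; [step4] adds
   [3 sum e4]. The sums of [e3] and [e4] are compared with [EV] through [Qerr], with
   [35 = 32 + 3]. *)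
have key p : EY <= 16 * EYV + 35 * EV + 35 * Ex P (Qerr s t p.+1).
  pose q := p.+1.
  have q0 : (0 < q)%N by [].
  pose e2 k := Ex P (fun w => y q k w ^+ 2 * n q k w).
  pose e3 k := Ex P (fun w => n q k w * x q k w ^+ 2).
  pose e4 k := Ex P (fun w => x q k w ^+ 4).
  have tel (f : nat -> R) : f 0%N = 0 -> f q = \sum_(k < q) (f k.+1 - f k).
    move=> f0; rewrite -(big_mkord xpredT (fun k => f k.+1 - f k)).
    by rewrite telescope_sumr// f0 subr0.
  have step4 k : Ex P (fun w => y q k.+1 w ^+ 4) - Ex P (fun w => y q k w ^+ 4) <=
      8 * e2 k + 3 * e4 k.
    have ? := by_ q k; have ? := by_ q k.+1; have ? := bx q k; have ? := bn q k.
    have z : Ex P (fun w => 4 * y q k w ^+ 3 * x q k w) = 0.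
      apply: (m0 q k (fun w => 4 * y q k w ^+ 3)); last by bm.
      by apply: (adM adP); [exact: (ad_cst adP)|apply: adX; exact: ay].
    have z2 : e2 k = Ex P (fun w => y q k w ^+ 2 * x q k w ^+ 2).
      by rewrite /e2 -m1//; [apply: adX; exact: ay|bm].
    rewrite -ExB; [|by apply: bmf_ibl; bm..].
    rewrite -[leRHS]add0r -z z2 /e4.
    rewrite -ExZ; last by apply: bmf_ibl; bm.
    rewrite -ExZ; last by apply: bmf_ibl; bm.
    rewrite -ExD; [|by apply: bmf_ibl; bm..].
    rewrite -ExD; [|by apply: bmf_ibl; bm..].
    apply: Ex_le; [by apply: bmf_ibl; bm|by apply: bmf_ibl; bm|move=> w].
    rewrite yS; set a := y q k w; set b := x q k w.
    have : 0 <= 2 * b ^+ 2 * (a - b) ^+ 2 by apply: mulr_ge0; [apply: mulr_ge0; [exact: ler0n|exact: sqr_ge0]|exact: sqr_ge0].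
    by move=> h; rewrite -subr_ge0 (_ : _ - _ = 2 * b ^+ 2 * (a - b) ^+ 2)//; ring.
  (* The increment of [y^2 V] is the new [y^2] times [dN], plus [V] times the increment of [y^2],
     whose mean is nonnegative. Replacing the new [y] by the old one costs [e2 / 2] and [2 e3]. *)
  have stepU k : e2 k <= Ex P (fun w => y q k.+1 w ^+ 2 * V q k.+1 w) -
      Ex P (fun w => y q k w ^+ 2 * V q k w) + 2^-1 * e2 k + 2 * e3 k.
    have ? := by_ q k; have ? := by_ q k.+1; have ? := bx q k; have ? := bn q k.
    have ? := bV q k; have ? := bV q k.+1.
    have z : Ex P (fun w => 2 * V q k w * y q k w * x q k w) = 0.
      apply: (m0 q k (fun w => 2 * V q k w * y q k w)); last by bm.
      apply: (adM adP); last exact: ay.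
      by apply: (adM adP); [exact: (ad_cst adP)|exact: aV].
    rewrite -ExB; [|by apply: bmf_ibl; bm..].
    rewrite /e2 /e3 -ExZ; last by apply: bmf_ibl; bm.
    rewrite -ExZ; last by apply: bmf_ibl; bm.
    rewrite -ExD; [|by apply: bmf_ibl; bm..].
    rewrite -ExD; [|by apply: bmf_ibl; bm..].
    rewrite -[leLHS]addr0 -z -ExD; [|by apply: bmf_ibl; bm..].
    apply: Ex_le; [by apply: bmf_ibl; bm|by apply: bmf_ibl; bm|move=> w].
    rewrite yS VS; set a := y q k w; set b := x q k w; set v := V q k w; set c := n q k w.
    have c0 : 0 <= c by exact: n0.
    have v0 : 0 <= v by exact: V0.
    have : 0 <= c * (2^-1 * (a + 2 * b) ^+ 2 + b ^+ 2) + v * b ^+ 2.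
      apply: addr_ge0; apply: mulr_ge0 => //; last exact: sqr_ge0.
      by apply: addr_ge0; [apply: mulr_ge0 => //; exact: sqr_ge0|exact: sqr_ge0].
    move=> h; rewrite -subr_ge0.
    by rewrite (_ : _ - _ = c * (2^-1 * (a + 2 * b) ^+ 2 + b ^+ 2) + v * b ^+ 2)//; field.
  pose U := \sum_(k < q) e2 k.
  have h4 : EY <= 8 * U + 3 * \sum_(k < q) e4 k.
    have -> : EY = Ex P (fun w => y q q w ^+ 4) by rewrite /y partp.
    rewrite (tel (fun k => Ex P (fun w => y q k w ^+ 4))); last first.
      by rewrite -[RHS](Ex_cst P); congr (Ex P _); apply/funext => w; rewrite y00 expr0n.
    by rewrite /U !mulr_sumr -big_split; apply: ler_sum => k _; exact: step4.
  have hU : U <= EYV + 2^-1 * U + 2 * \sum_(k < q) e3 k.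
    have -> : EYV = Ex P (fun w => y q q w ^+ 2 * V q q w) by rewrite /y /V partp.
    rewrite (tel (fun k => Ex P (fun w => y q k w ^+ 2 * V q k w))); last first.
      by rewrite -[RHS](Ex_cst P); congr (Ex P _); apply/funext => w; rewrite V00 mulr0.
    by rewrite /U !mulr_sumr -!big_split; apply: ler_sum => k _; exact: stepU.
  have hQ : 32 * \sum_(k < q) e3 k + 3 * \sum_(k < q) e4 k <= 35 * EV + 35 * Ex P (Qerr s t q).
    have bQ := bmf_Qerr s0 st q.
    have -> : EV = Ex P (fun w => V q q w) by rewrite /V partp.
    rewrite (tel (fun k => Ex P (fun w => V q k w))); last first.
      by rewrite -[RHS](Ex_cst P); congr (Ex P _); apply/funext => w; rewrite V00.
    rewrite /Qerr Ex_sum; last first.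
      by move=> k; rewrite /qerr; have ? := bx q k; have ? := bn q k; bm.
    rewrite !mulr_sumr -!big_split; apply: ler_sum => k _ /=.
    have ? := bx q k; have ? := bn q k; have ? := bV q k; have ? := bV q k.+1.
    have ? : bmf (qerr s t q k) by rewrite /qerr; bm.
    rewrite /e3 /e4 -ExB; [|by apply: bmf_ibl; bm..].
    rewrite -!ExZ; [|by apply: bmf_ibl; bm..].
    rewrite -ExD; [|by apply: bmf_ibl; bm..].
    rewrite -ExD; [|by apply: bmf_ibl; bm..].
    apply: Ex_le; [by apply: bmf_ibl; bm|by apply: bmf_ibl; bm|move=> w].
    rewrite VS addrAC subrr add0r /qerr -/(x q k w) -/(n q k w).
    set a := n q k w; set b := x q k w.
    have h1 := ler_norm (a * b ^+ 2 - a); have h2 := ler_norm (b ^+ 4 - a).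
    have h3 := normr_ge0 (b ^+ 2 - a); have h5 := normr_ge0 (b ^+ 4 - a).
    have h6 := normr_ge0 (a * b ^+ 2 - a); lra.
  lra.
have lim : EY <= 16 * EYV + 35 * EV.
  have h : 16 * EYV + 35 * EV + 35 * Ex P (Qerr s t p.+1) @[p --> \oo] -->
      16 * EYV + 35 * EV + 35 * 0.
    by apply: cvgD; [exact: cvg_cst|apply: cvgM; [exact: cvg_cst|exact: Ex_Qerr]].
  rewrite mulr0 addr0 in h.
  by apply: (ler_cvg_to (cvg_cst EY) h); apply: nearW => p; exact: key.
(* From [(a^2 - 16 b)^2 >= 0]. Half of [EY], which is finite, moves to the left side; doubling then
   produces 256 and 70. *)
have young : 16 * EYV <= 2^-1 * EY + 128 * EV2.
  rewrite /EYV /EY /EV2 -!ExZ; [|by apply: bmf_ibl; bm..].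
  rewrite -ExD; [|by apply: bmf_ibl; bm..].
  apply: Ex_le; [by apply: bmf_ibl; bm|by apply: bmf_ibl; bm|move=> w].
  set a := M t w - M s w; set b := N t w - N s w.
  have := sqr_ge0 (a ^+ 2 - 16 * b); rewrite sqrrB -exprM; lra.
rewrite -/EY -/EV -/EV2; lra.
Qed.

End compensated_process.

(** * Hawkes processes *)

Lemma nneseries_finite {R : realType} (f : nat -> \bar R) (c : nat -> R) n :
  (forall k, (0 <= f k)%E) -> (forall k, (k < n)%N -> f k = (c k)%:E) ->
  (forall k, (n <= k)%N -> f k = 0%E) ->
  (\sum_(0 <= k <oo) f k = (\sum_(k < n) c k)%:E)%E.
Proof.
move=> f0 fc fn; rewrite (nneseries_split 0 n)// add0n (eseries0 (N := n)) ?adde0; last first.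
  by move=> k nk _; exact: fn.
rewrite big_mkord -sumEFin; apply: eq_bigr => k _; exact: fc.
Qed.

Section hawkes_paths.
Context {R : realType} {d : measure_display} {Omega : measurableType d}.
Variables (T : nat -> Omega -> \bar R) (Z : nat -> Omega -> 'I_2).
Hypothesis mt : marked_times T Z.

Definition jumped k t w : R := (T k w <= t%:E)%E%:R.

Definition stopped n t w : R := fine (Order.min t%:E (T n w)).

Lemma jump_time_gt0 n w : (0 < T n w)%E. Proof. by case: mt. Qed.

Lemma jump_time_nd i j w : (i <= j)%N -> (T i w <= T j w)%E.
Proof.
elim: j => [|j IH]; first by rewrite leqn0 => /eqP->.
rewrite leq_eqVlt => /predU1P[->//|]; rewrite ltnS => /IH h.
by apply: le_trans h _; case: mt.
Qed.

Lemma jump_time_lt i j w : (i < j)%N -> (T i w < +oo)%E -> (T i w < T j w)%E.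
Proof.
move=> ij h; apply: (@lt_le_trans _ _ (T i.+1 w)); last exact: jump_time_nd.
by case: mt => _ _ _ _; exact.
Qed.

Lemma stoppedE n t w : 0 <= t -> (stopped n t w)%:E = Order.min t%:E (T n w).
Proof.
move=> t0; rewrite /stopped fineK//; have := jump_time_gt0 n w.
case: (T n w) => [r _| _|//]; first by rewrite -EFin_min.
by rewrite min_l ?leey.
Qed.

Lemma stopped_ge0 n t w : 0 <= t -> 0 <= stopped n t w.
Proof.
by move=> t0; rewrite -lee_fin stoppedE// le_min lee_fin t0 ltW// jump_time_gt0.
Qed.

Lemma stopped_le n t w : 0 <= t -> stopped n t w <= t.
Proof. by move=> t0; rewrite -lee_fin stoppedE// ge_min lexx. Qed.

Lemma stopped_leT n t w : 0 <= t -> ((stopped n t w)%:E <= T n w)%E.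
Proof. by move=> t0; rewrite stoppedE// ge_min lexx orbT. Qed.

Lemma stopped_nd n t t' w : 0 <= t -> t <= t' -> stopped n t w <= stopped n t' w.
Proof.
move=> t0 tt; have t0' := le_trans t0 tt.
rewrite -lee_fin !stoppedE// le_min !ge_min lee_fin tt/=.
by rewrite lexx orbT.
Qed.

Lemma stopped_lip n t t' w : 0 <= t -> t <= t' ->
  stopped n t' w - stopped n t w <= t' - t.
Proof.
move=> t0 tt; have t0' := le_trans t0 tt.
have := stoppedE n w t0; have := stoppedE n w t0'; have := jump_time_gt0 n w.
case: (T n w) => [r r0| _|//]; last first.
  by rewrite !min_l ?leey// => -[->] [->].
rewrite -!EFin_min => -[->] [->].
case: (leP t' r) => h1; case: (leP t r) => h2; lra.
Qed.

Lemma jumped_stopped k n t w : 0 <= t -> (k <= n)%N -> jumped k (stopped n t w) w = jumped k t w.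
Proof. by move=> t0 kn; rewrite /jumped stoppedE// le_min jump_time_nd ?andbT. Qed.

Lemma jumped_gt k n t w : 0 <= t -> (n < k)%N -> jumped k (stopped n t w) w = 0.
Proof.
move=> t0 nk; rewrite /jumped; case: leP => // h; exfalso.
have h1 : (T k w <= T n w)%E by apply: le_trans h _; exact: stopped_leT.
have : (T n w < +oo)%E.
  apply: le_lt_trans (jump_time_nd w (ltnW nk)) _.
  by apply: le_lt_trans h _; rewrite ltry.
by move=> /(jump_time_lt nk); rewrite ltNge h1.
Qed.

Lemma jumped01 k t w : jumped k t w = 0 \/ jumped k t w = 1.
Proof. by rewrite /jumped; case: (_ <= _)%E; [right|left]. Qed.

Lemma jumped_ge0 k t w : 0 <= jumped k t w.
Proof. by have [|] := jumped01 k t w => ->. Qed.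

Lemma jumped_le1 k t w : jumped k t w <= 1.
Proof. by have [|] := jumped01 k t w => ->. Qed.

Lemma jumped_nd k t t' w : t <= t' -> jumped k t w <= jumped k t' w.
Proof.
move=> tt; rewrite /jumped; case: (leP (T k w) t%:E) => // h.
by rewrite (le_trans h)// lee_fin.
Qed.

(** Numbering from 0, the jumps [0] to [n] are those that can occur up to [T n]; a finite jump time
    with larger index is strictly later, so the series stops after [n + 1] terms. *)
Lemma counting_stopped i n t w : 0 <= t ->
  counting_process T Z i (stopped n t w) w = (\sum_(k < n.+1) (Z k w == i)%:R * jumped k t w)%:E.
Proof.
move=> t0; rewrite /counting_process.
have e k : \1_[set w0 | (T k w0 <= (stopped n t w)%:E)%E /\ Z k w0 = i] w =
    (Z k w == i)%:R * jumped k (stopped n t w) w :> R.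
  rewrite indicE /jumped.
  have -> : (w \in [set w0 | (T k w0 <= (stopped n t w)%:E)%E /\ Z k w0 = i]) =
      (Z k w == i) && (T k w <= (stopped n t w)%:E)%E.
    by apply/idP/idP => [/set_mem[h /eqP->]|/andP[/eqP h1 h2]] //; apply/mem_set.
  by case: (Z k w == i) => /=; rewrite ?mul1r ?mul0r.
apply: (nneseries_finite (n := n.+1) (c := fun k => (Z k w == i)%:R * jumped k t w)) => [k|k kn|k nk].
- by rewrite lee_fin e mulr_ge0 ?ler0n// jumped_ge0.
- by rewrite e jumped_stopped.
- by rewrite e jumped_gt// mulr0.
Qed.

Variable phi : R -> R.
Hypothesis phi_meas : measurable_fun (`[0, +oo[ : set R) phi.
Hypothesis phi_ge0 : forall t, 0 <= t -> 0 <= phi t.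
Hypothesis phi_lt1 : (\int[lebesgue_measure]_(t in `[0%R, +oo[) (phi t)%:E < 1)%E.

Let delayed th s : R := if th < s then phi (s - th) else 0.

Lemma integral_jump_measure j n s u w : 0 <= s -> s <= u -> (u%:E <= T n w)%E ->
  (\int[jump_measure T Z j w]_(x in `]0%R, s[) (phi (s - x))%:E =
  (\sum_(k < n.+1) ((Z k w == j)%:R * jumped k u w) * delayed (fine (T k w)) s)%:E)%E.
Proof.
move=> s0 su uT.
have mf : measurable_fun (`]0, s[ : set R) (fun x => (phi (s - x))%:E).
  apply/measurable_EFinP.
  apply: (@measurable_comp _ _ _ _ _ _ (`[0, +oo[ : set R) phi) => //.
    move=> _ [x /= + <-]; rewrite !in_itv/= andbT => /andP[_ /ltW].
    by rewrite subr_ge0.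
  by apply: measurable_funTS; apply: measurable_funB => //; exact: measurable_cst.
have f0 (x : R) : `]0, s[%classic x -> (0 <= (phi (s - x))%:E)%E.
  by rewrite /= in_itv/= => /andP[_ /ltW xs]; rewrite lee_fin phi_ge0// subr_ge0.
have mD : measurable (`]0, s[%classic : set (measurableTypeR R)) by exact: measurable_itv.
rewrite /jump_measure (ge0_integral_measure_series _ mD f0 mf).
have val k : (T k w < +oo)%E -> Z k w == j ->
    (\int[@dirac _ (measurableTypeR R) (fine (T k w)) R]_(x in `]0%R, s[) (phi (s - x))%:E)%E
    = (delayed (fine (T k w)) s)%:E.
  move=> h _; rewrite integral_dirac// diracE /delayed.
  have -> : (fine (T k w) \in (`]0, s[%classic : set R)) = (fine (T k w) < s).
    have Tk0 : 0 < fine (T k w) by rewrite fine_gt0// jump_time_gt0.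
    by apply/idP/idP => [/set_mem/=|hs]; [rewrite in_itv/= => /andP[]|
      apply/mem_set; rewrite /= in_itv/= Tk0].
  by case: ltP => _ /=; rewrite ?mul1e ?mul0e.
have Tfin k : T k w = +oo%E \/ T k w = (fine (T k w))%:E.
  have := jump_time_gt0 k w; case: (T k w) => //; [by right|by left].
apply: (nneseries_finite (n := n.+1)
  (c := fun k => ((Z k w == j)%:R * jumped k u w) * delayed (fine (T k w)) s)) => [k|k kn|k nk].
- by apply: integral_ge0 => x /f0.
- case: (Tfin k) => Tk.
    rewrite {1}Tk ltxx/= integral_measure_zero /jumped Tk.
    by rewrite leNgt ltry/= mulr0 mul0r.
  have Tk' : (T k w < +oo)%E by rewrite Tk ltry.
  rewrite Tk'/=; case: eqP => /= [/eqP zj|_]; last by rewrite integral_measure_zero !mul0r.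
  rewrite val// mul1r /jumped; case: leP => h; first by rewrite mul1r.
  rewrite mul0r /delayed ifF//; apply/negbTE; rewrite -leNgt -lee_fin -Tk.
  by apply: le_trans (ltW h); rewrite lee_fin.
- case: ifPn => [/andP[h zj]|_]; last by rewrite integral_measure_zero.
  rewrite val// /delayed ifF//; apply/negbTE; rewrite -leNgt -lee_fin.
  case: (Tfin k) h => [->|<-]; first by rewrite ltxx.
  move=> _; apply: (@le_trans _ _ u%:E); first by rewrite lee_fin.
  by apply: le_trans uT (jump_time_nd w (ltnW nk)).
Qed.

(** Up to time [u] at most [n + 1] jumps matter, so the intensity is a finite sum of delayed
    kernels, integrated term by term with [integral_delayed]. *)
Lemma integral_intensity nu j n u w : 0 <= nu -> 0 <= u -> (u%:E <= T n w)%E ->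
  (\int[lebesgue_measure]_(s in `[0%R, u])
    (nu%:E + \int[jump_measure T Z j w]_(x in `]0%R, s[) (phi (s - x))%:E) =
  (nu * u + \sum_(k < n.+1)
     ((Z k w == j)%:R * jumped k u w) * Phi phi (u - fine (T k w)))%:E)%E.
Proof.
move=> nu0 u0 uT.
pose g k s := (((Z k w == j)%:R * jumped k u w) * delayed (fine (T k w)) s)%:E.
transitivity (\int[lebesgue_measure]_(s in `[0%R, u]) (nu%:E + \sum_(k < n.+1) g k s))%E.
  apply: eq_integral => s /set_mem; rewrite /= in_itv/= => /andP[s0 su].
  by rewrite (integral_jump_measure j s0 su uT) -sumEFin.
have mdel k : measurable_fun setT (delayed (fine (T k w))).
  apply: measurable_fun_if => //.
  - by apply: measurable_fun_ltr => //; exact: measurable_cst.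
  - apply: (@measurable_comp _ _ _ _ _ _ (`[0, +oo[ : set R) phi) => //.
      move=> _ [x /= [_ +] <-]; rewrite in_itv/= andbT => /ltW.
      by rewrite subr_ge0.
    by apply: measurable_funTS; apply: measurable_funB => //; exact: measurable_cst.
have del0 k s : 0 <= delayed (fine (T k w)) s.
  by rewrite /delayed; case: ltP => // h; rewrite phi_ge0// subr_ge0 ltW.
have g0 k s : (0 <= g k s)%E.
  by rewrite lee_fin mulr_ge0// mulr_ge0 ?ler0n// jumped_ge0.
have mg k : measurable_fun (`[0, u] : set R) (g k).
  by apply: measurable_funTS; apply/measurable_EFinP; apply: measurable_funM => //; exact: measurable_cst.
rewrite ge0_integralD//; last 2 first.
- by move=> s _; apply: sume_ge0.
- by apply: emeasurable_sum => k _; exact: mg.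
rewrite integral_cst//= lebesgue_measure_itv/= lte_fin.
rewrite ge0_integral_sum//; last by move=> k; exact: mg.
rewrite EFinD -sumEFin; congr (_ + _)%E.
  by case: ltP => h; rewrite ?oppr0 ?adde0 ?EFinM// (le_anti (_ : u <= 0 <= u)) ?h// mulr0 mule0.
apply: eq_bigr => k _; rewrite /g.
under eq_integral do rewrite EFinM.
rewrite ge0_integralZl_EFin//; last 3 first.
- by move=> s _; rewrite lee_fin.
- by apply/measurable_EFinP; apply: measurable_funTS; exact: mdel.
- by apply: mulr_ge0; [exact: ler0n|exact: jumped_ge0].
rewrite [RHS]EFinM.
(* A jump that has not occurred by [u] contributes 0 to both sides; this includes [T k = +oo], whose
   [fine] is 0 and would not be a legitimate jump time. *)
case: (jumped01 k u w) => J; first by rewrite J mulr0 !mul0e.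
have Tk : (T k w <= u%:E)%E.
  by move: J; rewrite /jumped; case: leP => // _ /eqP; rewrite eq_sym oner_eq0.
congr (_ * _)%E; apply: integral_delayed => //.
rewrite fine_gt0// jump_time_gt0/=.
by apply: le_lt_trans Tk _; rewrite ltry.

Qed.

End hawkes_paths.

(** * Adaptedness to the history of the counting processes *)

Section history_adapted.
Context {R : realType} {d : measure_display} {Omega : measurableType d}.
Variables (T : nat -> Omega -> \bar R) (Z : nat -> Omega -> 'I_2).
Hypothesis mt : marked_times T Z.

Definition adapted t (f : Omega -> R) : Prop :=
  forall B, measurable B -> history T Z t (f @^-1` B).

Let gen (t : R) : set (set Omega) := [set A | exists (i : 'I_2) (s : R) (B : set (\bar R)),
  [/\ 0 <= s <= t, measurable B & A = counting_process T Z i s @^-1` B]].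

Lemma adaptedP t f :
  adapted t f <-> measurable_fun (setT : set (g_sigma_algebraType (gen t))) f.
Proof.
split=> [h _ B mB|h B mB]; first by rewrite setTI; exact: h.
by have := h measurableT B mB; rewrite setTI.
Qed.

Lemma history_le t t' : t <= t' -> history T Z t `<=` history T Z t'.
Proof.
move=> tt; apply: sub_sigma_algebra2 => A [i [s [B [/andP[s0 st] mB ->]]]].
by exists i, s, B; split=> //; rewrite s0 (le_trans st).
Qed.

Lemma measurable_counting i t : measurable_fun setT (counting_process T Z i t).
Proof.
apply: ge0_emeasurable_sum => [k w _ _|k _]; first by rewrite lee_fin.
apply/measurable_EFinP/measurable_indic.
apply: measurableI; last by case: mt => _ + _ _ _; exact.
rewrite -[X in measurable X]setTI.
by apply: emeasurable_fun_infty_c => //; case: mt.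
Qed.

Lemma history_measurable t A : history T Z t A -> measurable A.
Proof.
have : history T Z t `<=` (@measurable _ Omega); last exact.
apply: smallest_sub; first exact: sigma_algebra_measurable.
move=> _ [i [s [B [_ mB ->]]]].
by rewrite -[X in measurable X]setTI; exact: measurable_counting.
Qed.

Lemma adapted_measurable t f : adapted t f -> measurable_fun setT f.
Proof. by move=> h _ B mB; rewrite setTI; apply: history_measurable; exact: h. Qed.

Lemma adapted_adaptedness : adaptedness adapted.
Proof.
split.
- by move=> r c; apply/adaptedP; exact: measurable_cst.
- by move=> r f g /adaptedP mf /adaptedP mg; apply/adaptedP; exact: measurable_funD.
- by move=> r f g /adaptedP mf /adaptedP mg; apply/adaptedP; exact: measurable_funM.
- by move=> r f g /adaptedP mf /adaptedP mg; apply/adaptedP; exact: measurable_maxr.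
- by move=> r h f mh /adaptedP mf; apply/adaptedP; exact: measurableT_comp.
- by move=> r r' f rr mf B mB; apply: history_le rr _ _; exact: mf.
Qed.

Lemma counting_adapted i s t : 0 <= s <= t ->
  measurable_fun (setT : set (g_sigma_algebraType (gen t))) (counting_process T Z i s).
Proof.
move=> st _ B mB; rewrite setTI; apply: sub_sigma_algebra.
by exists i, s, B.
Qed.

(** The history is generated by the counts, not by the jump times; because the times are ordered,
    the total count detects each of them. *)
Lemma jumped_counting k t w :
  (T k w <= t%:E)%E = (k.+1%:R%:E <= counting_process T Z ord0 t w + counting_process T Z ord_max t w)%E.
Proof.
have e : (counting_process T Z ord0 t w + counting_process T Z ord_max t w =
    \sum_(0 <= m <oo) (jumped T m t w)%:E)%E.
  rewrite /counting_process -nneseriesD; last 2 first.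
  - by move=> m _ _; rewrite lee_fin.
  - by move=> m _ _; rewrite lee_fin.
  apply: eq_eseriesr => m _; rewrite -EFinD; congr (_%:E); rewrite /jumped !indicE.
  have q (i : 'I_2) : (w \in [set w0 | (T m w0 <= t%:E)%E /\ Z m w0 = i]) =
      (Z m w == i) && (T m w <= t%:E)%E.
    by apply/idP/idP => [/set_mem[h /eqP->]|/andP[/eqP h1 h2]] //; apply/mem_set.
  rewrite !q; case: (Z m w) => [[|[|//]] h]; rewrite -!val_eqE/=.
    by rewrite addr0.
  by rewrite add0r.
have j0 m : (0 <= (jumped T m t w)%:E)%E by rewrite lee_fin jumped_ge0.
rewrite e; case: (leP (T k w)) => h; apply/esym.
  have := nneseries_lim_ge (R := R) (P := xpredT) (m := 0) k.+1 (fun m _ _ => j0 m).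
  apply: le_trans; rewrite big_mkord sumEFin lee_fin.
  rewrite (_ : \sum_(i < k.+1) _ = k.+1%:R)//.
  rewrite -[in RHS](card_ord k.+1) -sum1_card natr_sum; apply: eq_bigr => m _.
  rewrite /jumped (le_trans (jump_time_nd mt w _) h)//.
  by rewrite -ltnS.
apply/negbTE; rewrite -ltNge.
rewrite (nneseries_finite (n := k) (c := fun m => jumped T m t w))//; last first.
  move=> m km; rewrite /jumped; case: leP => // h'.
  by have := lt_le_trans h (jump_time_nd mt w km); rewrite ltNge h'.
rewrite lte_fin; apply: (@le_lt_trans _ _ k%:R); last by rewrite ltr_nat.
rewrite -[in leRHS](card_ord k) -sum1_card natr_sum; apply: ler_sum => m _.
exact: jumped_le1.
Qed.

Lemma jumped_adapted k t : 0 <= t -> adapted t (jumped T k t).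
Proof.
move=> t0; apply/adaptedP.
pose F w := (counting_process T Z ord0 t w + counting_process T Z ord_max t w)%E.
have mF : measurable_fun (setT : set (g_sigma_algebraType (gen t))) F.
  by apply: emeasurable_funD; apply: counting_adapted; rewrite t0 lexx.
rewrite (_ : jumped T k t = \1_[set w | (k.+1%:R%:E <= F w)%E]); last first.
  apply/funext => w; rewrite /jumped indicE jumped_counting.
  by congr (nat_of_bool _)%:R; apply/idP/idP => [?|/set_mem//]; apply/mem_set.
apply: measurable_indic; rewrite -[X in measurable X]setTI.
exact: emeasurable_fun_c_infty.
Qed.

End history_adapted.

#[local] Opaque Phi mass.

(** * The compensated sum and difference of a Hawkes process *)

Section hawkes_martingale.
Context {R : realType} {d : measure_display} {Omega : measurableType d}.
Variable P : probability Omega R.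
Variables (T : nat -> Omega -> \bar R) (Z : nat -> Omega -> 'I_2).
Variable phi : R -> R.
Hypothesis phi_meas : measurable_fun (`[0, +oo[ : set R) phi.
Hypothesis phi_ge0 : forall t, 0 <= t -> 0 <= phi t.
Hypothesis phi_lt1 : (\int[lebesgue_measure]_(t in `[0%R, +oo[) (phi t)%:E < 1)%E.
Variable nu : R.
Hypothesis nu_ge0 : 0 <= nu.
Hypothesis hawkes : hawkes_process T Z P (fun i t w =>
  let j := if i == ord0 then ord_max else ord0 in
  nu%:E + \int[jump_measure T Z j w]_(s in `]0%R, t[) (phi (t - s))%:E)%E.

Let mt : marked_times T Z. Proof. by case: hawkes. Qed.

(* [eps = 1] gives the total number of jumps, [eps = -1] the difference [N_1 - N_2]. *)
Definition weight (eps : R) (i : 'I_2) : R := if i == ord0 then 1 else eps.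

Definition jumps n eps t w : R := \sum_(k < n.+1) weight eps (Z k w) * jumped T k t w.

(** The share of jump [k] in the integrated intensity of the opposite component, stopped at
    [T n]. *)
Definition memory k n t w : R :=
  jumped T k t w * Phi phi (stopped T n t w - fine (T k w)).

Definition memories n eps t w : R := \sum_(k < n.+1) weight eps (Z k w) * memory k n t w.

(** Each component excites the other, so [N_1 + eps N_2] is driven by [N_2 + eps N_1], which is
    [eps (N_1 + eps N_2)] because [eps^2 = 1]. *)
Definition drift n eps t w : R :=
  (1 + eps) * nu * stopped T n t w + eps * memories n eps t w.

Definition hmart n eps t w : R := jumps n eps t w - drift n eps t w.

(** Before a finite jump time [Phi] already vanishes, so the jump indicator acts at infinite times
    alone, where [fine] returns 0. In this form monotonicity and modulus of continuity in [t] are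
    inherited from [Phi]. *)
Lemma memory_stopped k n t w : (k <= n)%N -> 0 <= t ->
  memory k n t w = if (T k w < +oo)%E then Phi phi (stopped T n t w - fine (T k w)) else 0.
Proof.
move=> kn t0; rewrite /memory; have T0 := jump_time_gt0 mt k w.
case: ifPn => [h|]; last first.
  by rewrite -leNgt leye_eq => /eqP Tk; rewrite /jumped Tk leNgt ltry/= mul0r.
rewrite /jumped; case: leP => h'; first by rewrite mul1r.
rewrite mul0r Phi_le0// subr_le0; have := stopped_le mt n w t0.
by move=> s1; rewrite (le_trans s1)// -lee_fin fineK ?(ltW h')// ge0_fin_numE// ltW.
Qed.

Lemma memory_itv k n t w : 0 <= memory k n t w <= mass phi.
Proof.
have /andP[p0 p1] := Phi_itv phi_meas phi_ge0 phi_lt1 (stopped T n t w - fine (T k w)).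
have j0 := jumped_ge0 T k t w; have j1 := jumped_le1 T k t w.
by rewrite /memory mulr_ge0//= -[leRHS]mul1r ler_pM.
Qed.

Lemma memory_nd k n t t' w : (k <= n)%N -> 0 <= t -> t <= t' -> memory k n t w <= memory k n t' w.
Proof.
move=> kn t0 tt; have t0' := le_trans t0 tt.
rewrite (memory_stopped w kn t0) (memory_stopped w kn t0').
have h1 := stopped_nd mt n w t0 tt.
case: (T k w < +oo)%E; last exact: lexx.
apply: (Phi_nd phi_meas phi_ge0 phi_lt1).
by rewrite lerD2r.
Qed.

Lemma memory_unif k n t t' w e del : (k <= n)%N -> 0 <= t -> t <= t' -> t' <= t + del -> 0 <= e ->
  (forall x y, x <= y -> y <= x + del -> Phi phi y - Phi phi x <= e) ->
  memory k n t' w - memory k n t w <= e.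
Proof.
move=> kn t0 tt td e0 he; have t0' := le_trans t0 tt.
rewrite (memory_stopped w kn t0) (memory_stopped w kn t0').
case: (T k w < +oo)%E; last by rewrite subrr.
have h1 := stopped_nd mt n w t0 tt; have h2 := stopped_lip mt n w t0 tt.
apply: he; lra.
Qed.

Lemma weight1 i : weight 1 i = 1. Proof. by rewrite /weight if_same. Qed.

Definition marginal (i : 'I_2) n t w :=
  \sum_(k < n.+1) (Z k w == i)%:R * jumped T k t w - (nu * stopped T n t w +
    \sum_(k < n.+1) (Z k w == if i == ord0 then ord_max else ord0)%:R * memory k n t w).

Section signed.
Variable eps : R.
Hypothesis eps2 : eps * eps = 1.

Let weight_norm i : `|weight eps i| = 1.
Proof.
rewrite /weight; case: ifP => _; first exact: normr1.
by apply/eqP; rewrite -(pexpr_eq1 (n := 2))// -normrX expr2 eps2 normr1.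
Qed.

Lemma hmart_marginals n t w : hmart n eps t w = marginal ord0 n t w + eps * marginal ord_max n t w.
Proof.
rewrite /hmart /drift.
have -> : jumps n eps t w = \sum_(k < n.+1) (Z k w == ord0)%:R * jumped T k t w
    + eps * \sum_(k < n.+1) (Z k w == ord_max)%:R * jumped T k t w.
  rewrite mulr_sumr -big_split; apply: eq_bigr => k _; rewrite /weight.
  by case: (Z k w) => [[|[|//]] h]; rewrite -!val_eqE/=; ring.
have e : eps * memories n eps t w = \sum_(k < n.+1) (Z k w == ord_max)%:R * memory k n t w
    + eps * \sum_(k < n.+1) (Z k w == ord0)%:R * memory k n t w.
  rewrite /memories !mulr_sumr -big_split; apply: eq_bigr => k _; rewrite /weight.
  case: (Z k w) => [[|[|//]] h]; rewrite -!val_eqE/=; first by ring.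
  by rewrite mulrA eps2; ring.
rewrite e /marginal /=; ring.
Qed.

Definition intensity_residual (i : 'I_2) n (t : R) w : \bar R := (let u := fine (Order.min t%:E (T n w)) in
  counting_process T Z i u w - \int[lebesgue_measure]_(s in `[0%R, u])
    (let j := if i == ord0 then ord_max else ord0 in
    nu%:E + \int[jump_measure T Z j w]_(x in `]0%R, s[) (phi (s - x))%:E))%E.

Let procE (i : 'I_2) n t w : 0 <= t -> intensity_residual i n t w = (marginal i n t w)%:E.
Proof.
move=> t0; rewrite /intensity_residual /= -/(stopped T n t w) counting_stopped//.
set j := if _ then _ else _.
rewrite (integral_intensity mt phi_meas phi_ge0 phi_lt1 j nu_ge0 (stopped_ge0 mt n w t0) (stopped_leT mt n w t0)).
rewrite -EFinB; congr (_%:E); congr (_ - (_ + _)); apply: eq_bigr => k _.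
by rewrite -mulrA (jumped_stopped mt)// -ltnS.
Qed.

Let procE_fun i n t : 0 <= t -> intensity_residual i n t = EFin \o marginal i n t.
Proof. by move=> t0; apply/funext => w; exact: procE. Qed.

Let proc_mart i n : martingale P (history T Z) (intensity_residual i n).
Proof. have [_ h] := hawkes; exact: (h n i). Qed.

Let marginal_adapted i n t : 0 <= t -> adapted T Z t (marginal i n t).
Proof.
move=> t0 B mB; have [h _ _] := proc_mart i n.
have := h t t0 (EFin @` B) (measurable_image_EFin mB).
rewrite (procE_fun i n t0); congr (history _ _ _ _); apply/seteqP; split=> w /=.
  by move=> [b Bb] [<-].
by move=> Bb; exists (marginal i n t w).
Qed.

Let marginal_mart i n s t A : 0 <= s -> s <= t -> history T Z s A ->
  Ex P (fun w => (marginal i n t w - marginal i n s w) * \1_A w) = 0.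
Proof.
move=> s0 st hA; have t0 := le_trans s0 st.
have [_ h2 /(_ s t s0 st A hA)] := proc_mart i n.
have mA := history_measurable mt hA.
have i1 := h2 t t0; have i2 := h2 s s0; rewrite (procE_fun i n t0) in i1; rewrite (procE_fun i n s0) in i2.
have b1 : bmf (\1_A : Omega -> R) by exact: bmf_indic.
have c r : ibl P (marginal i n r) -> (\int[P]_(w in A) (EFin \o marginal i n r) w
    = (Ex P (fun w => marginal i n r w * \1_A w))%:E)%E.
  move=> ir; rewrite /Ex /Rintegral fineK; last first.
    by apply: integrable_fin_num => //; exact: (iblMb ir b1).
  rewrite [LHS]integral_mkcond. congr (integral _ _ _).
  apply/funext => w; rewrite patchE indicE; by case: (_ \in _) => /=; rewrite ?mulr1 ?mulr0.
rewrite (procE_fun i n t0) (procE_fun i n s0) => h0.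
have h := etrans (esym (c t i1)) (etrans h0 (c s i2)).
have {}h := EFin_inj h.
transitivity (Ex P (fun w => marginal i n t w * \1_A w - marginal i n s w * \1_A w)).
  by congr (Ex P _); apply/funext => w; rewrite mulrBl.
rewrite ExB; [|exact: iblMb i1 b1|exact: iblMb i2 b1].
by apply/eqP; rewrite subr_eq0; apply/eqP; exact: h.
Qed.

Let marginal_bound i n t w : 0 <= t -> `|marginal i n t w| <= n.+1%:R + (nu * t + n.+1%:R).
Proof.
move=> t0.
have S (f : nat -> R) (j : 'I_2) : (forall k, 0 <= f k <= 1) ->
    0 <= \sum_(k < n.+1) (Z k w == j)%:R * f k <= n.+1%:R.
  move=> f01; rewrite sumr_ge0 ?andTb/=; last first.
    by move=> k _; have /andP[? _] := f01 k; rewrite mulr_ge0.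
  rewrite -[in leRHS](card_ord n.+1) -sum1_card natr_sum; apply: ler_sum => k _.
  have /andP[? ?] := f01 k; case: eqP => _ /=; by rewrite ?mul1r ?mul0r.
have /andP[a0 a1] := S (fun k => jumped T k t w) i
  (fun k => introT andP (conj (jumped_ge0 T k t w) (jumped_le1 T k t w))).
have /andP[b0 b1] : 0 <= \sum_(k < n.+1) (Z k w == if i == ord0 then ord_max else ord0)%:R * memory k n t w <= n.+1%:R.
  apply: (S (fun k => memory k n t w)) => k; have /andP[-> h]/= := memory_itv k n t w.
  by rewrite (le_trans h)// ltW// mass_lt1.
have c0 := mulr_ge0 nu_ge0 (stopped_ge0 mt n w t0).
have c1 : nu * stopped T n t w <= nu * t by rewrite ler_wpM2l// (stopped_le mt).
rewrite /marginal ler_norml; apply/andP; split; lra.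
Qed.

Let marginal_bmf i n t : 0 <= t -> bmf (marginal i n t).
Proof.
move=> t0; split; first by have := adapted_measurable mt (marginal_adapted i n t0).
by eexists => w; exact: marginal_bound.
Qed.

Lemma hmartE n t : hmart n eps t = fun w => marginal ord0 n t w + eps * marginal ord_max n t w.
Proof. by apply/funext => w; exact: hmart_marginals. Qed.

Lemma hmart_bmf n t : 0 <= t -> bmf (hmart n eps t).
Proof.
by move=> t0; rewrite hmartE; apply: bmfD; [|apply: bmfM; [exact: bmf_cst|]]; exact: marginal_bmf.
Qed.

Lemma hmart_adapted n t : 0 <= t -> adapted T Z t (hmart n eps t).
Proof.
move=> t0; have a := adapted_adaptedness T Z.
rewrite hmartE; apply: (adD a); first exact: marginal_adapted.
by apply: (adM a); [exact: (ad_cst a)|exact: marginal_adapted].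
Qed.

(** The definition tests martingales on events. Level sets of an adapted [H] are such events, and
    [Ex_layer_bmf] extends the test to [H]. *)
Lemma hmart_mart n s t H : 0 <= s -> s <= t -> adapted T Z s H -> bmf H ->
  Ex P (fun w => H w * (hmart n eps t w - hmart n eps s w)) = 0.
Proof.
move=> s0 st aH bH; have t0 := le_trans s0 st.
have bi r (r0 : 0 <= r) := hmart_bmf n r0.
have bci i r (r0 : 0 <= r) := marginal_bmf i n r0.
have key A : history T Z s A -> Ex P (fun w => (hmart n eps t w - hmart n eps s w) * \1_A w) = 0.
  move=> hA; have b1 : bmf (\1_A : Omega -> R) by apply: bmf_indic; exact: history_measurable hA.
  have ? := bci ord0 _ s0; have ? := bci ord0 _ t0.
  have ? := bci ord_max _ s0; have ? := bci ord_max _ t0.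
  transitivity (Ex P (fun w => (marginal ord0 n t w - marginal ord0 n s w) * \1_A w +
      eps * ((marginal ord_max n t w - marginal ord_max n s w) * \1_A w))).
    congr (Ex P _); apply/funext => w; rewrite !hmart_marginals.
    set x1 := marginal _ _ _ _; set x2 := marginal _ _ _ _; set x3 := marginal _ _ _ _.
    by set x4 := marginal _ _ _ _; ring.
  rewrite ExD; [|by apply: bmf_ibl; bm|by apply: bmf_ibl; bm].
  rewrite ExZ; last by apply: bmf_ibl; bm.
  by rewrite !marginal_mart// mulr0 addr0.
transitivity (Ex P (fun w => (hmart n eps t w - hmart n eps s w) * H w)).
  by congr (Ex P _); apply/funext => w; rewrite mulrC.
have a1 : adapted T Z s (fun=> 0) := ad_cst (adapted_adaptedness T Z) s 0.
have sT : history T Z s setT := a1 setT measurableT.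
apply: Ex_layer_bmf => //.
- by apply: bmfB; exact: bi.
- rewrite -[RHS](key setT sT); congr (Ex P _); apply/funext => w.
  by rewrite indicE in_setT mulr1.
- move=> r; apply: key.
  rewrite (_ : [set w | r <= H w] = H @^-1` `[r, +oo[%classic); first exact: aH.
  by apply/seteqP; split=> w /=; rewrite in_itv/= andbT.
Qed.

Lemma jumps_nd n t t' w : t <= t' ->
  `|jumps n eps t' w - jumps n eps t w| <= jumps n 1 t' w - jumps n 1 t w.
Proof.
move=> tt; rewrite /jumps -!sumrB (le_trans (ler_norm_sum _ _ _))//.
apply: ler_sum => k _; rewrite -!mulrBr normrM weight_norm weight1 !mul1r.
by rewrite ger0_norm// subr_ge0 jumped_nd.
Qed.

Lemma drift_nd n t t' w : 0 <= t -> t <= t' ->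
  `|drift n eps t' w - drift n eps t w| <= drift n 1 t' w - drift n 1 t w.
Proof.
move=> t0 tt; have e1 : `|eps| = 1 by have := weight_norm ord_max; rewrite /weight.
have s1 := stopped_nd mt n w t0 tt.
have h : `|memories n eps t' w - memories n eps t w| <= memories n 1 t' w - memories n 1 t w.
  rewrite /memories -!sumrB (le_trans (ler_norm_sum _ _ _))//.
  apply: ler_sum => k _; rewrite -!mulrBr normrM weight_norm weight1 !mul1r.
  by rewrite ger0_norm// subr_ge0 memory_nd// -ltnS.
rewrite (_ : drift n eps t' w - _ = (1 + eps) * (nu * (stopped T n t' w - stopped T n t w))
  + eps * (memories n eps t' w - memories n eps t w)); last by rewrite /drift; ring.
rewrite (_ : drift n 1 t' w - _ = 2 * (nu * (stopped T n t' w - stopped T n t w))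
  + (memories n 1 t' w - memories n 1 t w)); last by rewrite /drift; ring.
rewrite (le_trans (ler_normD _ _))// !normrM e1 mul1r lerD//.
apply: ler_pM => //; first by rewrite (le_trans (ler_normD _ _))// normr1 e1.
by rewrite !ger0_norm ?subr_ge0.
Qed.

Lemma jumps_itv n t w : 0 <= jumps n 1 t w <= n.+1%:R.
Proof.
rewrite /jumps; apply/andP; split.
  by apply: sumr_ge0 => k _; rewrite weight1 mul1r jumped_ge0.
rewrite -[in leRHS](card_ord n.+1) -sum1_card natr_sum; apply: ler_sum => k _.
by rewrite weight1 mul1r jumped_le1.
Qed.

Lemma memories_itv n t w : 0 <= memories n 1 t w <= n.+1%:R.
Proof.
rewrite /memories; apply/andP; split.
  by apply: sumr_ge0 => k _; rewrite weight1 mul1r; have /andP[] := memory_itv k n t w.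
rewrite -[in leRHS](card_ord n.+1) -sum1_card natr_sum; apply: ler_sum => k _.
rewrite weight1 mul1r; have /andP[_ h] := memory_itv k n t w.
by rewrite (le_trans h)// ltW// mass_lt1.
Qed.

Lemma jumps_simple n w : exists2 del, 0 < del & forall t t', 0 <= t -> t <= t' -> t' <= t + del ->
  (jumps n 1 t' w - jumps n 1 t w = 0 \/ jumps n 1 t' w - jumps n 1 t w = 1) /\
  (jumps n eps t' w - jumps n eps t w) ^+ 2 = jumps n 1 t' w - jumps n 1 t w.
Proof.
(* The window is the least gap between consecutive finite jump times, with 1 as default when the
   next time is infinite; two jumps in []t, t + del]] would be closer than their gap allows. *)
pose gap k := if (T k.+1 w < +oo)%E then fine (T k.+1 w) - fine (T k w) else 1.
have Tfin k : (T k w < +oo)%E -> T k w = (fine (T k w))%:E.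
  by move=> h; rewrite fineK// ge0_fin_numE// ltW// (jump_time_gt0 mt).
have gap0 k : 0 < gap k.
  rewrite /gap; case: ifP => // h.
  have h1 : (T k w < +oo)%E by apply: le_lt_trans h; exact: (jump_time_nd mt).
  by rewrite subr_gt0 -lte_fin -!Tfin//; apply: (jump_time_lt mt).
exists (\big[Num.min/1]_(i < n) gap i); first by apply/lt_bigmin.
move=> t t' t0 tt td.
pose D k := jumped T k t' w - jumped T k t w.
have D01 k : D k = 0 \/ (D k = 1 /\ ((t%:E < T k w)%E /\ (T k w <= t'%:E)%E)).
  rewrite /D /jumped; case: (leP (T k w) t'%:E) => h1; case: (leP (T k w) t%:E) => h2.
  - by left; rewrite subrr.
  - by right; rewrite subr0.
  - by have := lt_le_trans h1 h2; rewrite lte_fin ltNge tt.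
  - by left; rewrite subrr.
have uniq_D i j : (i < j)%N -> (j <= n)%N -> D i = 1 -> D j = 1 -> False.
  move=> ij jn Di Dj; have [e|[_ [ti _]]] := D01 i; first by move: Di; rewrite e => /esym/eqP; rewrite oner_eq0.
  have [e|[_ [_ tj]]] := D01 j; first by move: Dj; rewrite e => /esym/eqP; rewrite oner_eq0.
  have fj : (T j w < +oo)%E by rewrite (le_lt_trans tj) ?ltry.
  have fi1 : (T i.+1 w < +oo)%E by apply: le_lt_trans fj; exact: (jump_time_nd mt).
  have fi : (T i w < +oo)%E by apply: le_lt_trans fi1; exact: (jump_time_nd mt).
  have i_n : (i < n)%N by exact: leq_trans jn.
  have : \big[Num.min/1]_(i < n) gap i <= gap i by apply: (@bigmin_le_cond _ _ _ _ (Ordinal i_n)).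
  have ij' : fine (T i.+1 w) <= fine (T j w).
    by rewrite -lee_fin -!Tfin//; exact: (jump_time_nd mt).
  have ti' : t < fine (T i w) by rewrite -lte_fin -Tfin.
  have tj' : fine (T j w) <= t' by rewrite -lee_fin -Tfin.
  rewrite /gap fi1 => hg.
  lra.
have e1 : jumps n 1 t' w - jumps n 1 t w = \sum_(k < n.+1) D k.
  by rewrite /jumps -sumrB; apply: eq_bigr => k _; rewrite !weight1 !mul1r.
have e2 : jumps n eps t' w - jumps n eps t w = \sum_(k < n.+1) weight eps (Z k w) * D k.
  by rewrite /jumps -sumrB; apply: eq_bigr => k _; rewrite mulrBr.
rewrite e1 e2.
have [[k0 Dk0]|noD] := pselect (exists k : 'I_n.+1, D k = 1); last first.
  have D0 (k : 'I_n.+1) : D k = 0.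
    by have [//|[h _]] := D01 k; exfalso; apply: noD; exists k.
  have z1 : \sum_(k < n.+1) D k = 0 by apply: big1 => k _; exact: D0.
  have z2 : \sum_(k < n.+1) weight eps (Z k w) * D k = 0 by apply: big1 => k _; rewrite D0 mulr0.
  by rewrite z1 z2 expr0n; split=> //; left.
have D0 (k : 'I_n.+1) : k != k0 -> D k = 0.
  move=> kk; have [//|[h _]] := D01 k; exfalso.
  have [lt|lt|e] := ltngtP k k0.
  - by apply: (uniq_D k k0) => //; rewrite -ltnS.
  - by apply: (uniq_D k0 k) => //; rewrite -ltnS.
  - by move/eqP: kk; apply; exact: val_inj.
have z1 : \sum_(k < n.+1) D k = 1.
  rewrite (bigD1 k0 isT) big1 /=; first by rewrite Dk0 addr0.
  by move=> k kk; exact: D0.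
have z2 : \sum_(k < n.+1) weight eps (Z k w) * D k = weight eps (Z k0 w).
  rewrite (bigD1 k0 isT) big1 /=; first by rewrite Dk0 addr0 mulr1.
  by move=> k kk; rewrite (D0 k kk) mulr0.
rewrite z1 z2; split; first by right.
by rewrite -real_normK ?num_real// weight_norm expr1n.
Qed.

Lemma drift_cont n w e : 0 < e -> exists2 del, 0 < del & forall t t', 0 <= t -> t <= t' ->
  t' <= t + del -> drift n 1 t' w - drift n 1 t w <= e.
Proof.
move=> e0.
pose e' := e / (2 * n.+1%:R).
have n0 : (0 : R) < 2 * n.+1%:R by rewrite mulr_gt0// ltr0n.
have e'0 : 0 < e' by rewrite divr_gt0.
have [d1 d10 h1] := Phi_unif phi_meas phi_ge0 phi_lt1 e'0.
pose d2 := e / (4 * (nu + 1)).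
have d20 : 0 < d2 by rewrite divr_gt0// mulr_gt0// ltr_wpDl.
exists (Num.min d1 d2); first by rewrite lt_min d10.
move=> t t' t0 tt td.
have td1 : t' <= t + d1 by rewrite (le_trans td)// lerD2l ge_min lexx.
have td2 : t' <= t + d2 by rewrite (le_trans td)// lerD2l ge_min lexx orbT.
have a1 : memories n 1 t' w - memories n 1 t w <= e / 2.
  apply: (@le_trans _ _ (\sum_(k < n.+1) e')).
    rewrite /memories -sumrB; apply: ler_sum => k _; rewrite !weight1 !mul1r.
    by apply: memory_unif (ltW e'0) h1 => //; rewrite -ltnS.
  rewrite sumr_const card_ord -[_ *+ _]mulr_natl /e'.
  have : n.+1%:R != 0 :> R by rewrite pnatr_eq0.
  move: (n.+1%:R : R) => N N0; rewrite le_eqVlt; apply/orP; left; apply/eqP; field.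
  exact: N0.
have a2 : nu * (stopped T n t' w - stopped T n t w) <= e / 4.
  apply: (@le_trans _ _ ((nu + 1) * d2)).
    have h := stopped_lip mt n w t0 tt; have h' := stopped_nd mt n w t0 tt.
    apply: ler_pM => //; [by rewrite subr_ge0|by rewrite lerDl|lra].
  rewrite /d2 le_eqVlt; apply/orP; left; apply/eqP; field.
  by rewrite gt_eqF// ltr_wpDl.
rewrite /drift; lra.
Qed.

Lemma drift_itv n t w : 0 <= t -> 0 <= drift n 1 t w <= 2 * nu * t + n.+1%:R.
Proof.
move=> t0; have /andP[m0 m1] := memories_itv n t w.
have c0 := mulr_ge0 nu_ge0 (stopped_ge0 mt n w t0).
have c1 : nu * stopped T n t w <= nu * t by rewrite ler_wpM2l// (stopped_le mt).
rewrite /drift; apply/andP; split; lra.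
Qed.

Lemma jumps_adapted n t : 0 <= t -> adapted T Z t (jumps n 1 t).
Proof.
move=> t0; have a := adapted_adaptedness T Z.
rewrite (_ : jumps n 1 t = fun w => \sum_(k < n.+1) jumped T k t w); last first.
  by apply/funext => w; apply: eq_bigr => k _; rewrite weight1 mul1r.
elim: n.+1 => [|m IH].
  rewrite (_ : (fun _ => _) = fun=> 0); first exact: (ad_cst a).
  by apply/funext => w; rewrite big_ord0.
rewrite (_ : (fun _ => _) = fun w => \sum_(k < m) jumped T k t w + jumped T m t w).
  by apply: (adD a) => //; exact: jumped_adapted.
by apply/funext => w; rewrite big_ord_recr.
Qed.

Lemma jumps_bmf n t : 0 <= t -> bmf (jumps n 1 t).
Proof.
move=> t0; split; first by have := adapted_measurable mt (jumps_adapted n t0).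
by exists n.+1%:R => w; have /andP[h1 h2] := jumps_itv n t w; rewrite ger0_norm.
Qed.

(* Time is frozen at [hz] because [compensated] asks for uniform bounds. *)
Theorem hawkes_compensated n hz : 0 <= hz ->
  compensated P (adapted T Z) (2 * nu * hz + n.+1%:R)
    (fun t => hmart n eps (Num.min t hz)) (fun t => jumps n 1 (Num.min t hz))
    (fun t => jumps n eps (Num.min t hz)) (fun t => drift n eps (Num.min t hz))
    (fun t => drift n 1 (Num.min t hz)).
Proof.
move=> hz0; have a := adapted_adaptedness T Z.
have m0 t : 0 <= t -> 0 <= Num.min t hz by move=> t0; rewrite le_min t0.
have mle t : Num.min t hz <= t by rewrite ge_min lexx.
have mnd t t' : t <= t' -> Num.min t hz <= Num.min t' hz.
  by move=> tt; rewrite le_min !ge_min tt lexx orbT.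
have mdel t t' del : t <= t' -> 0 < del -> t' <= t + del ->
    Num.min t' hz <= Num.min t hz + del.
  by move=> tt d0 td; case: (leP t hz) => h1; case: (leP t' hz) => h2; lra.
split.
- by move=> r r0; split; [exact/hmart_bmf/m0|exact/jumps_bmf/m0].
- move=> r r0; split.
    exact: (ad_mono a (mle r) (hmart_adapted n (m0 r r0))).
  exact: (ad_mono a (mle r) (jumps_adapted n (m0 r r0))).
- move=> r r' H r0 rr aH bH; have [rh|rh] := leP r hz.
    have h : r <= Num.min r' hz by rewrite le_min rr rh.
    exact: hmart_mart.
  rewrite (min_r (_ : hz <= r')); last by rewrite ltW// (lt_le_trans rh).
  rewrite (_ : (fun w => _) = fun=> 0) ?Ex_cst//.
  by apply/funext => w; rewrite subrr mulr0.
- by [].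
- move=> r w r0; have /andP[n1 n2] := jumps_itv n (Num.min r hz) w.
  have /andP[d1 d2] := drift_itv n w (m0 r r0).
  have nh : nu * Num.min r hz <= nu * hz by rewrite ler_wpM2l// ge_min lexx orbT.
  have nh0 : 0 <= nu * hz by rewrite mulr_ge0.
  rewrite n1 d1/=; split; lra.
- by move=> r r' w r0 rr; apply/jumps_nd/mnd.
- by move=> r r' w r0 rr; apply: drift_nd; [exact: m0|exact: mnd].
- move=> w e e0; have [del d0 h] := drift_cont n w e0; exists del; first exact: d0.
  move=> r r' r0 rr rd.
  by apply: h; [exact: m0|exact: mnd|exact: mdel].
- move=> w; have [del d0 h] := jumps_simple n w; exists del; first exact: d0.
  move=> r r' r0 rr rd.
  by apply: h; [exact: m0|exact: mnd|exact: mdel].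
Qed.

End signed.

End hawkes_martingale.

(** * Law of large numbers *)

(* The least bound of [e] on the interval is at most [m0] plus [a] times itself. *)
Lemma contraction_bound {R : realType} (e : R -> R) (a m0 u : R) :
  0 <= a -> a < 1 -> 0 <= u -> (exists C, forall s, 0 <= s <= u -> `|e s| <= C) ->
  (forall C, (forall s, 0 <= s <= u -> `|e s| <= C) ->
    forall s, 0 <= s <= u -> `|e s| <= m0 + a * C) ->
  forall s, 0 <= s <= u -> `|e s| <= m0 / (1 - a).
Proof.
move=> a0 a1 u0 [C0 hC0] h s su.
pose E := [set `|e r| | r in [set r | 0 <= r <= u]].
have sE : has_sup E.
  split; first by exists `|e s|, s.
  by exists C0 => _ [r /= ru <-]; exact: hC0.
have hS r : 0 <= r <= u -> `|e r| <= sup E.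
  by move=> ru; apply: (ub_le_sup sE.2); exists r.
have hS' : sup E <= m0 + a * sup E.
  apply: (ge_sup sE.1) => _ [r /= ru <-]; exact: h.
apply: le_trans (hS s su) _; rewrite ler_pdivlMr ?subr_gt0//; lra.
Qed.

Lemma part_cover {R : realType} (s t : R) p x : (0 < p)%N -> s <= x <= t ->
  exists2 k, (k < p)%N & part s t p k <= x <= part s t p k.+1.
Proof.
move=> p0 /andP[sx xt].
have : forall j, x <= part s t p j -> (0 < j)%N ->
    exists2 k, (k < j)%N & part s t p k <= x <= part s t p k.+1.
  elim=> // j IH xj _; case: (leP (part s t p j) x) => h; first by exists j; rewrite ?ltnSn ?h.
  case: j IH xj h => [|j] IH xj h.
    by exists 0%N => //; rewrite part0 sx xj.
  have [k kj hk] := IH (ltW h) isT.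
  by exists k => //; exact: ltnW.
by move=> /(_ p); rewrite (partp s t p0); apply.
Qed.

(** * Convolution of the kernel with a linear path *)

Section kernel_ramp.
Context {R : realType}.
Variable phi : R -> R.
Hypothesis phi_meas : measurable_fun (`[0, +oo[ : set R) phi.
Hypothesis phi_ge0 : forall t, 0 <= t -> 0 <= phi t.
Hypothesis phi_lt1 : (\int[lebesgue_measure]_(t in `[0%R, +oo[) (phi t)%:E < 1)%E.

Definition ramp (s x : R) : R := Num.max 0 (Num.min x s).

Lemma bmf_ramp s : bmf (ramp s : R -> R).
Proof.
split.
  apply: measurable_maxr; first exact: measurable_cst.
  by apply: measurable_minr => //; exact: measurable_cst.
exists `|s| => x; rewrite ger0_norm; last by rewrite le_max lexx.
by rewrite ge_max normr_ge0/= ge_min ler_norm orbT.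
Qed.

(** For [s >= 0] this is [a s] minus the convolution of [phi] with the positive part of time. It
    would stay bounded if [phi] had a first moment; in general it is [o(s)]. *)
Definition ramp_mean s := kint phi (ramp s).

Lemma ramp_mean_ge0 s : 0 <= ramp_mean s.
Proof.
rewrite -[leLHS](mul0r (mass phi)) -(kint_cst phi_meas phi_ge0 phi_lt1 0).
apply: (kint_le phi_meas phi_ge0 phi_lt1); [exact: bmf_cst|exact: bmf_ramp|].
by move=> x _; rewrite le_max lexx.
Qed.

Lemma ramp_mean_nd s t : s <= t -> ramp_mean s <= ramp_mean t.
Proof.
move=> st; apply: (kint_le phi_meas phi_ge0 phi_lt1); [exact: bmf_ramp..|].
move=> x _; rewrite /ramp ge_max !le_max lexx/=.
by rewrite le_min !ge_min lexx st !orbT.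
Qed.

(** The ramp is at most [A] for lags up to [A], and at most [t] beyond. *)
Lemma ramp_mean_tail A t : 0 <= A -> 0 <= t ->
  ramp_mean t <= A * mass phi + t * (mass phi - Phi phi A).
Proof.
move=> A0 t0.
have b1 := bmf_ind_le A.
have -> : A * mass phi + t * (mass phi - Phi phi A) =
    kint phi (fun x => A + t * (1 - ind_le A x)).
  rewrite (kintD phi_meas phi_ge0 phi_lt1); [|exact: bmf_cst|by bm].
  rewrite (kint_cst phi_meas phi_ge0 phi_lt1) (kintZ phi_meas phi_ge0 phi_lt1); last by bm.
  rewrite (kintB phi_meas phi_ge0 phi_lt1); [|exact: bmf_cst|by []].
  by rewrite (kint_cst phi_meas phi_ge0 phi_lt1) mul1r.
apply: (kint_le phi_meas phi_ge0 phi_lt1); [exact: bmf_ramp|by bm|move=> x x0].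
rewrite /ramp /ind_le; case: (leP x A) => xA.
  by rewrite subrr mulr0 addr0 ge_max A0 ge_min xA.
by rewrite subr0 mulr1 ge_max addr_ge0//= ge_min lerDr A0 orbT.
Qed.

Lemma Phi_tail e : 0 < e -> exists2 A, 0 <= A & forall x, A <= x -> mass phi - Phi phi x <= e.
Proof.
move=> e0; have /cvgrPdist_le/(_ e e0)[n _ /(_ n (leqnn n))/= h] := Phi_cvg phi_meas phi_ge0 phi_lt1.
exists n%:R => // x nx.
have := Phi_nd phi_meas phi_ge0 phi_lt1 nx; have := ler_norm (mass phi - Phi phi n%:R).
lra.
Qed.

Lemma ramp_mean_little e : 0 < e -> exists2 t0, 0 < t0 & forall t, t0 <= t -> ramp_mean t <= e * t.
Proof.
move=> e0; have e2 : 0 < e / 2 by rewrite divr_gt0.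
have [A A0 hA] := Phi_tail e2.
have a0 := mass_ge0 phi_ge0; have a1 := mass_lt1 phi_ge0 phi_lt1.
exists ((A + 1) / (e / 2)); first by rewrite divr_gt0// ltr_wpDl.
move=> t; rewrite ler_pdivrMr// => ht.
have t0 : 0 <= t.
  by rewrite -(pmulr_lge0 _ e2); apply: le_trans ht; rewrite addr_ge0.
have := ramp_mean_tail A0 t0; have := hA A (lexx A).
have : A * mass phi <= A by rewrite -[leRHS]mulr1 ler_wpM2l// ltW.
move: (mass phi - _) => z h1 h2 h3; nra.
Qed.

End kernel_ramp.

#[local] Opaque kint.

Section law_of_large_numbers.
Context {R : realType} {d : measure_display} {Omega : measurableType d}.
Variable P : probability Omega R.
Variables (T : nat -> Omega -> \bar R) (Z : nat -> Omega -> 'I_2).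
Variable phi : R -> R.
Hypothesis phi_meas : measurable_fun (`[0, +oo[ : set R) phi.
Hypothesis phi_ge0 : forall t, 0 <= t -> 0 <= phi t.
Hypothesis phi_lt1 : (\int[lebesgue_measure]_(t in `[0%R, +oo[) (phi t)%:E < 1)%E.
Variable nu : R.
Hypothesis nu_ge0 : 0 <= nu.
Hypothesis hawkes : hawkes_process T Z P (fun i t w =>
  let j := if i == ord0 then ord_max else ord0 in
  nu%:E + \int[jump_measure T Z j w]_(s in `]0%R, t[) (phi (t - s))%:E)%E.

Let mt : marked_times T Z. Proof. by case: hawkes. Qed.

Local Notation a := (mass phi).
Local Notation U := (stopped T).
Local Notation N n t := (jumps T Z n 1 t).
Local Notation M n eps t := (hmart T Z phi nu n eps t).

Let a0 : 0 <= a. Proof. exact: (mass_ge0 phi_ge0). Qed.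
Let a1 : a < 1. Proof. exact: (mass_lt1 phi_ge0 phi_lt1). Qed.

(** The solution of [c = 2 nu + a c]: the long-run growth rate of the total number of jumps. *)
Definition rate : R := 2 * nu / (1 - a).

Lemma rate_ge0 : 0 <= rate.
Proof. by rewrite divr_ge0 ?mulr_ge0 ?subr_ge0 ?(ltW a1)//. Qed.

Lemma rateE : rate = 2 * nu + a * rate.
Proof. rewrite /rate; field; by rewrite gt_eqF// subr_gt0. Qed.

Lemma jumped_shift k y w : (fun x => jumped T k (y - x) w) =
  if (T k w < +oo)%E then ind_le (y - fine (T k w)) else fun=> 0.
Proof.
apply/funext => x; have T0 := jump_time_gt0 mt k w; rewrite /jumped.
case: ifPn => [Tk|]; last by rewrite -leNgt leye_eq => /eqP ->; rewrite leNgt ltry.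
rewrite /ind_le -[T k w](@fineK) ?ge0_fin_numE ?(ltW T0)// lee_fin/=.
by congr (nat_of_bool _)%:R; apply/idP/idP => h; lra.
Qed.

Lemma bmf_jumped_shift k y w : bmf (fun x : R => jumped T k (y - x) w).
Proof. by rewrite jumped_shift; case: ifP => _; [exact: bmf_ind_le|exact: bmf_cst]. Qed.

Lemma jumps_shift n eps y w : bmf (fun x : R => jumps T Z n eps (y - x) w).
Proof.
by apply: bmf_sum => k; apply: bmfM; [exact: bmf_cst|exact: bmf_jumped_shift].
Qed.

Lemma memory_kint k n t w : (k <= n)%N -> 0 <= t ->
  memory T phi k n t w = kint phi (fun x => jumped T k (U n t w - x) w).
Proof.
move=> kn t0; rewrite (memory_stopped phi_meas phi_ge0 phi_lt1 hawkes w kn t0) jumped_shift.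
by case: (T k w < +oo)%E => //; rewrite (kint_cst phi_meas phi_ge0 phi_lt1) mul0r.
Qed.

(** The sum over jumps read as a convolution with the counting path; this is what turns the
    decomposition of the path into a renewal equation. *)
Lemma memories_kint n eps t w : 0 <= t ->
  memories T Z phi n eps t w = kint phi (fun x => jumps T Z n eps (U n t w - x) w).
Proof.
move=> t0; transitivity (\sum_(k < n.+1) weight eps (Z k w) *
    kint phi (fun x => jumped T k (U n t w - x) w)).
  by apply: eq_bigr => k _; rewrite memory_kint// -ltnS.
have h k : bmf (fun x : R => jumped T k (U n t w - x) w) by exact: bmf_jumped_shift.
exact: (esym (kint_sum phi_meas phi_ge0 phi_lt1 n.+1 (fun k => weight eps (Z k w)) h)).
Qed.

Lemma jumps_stopped n eps t w : 0 <= t -> jumps T Z n eps (U n t w) w = jumps T Z n eps t w.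
Proof.
by move=> t0; apply: eq_bigr => k _; rewrite (jumped_stopped mt)// -ltnS.
Qed.

Lemma jumps_le0 n eps t w : t <= 0 -> jumps T Z n eps t w = 0.
Proof.
move=> t0; apply: big1 => k _; rewrite /jumped leNgt.
rewrite (le_lt_trans (y := 0%E)) ?mulr0//.
exact: jump_time_gt0 mt k w.
Qed.

Lemma hmart0 n eps w : M n eps 0 w = 0.
Proof.
rewrite /hmart /drift jumps_le0//.
have -> : memories T Z phi n eps 0 w = 0.
  apply: big1 => k _; rewrite /memory /jumped leNgt (jump_time_gt0 mt k w).
  by rewrite mul0r mulr0.
have -> : U n 0 w = 0.
  by apply/le_anti; rewrite (stopped_ge0 mt)// (stopped_le mt).
by rewrite !mulr0 addr0 subrr.
Qed.

Let one_sqr : (1 : R) * 1 = 1. Proof. exact: mulr1. Qed.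

Lemma stopped_bmf n t : 0 <= t -> bmf (U n t).
Proof.
move=> t0; split; last first.
  by exists t => w; rewrite ger0_norm ?(stopped_ge0 mt)// (stopped_le mt).
apply: measurableT_comp => //; apply: measurable_mine; first exact: measurable_cst.
by case: mt.
Qed.

(** Each jump adds at most [a] to the compensator, so [E N <= 2 nu t + a E N]; the stopped count is
    bounded, so its mean is finite and can be moved to the left. *)
Lemma Ex_jumps n t : 0 <= t -> Ex P (N n t) <= rate * t.
Proof.
move=> t0; have bN := jumps_bmf hawkes n t0.
have bM := hmart_bmf phi_meas phi_ge0 phi_lt1 nu_ge0 hawkes one_sqr n t0.
have M0 : Ex P (M n 1 t) = 0.
  rewrite -[RHS](hmart_mart phi_meas phi_ge0 phi_lt1 nu_ge0 hawkes one_sqr n (lexx 0) t0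
    (ad_cst (adapted_adaptedness T Z) 0 1) (bmf_cst 1)).
  by congr (Ex P _); apply/funext => w; rewrite mul1r hmart0 subr0.
have h : Ex P (N n t) <= Ex P (fun w => 2 * nu * t + a * N n t w + M n 1 t w).
  apply: Ex_le; [exact: bmf_ibl|by apply: bmf_ibl; bm|move=> w].
  have e : N n t w = drift T Z phi nu n 1 t w + M n 1 t w by rewrite /hmart; ring.
  rewrite [leLHS]e lerD2r /drift mul1r; apply: lerD.
    by rewrite -!mulrA !ler_wpM2l// ?mulr_ge0// ?(stopped_le mt)//.
  rewrite /memories /jumps mulr_sumr; apply: ler_sum => k _.
  rewrite weight1 !mul1r /memory mulrC; apply: ler_wpM2r; first exact: jumped_ge0.
  by have /andP[] := Phi_itv phi_meas phi_ge0 phi_lt1 (U n t w - fine (T k w)).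
move: h; rewrite ExD; [|by apply: bmf_ibl; bm|exact: bmf_ibl].
rewrite ExD; [|by apply: bmf_ibl; bm|by apply: bmf_ibl; bm].
rewrite Ex_cst M0 ExZ; last exact: bmf_ibl bN.
move: (Ex P (N n t)) => x h; rewrite /rate mulrAC ler_pdivlMr ?subr_gt0//; lra.
Qed.

Lemma Pr_time_le n t : 0 <= t -> Pr P [set w | (T n w <= t%:E)%E] <= rate * t / n.+1%:R.
Proof.
move=> t0; rewrite ler_pdivlMr ?ltr0n// mulrC.
apply: le_trans (Ex_jumps n t0); apply: Pr_markov.
- rewrite -[X in measurable X]setTI.
  by apply: emeasurable_fun_infty_c => //; case: mt.
- exact/bmf_ibl/(jumps_bmf hawkes n t0).
- by move=> w; have /andP[] := jumps_itv T Z n t w.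
- move=> w /= Tn; rewrite /jumps.
  rewrite -[in leLHS](card_ord n.+1) -sum1_card natr_sum; apply: ler_sum => k _.
  rewrite weight1 mul1r /jumped (le_trans (jump_time_nd mt w _) Tn)//.
  by rewrite -ltnS.
Qed.

Lemma Ex_hmart_sqr n eps t : eps * eps = 1 -> 0 <= t -> Ex P (fun w => M n eps t w ^+ 2) <= rate * t.
Proof.
move=> e2 t0; have c := hawkes_compensated phi_meas phi_ge0 phi_lt1 nu_ge0 hawkes e2 n t0.
have := comp_variance (adapted_adaptedness T Z) c (lexx 0) t0
  (ad_cst (adapted_adaptedness T Z) 0 1) (bmf_cst 1).
rewrite minxx min_l// => h; apply: le_trans (Ex_jumps n t0).
have bM := hmart_bmf phi_meas phi_ge0 phi_lt1 nu_ge0 hawkes e2 n t0.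
have bN := jumps_bmf hawkes n t0.
rewrite -subr_le0 -ExB; [|by apply: bmf_ibl; bm|exact: bmf_ibl].
rewrite -h le_eqVlt; apply/orP; left; apply/eqP; congr (Ex P _); apply/funext => w.
by rewrite hmart0 (jumps_le0 n 1 w (lexx 0)) !subr0 mul1r.
Qed.

(** The error [e s = N s - rate s] solves [e = M + phi * e - rate ramp_mean], and convolution with
    [phi] contracts by [a < 1]. [M] is controlled on a grid; between grid points the monotonicity of
    [N] costs [rate t / p]. *)
Lemma law_of_large_numbers_path n t p w : 0 <= t -> (0 < p)%N ->
  `|N n t w - rate * U n t w| <=
  (runmax (fun k => `|M n 1 (Num.min (part 0 t p k) t) w|) p
   + rate * (ramp_mean phi t + t / p%:R)) / (1 - a).
Proof.
move=> t0 p0; set u := U n t w.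
have u0 : 0 <= u by exact: (stopped_ge0 mt).
have c0 := rate_ge0.
(* The positive part of time makes [e] vanish at negative times, where the convolution reads it. *)
pose e s := N n s w - rate * Num.max 0 s.
have uu : 0 <= u <= u by rewrite u0 lexx.
have eu : N n t w - rate * u = e u.
  by rewrite /e jumps_stopped// (max_r u0).
rewrite eu; set m0 := (X in X / _).
have tk k : 0 <= part 0 t p k by exact: part_ge.
pose g k := Num.min (part 0 t p k) t.
have g0 k : 0 <= g k by rewrite le_min tk.
have gt_ k : g k <= t by rewrite ge_min lexx orbT.
have su k : 0 <= U n (g k) w <= u by rewrite (stopped_ge0 mt)//= (stopped_nd mt).
apply: (contraction_bound a0 a1 u0 _ _ uu).
  exists (n.+1%:R + rate * u) => s /andP[s0 su'].
  have /andP[n1 n2] := jumps_itv T Z n s w.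
  have h1 : rate * s <= rate * u by rewrite ler_wpM2l.
  have h2 : 0 <= rate * s by rewrite mulr_ge0.
  have h3 : (0 : R) <= n.+1%:R by exact: ler0n.
  rewrite /e (max_r s0) ler_norml; apply/andP; split; lra.
move=> C hC.
have grid k : (k <= p)%N -> `|e (U n (g k) w)| <=
    runmax (fun k => `|M n 1 (g k) w|) p + rate * ramp_mean phi t + a * C.
  move=> kp; set s := U n (g k) w; have /andP[s0 su'] := su k; rewrite -/s in s0 su'.
  pose h x := N n (s - x) w - (rate * s - rate * ramp s x).
  have bh : bmf (h : R -> R).
    by have ? := jumps_shift n 1 s w; have ? := bmf_ramp s; rewrite /h; bm.
  have hC' x : 0 < x -> `|h x| <= C.
    move=> x0; rewrite /h /ramp; case: (leP x s) => xs.
      have hx : 0 <= s - x <= u by rewrite subr_ge0 xs; lra.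
      have := hC _ hx; rewrite /e (max_r (_ : 0 <= s - x)) ?subr_ge0//.
      by rewrite (max_r (ltW x0)) mulrBr.
    rewrite (max_r s0) jumps_le0 ?subr_le0 ?(ltW xs)//.
    by rewrite !subrr normr0; apply: le_trans (hC s _); rewrite ?s0.
  have kh : kint phi h = memories T Z phi n 1 (g k) w - a * (rate * s) + rate * ramp_mean phi s.
    rewrite memories_kint// /h.
    have b1 := jumps_shift n 1 s w; have b2 := bmf_ramp s.
    rewrite (kintB phi_meas phi_ge0 phi_lt1) //; last by bm.
    rewrite (kintB phi_meas phi_ge0 phi_lt1); [|exact: bmf_cst|by bm].
    rewrite (kint_cst phi_meas phi_ge0 phi_lt1) (kintZ phi_meas phi_ge0 phi_lt1)// /ramp_mean.
    rewrite -/s; ring.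
  have -> : e s = M n 1 (g k) w + kint phi h - rate * ramp_mean phi s.
    rewrite kh /e (max_r s0) {1}/s jumps_stopped// /hmart /drift -/s {1}rateE; ring.
  have r1 : 0 <= ramp_mean phi s by exact: (ramp_mean_ge0 phi_meas phi_ge0 phi_lt1).
  have r2 : ramp_mean phi s <= ramp_mean phi t.
    apply: (ramp_mean_nd phi_meas phi_ge0 phi_lt1); apply: le_trans su' _; exact: (stopped_le mt).
  have r3 : `|rate * ramp_mean phi s| <= rate * ramp_mean phi t.
    by rewrite (ger0_norm (mulr_ge0 c0 r1)); exact: ler_wpM2l.
  have k3 := kint_norm_le phi_meas phi_ge0 phi_lt1 bh hC'.
  have m3 : `|M n 1 (g k) w| <= runmax (fun k => `|M n 1 (g k) w|) p by exact: (runmax_ge (fun k => `|M n 1 (g k) w|)).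
  rewrite (le_trans (ler_normB _ _))//; have := ler_normD (M n 1 (g k) w) (kint phi h).
  lra.
move=> s /andP[s0 su'].
have st : 0 <= s <= t by rewrite s0 (le_trans su')// (stopped_le mt).
have [k kp /andP[k1 k2]] := part_cover p0 st.
have pt j : (j <= p)%N -> part 0 t p j <= t.
  move=> jp; rewrite /part add0r subr0 ler_piMr// ler_pdivrMr ?ltr0n// mul1r.
  by rewrite ler_nat.
have gk : g k = part 0 t p k by rewrite /g (min_l (pt k (ltnW kp))).
have gk1 : g k.+1 = part 0 t p k.+1 by rewrite /g (min_l (pt k.+1 kp)).
have sT : (s%:E <= T n w)%E.
  by apply: (@le_trans _ _ u%:E); [rewrite lee_fin|exact: (stopped_leT mt n w t0)].
have s1 : U n (g k) w <= s.
  by apply: le_trans (stopped_le mt n w (g0 k)) _; rewrite gk.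
have s2 : s <= U n (g k.+1) w by rewrite -lee_fin (stoppedE mt)// le_min sT lee_fin gk1 k2.
have s3 : U n (g k.+1) w - U n (g k) w <= t / p%:R.
  have h1 : g k <= g k.+1 by rewrite gk gk1; exact: part_nd.
  have e1 : g k.+1 - g k = t / p%:R by rewrite gk gk1 part_step// subr0; ring.
  by have := stopped_lip mt n w (g0 k) h1; rewrite e1.
have := grid k (ltnW kp); have := grid k.+1 kp.
have /andP[u1 _] := su k; have /andP[u2 _] := su k.+1.
have n1 := jumps_nd T Z one_sqr n w s1; have n2 := jumps_nd T Z one_sqr n w s2.
have n1' := le_trans (normr_ge0 _) n1; have n2' := le_trans (normr_ge0 _) n2.
rewrite /e (max_r s0) (max_r u1) (max_r u2) /m0 => /ler_normlP[_ h2] /ler_normlP[h1 _].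
have c1 : rate * U n (g k.+1) w - rate * s <= rate * (t / p%:R).
  by rewrite -mulrBr ler_wpM2l//; lra.
have c2 : rate * s - rate * U n (g k) w <= rate * (t / p%:R).
  by rewrite -mulrBr ler_wpM2l//; lra.
rewrite ler_norml mulrDr; apply/andP; split; lra.
Qed.

Lemma law_of_large_numbers n t : 0 <= t ->
  Ex P (fun w => (N n t w - rate * U n t w) ^+ 2) <=
  (8 * (rate * t) + 2 * (rate * (ramp_mean phi t + 1)) ^+ 2) / (1 - a) ^+ 2.
Proof.
move=> t0; have c0 := rate_ge0.
(* Mesh 1 is fine enough, since [ramp_mean t + 1] is still [o(t)]. *)
have [p p0 tp] : exists2 p, (0 < p)%N & t / p%:R <= 1.
  exists (Num.bound t).+1 => //; rewrite ler_pdivrMr ?ltr0n// mul1r.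
  by rewrite (le_trans (ltW (archi_boundP t0)))// ler_nat.
set C := rate * (ramp_mean phi t + 1).
pose X k w := `|M n 1 (Num.min (part 0 t p k) t) w|.
have a1' : 0 < 1 - a by rewrite subr_gt0.
have g0 k : 0 <= Num.min (part 0 t p k) t by rewrite le_min t0 part_ge.
have bX k : bmf (X k) by apply: bmf_norm; exact: (hmart_bmf phi_meas phi_ge0 phi_lt1 nu_ge0 hawkes one_sqr n (g0 k)).
have bR : bmf (fun w => runmax (X ^~ w) p).
  suff h q : bmf (fun w => runmax (X ^~ w) q) by exact: h.
  by elim: q => [|k IH] //=; apply: bmf_max.
have bN := jumps_bmf hawkes n t0.
have bU := stopped_bmf n t0.
apply: (@le_trans _ _ (Ex P (fun w => (2 / (1 - a) ^+ 2) * (runmax (X ^~ w) p ^+ 2 + C ^+ 2)))).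
  apply: Ex_le; [by apply: bmf_ibl; bm|by apply: bmf_ibl; bm|move=> w].
  have h := law_of_large_numbers_path n w t0 p0.
  rewrite -[leLHS]real_normK ?num_real//.
  have h' : `|N n t w - rate * U n t w| <= (runmax (X ^~ w) p + C) / (1 - a).
    apply: le_trans h _; rewrite ler_pM2r ?invr_gt0// lerD2l /C ler_wpM2l//.
    by rewrite lerD2l.
  apply: (@le_trans _ _ (((runmax (X ^~ w) p + C) / (1 - a)) ^+ 2)).
    by rewrite lerXn2r ?nnegrE//; apply: le_trans h'.
  rewrite expr_div_n [leRHS]mulrAC ler_pM2r ?invr_gt0 ?exprn_gt0//.
  have := sqr_ge0 (runmax (X ^~ w) p - C); rewrite sqrrB sqrrD; lra.
rewrite ExZ; last by apply: bmf_ibl; bm.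
rewrite ExD; [|by apply: bmf_ibl; bm|by apply: bmf_ibl; bm].
rewrite Ex_cst.
have c := hawkes_compensated phi_meas phi_ge0 phi_lt1 nu_ge0 hawkes one_sqr n t0.
have hd : Ex P (fun w => runmax (X ^~ w) p ^+ 2) <=
    4 * Ex P (fun w => M n 1 (Num.min (part 0 t p p) t) w ^+ 2).
  have := comp_doob2 (adapted_adaptedness T Z) c (tau := part 0 t p) p (part_ge t0 p 0) (part_nd t0 p).
  by [].
have hv := Ex_hmart_sqr n one_sqr (g0 p).
have rt : rate * Num.min (part 0 t p p) t <= rate * t by rewrite ler_wpM2l// ge_min lexx orbT.
rewrite [leLHS]mulrAC ler_pM2r ?invr_gt0 ?exprn_gt0//; lra.
Qed.

End law_of_large_numbers.

(** * Convergence of the increments *)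

Section increments.
Context {R : realType} {d : measure_display} {Omega : measurableType d}.
Variable P : probability Omega R.
Variables (T : nat -> Omega -> \bar R) (Z : nat -> Omega -> 'I_2).
Variable phi : R -> R.
Hypothesis phi_meas : measurable_fun (`[0, +oo[ : set R) phi.
Hypothesis phi_ge0 : forall t, 0 <= t -> 0 <= phi t.
Hypothesis phi_lt1 : (\int[lebesgue_measure]_(t in `[0%R, +oo[) (phi t)%:E < 1)%E.
Variable nu : R.
Hypothesis nu_ge0 : 0 <= nu.
Hypothesis hawkes : hawkes_process T Z P (fun i t w =>
  let j := if i == ord0 then ord_max else ord0 in
  nu%:E + \int[jump_measure T Z j w]_(s in `]0%R, t[) (phi (t - s))%:E)%E.

Let mt : marked_times T Z. Proof. by case: hawkes. Qed.

Local Notation a := (mass phi).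
Local Notation U := (stopped T).
Local Notation N n t := (jumps T Z n 1 t).
Local Notation M n t := (hmart T Z phi nu n (-1) t).
Local Notation c := (rate phi nu).

Let a0 : 0 <= a. Proof. exact: (mass_ge0 phi_ge0). Qed.
Let a1 : a < 1. Proof. exact: (mass_lt1 phi_ge0 phi_lt1). Qed.
Let c0 : 0 <= c. Proof. exact: rate_ge0. Qed.
Let one_sqr : (1 : R) * 1 = 1. Proof. exact: mulr1. Qed.
Let mone_sqr : (-1 : R) * -1 = 1. Proof. by rewrite mulrNN mulr1. Qed.

Let bN n t : 0 <= t -> bmf (N n t). Proof. exact: (jumps_bmf hawkes). Qed.
Let bM n t : 0 <= t -> bmf (M n t).
Proof. exact: (hmart_bmf phi_meas phi_ge0 phi_lt1 nu_ge0 hawkes mone_sqr). Qed.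
Let bU n t : 0 <= t -> bmf (U n t). Proof. exact: (stopped_bmf hawkes). Qed.

(** Gathers what is used of a large [tau]: the law of large numbers with mean square error
    [(e tau)^2], a small probability that the stopping acts, and [1 <= e tau], by which terms of
    order [tau] are absorbed into [e tau^2]. *)
Record regular (e tau : R) n : Prop := {
  regular_gt0 : 0 < tau;
  regular_lln : forall t, 0 <= t <= tau ->
    Ex P (fun w => (N n t w - c * U n t w) ^+ 2) <= (e * tau) ^+ 2;
  regular_explosion : Pr P [set w | (T n w <= tau%:E)%E] <= e;
  regular_time : 1 <= e * tau }.

Definition level (tau : R) : nat := Num.bound (tau ^+ 2).

Lemma level_regular e : 0 < e -> exists2 tau0, 0 < tau0 &
  forall tau, tau0 <= tau -> regular e tau (level tau).
Proof.
move=> e0; have cc := c0; have e4 : 0 < (1 - a) * e / (4 * (c + 1)).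
  by rewrite divr_gt0// mulr_gt0 ?subr_gt0// ltr_wpDl.
set eta := _ / _ in e4.
have [t1 t10 ht1] := ramp_mean_little phi_meas phi_ge0 phi_lt1 e4.
pose q := (1 - a) ^+ 2 * e ^+ 2.
have q0 : 0 < q by rewrite mulr_gt0// exprn_gt0// subr_gt0.
(* Each summand secures one estimate: [t1] the sublinear ramp, [(c + 1) / e] the stopping
   probability and [1 <= e tau], [16 c / q] the martingale part, and [1 / eta] the 1 added to the
   ramp. *)
pose t0 := t1 + (c + 1) / e + 16 * c / q + 1 / eta.
have p1 : 0 < (c + 1) / e by rewrite divr_gt0// ltr_wpDl.
have p2 : 0 <= 16 * c / q by rewrite divr_ge0 ?(ltW q0)// mulr_ge0.
have p3 : 0 < 1 / eta by rewrite divr_gt0.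
exists t0; first by rewrite /t0; lra.
move=> tau; rewrite /t0 => htau.
have tau0 : 0 < tau by lra.
have tau_ge0 := ltW tau0.
have h1 : c + 1 <= tau * e by rewrite -ler_pdivrMr//; lra.
split=> //; last by lra.
- move=> t /andP[tp tt].
  apply: le_trans (law_of_large_numbers phi_meas phi_ge0 phi_lt1 nu_ge0 hawkes (level tau) tp) _.
  rewrite ler_pdivrMr ?exprn_gt0 ?subr_gt0//.
  have r1 : ramp_mean phi t + 1 <= 2 * (eta * tau).
    have := ramp_mean_nd phi_meas phi_ge0 phi_lt1 tt.
    have : ramp_mean phi tau <= eta * tau by apply: ht1; lra.
    have : 1 <= tau * eta by rewrite -ler_pdivrMr//; lra.
    lra.
  have r0 : 0 <= ramp_mean phi t by exact: (ramp_mean_ge0 phi_meas phi_ge0 phi_lt1).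
  have r2 : c * (ramp_mean phi t + 1) <= (1 - a) * e / 2 * tau.
    apply: (@le_trans _ _ ((c + 1) * (2 * (eta * tau)))).
      by apply: ler_pM => //; [rewrite addr_ge0|rewrite lerDl].
    rewrite le_eqVlt; apply/orP; left; apply/eqP; rewrite /eta; field.
    by rewrite gt_eqF// ltr_wpDl.
  have r3 : (c * (ramp_mean phi t + 1)) ^+ 2 <= ((1 - a) * e / 2 * tau) ^+ 2.
    have x0 : 0 <= c * (ramp_mean phi t + 1) by rewrite mulr_ge0// addr_ge0.
    by rewrite lerXn2r ?nnegrE//; exact: le_trans r2.
  have r4 : 16 * c <= tau * q by rewrite -ler_pdivrMr//; lra.
  have r5 : c * t <= c * tau by rewrite ler_wpM2l.
  have r6 : 16 * c * tau <= tau * q * tau by rewrite ler_wpM2r.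
  have -> : (e * tau) ^+ 2 * (1 - a) ^+ 2 = tau * q * tau by rewrite /q; ring.
  have e3 : ((1 - a) * e / 2 * tau) ^+ 2 = tau * q * tau / 4 by rewrite /q; field.
  rewrite e3 in r3; lra.
- apply: le_trans (Pr_time_le phi_meas phi_ge0 phi_lt1 nu_ge0 hawkes (level tau) tau_ge0) _.
  rewrite ler_pdivrMr ?ltr0n//.
  have h2 : tau ^+ 2 <= (level tau).+1%:R.
    by rewrite (le_trans (ltW (archi_boundP (sqr_ge0 tau))))// ler_nat.
  apply: (@le_trans _ _ (e * tau ^+ 2)); last by rewrite ler_wpM2l// ltW.
  by rewrite expr2 mulrA ler_wpM2r//; lra.
Qed.

Lemma hmart_variance n s t H : 0 <= s -> s <= t -> adapted T Z s H -> bmf H ->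
  Ex P (fun w => H w * ((M n t w - M n s w) ^+ 2 - (N n t w - N n s w))) = 0.
Proof.
move=> s0 st aH bH; have t0 := le_trans s0 st.
have cp := hawkes_compensated phi_meas phi_ge0 phi_lt1 nu_ge0 hawkes mone_sqr n t0.
have := comp_variance (adapted_adaptedness T Z) cp s0 st aH bH.
by rewrite minxx (min_l st).
Qed.

Lemma hmart_fourth n s t : 0 <= s -> s <= t ->
  Ex P (fun w => (M n t w - M n s w) ^+ 4) <=
  256 * Ex P (fun w => (N n t w - N n s w) ^+ 2) + 70 * Ex P (fun w => N n t w - N n s w).
Proof.
move=> s0 st; have t0 := le_trans s0 st.
have cp := hawkes_compensated phi_meas phi_ge0 phi_lt1 nu_ge0 hawkes mone_sqr n t0.
have := comp_fourth (adapted_adaptedness T Z) cp s0 st.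
by rewrite minxx (min_l st).
Qed.

Section regular_increments.
Variables (e tau : R) (n : nat).
Hypothesis reg : regular e tau n.
Hypothesis e1 : e <= 1.
Variables s t : R.
Hypotheses (s0 : 0 <= s) (st : s <= t) (t1 : t <= tau).

Let t0 : 0 <= t. Proof. exact: le_trans st. Qed.
Let tau0 : 0 < tau. Proof. exact: regular_gt0 reg. Qed.
Let tau_ge0 : 0 <= tau. Proof. exact: ltW. Qed.
Let e0 : 0 < e.
Proof. by rewrite -(pmulr_lgt0 _ tau0) (lt_le_trans _ (regular_time reg)). Qed.

Let D r w := N n r w - c * U n r w.

Let bD r : 0 <= r -> bmf (D r).
Proof. by move=> r0; have ? := bN n r0; have ? := bU n r0; rewrite /D; bm. Qed.

Let Ex_D r : 0 <= r <= tau -> Ex P (fun w => `|D r w|) <= e * tau.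
Proof.
move=> /andP[r0 rt].
have h := le_trans (Ex_sqr_norm P (bD r0)) (regular_lln reg (introT andP (conj r0 rt))).
rewrite -(@ler_pXn2r _ 2)// nnegrE; first exact: Ex_ge0.
by rewrite mulr_ge0 ?(ltW e0).
Qed.

Let sI : 0 <= s <= tau. Proof. by rewrite s0 (le_trans st). Qed.
Let tI : 0 <= t <= tau. Proof. by rewrite t0. Qed.

Let dN w := N n t w - N n s w.

Let bdN : bmf dN. Proof. by have ? := bN n t0; have ? := bN n s0; rewrite /dN; bm. Qed.

Let dN_eq w : dN w = D t w - D s w + c * (U n t w - U n s w).
Proof. rewrite /dN /D; ring. Qed.

Let dU w : 0 <= U n t w - U n s w <= t - s.
Proof. by rewrite subr_ge0 (stopped_nd mt)//= (stopped_lip mt). Qed.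

(** [D = N - c U] is small in mean at both ends. The stopped clock [U] differs from time only if
    [T n <= tau], an event of probability at most [e], on which the error is at most [c tau]. *)
Lemma Ex_increment_dist :
  Ex P (fun w => `|N n t w - N n s w - c * (t - s)|) <= (2 + c) * e * tau.
Proof.
have mA : measurable [set w | (T n w <= tau%:E)%E].
  rewrite -[X in measurable X]setTI.
  by apply: emeasurable_fun_infty_c => //; case: mt.
pose I := \1_[set w | (T n w <= tau%:E)%E] : Omega -> R.
have bI : bmf I by exact: bmf_indic.
have b1 := bD s0; have b2 := bD t0.
apply: (@le_trans _ _ (Ex P (fun w => `|D t w| + `|D s w| + c * tau * I w))).
  apply: Ex_le.
  - apply: bmf_ibl; have ? := bdN; rewrite -/dN; bm.
  - by apply: bmf_ibl; bm.
  move=> w; rewrite -/(dN w) dN_eq.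
  have hd : `|c * (U n t w - U n s w) - c * (t - s)| <= c * tau * I w.
    rewrite -mulrBr normrM (ger0_norm c0) -mulrA ler_wpM2l// /I indicE.
    case: (boolP (w \in _)) => [_|/negP hw].
      have /andP[u1 u2] := dU w; rewrite /= mulr1 ler_norml.
      by have h1 := s0; have h2 := st; have h3 := t1; apply/andP; split; lra.
    have Tn : (tau%:E < T n w)%E by rewrite ltNge; apply/negP => h; apply: hw; apply/mem_set.
    have hU r : r <= tau -> 0 <= r -> U n r w = r.
      move=> rt r0; apply: EFin_inj; rewrite (stoppedE mt)// min_l//.
      by apply: le_trans (ltW Tn); rewrite lee_fin.
    by rewrite !hU ?subrr ?normr0 ?mulr0//; have /andP[] := sI.
  rewrite -addrA (le_trans (ler_normD _ _))// lerD//.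
  exact: ler_normB.
rewrite ExD; [|by apply: bmf_ibl; bm|by apply: bmf_ibl; bm].
rewrite ExD; [|by apply: bmf_ibl; bm|by apply: bmf_ibl; bm].
rewrite ExZ; last exact: bmf_ibl.
have h1 := Ex_D sI; have h2 := Ex_D tI.
have h3 : c * tau * Ex P I <= c * tau * e.
  have hI : Ex P I <= e by rewrite (Ex_indic P mA); exact: regular_explosion reg.
  exact: ler_wpM2l (mulr_ge0 c0 tau_ge0) _ _ hI.
lra.
Qed.

Lemma Ex_increment : Ex P (fun w => N n t w - N n s w) <= c * (t - s) + 2 * e * tau.
Proof.
have b1 := bD s0; have b2 := bD t0.
apply: (@le_trans _ _ (Ex P (fun w => `|D t w| + `|D s w| + c * (t - s)))).
  apply: Ex_le; [exact: bmf_ibl bdN|by apply: bmf_ibl; bm|move=> w].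
  rewrite -/(dN w) dN_eq lerD//; last by rewrite ler_wpM2l//; have /andP[] := dU w.
  exact: le_trans (ler_norm _) (ler_normB _ _).
rewrite ExD; [|by apply: bmf_ibl; bm|by apply: bmf_ibl; bm].
rewrite ExD; [|by apply: bmf_ibl; bm|by apply: bmf_ibl; bm].
rewrite Ex_cst; have h1 := Ex_D sI; have h2 := Ex_D tI; lra.
Qed.

Lemma Ex_increment_sqr : Ex P (fun w => (N n t w - N n s w) ^+ 2) <=
  3 * (c * (t - s)) ^+ 2 + 6 * (e * tau) ^+ 2.
Proof.
have b1 := bD s0; have b2 := bD t0.
apply: (@le_trans _ _ (Ex P (fun w => 3 * (D t w ^+ 2 + D s w ^+ 2) + 3 * (c * (t - s)) ^+ 2))).
  apply: Ex_le; [by apply: bmf_ibl; have ? := bdN; bm|by apply: bmf_ibl; bm|move=> w].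
  rewrite -/(dN w) dN_eq; have /andP[u1 u2] := dU w.
  have h : (c * (U n t w - U n s w)) ^+ 2 <= (c * (t - s)) ^+ 2.
    by rewrite lerXn2r ?nnegrE ?ler_wpM2l// mulr_ge0// subr_ge0.
  move: (c * (U n t w - U n s w)) h => x h; move: (D t w) (D s w) => y z.
  have := sqr_ge0 (y + z); have := sqr_ge0 (y - x); have := sqr_ge0 (z + x).
  rewrite !expr2; rewrite !expr2 in h; lra.
rewrite ExD; [|by apply: bmf_ibl; bm|by apply: bmf_ibl; bm].
rewrite ExZ; last by apply: bmf_ibl; bm.
rewrite ExD; [|by apply: bmf_ibl; bm|by apply: bmf_ibl; bm].
rewrite Ex_cst.
have h1 := regular_lln reg sI; have h2 := regular_lln reg tI.
rewrite -/(D _ _); lra.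
Qed.

(** One constant for all increment bounds: 768 is 3 times 256, and 1700 exceeds 6 times 256 plus 2
    times 70, as produced by [hmart_fourth] with [Ex_increment_sqr] and [Ex_increment]. *)
Definition moment_cst : R := 768 * c ^+ 2 + 71 * c + 1700.

Let ts : 0 <= (t - s) / tau <= 1.
Proof. by rewrite divr_ge0 ?subr_ge0//= ler_pdivrMr// mul1r; have h1 := s0; have h2 := t1; lra. Qed.

Lemma Ex_hmart_increment_sqr :
  Ex P (fun w => (M n t w - M n s w) ^+ 2) <= moment_cst * ((t - s) / tau + e) * tau.
Proof.
have b1 := bM n t0; have b2 := bM n s0.
have -> : Ex P (fun w => (M n t w - M n s w) ^+ 2) = Ex P (fun w => N n t w - N n s w).
  apply/eqP; rewrite -subr_eq0 -ExB; [|by apply: bmf_ibl; bm|exact: bmf_ibl bdN].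
  apply/eqP; rewrite -[RHS](hmart_variance n s0 st (ad_cst (adapted_adaptedness T Z) s 1) (bmf_cst 1)).
  by congr (Ex P _); apply/funext => w; rewrite mul1r.
apply: le_trans Ex_increment _.
have {1}-> : t - s = (t - s) / tau * tau by rewrite divfK// gt_eqF.
have /andP[d0 d1] := ts; move: (_ / tau) d0 d1 => x d0 d1.
rewrite mulrA -mulrDl ler_wpM2r// /moment_cst.
have q := sqr_ge0 c; have ee := ltW e0.
have : 0 <= c ^+ 2 * x by rewrite mulr_ge0.
have : 0 <= c ^+ 2 * e by rewrite mulr_ge0.
have : 0 <= c * x by rewrite mulr_ge0.
have : 0 <= c * e by rewrite mulr_ge0.
lra.
Qed.

(** Quadratic in the relative length up to [e], so that [m] blocks of relative length [1 / m]
    contribute a total of order [1 / m]. *)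
Lemma Ex_hmart_increment_fourth :
  Ex P (fun w => (M n t w - M n s w) ^+ 4) <= moment_cst * (((t - s) / tau) ^+ 2 + e) * tau ^+ 2.
Proof.
apply: le_trans (hmart_fourth n s0 st) _.
have h1 := Ex_increment; have h2 := Ex_increment_sqr; have h3 := regular_time reg.
have tsE : t - s = (t - s) / tau * tau by rewrite divfK// gt_eqF.
rewrite tsE in h1 h2.
have /andP[d0 d1] := ts; move: (_ / tau) d0 d1 h1 h2 => x d0 d1.
move: (Ex P _) (Ex P _) => y z h1 h2.
have h4 : tau <= e * tau ^+ 2.
  by rewrite expr2 mulrA -[leLHS]mul1r ler_wpM2r.
have q := sqr_ge0 c; have ee := ltW e0; have q2 := sqr_ge0 tau.
have h5 : c * (x * tau) + 2 * e * tau <= (c + 2) * (e * tau ^+ 2).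
  apply: (@le_trans _ _ ((c + 2) * tau)); last by rewrite ler_wpM2l// addr_ge0.
  have : c * (x * tau) <= c * tau by rewrite ler_wpM2l// ler_piMl.
  have : e * tau <= tau by rewrite ler_piMl.
  lra.
have h6 : (e * tau) ^+ 2 <= e * tau ^+ 2.
  by rewrite exprMn ler_wpM2r// expr2 ler_piMl.
have h10 : 0 <= e * tau ^+ 2 by exact: mulr_ge0 ee q2.
have h9 : 0 <= x ^+ 2 * tau ^+ 2 by exact: mulr_ge0 (sqr_ge0 x) q2.
have h7 := mulr_ge0 q h10; have h8 := mulr_ge0 c0 h9; have h11 := mulr_ge0 c0 h10.
have h12 := mulr_ge0 q h9.
have e2 : (c * (x * tau)) ^+ 2 = c ^+ 2 * (x ^+ 2 * tau ^+ 2) by ring.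
rewrite e2 in h2; rewrite /moment_cst.
lra.
Qed.

End regular_increments.

End increments.

(** * Gaussian approximation of one block *)

Section blocks.
Context {R : realType} {d : measure_display} {Omega : measurableType d}.
Variable P : probability Omega R.
Variables (T : nat -> Omega -> \bar R) (Z : nat -> Omega -> 'I_2).
Variable phi : R -> R.
Hypothesis phi_meas : measurable_fun (`[0, +oo[ : set R) phi.
Hypothesis phi_ge0 : forall t, 0 <= t -> 0 <= phi t.
Hypothesis phi_lt1 : (\int[lebesgue_measure]_(t in `[0%R, +oo[) (phi t)%:E < 1)%E.
Variable nu : R.
Hypothesis nu_ge0 : 0 <= nu.
Hypothesis hawkes : hawkes_process T Z P (fun i t w =>
  let j := if i == ord0 then ord_max else ord0 in
  nu%:E + \int[jump_measure T Z j w]_(s in `]0%R, t[) (phi (t - s))%:E)%E.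
Context {d' : measure_display} {Omega' : measurableType d'}.
Variables (P' : probability Omega' R) (W : R -> Omega' -> R).
Hypothesis W_brownian : standard_brownian01 P' W.

Local Notation a := (mass phi).
Local Notation N n t := (jumps T Z n 1 t).
Local Notation M n t := (hmart T Z phi nu n (-1) t).
Local Notation c := (rate phi nu).
Local Notation C := (moment_cst phi nu).

Variable sigma : R.
Hypothesis sigma2 : sigma ^+ 2 = c / (1 + a) ^+ 2.

Let a0 : 0 <= a. Proof. exact: (mass_ge0 phi_ge0). Qed.
Let c0 : 0 <= c. Proof. exact: rate_ge0. Qed.
Let mone_sqr : (-1 : R) * -1 = 1. Proof. by rewrite mulrNN mulr1. Qed.
Let bN n t : 0 <= t -> bmf (N n t). Proof. exact: (jumps_bmf hawkes). Qed.
Let bM n t : 0 <= t -> bmf (M n t).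
Proof. exact: (hmart_bmf phi_meas phi_ge0 phi_lt1 nu_ge0 hawkes mone_sqr). Qed.
Let adP := adapted_adaptedness T Z.

(** Dividing by [1 + a] anticipates that [S] is close to [M / (1 + a)]; the process then has
    asymptotic variance [sigma^2] per unit of time. *)
Definition rescaled n (tau s : R) w : R := M n (tau * s) w / ((1 + a) * Num.sqrt tau).

Lemma moment_cst_ge : 2 + c <= C /\ 0 <= C.
Proof.
have h := sqr_ge0 c; have h' := c0; rewrite /moment_cst; split; lra.
Qed.

(** [lindeberg] with [K] sub-steps of rescaled length [b^2], the scaled increments of [N] serving as
    [v] by [hmart_variance]. Since [q^2 tau <= 1], the moment bounds lose their dependence on [tau];
    [b] stays free. *)
Lemma block_error e tau n s t b K L f f1 f2 H :
  regular P T Z phi nu e tau n -> e <= 1 -> smooth3 L f f1 f2 ->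
  0 <= s -> s < t -> t <= 1 -> 0 < b -> t - s = K%:R * b ^+ 2 ->
  bmf H -> adapted T Z (tau * s) H -> (forall w, `|H w| <= 1) ->
  `|Ex P (fun w => H w * f (rescaled n tau t w - rescaled n tau s w)) -
    Ex P H * Ex P' (fun w => f (sigma * incr W s t w))| <=
  K%:R * (L * (b * (C * (b ^+ 2 + e)) + C * (b ^+ 4 + e) / b) + L * (C * e)
    + L * `|sigma| ^+ 3 * (4 * b ^+ 3)).
Proof.
move=> reg e1 sm s0 st t1 b0 tsK bH aH H1.
have tau0 : 0 < tau := regular_gt0 reg.
have tau_ge0 := ltW tau0.
have e0 : 0 < e by rewrite -(pmulr_lgt0 _ tau0) (lt_le_trans _ (regular_time reg)).
have [C2 C0] := moment_cst_ge.
have sc1 : 1 <= 1 + a by rewrite lerDl.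
have sc0 : 0 < 1 + a by rewrite (lt_le_trans _ sc1).
pose q := ((1 + a) * Num.sqrt tau)^-1.
have sq0 : 0 < Num.sqrt tau by rewrite sqrtr_gt0.
have q2 : q ^+ 2 = ((1 + a) ^+ 2 * tau)^-1 by rewrite /q exprVn exprMn sqr_sqrtr.
have q2tau : q ^+ 2 * tau <= 1.
  rewrite q2 invfM -mulrA mulVf ?gt_eqF// mulr1 invf_le1 ?exprn_gt0//.
  by rewrite expr_ge1// ltW.
have q2_ge0 : 0 <= q ^+ 2 by exact: sqr_ge0.
pose g k := tau * (s + k%:R * b ^+ 2).
have b2 : 0 < b ^+ 2 by rewrite exprn_gt0.
have g0 k : 0 <= g k by rewrite mulr_ge0// addr_ge0// mulr_ge0// ltW.
have gs k : tau * s <= g k by rewrite ler_wpM2l// lerDl mulr_ge0// ltW.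
have gS k : g k.+1 - g k = tau * b ^+ 2 by rewrite /g -natr1; ring.
have tb : tau * b ^+ 2 / tau = b ^+ 2 by rewrite mulrAC divff ?gt_eqF// mul1r.
have gnd k : g k <= g k.+1 by rewrite -subr_ge0 gS mulr_ge0// ltW.
have gK : s + K%:R * b ^+ 2 = t by rewrite -tsK; ring.
have g1 k : (k <= K)%N -> g k <= tau.
  move=> kK; rewrite /g -[leRHS]mulr1 ler_wpM2l//; apply: le_trans t1.
  by rewrite -gK lerD2l ler_wpM2r ?(ltW b2)// ler_nat.
pose y k w := q * (M n (g k) w - M n (tau * s) w).
pose v k w := q ^+ 2 * (N n (g k.+1) w - N n (g k) w).
have ts0 : 0 <= tau * s by rewrite mulr_ge0.
have by_ k : bmf (y k).
  by have ? := bM n (g0 k); have ? := bM n ts0; rewrite /y; bm.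
have bv k : bmf (v k).
  by have ? := bN n (g0 k); have ? := bN n (g0 k.+1); rewrite /v; bm.
have ay k : adapted T Z (g k) (y k).
  apply: (adM adP); first exact: (ad_cst adP).
  apply: (adB adP); first exact: (hmart_adapted phi_meas phi_ge0 phi_lt1 nu_ge0 hawkes mone_sqr n (g0 k)).
  exact: (ad_mono adP (gs k) (hmart_adapted phi_meas phi_ge0 phi_lt1 nu_ge0 hawkes mone_sqr n ts0)).
have yS k w : y k.+1 w - y k w = q * (M n (g k.+1) w - M n (g k) w).
  rewrite /y -mulrBr; congr (q * _).
  by move: (M n (g k.+1) w) (M n (g k) w) (M n (tau * s) w) => x1 x2 x3; ring.
have aHg k (h : R -> R) : bmf h -> adapted T Z (g k) (fun w => H w * h (y k w)).
  move=> bh; apply: (adM adP); first exact: (ad_mono adP (gs k) aH).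
  by apply: (ad_comp adP) (ay k); exact: bmf_meas bh.
have bHg k (h : R -> R) : bmf h -> bmf (fun w => H w * h (y k w)).
  move=> [mh [B hB]]; apply: bmfM => //; apply: (bmf_comp mh hB).
  exact: bmf_meas (by_ k).
have yK w : y K w = rescaled n tau t w - rescaled n tau s w.
  by rewrite /y /rescaled /g gK -/q mulrC mulrBl.
have -> : (fun w => H w * f (rescaled n tau t w - rescaled n tau s w)) = (fun w => H w * f (y K w)).
  by apply/funext => w; rewrite yK.
apply: (lindeberg W_brownian (y := y) (v := v) sm s0 st t1 b0 tsK) => //.
- by move=> w; rewrite /y /g mul0r addr0 subrr mulr0.
- move=> k h kK bh.
  transitivity (q * Ex P (fun w => (H w * h (y k w)) * (M n (g k.+1) w - M n (g k) w))).
    rewrite -ExZ; last first.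
      apply: bmf_ibl; have ? := bHg k h bh; have ? := bM n (g0 k); have ? := bM n (g0 k.+1); bm.
    congr (Ex P _); apply/funext => w; rewrite (yS k w).
    by move: (h _) (_ - _) => x1 x2; ring.
  by rewrite (hmart_mart phi_meas phi_ge0 phi_lt1 nu_ge0 hawkes mone_sqr n (g0 k) (gnd k) (aHg k h bh) (bHg k h bh)) mulr0.
- move=> k h kK bh.
  transitivity (q ^+ 2 * Ex P (fun w => (H w * h (y k w)) *
      ((M n (g k.+1) w - M n (g k) w) ^+ 2 - (N n (g k.+1) w - N n (g k) w)))).
    rewrite -ExZ; last first.
      apply: bmf_ibl; have ? := bHg k h bh; have ? := bM n (g0 k); have ? := bM n (g0 k.+1).
      have ? := bN n (g0 k); have ? := bN n (g0 k.+1); bm.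
    congr (Ex P _).
    apply/funext => w.
    apply: etrans (congr1 (fun z => H w * (h (y k w) * (z ^+ 2 - v k w))) (yS k w)) _.
    rewrite /v.
    by rewrite exprMn -mulrBr mulrA mulrCA.
  by rewrite (hmart_variance phi_meas phi_ge0 phi_lt1 nu_ge0 hawkes n (g0 k) (gnd k) (aHg k h bh) (bHg k h bh)) mulr0.
- move=> k kK.
  have -> : (fun w => (y k.+1 w - y k w) ^+ 2) = (fun w => q ^+ 2 * (M n (g k.+1) w - M n (g k) w) ^+ 2).
    by apply/funext => w; rewrite (yS k w) exprMn.
  have h := Ex_hmart_increment_sqr phi_meas phi_ge0 phi_lt1 nu_ge0 hawkes reg (g0 k) (gnd k) (g1 _ kK).
  rewrite gS tb in h.
  rewrite ExZ; last by apply: bmf_ibl; have ? := bM n (g0 k); have ? := bM n (g0 k.+1); bm.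
  apply: (le_trans (ler_wpM2l q2_ge0 h)); rewrite mulrCA -[leRHS]mulr1 ler_wpM2l//.
  by rewrite mulr_ge0// addr_ge0 ?ltW.
- move=> k kK.
  have -> : (fun w => (y k.+1 w - y k w) ^+ 4) = (fun w => q ^+ 4 * (M n (g k.+1) w - M n (g k) w) ^+ 4).
    by apply/funext => w; rewrite (yS k w) exprMn.
  have h := Ex_hmart_increment_fourth phi_meas phi_ge0 phi_lt1 nu_ge0 hawkes reg e1 (g0 k) (gnd k) (g1 _ kK).
  rewrite gS tb -exprM in h.
  rewrite ExZ; last by apply: bmf_ibl; have ? := bM n (g0 k); have ? := bM n (g0 k.+1); bm.
  have q4 : 0 <= q ^+ 4 by rewrite (exprM q 2 2) sqr_ge0.
  apply: (le_trans (ler_wpM2l q4 h)); rewrite mulrCA -[leRHS]mulr1 ler_wpM2l//.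
    by rewrite mulr_ge0// addr_ge0 ?(ltW e0)// exprn_ge0// ltW.
  by rewrite (exprM q 2 2) -exprMn exprn_ile1// mulr_ge0.
- move=> k kK.
  have h := Ex_increment_dist phi_ge0 phi_lt1 nu_ge0 hawkes reg (g0 k) (gnd k) (g1 _ kK).
  rewrite gS in h.
  have -> : (fun w => `|v k w - sigma ^+ 2 * b ^+ 2|) =
      (fun w => q ^+ 2 * `|N n (g k.+1) w - N n (g k) w - c * (tau * b ^+ 2)|).
    apply/funext => w; rewrite -[q ^+ 2 in RHS]ger0_norm// -normrM /v; congr `|_|.
    rewrite [RHS]mulrBr sigma2; congr (_ - _); rewrite q2; field.
    by rewrite !gt_eqF.
  rewrite ExZ; last by apply: bmf_ibl; have ? := bN n (g0 k); have ? := bN n (g0 k.+1); bm.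
  apply: (le_trans (ler_wpM2l q2_ge0 h)); rewrite mulrCA.
  apply: (@le_trans _ _ ((2 + c) * e * 1)).
    by rewrite ler_wpM2l// mulr_ge0 ?(ltW e0)// addr_ge0.
  by rewrite mulr1 ler_wpM2r// ltW.
Qed.

End blocks.

(** * Joint law of the blocks *)

Section products.
Context {R : realType} {d : measure_display} {Omega : measurableType d}.
Variable P : probability Omega R.
Variables (T : nat -> Omega -> \bar R) (Z : nat -> Omega -> 'I_2).
Variable phi : R -> R.
Hypothesis phi_meas : measurable_fun (`[0, +oo[ : set R) phi.
Hypothesis phi_ge0 : forall t, 0 <= t -> 0 <= phi t.
Hypothesis phi_lt1 : (\int[lebesgue_measure]_(t in `[0%R, +oo[) (phi t)%:E < 1)%E.
Variable nu : R.
Hypothesis nu_ge0 : 0 <= nu.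
Hypothesis hawkes : hawkes_process T Z P (fun i t w =>
  let j := if i == ord0 then ord_max else ord0 in
  nu%:E + \int[jump_measure T Z j w]_(s in `]0%R, t[) (phi (t - s))%:E)%E.
Context {d' : measure_display} {Omega' : measurableType d'}.
Variables (P' : probability Omega' R) (W : R -> Omega' -> R).
Hypothesis W_brownian : standard_brownian01 P' W.

Local Notation a := (mass phi).
Local Notation M n t := (hmart T Z phi nu n (-1) t).
Local Notation c := (rate phi nu).
Local Notation C := (moment_cst phi nu).
Local Notation X n tau s := (rescaled T Z phi nu n tau s).

Variable sigma : R.
Hypothesis sigma2 : sigma ^+ 2 = c / (1 + a) ^+ 2.

Let a0 : 0 <= a. Proof. exact: (mass_ge0 phi_ge0). Qed.
Let mone_sqr : (-1 : R) * -1 = 1. Proof. by rewrite mulrNN mulr1. Qed.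
Let bM n t : 0 <= t -> bmf (M n t).
Proof. exact: (hmart_bmf phi_meas phi_ge0 phi_lt1 nu_ge0 hawkes mone_sqr). Qed.
Let adP := adapted_adaptedness T Z.
Let C0 : 0 <= C. Proof. by have [] := moment_cst_ge phi_ge0 phi_lt1 nu_ge0. Qed.

Lemma rescaled_bmf n tau s : 0 <= tau -> 0 <= s -> bmf (X n tau s).
Proof.
move=> t0 s0; have h := bM n (mulr_ge0 t0 s0).
by apply: bmfM => //; exact: bmf_cst.
Qed.

Lemma rescaled_adapted n tau s r : 0 <= tau -> 0 <= s -> s <= r -> adapted T Z (tau * r) (X n tau s).
Proof.
move=> t0 s0 sr; have ts := mulr_ge0 t0 s0.
apply: (adM adP); last exact: (ad_cst adP).
apply: (ad_mono adP (ler_wpM2l t0 sr)).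
exact: (hmart_adapted phi_meas phi_ge0 phi_lt1 nu_ge0 hawkes mone_sqr n ts).
Qed.

Lemma regular_near e : 0 < e ->
  \forall tau \near (+oo : set_system R), regular P T Z phi nu e tau (level tau).
Proof.
move=> e0; have [tau0 _ h] := level_regular phi_meas phi_ge0 phi_lt1 nu_ge0 hawkes e0.
by apply: filterS (nbhs_pinfty_ge (num_real tau0)) => tau /h.
Qed.

(** As [K b^3 = (t - s) b], the Taylor errors vanish with [b], whereas the terms in [e] carry a
    factor that blows up as [b] decreases. Hence [b] is fixed before [e]. *)
Lemma block_cvg f s t eps : smooth f -> 0 <= s -> s < t -> t <= 1 -> 0 < eps ->
  exists2 e, 0 < e & forall tau n H, regular P T Z phi nu e tau n ->
  bmf H -> adapted T Z (tau * s) H -> (forall w, `|H w| <= 1) ->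
  `|Ex P (fun w => H w * f (X n tau t w - X n tau s w)) -
    Ex P H * Ex P' (fun w => f (sigma * incr W s t w))| <= eps.
Proof.
move=> [L [f1 [f2 sm]]] s0 st t1 eps0.
have L0 : 0 <= L by have [h _ _] := smooth3_bounded sm 0; exact: le_trans h.
(* [A] is the coefficient of [K b^3] in [block_error]; [B] below is that of [e]. *)
pose A := 2 * (L * C) + 4 * (L * `|sigma| ^+ 3).
have A0 : 0 <= A.
  by apply: addr_ge0; apply: mulr_ge0; rewrite ?ler0n//; apply: mulr_ge0 => //; exact: exprn_ge0.
pose beta := eps / (2 * (A + 1)).
have beta0 : 0 < beta by rewrite divr_gt0// mulr_gt0// ltr_wpDl.
have Abeta : A * beta <= eps / 2.
  have : (A + 1) * beta = eps / 2.
    by rewrite /beta; field; rewrite gt_eqF// ltr_wpDl.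
  have := ltW beta0; lra.
have ts0 : 0 < t - s by rewrite subr_gt0.
pose K := (Num.bound ((t - s) / beta ^+ 2)).+1.
have K0 : (0 : R) < K%:R by rewrite ltr0n.
pose b := Num.sqrt ((t - s) / K%:R).
have b2 : b ^+ 2 = (t - s) / K%:R by rewrite sqr_sqrtr// ltW// divr_gt0.
have b0 : 0 < b by rewrite sqrtr_gt0 divr_gt0.
have tsK : t - s = K%:R * b ^+ 2 by rewrite b2 mulrC divfK// gt_eqF.
have bbeta : b <= beta.
  rewrite -(@ler_pXn2r _ 2)// ?nnegrE ?(ltW b0) ?(ltW beta0)// b2.
  rewrite ler_pdivrMr// mulrC -ler_pdivrMr ?exprn_gt0//.
  have h : 0 <= (t - s) / beta ^+ 2 by rewrite divr_ge0// ?sqr_ge0// ltW.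
  by rewrite (le_trans (ltW (archi_boundP h)))// ler_nat.
pose B := K%:R * (L * C) * (b + b^-1 + 1).
have B0 : 0 <= B.
  rewrite mulr_ge0// ?mulr_ge0// ?(ltW K0)// !addr_ge0// ?(ltW b0)//.
  by rewrite invr_ge0 ltW.
pose e := Num.min 1 (eps / (2 * (B + 1))).
have e0 : 0 < e by rewrite lt_min ltr01/= divr_gt0// mulr_gt0// ltr_wpDl.
have eB : e * B <= eps / 2.
  have h : e <= eps / (2 * (B + 1)) by rewrite ge_min lexx orbT.
  have h' : eps / (2 * (B + 1)) * (B + 1) = eps / 2.
    by field; rewrite gt_eqF// ltr_wpDl.
  rewrite -h'; apply: ler_pM => //; [exact: ltW|by rewrite lerDl].
have e1 : e <= 1 by rewrite ge_min lexx.
exists e => // tau n H reg bH aH H1.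
apply: le_trans (block_error phi_meas phi_ge0 phi_lt1 nu_ge0 hawkes W_brownian sigma2 reg e1 sm s0 st t1 b0 tsK bH aH H1) _.
have bn : b != 0 by rewrite gt_eqF.
have -> : K%:R * (L * (b * (C * (b ^+ 2 + e)) + C * (b ^+ 4 + e) / b) + L * (C * e)
    + L * `|sigma| ^+ 3 * (4 * b ^+ 3)) = K%:R * b ^+ 2 * b * A + e * B.
  by rewrite /A /B; move: (K%:R : R) (C) (`|sigma|) => k x y; field.
rewrite -tsK.
have h1 : (t - s) * b * A <= A * beta.
  rewrite mulrC ler_wpM2l//; apply: le_trans bbeta.
  by rewrite ler_piMl ?(ltW b0)//; lra.
lra.
Qed.

(** The positive part of [tau] keeps blocks bounded and measurable for every real [tau]; near [+oo]
    it is [tau] itself. *)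
Definition block tau m k w : R :=
  X (level tau) (Num.max 0 tau) (tm m k.+1) w - X (level tau) (Num.max 0 tau) (tm m k) w.

Let tm_ge0 m k : 0 <= tm m k :> R. Proof. exact: divr_ge0. Qed.

Let tm_nd m k l : (k <= l)%N -> tm m k <= tm m l :> R.
Proof. by move=> kl; rewrite ler_wpM2r ?invr_ge0// ler_nat. Qed.

Let tm_lt m k : (0 < m)%N -> tm m k < tm m k.+1 :> R.
Proof. by move=> m0; rewrite ltr_pM2r ?invr_gt0 ?ltr0n// ltr_nat. Qed.

Let tm_le1 m k : (0 < m)%N -> (k <= m)%N -> tm m k <= 1 :> R.
Proof. by move=> m0 km; rewrite ler_pdivrMr ?ltr0n// mul1r ler_nat. Qed.

Let max_ge0 (tau : R) : 0 <= Num.max 0 tau. Proof. by rewrite le_max lexx. Qed.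

Lemma block_bmf tau m k : bmf (block tau m k).
Proof. by apply: bmfB; apply: rescaled_bmf. Qed.

Lemma block_adapted tau m k j : (k < j)%N ->
  adapted T Z (Num.max 0 tau * tm m j) (block tau m k).
Proof.
move=> kj; apply: (adB adP); apply: rescaled_adapted => //; apply: tm_nd => //.
exact: ltnW.
Qed.

(** Induction on the number of blocks: the product over the earlier ones, divided by a uniform
    bound, is the past variable [H] of [block_cvg] for the next. Asymptotic independence thus comes
    together with normality. *)
Lemma block_prod_cvg m j (f : nat -> R -> R) : (0 < m)%N -> (j <= m)%N ->
  (forall k, smooth (f k)) ->
  Ex P (fun w => \prod_(k < j) f k (block tau m k w)) @[tau --> +oo] -->
  \prod_(k < j) Ex P' (fun w => f k (brownian_step W sigma m k w)).
Proof.
move=> m0 + sf; elim: j => [|j IH] jm.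
  rewrite big_ord0 (_ : (fun _ => _) = fun=> 1); first exact: cvg_cst.
  apply/funext => tau; rewrite -[RHS](Ex_cst P); congr (Ex P _).
  by apply/funext => w; rewrite big_ord0.
rewrite big_ord_recr/=; set q := Ex P' _.
have [B B0 hB] : exists2 B, 0 < B & forall x : nat -> R, `|\prod_(k < j) f k (x k)| <= B.
  elim: j {IH jm q} => [|j [B B0 hB]].
    by exists 1 => // x; rewrite big_ord0 normr1.
  have [L [f1 [f2 sm]]] := sf j.
  have L0 : 0 <= L by have [h _ _] := smooth3_bounded sm 0; exact: le_trans h.
  exists (B * (L + 1)); first by rewrite mulr_gt0// ltr_wpDl.
  move=> x; rewrite big_ord_recr/= normrM ler_pM//.
  by have [h _ _] := smooth3_bounded sm (x j); rewrite (le_trans h)// lerDl.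
pose H tau w := B^-1 * \prod_(k < j) f k (block tau m k w).
have bfk tau k : bmf (fun w => f k (block tau m k w)).
  have [mf [D hD]] := smooth_bmf (sf k).
  by apply: (bmf_comp mf hD); exact: bmf_meas (block_bmf tau m k).
have bprod tau : bmf (fun w => \prod_(k < j) f k (block tau m k w)) by exact: bmf_prod.
have bH tau : bmf (H tau) by have ? := bprod tau; rewrite /H; bm.
have H1 tau w : `|H tau w| <= 1.
  rewrite normrM ger0_norm ?invr_ge0 ?(ltW B0)// mulrC ler_pdivrMr// mul1r.
  exact: (hB (fun k => block tau m k w)).
have aH tau : adapted T Z (Num.max 0 tau * tm m j) (H tau).
  apply: (adM adP); first exact: (ad_cst adP).
  suff h i : (i <= j)%N -> adapted T Z (Num.max 0 tau * tm m j)
      (fun w => \prod_(k < i) f k (block tau m k w)) by exact: h.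
  elim: i => [|i IHi] ij.
    rewrite (_ : (fun _ => _) = fun=> 1); first exact: (ad_cst adP).
    by apply/funext => w; rewrite big_ord0.
  rewrite (_ : (fun _ => _) = fun w => \prod_(k < i) f k (block tau m k w) * f i (block tau m i w)).
    apply: (adM adP); first by apply: IHi; exact: ltnW.
    apply: (ad_comp adP); first exact: bmf_meas (smooth_bmf (sf i)).
    exact: block_adapted.
  by apply/funext => w; rewrite big_ord_recr.
pose D tau := Ex P (fun w => H tau w * f j (block tau m j w)) - Ex P (H tau) * q.
have D0 : D tau @[tau --> +oo] --> (0 : R).
  apply/cvgrPdist_le => eps eps0.
  have [e e0 he] := block_cvg (sf j) (tm_ge0 m j) (tm_lt j m0) (tm_le1 m0 jm) eps0.
  apply: filterS (regular_near e0) => tau reg; rewrite sub0r normrN /D.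
  have tau0 := regular_gt0 reg; have mx : Num.max 0 tau = tau by rewrite max_r// ltW.
  have := he tau (level tau) (H tau) reg (bH tau); rewrite /block mx.
  have := aH tau; rewrite mx => h1 h2; apply: h2 => //.
rewrite (_ : (fun tau => _) = fun tau => B * D tau +
    Ex P (fun w => \prod_(k < j) f k (block tau m k w)) * q).
  have -> : \prod_(k < j) Ex P' (fun w => f k (brownian_step W sigma m k w)) * q =
    B * 0 + \prod_(k < j) Ex P' (fun w => f k (brownian_step W sigma m k w)) * q.
    by rewrite mulr0 add0r.
  apply: cvgD; first by apply: cvgM => //; exact: cvg_cst.
  by apply: cvgM; [apply: IH; exact: ltnW|exact: cvg_cst].
apply/funext => tau.
have e1 w : B * H tau w = \prod_(k < j) f k (block tau m k w) by rewrite mulVKf// gt_eqF.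
have eH : B * Ex P (H tau) = Ex P (fun w => \prod_(k < j) f k (block tau m k w)).
  rewrite -ExZ; last exact: bmf_ibl.
  by congr (Ex P _); apply/funext => w.
have eF : B * Ex P (fun w => H tau w * f j (block tau m j w)) =
    Ex P (fun w => \prod_(k < j.+1) f k (block tau m k w)).
  rewrite -ExZ; last by apply: bmf_ibl; have ? := bH tau; have ? := bfk tau j; bm.
  by congr (Ex P _); apply/funext => w; rewrite mulrA e1 big_ord_recr.
by rewrite /D mulrBr eF mulrA eH subrK.
Qed.

Lemma block_sqr_near m : (0 < m)%N ->
  \forall tau \near (+oo : set_system R), forall k, (k < m)%N -> Ex P (fun w => block tau m k w ^+ 2) <= 2 * C.
Proof.
move=> m0; apply: filterS (regular_near ltr01) => tau reg k km.
have tau0 := regular_gt0 reg; have tau_ge0 := ltW tau0.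
have mx : Num.max 0 tau = tau by rewrite max_r.
have s0 : 0 <= tau * tm m k by rewrite mulr_ge0.
have st : tau * tm m k <= tau * tm m k.+1 by rewrite ler_wpM2l// tm_nd.
have t1 : tau * tm m k.+1 <= tau by rewrite -[leRHS]mulr1 ler_wpM2l// tm_le1.
have h := Ex_hmart_increment_sqr phi_meas phi_ge0 phi_lt1 nu_ge0 hawkes reg s0 st t1.
set q := (1 + a) * Num.sqrt tau.
have q2 : q ^+ 2 = (1 + a) ^+ 2 * tau by rewrite exprMn sqr_sqrtr.
have sc1 : 1 <= (1 + a) ^+ 2 by rewrite exprn_ege1// lerDl.
have q20 : 0 < q ^+ 2 by rewrite q2 mulr_gt0// (lt_le_trans ltr01).
have -> : (fun w => block tau m k w ^+ 2) = (fun w => (q ^+ 2)^-1 *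
    (M (level tau) (tau * tm m k.+1) w - M (level tau) (tau * tm m k) w) ^+ 2).
  by apply/funext => w; rewrite /block mx /rescaled -/q -mulrBl exprMn exprVn mulrC.
have b1 := bM (level tau) s0; have b2 := bM (level tau) (le_trans s0 st).
rewrite ExZ; last by apply: bmf_ibl; bm.
rewrite mulrC ler_pdivrMr//; apply: le_trans h _.
have -> : (tau * tm m k.+1 - tau * tm m k) / tau = tm m k.+1 - tm m k.
  by rewrite -mulrBr mulrAC divff ?gt_eqF// mul1r.
rewrite q2 mulrA ler_wpM2r//.
have d1 : tm m k.+1 - tm m k <= 1 :> R.
  by have := tm_le1 m0 km; have := tm_ge0 m k; lra.
have h1 : C * (tm m k.+1 - tm m k + 1) <= 2 * C by rewrite mulrC ler_wpM2r//; lra.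
apply: le_trans h1 _; rewrite -[leLHS]mulr1 ler_wpM2l// mulr_ge0//.
Qed.

End products.

(** * Tightness and approximation of the path *)

Lemma cvg_sum_ord {R : realType} {T : Type} (F : set_system T) {FF : Filter F} n
    (f : nat -> T -> R) (l : nat -> R) :
  (forall k, f k @ F --> l k) -> \sum_(k < n) f k x @[x --> F] --> \sum_(k < n) l k.
Proof.
move=> fl; elim: n => [|n IH].
  rewrite big_ord0 (_ : (fun _ => _) = fun=> 0); first exact: cvg_cst.
  by apply/funext => x; rewrite big_ord0.
rewrite big_ord_recr/= (_ : (fun _ => _) = fun x => \sum_(k < n) f k x + f n x).
  exact: cvgD.
by apply/funext => x; rewrite big_ord_recr.
Qed.

Lemma sqr_ge_near {R : realFieldType} (x y z : R) :
  `|y| <= (z ^+ 2 - x) / (2 * `|z| + 1) -> x <= (z + y) ^+ 2.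
Proof.
rewrite ler_pdivlMr ?ltr_wpDl ?mulr_ge0// => h.
have h1 : - (2 * z * y) <= 2 * `|z| * `|y|.
  by rewrite (le_trans (ler_norm _))// normrN !normrM (ger0_norm (ler0n R 2)).
have := sqr_ge0 y; have := normr_ge0 y; move: h; rewrite sqrrD mulrDr mulr1; lra.
Qed.

Section liminf.
Context {R : realType} {d : measure_display} {Omega : measurableType d}.
Variable P : probability Omega R.

(** Fatou's lemma for events: the intersections increase to the lower limit, and each is contained
    in one of the [F J]. *)
Lemma Pr_liminf (F : nat -> set Omega) (beta : R) : (forall j, measurable (F j)) ->
  (forall j, Pr P (F j) <= beta) ->
  measurable (\bigcup_J \bigcap_(j in [set j | (J <= j)%N]) F j) /\
  Pr P (\bigcup_J \bigcap_(j in [set j | (J <= j)%N]) F j) <= beta.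
Proof.
move=> mF hF; pose G J := \bigcap_(j in [set j | (J <= j)%N]) F j.
have mG J : measurable (G J) by apply: bigcap_measurableType.
have mU : measurable (\bigcup_J G J) by exact: bigcupT_measurable.
split=> //.
have nd : nondecreasing_seq G.
  move=> i j ij; apply/subsetPset => w Gw k /= jk; apply: Gw => /=; exact: leq_trans jk.
have h := nondecreasing_cvg_mu mG mU nd.
rewrite -lee_fin PrE//.
have h' : P \o G @ \oo --> P (\bigcup_J G J) by exact: h.
rewrite -(cvg_lim _ h')//; apply: lime_le; first by apply/cvg_ex; eexists; exact: h'.
apply: nearW => J /=; rewrite -PrE// lee_fin; apply: le_trans (hF J).
by apply: Pr_le => // w; apply => /=.
Qed.

End liminf.

(** * Cadlag paths and oscillations of the martingale *)

Section paths.
Context {R : realType} {d : measure_display} {Omega : measurableType d}.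
Variable P : probability Omega R.
Variables (T : nat -> Omega -> \bar R) (Z : nat -> Omega -> 'I_2).
Variable phi : R -> R.
Hypothesis phi_meas : measurable_fun (`[0, +oo[ : set R) phi.
Hypothesis phi_ge0 : forall t, 0 <= t -> 0 <= phi t.
Hypothesis phi_lt1 : (\int[lebesgue_measure]_(t in `[0%R, +oo[) (phi t)%:E < 1)%E.
Variable nu : R.
Hypothesis nu_ge0 : 0 <= nu.
Hypothesis hawkes : hawkes_process T Z P (fun i t w =>
  let j := if i == ord0 then ord_max else ord0 in
  nu%:E + \int[jump_measure T Z j w]_(s in `]0%R, t[) (phi (t - s))%:E)%E.

Let mt : marked_times T Z. Proof. by case: hawkes. Qed.

Local Notation M n t := (hmart T Z phi nu n (-1) t).

Let mone_sqr : (-1 : R) * -1 = 1. Proof. by rewrite mulrNN mulr1. Qed.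
Let bM n t : 0 <= t -> bmf (M n t).
Proof. exact: (hmart_bmf phi_meas phi_ge0 phi_lt1 nu_ge0 hawkes mone_sqr). Qed.

Definition counting_diff t w : R :=
  fine (counting_process T Z ord0 t w) - fine (counting_process T Z ord_max t w).

Lemma counting_diffE n t w : 0 <= t -> (t%:E <= T n w)%E ->
  counting_diff t w = jumps T Z n (-1) t w.
Proof.
move=> t0 tT; have e : stopped T n t w = t.
  by apply: EFin_inj; rewrite (stoppedE mt)// min_l.
rewrite /counting_diff -{1 2}e !counting_stopped//= -sumrB.
apply: eq_bigr => k _; rewrite -mulrBl; congr (_ * _); rewrite /weight.
by case: (Z k w) => [[|[|//]] h]; rewrite -!val_eqE/= ?subr0 ?sub0r.
Qed.

Let jumped_right k tau x w : 0 < tau ->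
  jumped T k (tau * y) w @[y --> x^'+] --> jumped T k (tau * x) w.
Proof.
move=> tau0; apply: cvg_near_cst; rewrite /jumped.
case: (leP (T k w)) => h.
  have := nbhs_right_gt x; apply: filterS => y xy.
  by rewrite (le_trans h)// lee_fin ler_pM2l// ltW.
case Tk : (T k w) h => [r| |] // h; last first.
  by apply: nearW => y; rewrite leNgt ltry.
have xr : x < r / tau by rewrite ltr_pdivlMr// mulrC; rewrite lte_fin in h.
apply: filterS (nbhs_right_lt xr) => y; rewrite ltr_pdivlMr// mulrC => yr.
by rewrite lee_fin leNgt yr.
Qed.

Let jumped_left k tau x w : 0 < tau -> cvg (jumped T k (tau * y) w @[y --> x^'-]).
Proof.
move=> tau0; case: (ltP (T k w) (tau * x)%:E) => h.
  apply/cvg_ex; exists 1; apply: cvg_near_cst; rewrite /jumped.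
  have T0 := jump_time_gt0 mt k w.
  case Tk : (T k w) T0 h => [r| |] // _ h.
  have xr : r / tau < x by rewrite ltr_pdivrMr// mulrC; rewrite lte_fin in h.
  apply: filterS (nbhs_left_gt xr) => y; rewrite ltr_pdivrMr// mulrC => yr.
  by rewrite lee_fin ltW.
apply/cvg_ex; exists 0; apply: cvg_near_cst; rewrite /jumped.
apply: filterS (nbhs_left_lt x) => y yx; rewrite leNgt (lt_le_trans _ h)//.
by rewrite lte_fin ltr_pM2l.
Qed.

Lemma jumps_right n eps tau x w : 0 < tau ->
  jumps T Z n eps (tau * y) w @[y --> x^'+] --> jumps T Z n eps (tau * x) w.
Proof.
move=> tau0.
have h k : weight eps (Z k w) * jumped T k (tau * y) w @[y --> x^'+] -->
    weight eps (Z k w) * jumped T k (tau * x) w.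
  by apply: cvgM; [exact: cvg_cst|exact: jumped_right].
have := cvg_sum_ord (n := n.+1) h; exact.
Qed.

Lemma jumps_left n eps tau x w : 0 < tau ->
  cvg (jumps T Z n eps (tau * y) w @[y --> x^'-]).
Proof.
move=> tau0.
have /choice[l hl] : forall k, exists l : R, jumped T k (tau * y) w @[y --> x^'-] --> l.
  by move=> k; apply/cvg_ex; exact: jumped_left.
apply/cvg_ex; exists (\sum_(k < n.+1) weight eps (Z k w) * l k).
have h k : weight eps (Z k w) * jumped T k (tau * y) w @[y --> x^'-] -->
    weight eps (Z k w) * l k.
  by apply: cvgM; [exact: cvg_cst|exact: hl].
have := cvg_sum_ord (n := n.+1) h; exact.
Qed.

(** On [[0, 1]] the path coincides with a finite sum of steps, and the one-sided limits required at
    0 and at 1 look inside the interval. *)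
Lemma cadlag_counting_diff n tau q w : 0 < tau -> (tau%:E < T n w)%E ->
  cadlag01 (fun v => q * counting_diff (tau * v) w).
Proof.
move=> tau0 Tn.
have e v : 0 <= v <= 1 -> counting_diff (tau * v) w = jumps T Z n (-1) (tau * v) w.
  move=> /andP[v0 v1]; apply: counting_diffE; first by rewrite mulr_ge0// ltW.
  by apply: le_trans (ltW Tn); rewrite lee_fin ler_piMr// ltW.
split=> x /andP[x0 x1]; [apply: cvgM; first exact: cvg_cst|
  apply: is_cvgM; first exact: is_cvg_cst].
- rewrite e ?x0 ?(ltW x1)//.
  have hj := @jumps_right n (-1) tau x w tau0.
  have hq : (fun y => jumps T Z n (-1) (tau * y) w) y @[y --> x^'+] --> jumps T Z n (-1) (tau * x) w by exact: hj.
  apply: cvg_trans hq.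
  apply: near_eq_cvg; have h1 := nbhs_right_gt x; have h2 := nbhs_right_lt x1.
  apply: filterS (filterI h1 h2) => y [xy y1].
  by rewrite /= e// (ltW y1) (le_trans x0)// ltW.
- apply/cvg_ex; have /cvg_ex[l hl] := @jumps_left n (-1) _ x w tau0; exists l.
  apply: cvg_trans; last exact: hl.
  apply: near_eq_cvg.
  have h1 := nbhs_left_gt x0; have h2 := nbhs_left_lt x.
  apply: filterS (filterI h1 h2) => y [xy y1].
  by rewrite /= e// (ltW xy) (le_trans (ltW y1)).
Qed.

(** By [Pr_time_le], the probability of [n + 1] jumps before [tau] is [O(1 / n)]. *)
Lemma no_explosion tau : 0 < tau -> {ae P, forall w, exists n, (tau%:E < T n w)%E}.
Proof.
move=> tau0; have tau_ge0 := ltW tau0.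
pose A n := [set w | (T n w <= tau%:E)%E].
have mA n : measurable (A n).
  rewrite -[X in measurable X]setTI.
  by apply: emeasurable_fun_infty_c => //; case: mt.
have mI : measurable (\bigcap_n A n) by exact: bigcapT_measurable.
exists (\bigcap_n A n); split=> //.
  rewrite -PrE//; congr (_%:E); apply/eqP; rewrite eq_le Pr_ge0 andbT.
  have c0 := rate_ge0 phi_ge0 phi_lt1 nu_ge0.
  apply/ler_addgt0Pr => e e0; rewrite add0r.
  pose n := Num.bound (rate phi nu * tau / e).
  have h0 : 0 <= rate phi nu * tau / e by rewrite divr_ge0 ?(ltW e0)// mulr_ge0.
  apply: (@le_trans _ _ (Pr P (A n))); first by apply: Pr_le => // w; exact.
  apply: le_trans (Pr_time_le phi_meas phi_ge0 phi_lt1 nu_ge0 hawkes n tau_ge0) _.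
  rewrite ler_pdivrMr ?ltr0n// [leRHS]mulrC -ler_pdivrMr//.
  by rewrite (le_trans (ltW (archi_boundP h0)))// ler_nat.
move=> w /= nex n _; rewrite /A /= leNgt; apply/negP => h; apply: nex.
by exists n.
Qed.

Lemma hmart_right n s w e : 0 <= s -> 0 < e ->
  exists2 del, 0 < del & forall r, s <= r -> r < s + del -> `|M n r w - M n s w| <= e.
Proof.
move=> s0 e0; have e2 : 0 < e / 2 by rewrite divr_gt0.
have [d1 d10 h1] := drift_cont phi_meas phi_ge0 phi_lt1 nu_ge0 hawkes n w e2.
have /cvgrPdist_le/(_ _ e2) := @jumps_right n (-1) 1 s w ltr01.
move=> [d2 /= d20 h2].
exists (Num.min d1 d2); first by rewrite lt_min d10.
move=> r sr; rewrite -ltrBlDl lt_min => /andP[r1 r2].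
have dr : `|drift T Z phi nu n (-1) r w - drift T Z phi nu n (-1) s w| <= e / 2.
  apply: le_trans (drift_nd phi_meas phi_ge0 phi_lt1 nu_ge0 hawkes mone_sqr n w s0 sr) _.
  by apply: h1 => //; lra.
have jr : `|jumps T Z n (-1) r w - jumps T Z n (-1) s w| <= e / 2.
  move: sr; rewrite le_eqVlt => /predU1P[->|sr]; first by rewrite subrr normr0 ltW.
  have := h2 r; rewrite !mul1r distrC; apply => //=.
  by rewrite distrC gtr0_norm ?subr_gt0.
have tri (x1 x2 x3 x4 : R) : `|x1 - x2| <= e / 2 -> `|x3 - x4| <= e / 2 ->
    `|(x1 - x3) - (x2 - x4)| <= e.
  move=> h3 h4; rewrite (_ : _ - _ - _ = (x1 - x2) - (x3 - x4)); last by ring.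
  by rewrite (le_trans (ler_normB _ _))//; lra.
exact: tri jr dr.
Qed.

Section oscillation.
Variables (n : nat) (s t x : R).
Hypotheses (s0 : 0 <= s) (st : s <= t) (x0 : 0 < x).

Let F p := [set w | x <= runmax (fun k => (M n (part s t p.+1 k) w - M n s w) ^+ 2) p.+1].

(* By right continuity an oscillation is seen by all grids that are fine enough, hence
   a lower limit and no need for nested grids. *)
Definition oscillating := \bigcup_J \bigcap_(p in [set p | (J <= p)%N]) F p.

Let t0 : 0 <= t. Proof. exact: le_trans st. Qed.

Let pge p k : s <= part s t p k. Proof. exact: part_ge. Qed.
Let pge0 p k : 0 <= part s t p k. Proof. exact: le_trans (pge p k). Qed.

Let brun p m : bmf (fun w => runmax (fun k => (M n (part s t p k) w - M n s w) ^+ 2) m).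
Proof.
have b k : bmf (fun w => (M n (part s t p k) w - M n s w) ^+ 2).
  by apply: bmfX; apply: bmfB; exact: bM.
by elim: m => [|m IH] //=; apply: bmf_max.
Qed.

Let part_le_end p k : (0 < p)%N -> (k <= p)%N -> part s t p k <= t.
Proof.
move=> p0 kp; rewrite /part -lerBrDl ler_piMr ?subr_ge0//.
by rewrite ler_pdivrMr ?ltr0n// mul1r ler_nat.
Qed.

Let eq_runmax (X Y : nat -> R) m : (forall k, (k <= m)%N -> X k = Y k) -> runmax X m = runmax Y m.
Proof.
elim: m => [|m IH] h /=; first exact: h.
by rewrite IH ?h// => k km; apply: h; exact: leqW.
Qed.

(** Doob's inequality for the squared increments on each grid, and Markov's at level [x^2]. The
    bound is the same for all grids, so it passes to the lower limit. *)
Lemma oscillating_small : measurable oscillating /\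
  Pr P oscillating <= 4 * Ex P (fun w => (M n t w - M n s w) ^+ 4) / x ^+ 2.
Proof.
apply: Pr_liminf => p; first by apply: measurable_ge; exact: bmf_meas (brun p.+1 p.+1).
rewrite ler_pdivlMr ?exprn_gt0// mulrC.
have cp := hawkes_compensated phi_meas phi_ge0 phi_lt1 nu_ge0 hawkes mone_sqr n t0.
have h := comp_doob4 (adapted_adaptedness T Z) cp (tau := part s t p.+1) p.+1
  (pge0 p.+1 0) (part_nd st p.+1).
rewrite part0 (partp s t (ltn0Sn p)) minxx (min_l st) in h.
have e w : runmax (fun k => (M n (Num.min (part s t p.+1 k) t) w - M n s w) ^+ 2) p.+1 =
    runmax (fun k => (M n (part s t p.+1 k) w - M n s w) ^+ 2) p.+1.
  apply: eq_runmax => k kp.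
  by have -> := min_l (part_le_end (ltn0Sn p) kp).
apply: le_trans h; apply: Pr_markov.
- by apply: measurable_ge; exact: bmf_meas (brun p.+1 p.+1).
- apply: bmf_ibl; apply: bmfX.
  rewrite (funext e); exact: brun.
- by move=> w; exact: sqr_ge0.
- move=> w hw; have hw' : x <= runmax (fun k => (M n (part s t p.+1 k) w - M n s w) ^+ 2) p.+1 by exact: hw.
  rewrite e lerXn2r ?nnegrE ?(ltW x0)//.
  by rewrite (le_trans (ltW x0)).
Qed.

(** Otherwise the square would be at least [x] on some [[r, r + del[], which meets every grid of
    mesh below [del]; then [w] would belong to the lower limit. *)
Lemma not_oscillating w r : ~ oscillating w -> s <= r <= t -> (M n r w - M n s w) ^+ 2 <= x.
Proof.
move=> no rst; rewrite leNgt; apply/negP => hx; apply: no.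
have /andP[sr rt] := rst; have r0 := le_trans s0 sr.
set z := M n r w - M n s w in hx.
have [del del0 hdel] : exists2 del, 0 < del & forall r', r <= r' -> r' < r + del ->
    x <= (M n r' w - M n s w) ^+ 2.
  have e0 : 0 < (z ^+ 2 - x) / (2 * `|z| + 1).
    by rewrite divr_gt0 ?subr_gt0// ltr_wpDl// mulr_ge0.
  have [del1 del10 h] := hmart_right n w r0 e0.
  exists del1; first exact: del10.
  move=> r' rr' rd.
  have -> : M n r' w - M n s w = z + (M n r' w - M n r w) by rewrite [RHS]addrC subrKA.
  exact: sqr_ge_near (h r' rr' rd).
pose J := Num.bound ((t - s) / del); exists J => // p /= Jp.
have [k kp /andP[k1 k2]] := part_cover (ltn0Sn p) rst.
rewrite /F /=; apply: le_trans (runmax_ge (fun k => (M n (part s t p.+1 k) w - M n s w) ^+ 2) kp).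
apply: hdel => //; rewrite part_step//.
apply: ler_ltD => //.
have h0 : 0 <= (t - s) / del by rewrite divr_ge0 ?subr_ge0// ltW.
rewrite ltr_pdivrMr ?ltr0n// mulrC -ltr_pdivrMr//.
by apply: lt_le_trans (archi_boundP h0) _; rewrite ler_nat leqW.
Qed.

End oscillation.

End paths.

(** * Pathwise comparison of the difference with its martingale *)

Section approximation.
Context {R : realType} {d : measure_display} {Omega : measurableType d}.
Variable P : probability Omega R.
Variables (T : nat -> Omega -> \bar R) (Z : nat -> Omega -> 'I_2).
Variable phi : R -> R.
Hypothesis phi_meas : measurable_fun (`[0, +oo[ : set R) phi.
Hypothesis phi_ge0 : forall t, 0 <= t -> 0 <= phi t.
Hypothesis phi_lt1 : (\int[lebesgue_measure]_(t in `[0%R, +oo[) (phi t)%:E < 1)%E.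
Variable nu : R.
Hypothesis nu_ge0 : 0 <= nu.
Hypothesis hawkes : hawkes_process T Z P (fun i t w =>
  let j := if i == ord0 then ord_max else ord0 in
  nu%:E + \int[jump_measure T Z j w]_(s in `]0%R, t[) (phi (t - s))%:E)%E.

Let mt : marked_times T Z. Proof. by case: hawkes. Qed.

Local Notation a := (mass phi).
Local Notation S n t := (jumps T Z n (-1) t).
Local Notation M n t := (hmart T Z phi nu n (-1) t).

Let a0 : 0 <= a. Proof. exact: (mass_ge0 phi_ge0). Qed.
Let a1 : a < 1. Proof. exact: (mass_lt1 phi_ge0 phi_lt1). Qed.

Section path.
Variables (n m : nat) (tau eta : R) (w : Omega).
Hypotheses (tau0 : 0 < tau) (m0 : (0 < m)%N) (Tn : (tau%:E < T n w)%E).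
Hypothesis osc : forall k s, (k < m)%N ->
  tau * tm m k <= s <= tau * tm m k.+1 -> `|M n s w - M n (tau * tm m k) w| <= eta.
Hypothesis tail : a - Phi phi (tau * m%:R^-1) <= m%:R^-1.

Let mp : (0 : R) < m%:R. Proof. by rewrite ltr0n. Qed.

Let stoppedy y : y <= tau -> stopped T n y w = y.
Proof.
move=> yt; rewrite /stopped min_l//.
by apply: le_trans (ltW Tn); rewrite lee_fin.
Qed.

Let recall k y := jumped T k y w * Phi phi (y - fine (T k w)).

(** The formula of [M] without stopping: it equals [M] up to [tau], and it is visibly a bounded
    measurable function of the lag, as [kint] requires. *)
Let mpath y := S n y w + \sum_(k < n.+1) weight (-1) (Z k w) * recall k y.

Let mpathE y : y <= tau -> M n y w = mpath y.
Proof.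
move=> yt; rewrite /hmart /drift stoppedy// /mpath subrr !mul0r add0r mulN1r opprK.
by congr (_ + _); apply: eq_bigr => k _; rewrite /memory stoppedy.
Qed.

Let hmart_le0 y : y <= 0 -> M n y w = 0.
Proof.
move=> y0; rewrite mpathE; last by rewrite (le_trans y0)// ltW.
rewrite /mpath (jumps_le0 hawkes)// add0r; apply: big1 => k _.
rewrite /recall /jumped leNgt (le_lt_trans (y := 0%E)) ?lee_fin ?(jump_time_gt0 mt)//.
by rewrite mul0r mulr0.
Qed.

Let bmf_recall k s : bmf (fun x : R => recall k (s - x)).
Proof.
apply: bmfM; first exact: (bmf_jumped_shift hawkes).
split.
  apply: (@measurableT_comp _ _ _ _ _ _ (Phi phi) _ (fun x : R => s - x - fine (T k w))).
    apply: nondecreasing_measurable => // x y xy.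
    exact: (Phi_nd phi_meas phi_ge0 phi_lt1).
  apply: measurable_funB; last exact: measurable_cst.
  by apply: measurable_funB => //; exact: measurable_cst.
exists a => x; have /andP[h1 h2] := Phi_itv phi_meas phi_ge0 phi_lt1 (s - x - fine (T k w)).
by rewrite ger0_norm.
Qed.

Let bmf_mpath s : bmf (fun x : R => mpath (s - x)).
Proof.
apply: bmfD; first exact: (jumps_shift hawkes).
by apply: bmf_sum => k; apply: bmfM; [exact: bmf_cst|exact: bmf_recall].
Qed.

Let hmartE s : 0 <= s <= tau -> M n s w = S n s w + kint phi (fun x => S n (s - x) w).
Proof.
move=> /andP[s0 st]; rewrite /hmart /drift subrr !mul0r add0r mulN1r opprK; congr (_ + _).
by rewrite (memories_kint phi_meas phi_ge0 phi_lt1 hawkes)// stoppedy.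
Qed.

Let block_of s : 0 <= s <= tau ->
  exists2 k, (k < m)%N & tau * tm m k <= s <= tau * tm m k.+1.
Proof.
move=> st; have [k km h] := part_cover m0 st; exists k => //.
by move: h; rewrite /part !add0r subr0.
Qed.

Let tm0 : tau * tm m 0 = 0. Proof. by rewrite /tm mul0r mulr0. Qed.

Let tmS k : tau * tm m k.+1 = tau * tm m k + tau * m%:R^-1.
Proof. by rewrite /tm -natr1; field; rewrite gt_eqF. Qed.

Let tm_ge0 k : 0 <= tau * tm m k.
Proof. by rewrite mulr_ge0 ?(ltW tau0)// divr_ge0. Qed.

Let h0 : 0 < tau * m%:R^-1. Proof. by rewrite mulr_gt0// invr_gt0. Qed.

Let eta0 : 0 <= eta.
Proof.
apply: le_trans (osc (k := 0) (s := 0) m0 _); first exact: normr_ge0.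
by rewrite tm0 tmS tm0 add0r lexx ltW.
Qed.

Let M_grid k : (k <= m)%N -> `|M n (tau * tm m k) w| <= k%:R * eta.
Proof.
elim: k => [|k IH] km; first by rewrite tm0 hmart_le0// normr0 mul0r.
have h1 := IH (ltnW km).
have h2 : `|M n (tau * tm m k.+1) w - M n (tau * tm m k) w| <= eta.
  by apply: osc => //; rewrite lexx andbT tmS lerDl ltW.
rewrite -natr1 mulrDl mul1r addrC -[M n (tau * tm m k.+1) w](subrK (M n (tau * tm m k) w)).
by rewrite (le_trans (ler_normD _ _))// lerD.
Qed.

Let M_bound s : s <= tau -> `|M n s w| <= m%:R * eta.
Proof.
move=> st; case: (leP s 0) => s0; first by rewrite hmart_le0// normr0 mulr_ge0// ltW.
have st' : 0 <= s <= tau by rewrite (ltW s0).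
have [k km hk] := block_of st'.
have h1 := M_grid (ltnW km); have h2 := osc km hk.
apply: (@le_trans _ _ (k.+1%:R * eta)); last by rewrite ler_wpM2r// ler_nat.
rewrite -natr1 mulrDl mul1r addrC -[M n s w](subrK (M n (tau * tm m k) w)).
by rewrite (le_trans (ler_normD _ _))// lerD.
Qed.

(** A lag of at most one block stays in the same block or reaches the previous one: at most three
    oscillations. *)
Let M_local s x : 0 <= s <= tau -> 0 < x -> x <= tau * m%:R^-1 ->
  `|M n s w - M n (s - x) w| <= 3 * eta.
Proof.
move=> st x0 xh; have [k km hk] := block_of st.
have h1 := osc km hk; have /andP[hk1 hk2] := hk; have /andP[s0 s1] := st.
have e0 := eta0.
move: (M n s w) h1 => y h1.
case: (leP (tau * tm m k) (s - x)) => h.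
  have h2 : `|M n (s - x) w - M n (tau * tm m k) w| <= eta.
    by apply: osc => //; rewrite h/=; lra.
  move: (M n (s - x) w) (M n (tau * tm m k) w) h1 h2 => z u.
  rewrite !ler_norml => /andP[? ?] /andP[? ?]; apply/andP; split; lra.
case: k km hk hk1 hk2 h h1 => [|k] km hk hk1 hk2 h h1.
  rewrite tm0 in h h1; rewrite hmart_le0 in h1; last exact: lexx.
  rewrite hmart_le0; last exact: ltW.
  by rewrite (le_trans h1)//; lra.
have km' : (k < m)%N by exact: ltnW.
have h2 : `|M n (tau * tm m k.+1) w - M n (tau * tm m k) w| <= eta.
  by apply: osc => //; rewrite lexx andbT tmS lerDl ltW.
have h3 : `|M n (s - x) w - M n (tau * tm m k) w| <= eta.
  apply: osc => //; apply/andP; split; last exact: ltW.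
  by rewrite lerBrDr (le_trans _ hk1)// tmS lerD2l.
move: (M n (s - x) w) (M n (tau * tm m k) w) (M n (tau * tm m k.+1) w) h1 h2 h3 => z u v.
rewrite !ler_norml => /andP[? ?] /andP[? ?] /andP[? ?]; apply/andP; split; lra.
Qed.

(** With [e = S - M / (1 + a)], the equation [S + phi * S = M] becomes
    [e = (a M - phi * M) / (1 + a) - phi * e]. The forcing term is at most [5 eta], and convolution
    with [phi] contracts by [a]. *)
Lemma diff_hmart_close s : 0 <= s <= tau ->
  `|S n s w - M n s w / (1 + a)| <= 5 * eta / (1 - a).
Proof.
move=> st; have aa := a0; have e0 := eta0.
have sc : 0 < 1 + a by rewrite ltr_wpDr.
have tau_ge0 := ltW tau0.
pose e s := S n s w - M n s w / (1 + a).
apply: (contraction_bound (e := e) a0 a1 tau_ge0 _ _ st).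
  exists (n.+1%:R + m%:R * eta) => r /andP[r0 r1].
  have mone_sqr : (-1 : R) * -1 = 1 by rewrite mulrNN mulr1.
  have hS : `|S n r w| <= n.+1%:R.
    have := jumps_nd T Z mone_sqr n w r0; rewrite !(jumps_le0 hawkes _ _ _ (lexx 0)) !subr0.
    by move=> h; apply: le_trans h _; have /andP[] := jumps_itv T Z n r w.
  rewrite (le_trans (ler_normB _ _))// lerD//.
  rewrite normrM (ger0_norm (_ : 0 <= (1 + a)^-1)) ?invr_ge0 ?(ltW sc)//.
  rewrite ler_pdivrMr//; apply: le_trans (M_bound r1) _.
  by rewrite ler_peMr// ?lerDl// mulr_ge0// ltW.
move=> C hC r rt; have /andP[r0 r1] := rt.
have C0 : 0 <= C by apply: le_trans (hC r rt).
have rx x : 0 < x -> r - x <= tau by move=> x0; lra.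
have bS : bmf (fun x : R => S n (r - x) w) by exact: (jumps_shift hawkes).
have bm := bmf_mpath r.
pose h1 x := S n (r - x) w - (1 + a)^-1 * mpath (r - x).
have bh1 : bmf (h1 : R -> R).
  by apply: bmfB => //; apply: bmfM => //; exact: bmf_cst.
pose h2 x := M n r w - mpath (r - x).
have bh2 : bmf (h2 : R -> R) by apply: bmfB => //; exact: bmf_cst.
have k1 : `|kint phi h1| <= C * a.
  apply: (kint_norm_le phi_meas phi_ge0 phi_lt1 bh1) => x x0.
  rewrite /h1 -mpathE; last exact: rx.
  case: (leP 0 (r - x)) => hx.
    have := hC (r - x); rewrite /e [_ / _]mulrC; apply.
    by rewrite hx rx.
  by rewrite hmart_le0 ?(jumps_le0 hawkes) ?(ltW hx)// mulr0 subrr normr0.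
have bi := bmf_ind_le (tau * m%:R^-1).
(* [5 = 3 + 2]: lags within one block cost [3 eta]; longer ones cost at most [2 m eta] each, on a
   kernel tail of mass at most [1 / m]. *)
have k2 : `|kint phi h2| <= 5 * eta.
  apply: (le_trans (kint_norm phi_meas phi_ge0 phi_lt1 bh2)).
  pose h3 x := 3 * eta + 2 * (m%:R * eta) * (1 - ind_le (tau * m%:R^-1) x).
  have b1 : bmf (fun x : R => 1 - ind_le (tau * m%:R^-1) x) by apply: bmfB => //; exact: bmf_cst.
  have bh3 : bmf (h3 : R -> R).
    by apply: bmfD; [exact: bmf_cst|apply: bmfM => //; exact: bmf_cst].
  apply: (@le_trans _ _ (kint phi h3)).
    apply: (kint_le phi_meas phi_ge0 phi_lt1) => //; first exact: bmf_norm.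
    move=> x x0; rewrite /h2 -mpathE; last exact: rx.
    case: (leP x (tau * m%:R^-1)) => hx.
      have -> : h3 x = 3 * eta by rewrite /h3 /ind_le hx subrr mulr0 addr0.
      exact: (M_local rt x0 hx).
    have -> : h3 x = 3 * eta + 2 * (m%:R * eta).
      by rewrite /h3 /ind_le leNgt hx subr0 mulr1.
    have e1 := M_bound r1; have e2 := M_bound (rx x x0).
    rewrite (le_trans (ler_normB _ _))// (le_trans (lerD e1 e2))//.
    by rewrite -mulr2n -[leLHS]mulr_natl lerDr mulr_ge0.
  rewrite (kintD phi_meas phi_ge0 phi_lt1); [|exact: bmf_cst|apply: bmfM => //; exact: bmf_cst].
  rewrite (kint_cst phi_meas phi_ge0 phi_lt1) (kintZ phi_meas phi_ge0 phi_lt1)//.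
  rewrite (kintB phi_meas phi_ge0 phi_lt1)//; last exact: bmf_cst.
  rewrite (kint_cst phi_meas phi_ge0 phi_lt1) mul1r.
  have e1 : 2 * (m%:R * eta) * (a - Phi phi (tau * m%:R^-1)) <= 2 * eta.
    apply: (@le_trans _ _ (2 * (m%:R * eta) * m%:R^-1)).
      by apply: ler_wpM2l => //; rewrite !mulr_ge0// ltW.
    have -> : 2 * (m%:R * eta) * m%:R^-1 = 2 * eta by field; rewrite gt_eqF.
    exact: lexx.
  have e2 : 3 * eta * a <= 3 * eta by rewrite ler_piMr ?(ltW a1)// mulr_ge0.
  apply: le_trans (lerD e2 e1) _; lra.
have kh2 : kint phi h2 = M n r w * a - kint phi (fun x => mpath (r - x)).
  by rewrite (kintB phi_meas phi_ge0 phi_lt1 (bmf_cst _) bm) (kint_cst phi_meas phi_ge0 phi_lt1).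
have kh1 : kint phi h1 = kint phi (fun x => S n (r - x) w) - (1 + a)^-1 * kint phi (fun x => mpath (r - x)).
  rewrite (kintB phi_meas phi_ge0 phi_lt1 bS (bmfM (bmf_cst _) bm)).
  by rewrite (kintZ phi_meas phi_ge0 phi_lt1 _ bm).
have -> : e r = (1 + a)^-1 * kint phi h2 - kint phi h1.
  rewrite kh1 kh2 /e; have := hmartE rt.
  move: (kint phi (fun x => S n (r - x) w)) (kint phi (fun x => mpath (r - x))) => x y.
  move: (M n r w) (S n r w) => u v ->; field; by rewrite gt_eqF.
have i0 : 0 <= (1 + a)^-1 by rewrite invr_ge0 ltW.
have p1 : `|(1 + a)^-1 * kint phi h2| <= 5 * eta.
  rewrite normrM (ger0_norm i0) -[leRHS]mul1r; apply: ler_pM => //.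
  by rewrite invf_le1// lerDl.
by rewrite (le_trans (ler_normB _ _))// lerD// mulrC.
Qed.

End path.

End approximation.

(** * The good event and the functional limit *)

Section conclusion.
Context {R : realType} {d : measure_display} {Omega : measurableType d}.
Variable P : probability Omega R.
Variables (T : nat -> Omega -> \bar R) (Z : nat -> Omega -> 'I_2).
Variable phi : R -> R.
Hypothesis phi_meas : measurable_fun (`[0, +oo[ : set R) phi.
Hypothesis phi_ge0 : forall t, 0 <= t -> 0 <= phi t.
Hypothesis phi_lt1 : (\int[lebesgue_measure]_(t in `[0%R, +oo[) (phi t)%:E < 1)%E.
Variable nu : R.
Hypothesis nu_ge0 : 0 <= nu.
Hypothesis hawkes : hawkes_process T Z P (fun i t w =>
  let j := if i == ord0 then ord_max else ord0 in
  nu%:E + \int[jump_measure T Z j w]_(s in `]0%R, t[) (phi (t - s))%:E)%E.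
Context {d' : measure_display} {Omega' : measurableType d'}.
Variables (P' : probability Omega' R) (W : R -> Omega' -> R).
Hypothesis W_brownian : standard_brownian01 P' W.

Let mt : marked_times T Z. Proof. by case: hawkes. Qed.

Local Notation a := (mass phi).
Local Notation S n t := (jumps T Z n (-1) t).
Local Notation M n t := (hmart T Z phi nu n (-1) t).
Local Notation c := (rate phi nu).
Local Notation C := (moment_cst phi nu).

Variable sigma : R.
Hypothesis sigma2 : sigma ^+ 2 = c / (1 + a) ^+ 2.

Let a0 : 0 <= a. Proof. exact: (mass_ge0 phi_ge0). Qed.
Let a1 : a < 1. Proof. exact: (mass_lt1 phi_ge0 phi_lt1). Qed.
Let C0 : 0 <= C. Proof. by have [] := moment_cst_ge phi_ge0 phi_lt1 nu_ge0. Qed.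

Let tm_nd m k : tm m k <= tm m k.+1 :> R.
Proof. by rewrite ler_wpM2r ?invr_ge0// ler_nat. Qed.

Let tm_ge0 m k : 0 <= tm m k :> R. Proof. exact: divr_ge0. Qed.

Let tm_le1 m k : (0 < m)%N -> (k <= m)%N -> tm m k <= 1 :> R.
Proof. by move=> m0 km; rewrite ler_pdivrMr ?ltr0n// mul1r ler_nat. Qed.

Lemma block_law_cvg m (f : nat -> R -> R) : (0 < m)%N -> (forall k, smooth (f k)) ->
  Ex P (fun w => \prod_(k < m) f k (block T Z phi nu tau m k w)) @[tau --> +oo] -->
  Ex P' (fun w => \prod_(k < m) f k (brownian_step W sigma m k w)).
Proof.
move=> m0 sf.
have b k : bmf (fun x : R => f k (sigma * x)).
  have [mf [D hD]] := smooth_bmf (sf k).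
  by apply: (bmf_comp mf hD); apply: measurable_funM => //; exact: measurable_cst.
have h0 : 0 <= tm m 0 :> R by exact: tm_ge0.
have h1 : tm m m <= 1 :> R by exact: tm_le1.
have := Ex_prod_incr W_brownian h0 h1 (fun k _ => tm_nd m k) b => ->.
exact: (block_prod_cvg phi_meas phi_ge0 phi_lt1 nu_ge0 hawkes W_brownian sigma2 m0 (leqnn m) sf).
Qed.

Section good_event.
Variables (n m : nat) (tau e1 : R).
Hypotheses (tau0 : 0 < tau) (m0 : (0 < m)%N) (e10 : 0 < e1).

Let osc_event k := oscillating T Z phi nu n (tau * tm m k) (tau * tm m k.+1) (e1 ^+ 2 * tau).

Definition good_event : set Omega :=
  ~` ([set w | (T n w <= tau%:E)%E] `|` \big[setU/set0]_(k < m) osc_event k).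

Let x0 : 0 < e1 ^+ 2 * tau. Proof. by rewrite mulr_gt0// exprn_gt0. Qed.
Let tau_ge0 : 0 <= tau. Proof. exact: ltW. Qed.
Let s0 k : 0 <= tau * tm m k. Proof. by rewrite mulr_ge0. Qed.
Let st k : tau * tm m k <= tau * tm m k.+1. Proof. by rewrite ler_wpM2l. Qed.

Let mosc k : measurable (osc_event k).
Proof.
by have [] := oscillating_small phi_meas phi_ge0 phi_lt1 nu_ge0 hawkes n (s0 k) (st k) x0.
Qed.

Let mbad : measurable [set w | (T n w <= tau%:E)%E].
Proof.
rewrite -[X in measurable X]setTI.
by apply: emeasurable_fun_infty_c => //; case: mt.
Qed.

Let mbig : measurable (\big[setU/set0]_(k < m) osc_event k).
Proof. by apply: bigsetU_measurable => k _; exact: mosc. Qed.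

Lemma measurable_good_event : measurable good_event.
Proof. by apply: measurableC; apply: measurableU. Qed.

(** A union bound over [m] blocks. Fourth moments give each of them a probability of order [m^-2],
    up to [e]; second moments would leave a sum of order 1. *)
Lemma Pr_good_event e : regular P T Z phi nu e tau n -> e <= 1 ->
  1 - (e + m%:R * (4 * (C * (m%:R^-1 ^+ 2 + e)) / e1 ^+ 4)) <= Pr P good_event.
Proof.
move=> reg ele1; rewrite /good_event PrC; last exact: measurableU.
rewrite lerD2l lerN2; apply: (le_trans (PrU P mbad mbig)).
apply: lerD; first exact: regular_explosion reg.
apply: (le_trans (Pr_bigsetU P m mosc)).
set y := 4 * _ / _.
apply: (@le_trans _ _ (\sum_(k < m) y)); last by rewrite sumr_const card_ord mulr_natl.
apply: ler_sum => k _; rewrite /y.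
have [_ h] := oscillating_small phi_meas phi_ge0 phi_lt1 nu_ge0 hawkes n (s0 k) (st k) x0.
apply: (le_trans h).
have t1 : tau * tm m k.+1 <= tau.
  by rewrite -[leRHS]mulr1 ler_wpM2l// tm_le1.
have h4 := Ex_hmart_increment_fourth phi_meas phi_ge0 phi_lt1 nu_ge0 hawkes reg ele1 (s0 k) (st k) t1.
have e2 : (tau * tm m k.+1 - tau * tm m k) / tau = m%:R^-1.
  rewrite -mulrBr mulrAC divff ?gt_eqF// mul1r /tm -mulrBl -natr1 addrAC subrr add0r.
  by rewrite mul1r.
rewrite e2 in h4; rewrite ler_pdivrMr ?exprn_gt0//.
have -> : 4 * (C * (m%:R^-1 ^+ 2 + e)) / e1 ^+ 4 * (e1 ^+ 2 * tau) ^+ 2 =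
    4 * (C * (m%:R^-1 ^+ 2 + e) * tau ^+ 2).
  by move: (m%:R^-1 : R) (C) => u v; field; rewrite gt_eqF.
by rewrite ler_wpM2l.
Qed.

Hypothesis tail : a - Phi phi (tau * m%:R^-1) <= m%:R^-1.

(** [6 = 5 + 1]: [diff_hmart_close] costs [5 eta / (1 - a)], and going back from [t] to the last
    grid point costs one oscillation [eta / (1 + a)], at most [eta / (1 - a)]. *)
Lemma good_event_close w : good_event w ->
  (tau%:E < T n w)%E /\
  forall t, t \in `[0, 1] -> `|(Num.sqrt tau)^-1 * counting_diff T Z (tau * t) w -
    step_path m (fun k => rescaled T Z phi nu n tau (tm m k.+1) w - rescaled T Z phi nu n tau (tm m k) w) t|
  <= 6 * e1 / (1 - a).
Proof.
rewrite /good_event setCU => -[Tn nosc].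
have {}Tn : (tau%:E < T n w)%E by rewrite ltNge; apply/negP.
split=> // t; rewrite in_itv/= => /andP[t0 t1].
pose eta := e1 * Num.sqrt tau.
have sq0 : 0 < Num.sqrt tau by rewrite sqrtr_gt0.
have eta_ge0 : 0 <= eta by rewrite mulr_ge0 ?ltW.
have eta2 : eta ^+ 2 = e1 ^+ 2 * tau by rewrite exprMn sqr_sqrtr.
have osc k s : (k < m)%N -> tau * tm m k <= s <= tau * tm m k.+1 ->
    `|M n s w - M n (tau * tm m k) w| <= eta.
  move=> km hs.
  have hno : ~ osc_event k w.
    by move=> h; apply: nosc; rewrite -(bigcup_mkord m osc_event); exists k.
  have := not_oscillating phi_meas phi_ge0 phi_lt1 nu_ge0 hawkes (s0 k) (st k) hno hs.
  rewrite -eta2 -[X in X <= _]real_normK ?num_real// ler_pXn2r// nnegrE; exact: normr_ge0.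
have st' : 0 <= tau * t <= tau by rewrite mulr_ge0//= ler_piMr.
have close := diff_hmart_close phi_meas phi_ge0 phi_lt1 hawkes tau0 m0 Tn osc tail st'.
have tI : 0 <= t <= 1 by rewrite t0.
have [p pm [/andP[p1 p2] ->]] := step_path_telescope m (fun k => rescaled T Z phi nu n tau (tm m k) w) tI.
have mp : (0 : R) < m%:R by rewrite ltr0n.
have h0 : rescaled T Z phi nu n tau (tm m 0) w = 0.
  by rewrite /rescaled /tm mul0r mulr0 (hmart0 hawkes) mul0r.
rewrite h0 subr0.
have e_ : tau * tm m p <= tau * t by rewrite ler_wpM2l// ler_pdivrMr// mulrC.
have hp : `|M n (tau * t) w - M n (tau * tm m p) w| <= eta.
  (* For [p = m] no block follows, but then [t = 1] is the grid point itself. *)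
  move: pm; rewrite leq_eqVlt => /predU1P[pE|pm].
    have -> : t = tm m p.
      apply/le_anti; rewrite pE /tm divff ?gt_eqF// t1/=.
      by rewrite pE ler_pMr// in p1.
    by rewrite subrr normr0.
  apply: osc => //; rewrite e_/= ler_wpM2l// ler_pdivlMr// mulrC; exact: ltW.
rewrite (counting_diffE hawkes (n := n)); last 2 first.
- by case/andP: st'.
- by apply: le_trans (ltW Tn); case/andP: st'.
have aa := a0.
have sc : 0 < 1 + a by rewrite ltr_wpDr.
rewrite /rescaled.
have -> : (Num.sqrt tau)^-1 * S n (tau * t) w - M n (tau * tm m p) w / ((1 + a) * Num.sqrt tau) =
   (Num.sqrt tau)^-1 * ((S n (tau * t) w - M n (tau * t) w / (1 + a))
     + (M n (tau * t) w - M n (tau * tm m p) w) / (1 + a)).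
  move: (S n (tau * t) w) (M n (tau * t) w) (M n (tau * tm m p) w) => x y z.
  by field; rewrite !gt_eqF.
rewrite normrM gtr0_norm ?invr_gt0// mulrC ler_pdivrMr//.
apply: (le_trans (ler_normD _ _)).
have hq : `|(M n (tau * t) w - M n (tau * tm m p) w) / (1 + a)| <= eta / (1 - a).
  rewrite normrM (gtr0_norm (_ : 0 < (1 + a)^-1)) ?invr_gt0//.
  apply: ler_pM => //; first by rewrite invr_ge0 ltW.
  by rewrite lef_pV2 ?posrE ?subr_gt0//; lra.
apply: (le_trans (lerD close hq)).
rewrite -mulrDl mulrAC ler_pM2r ?invr_gt0 ?subr_gt0//.
rewrite /eta; lra.
Qed.

End good_event.

Lemma hawkes_step_approximable : step_approximable P P' W sigma
  (fun tau v w => (Num.sqrt tau)^-1 * counting_diff T Z (tau * v) w).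
Proof.
move=> e e0; have a1' : 0 < 1 - a by rewrite subr_gt0.
(* [e1] compensates the factor [6 / (1 - a)] of [good_event_close]; [q] is chosen so that
   [8 C / (m e1^4) <= e / 2] once [m >= q]. *)
pose e1 := e * (1 - a) / 6.
have e10 : 0 < e1 by rewrite divr_gt0// mulr_gt0.
have e1E : 6 * e1 / (1 - a) = e by rewrite /e1; field; rewrite gt_eqF.
pose q := 16 * C / (e1 ^+ 4 * e).
have q0 : 0 <= q.
  apply: divr_ge0; first exact: mulr_ge0.
  by apply: mulr_ge0; [apply: exprn_ge0|]; exact: ltW.
exists (Num.bound q) => m qm m0.
have mp : (0 : R) < m%:R by rewrite ltr0n.
have mi : (0 : R) < m%:R^-1 by rewrite invr_gt0.
have {}qm : q <= m%:R by rewrite (le_trans (ltW (archi_boundP q0)))// ler_nat.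
exists (fun tau => block T Z phi nu tau m), (2 * C); split.
- by move=> tau k _; exact: (block_bmf phi_meas phi_ge0 phi_lt1 nu_ge0 hawkes).
- exact: (block_sqr_near phi_meas phi_ge0 phi_lt1 nu_ge0 hawkes m0).
- by move=> f sf; exact: block_law_cvg.
(* The bound [m^-2] merges the two terms of the block probability, [e / 2] is for the stopping
   probability, and 1 is asked for by the fourth moment estimate. *)
pose e' := Num.min (m%:R^-1 ^+ 2) (Num.min (e / 2) 1).
have e'0 : 0 < e' by rewrite !lt_min exprn_gt0// divr_gt0//= ltr01.
have l1 : e' <= m%:R^-1 ^+ 2 by rewrite ge_min lexx.
have l2 : e' <= e / 2 by rewrite !ge_min lexx orbT.
have l3 : e' <= 1 by rewrite !ge_min lexx !orbT.
(* For [tau >= A m] a single block is long enough to hold all but [1 / m] of the mass of the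
   kernel. *)
have [A A0 hA] := Phi_tail phi_meas phi_ge0 phi_lt1 mi.
have hreg := regular_near phi_meas phi_ge0 phi_lt1 nu_ge0 hawkes e'0.
have hbig := nbhs_pinfty_ge (num_real (A * m%:R)).
apply: filterS (filterI hreg hbig) => tau [reg Atau].
have tau0 := regular_gt0 reg.
have tail : a - Phi phi (tau * m%:R^-1) <= m%:R^-1 by apply: hA; rewrite ler_pdivlMr.
have mx : Num.max 0 tau = tau by rewrite max_r// ltW.
exists (good_event (level tau) m tau e1); split.
- exact: measurable_good_event.
- apply: le_trans (Pr_good_event tau0 m0 e10 reg l3); rewrite lerD2l lerN2.
  have h : m%:R * (4 * (C * (m%:R^-1 ^+ 2 + e')) / e1 ^+ 4) <= e / 2.
    apply: (@le_trans _ _ (m%:R * (4 * (C * (2 * m%:R^-1 ^+ 2)) / e1 ^+ 4))).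
      apply: ler_wpM2l; first exact: ltW.
      rewrite ler_pM2r ?invr_gt0 ?exprn_gt0//; apply: ler_wpM2l; first exact: ler0n.
      by apply: ler_wpM2l => //; lra.
    have -> : m%:R * (4 * (C * (2 * m%:R^-1 ^+ 2)) / e1 ^+ 4) = q * m%:R^-1 * (e / 2).
      rewrite /q; move: (C) => x; move: (m%:R : R) mp => y y0.
      by field; rewrite !gt_eqF.
    rewrite -[leRHS]mul1r; apply: ler_wpM2r; first by rewrite ltW// divr_gt0.
    by rewrite ler_pdivrMr// mul1r.
  lra.
- move=> w /(good_event_close tau0 m0 e10 tail)[Tn hw]; split.
    exact: (cadlag_counting_diff hawkes _ tau0 Tn).
  by move=> t tI; have := hw t tI; rewrite e1E /block mx.
Qed.

End conclusion.

Theorem proposition1 (R : realType)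
    (nu : R) (nu_ge0 : 0 <= nu)
    (phi : R -> R)
    (phi_meas : measurable_fun (`[0, +oo[ : set R) phi)
    (phi_ge0 : forall t, 0 <= t -> 0 <= phi t)
    (phi_lt1 :
      (\int[lebesgue_measure]_(t in `[0%R, +oo[) (phi t)%:E < 1)%E)
    (d : measure_display) (Omega : measurableType d) (P : probability Omega R)
    (T : nat -> Omega -> \bar R) (Z : nat -> Omega -> 'I_2)
    (hawkes : hawkes_process T Z P (fun i t w =>
      (* the component other than [i] *)
      let j := if i == ord0 then ord_max else ord0 in
      nu%:E + \int[jump_measure T Z j w]_(s in `]0%R, t[) (phi (t - s))%:E)%E)
    (d' : measure_display) (Omega' : measurableType d')
    (P' : probability Omega' R) (W : R -> Omega' -> R)
    (W_brownian : standard_brownian01 P' W)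
    (sigma : R) :
  let phi1 := fine (\int[lebesgue_measure]_(t in `[0%R, +oo[) (phi t)%:E)%E in
  let S t w := fine (counting_process T Z ord0 t w)
               - fine (counting_process T Z ord_max t w) in
  sigma ^+ 2 = 2 * nu / ((1 - phi1) * (1 + phi1) ^+ 2) ->
  cvg_in_law (+oo : set_system R)
    P (fun (tau v : R) w => (Num.sqrt tau)^-1 * S (tau * v) w)
    P' (fun v w => sigma * W v w).
Proof.
move=> phi1 S hsigma.
have sigma2 : sigma ^+ 2 = rate phi nu / (1 + mass phi) ^+ 2.
  by rewrite hsigma /rate invfM mulrA.
apply: (abstract_fclt W_brownian); last first.
  exact: (hawkes_step_approximable phi_meas phi_ge0 phi_lt1 nu_ge0 hawkes W_brownian sigma2).
apply: filterS (nbhs_pinfty_gt (num_real 0)) => tau tau0.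
have := no_explosion phi_meas phi_ge0 phi_lt1 nu_ge0 hawkes tau0.
apply: filterS => w [n Tn].
exact: (cadlag_counting_diff hawkes _ tau0 Tn).
Qed.
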